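(* Let $0<k<n$ and let $\lambda_1,\ldots,\lambda_r\subseteq k\times(n-k)$ be Young diagrams with $\sum_{j=1}^r|\lambda_j|=k(n-k)$. The number of solutions of the double real Schubert problem $(D\lambda_j)$ is bounded below by the number of solutions of the half sized complex one $(\lambda_j)$: for every generic choice of complete flags $F^1_\bullet,\ldots,F^r_\bullet$ in $\mathbb{R}^{2n}$, $$\Big|\bigcap_{j=1}^r\sigma_{D\lambda_j}^{\mathbb{R}}(F^j_\bullet)\Big|\ \ge\ \Big|\bigcap_{j=1}^r\sigma_{\lambda_j}^{\mathbb{C}}(A^j_\bullet)\Big|,$$ where the left-hand intersection is taken in $\mathrm{Gr}_{2k}(\mathbb{R}^{2n})$, the right-hand one in $\mathrm{Gr}_k(\mathbb{C}^n)$, and $A^1_\bullet,\ldots,A^r_\bullet$ are any generic complete flags in $\mathbb{C}^n$.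
   Context: $\mathrm{Gr}_K(\mathbb{F}^N)$ is the Grassmannian of $K$-planes in $\mathbb{F}^N$, $\mathbb{F}=\mathbb{R},\mathbb{C}$. For a Young diagram $\lambda\subseteq K\times(N-K)$ and a complete flag $F_\bullet$ in $\mathbb{F}^N$ ($\dim F_i=i$), the Schubert variety is $\sigma_\lambda^{\mathbb{F}}(F_\bullet)=\{U\in\mathrm{Gr}_K(\mathbb{F}^N):\dim_{\mathbb F}(U\cap F_{N-K+j-\lambda_j})\ge j,\ j=1,\ldots,K\}$, of codimension $|\lambda|$ over $\mathbb{F}$. The double of $\lambda\subseteq k\times(n-k)$ is $D\lambda=(2\lambda_1,2\lambda_1,\ldots,2\lambda_k,2\lambda_k)\subseteq 2k\times2(n-k)$. A collection of flags is generic if the corresponding Schubert varieties are transversal. In the complex case the number of solutions is independent of the generic flags (the space of generic configurations is connected) and equals the intersection number of the Schubert classes. *)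

(* Defs.v *)
From mathcomp Require Import all_boot all_order all_algebra.
From mathcomp Require Import complex.
From mathcomp Require Import boolp classical_sets functions cardinality reals.
(* Not imported: the notations of mpoly clash with those of classical_sets. *)
From mathcomp Require mpoly.

Set Implicit Arguments.
Unset Strict Implicit.
Unset Printing Implicit Defensive.

Import GRing.Theory.
Local Open Scope classical_set_scope.
Local Open Scope nat_scope.

(* A Young diagram is the sequence of its row lengths, trailing zeros being
   allowed; its parts are numbered from 1 and its size is sumn lam. *)
Definition part (lam : seq nat) (j : nat) : nat := nth 0 lam j.-1.

Definition diagram_in_box (K L : nat) (lam : seq nat) : bool :=
  [&& sorted geq lam, size lam <= K & all (geq L) lam].

Definition double_diagram (lam : seq nat) : seq nat :=
  flatten [seq [:: 2 * a; 2 * a] | a <- lam].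

Section Schubert.
Variables (F : fieldType) (N K : nat).
Notation V := 'rV[F]_N.

(* Only the values E i with i <= N are meaningful. *)
Definition complete_flag (E : nat -> {vspace V}) : Prop :=
  (forall i, i <= N -> \dim (E i) = i) /\
  (forall i j, i <= j -> j <= N -> (E i <= E j)%VS).

Definition grassmannian : set {vspace V} := [set U | \dim U = K].

(* When lam is contained in the K x (N - K) box and K <= N, the truncated
   subtractions are exact. *)
Definition schubert (E : nat -> {vspace V}) (lam : seq nat) :
    set {vspace V} :=
  [set U | grassmannian U /\
    forall j, 1 <= j <= K ->
      j <= \dim (U :&: E (N - K + j - part lam j)%N)%VS].

(* Tangent spaces are computed on K x N matrices of rank K (frames).  The map
   sending a frame to its row space is a submersion onto the Grassmannian, so
   taking preimages preserves smoothness, codimension and transversality. *)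
Definition row_space (M : 'M[F]_(K, N)) : {vspace V} :=
  <<[seq row i M | i : 'I_K]>>%VS.

Definition vanishes_on (X : set {vspace V}) (f : mpoly.mpoly (K * N) F) :
    Prop :=
  forall M : 'M[F]_(K, N), X (row_space M) ->
    mpoly.meval (mxvec M 0%R) f = 0%R.

Definition differential (f : mpoly.mpoly (K * N) F) (M v : 'M[F]_(K, N)) : F :=
  (\sum_i mpoly.meval (mxvec M 0) (mpoly.mderiv i f) * mxvec v 0 i)%R.

(* T is the Zariski tangent space, at the frame M, of the variety of frames
   whose row space lies in X. *)
Definition is_tangent_space (X : set {vspace V}) (M : 'M[F]_(K, N))
    (T : {vspace 'M[F]_(K, N)}) : Prop :=
  forall v, v \in T <->
    forall f, vanishes_on X f -> differential f M v = 0%R.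

(* The varieties X j, of codimension c j, meet transversally at M: M is a
   smooth point of each of them (the tangent space of X j has codimension c j)
   and the codimensions of the tangent spaces add up. *)
Definition transversal_at (r : nat) (X : 'I_r -> set {vspace V})
    (c : 'I_r -> nat) (M : 'M[F]_(K, N)) : Prop :=
  exists T : 'I_r -> {vspace 'M[F]_(K, N)},
    [/\ forall j, is_tangent_space (X j) M (T j),
        forall j, \dim (T j) + c j = K * N
      & \dim (\bigcap_j T j)%VS + \sum_j c j = K * N].

Definition solutions (r : nat) (lam : 'I_r -> seq nat)
    (E : 'I_r -> nat -> {vspace V}) : set {vspace V} :=
  \bigcap_(j in [set: 'I_r]) schubert (E j) (lam j).

Definition generic_flags (r : nat) (lam : 'I_r -> seq nat)
    (E : 'I_r -> nat -> {vspace V}) : Prop :=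
  (forall j, complete_flag (E j)) /\
  forall M : 'M[F]_(K, N), solutions lam E (row_space M) ->
    transversal_at (fun j => schubert (E j) (lam j))
                   (fun j => sumn (lam j)) M.

End Schubert.

(* Main.v *)
(* The solutions of the double real problem are counted with signs.  A Schubert
   problem is encoded by a representation X of a tree quiver (the flags, joined
   at the ambient space): its solutions are the graded subspaces U with
   X U <= U, that is, the orthogonal projections P with P X (1 - P) = 0.  This
   is a section of a bundle over a product of Grassmannians, whose rank equals
   the dimension.  For a doubled real problem the bundle is oriented relatively
   to its base, so the signed number of zeros is the same for all nondegenerate
   sections depending quadratically on (1, P).  It is a lower bound for the
   number of solutions at generic real flags.

   It is computed at a section coming from the complex problem.  Let J be the
   complex structure on C^n = R^2n, W the real form of the complex
   representation and P_- the part of P that anticommutes with J.  The section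
   W + |P_-|^2 Y + L(P_-), with Y commuting with J and L equivariant under the
   rotations generated by J, is invariant under these rotations; for generic Y
   and L it therefore has no isolated zero, hence no zero at all, with
   P_- <> 0.  The zeros with P_- = 0 are the complex solutions, and their
   Jacobians commute with J, so that all their signs are positive. *)
Require Defs.
From HB Require structures.
From mathcomp Require all_algebra all_boot all_fingroup all_order boolp cardinality classical_sets complex filter functions interval_inference lra matrix_normedtype mpoly normedtype realfun reals ring sequences topology zify.

Set Implicit Arguments.
Unset Strict Implicit.
Unset Printing Implicit Defensive.

(** The signed counts of two nondegenerate sections y0 and y1 are compared along the path (1 - s) y0
    + s y1 + s (1 - s) a, with a such that the only singularities met are folds, where two zeros of
    opposite signs appear or disappear. Generic means off a proper algebraic hypersurface: q + 1
    equations in q unknowns, q of them affine and of full rank in the parameters, are solvable only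
    on such a hypersurface, by a count of monomials. Quadratic sections suffice because products of
    two affine forms prescribe jets of order two, which is all that a fold involves. Differentials
    are replaced by symmetric polynomial difference quotients. The orientation comes from the
    charts: the tangent space and the fibre both change by operators A -> K A K', and doubling
    splits these into two conjugate halves, so that the determinants are squares. The rotations act
    through the same dimension count: a zero with P_- <> 0 can be rotated until a chosen entry of
    P_- vanishes, one equation too many. Two kinds of perturbation occur because |P_-|^2 Y only
    reaches the part of the fibre commuting with J, and L the anticommuting part. *)

(** * Polynomial functions and elimination by counting monomials *)

Module PolynomialFunctions.
Import all_boot all_order all_algebra.
Import zify.
Import -(notations) mpoly.
Import Order.TTheory GRing.Theory Num.Theory.
Local Open Scope ring_scope.

(** Polynomial functions are a predicate on functions rather than elements of [mpoly]: determinants,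
    adjugates and compositions then need no symbolic counterpart. [polyf_ext] absorbs pointwise
    rewriting. *)
Inductive polyf (R : realFieldType) n : ('rV[R]_n -> R) -> Prop :=
| polyf_cst c : polyf (fun=> c)
| polyf_coord i : polyf (fun x => x 0 i)
| polyf_add f g : polyf f -> polyf g -> polyf (fun x => f x + g x)
| polyf_mul f g : polyf f -> polyf g -> polyf (fun x => f x * g x)
| polyf_ext f g : polyf f -> (forall x, f x = g x) -> polyf g.

Section Polyf.
Variable R : realFieldType.

Lemma polyf_opp n (f : 'rV[R]_n -> R) : polyf f -> polyf (fun x => - f x).
Proof.
move=> pf; apply: polyf_ext (polyf_mul (polyf_cst n (-1)) pf) _ => x.
by rewrite mulN1r.
Qed.

Lemma polyf_sub n (f g : 'rV[R]_n -> R) :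
  polyf f -> polyf g -> polyf (fun x => f x - g x).
Proof. by move=> pf pg; apply: polyf_add => //; apply: polyf_opp. Qed.

Lemma polyf_sum n (I : Type) (r : seq I) (P : pred I)
    (F : I -> 'rV[R]_n -> R) :
  (forall i, polyf (F i)) -> polyf (fun x => \sum_(i <- r | P i) F i x).
Proof.
move=> pF; elim: r => [|i r IH].
  by apply: polyf_ext (polyf_cst n 0) _ => x; rewrite big_nil.
apply: (@polyf_ext _ _ (fun x => (if P i then F i x else 0) +
   \sum_(j <- r | P j) F j x)).
  by apply: polyf_add => //; case: (P i) => //; apply: polyf_cst.
by move=> x; rewrite big_cons; case: (P i); rewrite ?add0r.
Qed.

Lemma polyf_prod n (I : Type) (r : seq I) (P : pred I)
    (F : I -> 'rV[R]_n -> R) :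
  (forall i, polyf (F i)) -> polyf (fun x => \prod_(i <- r | P i) F i x).
Proof.
move=> pF; elim: r => [|i r IH].
  by apply: polyf_ext (polyf_cst n 1) _ => x; rewrite big_nil.
apply: (@polyf_ext _ _ (fun x => (if P i then F i x else 1) *
   \prod_(j <- r | P j) F j x)).
  by apply: polyf_mul => //; case: (P i) => //; apply: polyf_cst.
by move=> x; rewrite big_cons; case: (P i); rewrite ?mul1r.
Qed.

Lemma polyf_comp n k (f : 'rV[R]_n -> R) (g : 'rV[R]_k -> 'rV[R]_n) :
  polyf f -> (forall i, polyf (fun x => g x 0 i)) -> polyf (fun x => f (g x)).
Proof.
move=> pf pg; elim: pf => {f} //.
- by move=> c; apply: polyf_cst.
- by move=> f h _ pf _ ph; apply: polyf_add.
- by move=> f h _ pf _ ph; apply: polyf_mul.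
- by move=> f h _ pf e; apply: polyf_ext pf _ => x; rewrite e.
Qed.

Definition mxpolyf n a b (A : 'rV[R]_n -> 'M[R]_(a, b)) :=
  forall i j, polyf (fun x => A x i j).

Lemma mxpolyf_cst n a b (A : 'M[R]_(a, b)) : mxpolyf (fun _ : 'rV[R]_n => A).
Proof. by move=> i j; apply: polyf_cst. Qed.

Lemma mxpolyf_id n : mxpolyf (fun x : 'rV[R]_n => x).
Proof. by move=> i j; rewrite (ord1 i); apply: polyf_coord. Qed.

Lemma mxpolyf_add n a b (A B : 'rV[R]_n -> 'M[R]_(a, b)) :
  mxpolyf A -> mxpolyf B -> mxpolyf (fun x => A x + B x).
Proof.
move=> pA pB i j; apply: polyf_ext (polyf_add (pA i j) (pB i j)) _ => x.
by rewrite mxE.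
Qed.

Lemma mxpolyf_scale n a b f (A : 'rV[R]_n -> 'M[R]_(a, b)) :
  polyf f -> mxpolyf A -> mxpolyf (fun x => f x *: A x).
Proof.
move=> pf pA i j; apply: polyf_ext (polyf_mul pf (pA i j)) _ => x.
by rewrite mxE.
Qed.

Lemma mxpolyf_opp n a b (A : 'rV[R]_n -> 'M[R]_(a, b)) :
  mxpolyf A -> mxpolyf (fun x => - A x).
Proof.
move=> pA i j; apply: polyf_ext (polyf_opp (pA i j)) _ => x.
by rewrite mxE.
Qed.

Lemma mxpolyf_sub n a b (A B : 'rV[R]_n -> 'M[R]_(a, b)) :
  mxpolyf A -> mxpolyf B -> mxpolyf (fun x => A x - B x).
Proof. by move=> pA pB; apply: mxpolyf_add => //; apply: mxpolyf_opp. Qed.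

Lemma mxpolyf_mul n a b c (A : 'rV[R]_n -> 'M[R]_(a, b))
    (B : 'rV[R]_n -> 'M[R]_(b, c)) :
  mxpolyf A -> mxpolyf B -> mxpolyf (fun x => A x *m B x).
Proof.
move=> pA pB i j; apply: (@polyf_ext _ _ (fun x => \sum_k A x i k * B x k j)).
  by apply: polyf_sum => k; apply: polyf_mul.
by move=> x; rewrite mxE.
Qed.

Lemma mxpolyf_sum n a b (I : Type) (r : seq I) (P : pred I)
    (F : I -> 'rV[R]_n -> 'M[R]_(a, b)) :
  (forall i, mxpolyf (F i)) -> mxpolyf (fun x => \sum_(i <- r | P i) F i x).
Proof.
move=> pF i j; apply: (@polyf_ext _ _ (fun x => \sum_(k <- r | P k) F k x i j)).
  by apply: polyf_sum => k; apply: pF.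
by move=> x; rewrite summxE.
Qed.

Lemma mxpolyf_tr n a b (A : 'rV[R]_n -> 'M[R]_(a, b)) :
  mxpolyf A -> mxpolyf (fun x => (A x)^T).
Proof. by move=> pA i j; apply: polyf_ext (pA j i) _ => x; rewrite mxE. Qed.

Lemma mxpolyf_sub_mx n a b a' b' (s : 'I_a' -> 'I_a) (t : 'I_b' -> 'I_b)
    (A : 'rV[R]_n -> 'M[R]_(a, b)) :
  mxpolyf A -> mxpolyf (fun x => mxsub s t (A x)).
Proof. by move=> pA i j; apply: polyf_ext (pA (s i) (t j)) _ => x; rewrite mxE. Qed.

Lemma mxpolyf_comp n k a b (A : 'rV[R]_n -> 'M[R]_(a, b)) (g : 'rV[R]_k -> 'rV[R]_n) :
  mxpolyf A -> mxpolyf g -> mxpolyf (fun x => A (g x)).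
Proof. by move=> pA pg i j; apply: (polyf_comp (pA i j)). Qed.

Lemma mxpolyf_row_mx n a b b' (A : 'rV[R]_n -> 'M[R]_(a, b))
    (B : 'rV[R]_n -> 'M[R]_(a, b')) :
  mxpolyf A -> mxpolyf B -> mxpolyf (fun x => row_mx (A x) (B x)).
Proof.
move=> pA pB i j; case: (splitP j) => k e.
  apply: polyf_ext (pA i k) _ => x.
  by rewrite (_ : j = lshift b' k) ?row_mxEl //; apply: val_inj.
apply: polyf_ext (pB i k) _ => x.
by rewrite (_ : j = rshift b k) ?row_mxEr //; apply: val_inj.
Qed.

Lemma mxpolyf_mxvec n a b (A : 'rV[R]_n -> 'M[R]_(a, b)) :
  mxpolyf A -> mxpolyf (fun x => mxvec (A x)).
Proof.
move=> pA i j; case/mxvec_indexP: j => u v.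
by apply: polyf_ext (pA u v) _ => x; rewrite (ord1 i) mxvecE.
Qed.

Lemma mxpolyf_vec_mx n a b (A : 'rV[R]_n -> 'rV[R]_(a * b)) :
  mxpolyf A -> mxpolyf (fun x => vec_mx (A x) : 'M_(a, b)).
Proof.
by move=> pA i j; apply: polyf_ext (pA 0 (mxvec_index i j)) _ => x; rewrite mxE.
Qed.

Lemma polyf_det n a (A : 'rV[R]_n -> 'M[R]_a) :
  mxpolyf A -> polyf (fun x => \det (A x)).
Proof.
move=> pA; rewrite /determinant; apply: polyf_sum => s.
apply: polyf_mul; first exact: polyf_cst.
by apply: polyf_prod => i; apply: pA.
Qed.

Lemma mxpolyf_adj n a (A : 'rV[R]_n -> 'M[R]_a) :
  mxpolyf A -> mxpolyf (fun x => \adj (A x)).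
Proof.
move=> pA i j; apply: (@polyf_ext _ _ (fun x => cofactor (A x) j i)); last first.
  by move=> x; rewrite mxE.
apply: polyf_mul; first exact: polyf_cst.
apply: polyf_det => u v; apply: polyf_ext (pA (lift j u) (lift i v)) _ => x.
by rewrite !mxE.
Qed.

End Polyf.

Section Dependence.
Variable R : realFieldType.
Local Notation mp n := (mpoly n R).
Local Notation mnm n := (multinom n).
Local Notation cf m p := (mcoeff m p).

Lemma polyf_mpoly n (f : 'rV[R]_n -> R) : polyf f ->
  exists p : mp n, forall x : 'rV[R]_n, meval (x 0) p = f x.
Proof.
elim=> {f}.
- by move=> c; exists (mpolyC n c) => x; rewrite mevalC.
- move=> i; exists (mpolyX R (mnm1 i)) => x.
  by rewrite mevalXU.
- by move=> f g _ [p ep] _ [q eq]; exists (p + q) => x; rewrite mevalD ep eq.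
- by move=> f g _ [p ep] _ [q eq]; exists (p * q) => x; rewrite mevalM ep eq.
- by move=> f g _ [p ep] e; exists p => x; rewrite ep e.
Qed.

(** The degree is bounded in each variable separately, so that the space of such polynomials has
    dimension exactly (e + 1)^n and the count below is one between powers. *)
Definition boxdeg n (e : nat) (p : mp n) :=
  forall m, m \in msupp p -> forall i, (m i <= e)%N.

Lemma boxdeg_le n e e' (p : mp n) : (e <= e')%N -> boxdeg e p -> boxdeg e' p.
Proof. by move=> le bp m /bp h i; apply: leq_trans (h i) le. Qed.

Lemma boxdeg_ex n (p : mp n) : exists e, boxdeg e p.
Proof.
exists (\sum_(m <- msupp p) \sum_i m i)%N => m mp' i.
by rewrite (big_rem m) //= (bigD1 i) //= -addnA; apply: leq_addr.
Qed.

Lemma boxdegM n a b (p q : mp n) :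
  boxdeg a p -> boxdeg b q -> boxdeg (a + b) (p * q).
Proof.
move=> bp bq m /(msuppM_le) /allpairsP [[u v] /= [/bp hu /bq hv ->]] i.
by rewrite mnmDE leq_add.
Qed.

Lemma boxdeg1 n : boxdeg 0 (1 : mp n).
Proof. by move=> m; rewrite msupp1 inE => /eqP -> i; rewrite mnm0E. Qed.

Lemma boxdegX n a k (p : mp n) : boxdeg a p -> boxdeg (k * a) (p ^+ k).
Proof.
move=> bp; elim: k => [|k IH]; first by rewrite expr0; apply: boxdeg1.
by rewrite exprS mulSn; apply: boxdegM.
Qed.

Lemma boxdeg_prod n k a (F : 'I_k -> mp n) :
  (forall i, boxdeg a (F i)) -> boxdeg (k * a) (\prod_i F i).
Proof.
elim: k F => [|k IH] F bF; first by rewrite big_ord0; apply: boxdeg1.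
by rewrite big_ord_recl mulSn; apply: boxdegM => //; apply: IH.
Qed.

Definition mnmf n e (u : {ffun 'I_n -> 'I_e}) : mnm n :=
  Multinom [tuple (u i : nat) | i < n].

Lemma mnmfE n e (u : {ffun 'I_n -> 'I_e}) i : mnmf u i = u i.
Proof. by rewrite mnmE. Qed.

Lemma mnmf_inj n e : injective (@mnmf n e).
Proof.
move=> u v euv; apply/ffunP => i; apply: val_inj => /=.
by have := congr1 (fun m : mnm n => m i) euv; rewrite !mnmfE.
Qed.

Lemma mpolyX_free n e (c : {ffun 'I_n -> 'I_e} -> R) :
  \sum_u c u *: mpolyX R (mnmf u) = 0 -> forall u, c u = 0.
Proof.
move=> s0 u; have := congr1 (fun p => cf (mnmf u) p) s0.
rewrite mcoeff0 linear_sum (bigD1 u) //= linearZ /= mcoeffX eqxx mulr1.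
rewrite big1 ?addr0 // => v vu; rewrite linearZ /= mcoeffX.
by rewrite (inj_eq (@mnmf_inj _ _)) (negPf vu) mulr0.
Qed.

Lemma boxdeg_sum n e (I : finType) (c : I -> R) (F : I -> mp n) :
  (forall i, boxdeg e (F i)) -> boxdeg e (\sum_i c i *: F i).
Proof.
move=> bF m; rewrite mcoeff_msupp linear_sum => nz.
have [i Fi] : exists i, m \in msupp (F i).
  apply/existsP; apply: contraNT nz; rewrite negb_exists => /forallP h.
  rewrite big1 // => i _; rewrite linearZ /=.
  by rewrite (memN_msupp_eq0 (h i)) mulr0.
exact: bF Fi.
Qed.

Lemma boxdeg_coefs n e (p : mp n) : boxdeg e p ->
  (forall u : {ffun 'I_n -> 'I_e.+1}, cf (mnmf u) p = 0) -> p = 0.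
Proof.
move=> bp cp; apply/mpolyP => m; rewrite mcoeff0.
case: (boolP (m \in msupp p)) => [ms|]; last by apply: memN_msupp_eq0.
pose u := [ffun i => inord (m i) : 'I_e.+1].
rewrite -(cp u); congr (cf _ p).
by apply/mnmP => i; rewrite mnmfE ffunE inordK // ltnS bp.
Qed.

Lemma boxdeg_mpolyX n e (u : {ffun 'I_n -> 'I_e.+1}) :
  boxdeg e (mpolyX R (mnmf u)).
Proof.
move=> m; rewrite msuppX inE => /eqP -> i.
by rewrite mnmfE -ltnS.
Qed.

Lemma sub_expn_le D (x y : nat) : (y <= x)%N ->
  (x ^ D - y ^ D <= D * (x - y) * x ^ D.-1)%N.
Proof.
move=> le; elim: D => [|D IH]; first by rewrite !expn0 subnn.
rewrite /= !expnS.
have -> : (x * x ^ D - y * y ^ D = x * (x ^ D - y ^ D) + (x - y) * y ^ D)%N.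
  have h := leq_exp2r.
  have le2 : (y ^ D <= x ^ D)%N by case: (D) => // D'; rewrite leq_exp2r.
  rewrite mulnBr mulnBl addnBA ?leq_mul // subnK //.
  by rewrite leq_mul.
rewrite mulSn mulnDl addnC leq_add //.
  by rewrite leq_mul2l; case: (D) => [|D']; rewrite ?orbT // leq_exp2r // le orbT.
case: D IH => [|D] IH; first by rewrite subnn muln0.
by apply: leq_trans (leq_mul (leqnn x) IH) _; rewrite /= expnS mulnCA.
Qed.

Lemma leq_exp2r_w a b k : (a <= b)%N -> (a ^ k <= b ^ k)%N.
Proof. by case: k => // k; rewrite leq_exp2r. Qed.

(** The right-hand side counts unknown coefficients and the left-hand side the linear conditions on
    them in [hypersurface_image]. The bases of the two large powers differ by [dl], so the powers
    differ by O(d^(D-1)), and d^D exceeds this for large [d]. *)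
Lemma count_monomials D dl E : exists2 d, (0 < d)%N &
  ((D * (d * E) + dl).+1 ^ D < d ^ D + (D * (d * E)).+1 ^ D)%N.
Proof.
have [->|D0] := posnP D; first by (exists 1%N; rewrite // !expn0).
set c := (D * E + dl).+1.
have [d dE] : exists d, d = (D * dl * c ^ D.-1).+1 by eexists.
exists d; first by rewrite dE.
have le : ((D * (d * E)).+1 <= (D * (d * E) + dl).+1)%N by rewrite ltnS leq_addr.
rewrite [X in (_ < X)%N]addnC -ltn_subLR; last exact: leq_exp2r_w.
apply: leq_ltn_trans (sub_expn_le D le) _.
have -> : ((D * (d * E) + dl).+1 - (D * (d * E)).+1 = dl)%N.
  by rewrite subSS addnC addnK.
have le2 : ((D * (d * E) + dl).+1 <= d * c)%N by rewrite /c dE; nia.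
apply: (@leq_ltn_trans (D * dl * (d * c) ^ D.-1)%N).
  by rewrite leq_mul // leq_exp2r_w.
have -> : (d ^ D = d ^ D.-1 * d)%N by rewrite -expnSr prednK.
by rewrite expnMn mulnCA ltn_mul2l expn_gt0 dE /=.
Qed.

(** On the hypersurface h = 0 the [D] fractions [f i] / [w] depend on only D - 1 parameters, hence
    are algebraically dependent. The relation is found by linear algebra: monomials in the
    fractions, homogenized by [w], together with multiples of [h] outnumber the monomials of their
    degree. *)
Lemma hypersurface_image D (f : 'I_D -> 'rV[R]_D -> R) (w h : 'rV[R]_D -> R) :
  (forall i, polyf (f i)) -> polyf w -> polyf h -> (exists x, h x != 0) ->
  exists2 P : mp D, P != 0 & forall x, h x = 0 -> w x != 0 ->
    forall y : 'rV_D, (forall i, w x * y 0 i = f i x) -> meval (y 0) P = 0.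
Proof.
move=> pf pw ph [x0 hx0].
have {}pf i : exists p : mp D, forall x : 'rV[R]_D, meval (x 0) p = f i x.
  exact: polyf_mpoly (pf i).
have [F fE] := fin_all_exists pf.
have [W wE] := polyf_mpoly pw; have [H hE] := polyf_mpoly ph.
have H0 : H != 0 by apply: contraNneq hx0 => H0; rewrite -hE H0 meval0.
have [dl bH] := boxdeg_ex H.
have [E [bF bW]] : exists E, (forall i, boxdeg E (F i)) /\ boxdeg E W.
  have [eF bF] := fin_all_exists (fun i => boxdeg_ex (F i)).
  have [eW bW] := boxdeg_ex W; exists (\sum_i eF i + eW)%N; split=> [i|].
    apply: boxdeg_le (bF i); rewrite (bigD1 i) //= -addnA; apply: leq_addr.
  by apply: boxdeg_le bW; apply: leq_addl.
have [d d0 lt] := count_monomials D dl E.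
set e := (D * (d * E) + dl)%N in lt; set e' := (D * (d * E))%N in lt.
(* The monomial of exponent [u] in the fractions, multiplied by w^(D d) so as to become a
   polynomial. *)
pose Phi (u : {ffun 'I_D -> 'I_d}) : mp D :=
  \prod_i (F i ^+ u i * W ^+ (d - u i)).
have bPhi u : boxdeg e (Phi u).
  apply: (@boxdeg_le _ (D * (d * E))%N); first by apply: leq_addr.
  apply: boxdeg_prod => i.
  have -> : (d * E = u i * E + (d - u i) * E)%N by rewrite -mulnDl subnKC // ltnW.
  by apply: boxdegM; apply: boxdegX.
pose Psi (v : {ffun 'I_D -> 'I_e'.+1}) : mp D := H * mpolyX R (mnmf v).
have bPsi v : boxdeg e (Psi v).
  by rewrite /e addnC; apply: boxdegM => //; apply: boxdeg_mpolyX.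
pose T : finType := ({ffun 'I_D -> 'I_d} + {ffun 'I_D -> 'I_e'.+1})%type.
pose G (t : T) := match t with inl u => Phi u | inr v => Psi v end.
pose A := \matrix_(i < #|T|, j < #|{ffun 'I_D -> 'I_e.+1}|)
   cf (mnmf (enum_val j)) (G (enum_val i)).
have /matrix0Pn [z [k czk]] : kermx A != 0.
  rewrite kermx_eq0; apply/negP => /eqP rk.
  have := rank_leq_col A; rewrite rk leqNgt card_sum !card_ffun !card_ord.
  by rewrite lt.
pose c t := kermx A z (enum_rank t).
have c0 : \sum_t c t *: G t = 0.
  apply: (@boxdeg_coefs _ e); first by apply: boxdeg_sum; case.
  move=> u; have := mulmx_ker A => /matrixP /(_ z (enum_rank u)).
  rewrite !mxE => zu; rewrite linear_sum -[RHS]zu.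
  rewrite (reindex _ (onW_bij _ (enum_val_bij T))) /=.
  by apply: eq_bigr => t _; rewrite /c enum_valK linearZ /= !mxE enum_rankK.
pose P := \sum_u c (inl u) *: mpolyX R (mnmf u).
pose Q := \sum_v c (inr v) *: mpolyX R (mnmf v).
have PQ : \sum_u c (inl u) *: Phi u + H * Q = 0.
  rewrite -[RHS]c0 big_sumType /=; congr (_ + _).
  by rewrite mulr_sumr; apply: eq_bigr => v _; rewrite -scalerAr.
exists P.
  (* If P = 0, the relation reads H Q = 0, so Q vanishes too, and with it all coefficients, against
     the choice of the kernel vector. *)
  apply/eqP => /mpolyX_free cl.
  move: PQ; rewrite big1 ?add0r => [/eqP|u _]; last by rewrite cl scale0r.
  rewrite mulf_eq0 (negPf H0) /= => /eqP /mpolyX_free cr.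
  by move/eqP: czk; apply; rewrite -(enum_valK k) -/(c _); case: (enum_val k).
move=> x hx wx y wy; have /(congr1 (meval (x 0))) := PQ.
rewrite mevalD mevalM hE hx mul0r addr0 meval0 => PhiS.
have := PhiS; rewrite raddf_sum /=.
have -> : \sum_u meval (x 0) (c (inl u) *: Phi u) =
    w x ^+ (D * d) * \sum_u meval (y 0) (c (inl u) *: mpolyX R (mnmf u)).
  rewrite mulr_sumr; apply: eq_bigr => u _; rewrite !mevalZ mulrCA; congr (_ * _).
  rewrite mevalX (big_morph (meval (x 0)) (mevalM (x 0)) (meval1 (x 0))).
  have -> : w x ^+ (D * d) = \prod_(i < D) w x ^+ d.
    by rewrite prodr_const card_ord -exprM mulnC.
  rewrite -big_split /=.
  apply: eq_bigr => i _; rewrite mevalM !rmorphXn /= fE wE mnmfE -wy.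
  by rewrite exprMn mulrAC -exprD subnKC 1?ltnW.
move/eqP; rewrite mulf_eq0 expf_eq0 (negPf wx) andbF /= => /eqP.
by rewrite -raddf_sum.
Qed.

(** Cramer's rule solves the [q] equations for the coordinates [k] of [y]. The solutions with h = 0
    are then parametrized by [x] and the remaining D - q coordinates, that is by [D] parameters
    subject to one equation. *)
Lemma incidence_minor D q (k : 'I_q -> 'I_D) (T : 'rV[R]_q -> 'M[R]_(D, q))
    (C : 'rV[R]_q -> 'rV[R]_q) (h : 'rV[R]_q -> R) :
  injective k -> mxpolyf T -> mxpolyf C -> polyf h -> (exists x, h x != 0) ->
  exists2 P : mp D, P != 0 & forall x y, h x = 0 ->
    rowsub k (T x) \in unitmx -> y *m T x = C x -> meval (y 0) P = 0.
Proof.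
move=> kinj pT pC ph [x0 hx0].
(* The slots [k] of [z] are free, since those coordinates of [y] are recovered by Cramer's rule;
   they are reused for the [q] coordinates of [x]. *)
pose X (z : 'rV[R]_D) : 'rV[R]_q := \row_i z 0 (k i).
have pX : mxpolyf X.
  by move=> i j; apply: polyf_ext (polyf_coord R (k j)) _ => z; rewrite mxE.
pose Tk z := rowsub k (T (X z)).
pose w z := \det (Tk z).
have pTX : mxpolyf (fun z => T (X z)) := mxpolyf_comp pT pX.
have pTk : mxpolyf Tk by apply: mxpolyf_sub_mx.
pose rest (z : 'rV[R]_D) : 'rV[R]_q := \sum_(l | l \notin codom k) z 0 l *: row l (T (X z)).
have prest : mxpolyf rest.
  apply: mxpolyf_sum => l; apply: mxpolyf_scale; first exact: polyf_coord.
  by move=> i j; apply: polyf_ext (pTX l j) _ => z; rewrite mxE.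
pose f l (z : 'rV[R]_D) := if [pick i | k i == l] is Some i
  then ((C (X z) - rest z) *m \adj (Tk z)) 0 i else w z * z 0 l.
have [] := @hypersurface_image D f w (fun z => h (X z)).
- move=> l; rewrite /f; case: pickP => [i _|_].
    have := mxpolyf_mul (mxpolyf_sub (mxpolyf_comp pC pX) prest) (mxpolyf_adj pTk).
    by apply.
  by apply: polyf_mul; [apply: polyf_det | apply: polyf_coord].
- exact: polyf_det.
- by apply: polyf_comp => // i; apply: pX.
- exists (\row_l if [pick i | k i == l] is Some i then x0 0 i else 0).
  congr (h _ != 0): hx0; apply/rowP => i; rewrite !mxE.
  by case: pickP => [j /eqP /kinj -> //|/(_ i)]; rewrite eqxx.
move=> P P0 hP; exists P => // x y hx ux e.
pose z : 'rV[R]_D := \row_l if [pick i | k i == l] is Some i then x 0 i else y 0 l.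
have Xz : X z = x.
  apply/rowP => i; rewrite !mxE.
  by case: pickP => [j /eqP /kinj -> //|/(_ i)]; rewrite eqxx.
apply: (hP z); rewrite ?Xz //.
  by rewrite /w /Tk Xz -unitfE -unitmxE.
move=> l; rewrite /f /w /Tk Xz; case: pickP => [i /eqP <-|none]; last first.
  congr (_ * _); rewrite mxE; by case: pickP => [i0|//]; rewrite none.
have -> : rest z = \sum_(l | l \notin codom k) y 0 l *: row l (T x).
  rewrite /rest Xz; apply: eq_bigr => l' nl; congr (_ *: _); rewrite mxE.
  case: pickP => [j /eqP e'|//].
  by move: nl; rewrite -e' codom_f.
have -> : C x - \sum_(l | l \notin codom k) y 0 l *: row l (T x) =
    (\row_i y 0 (k i)) *m rowsub k (T x).
  rewrite -e !mulmx_sum_row (bigID (mem (codom k))) /= addrK.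
  rewrite -big_uniq /=; last by rewrite map_inj_uniq ?enum_uniq.
  by rewrite big_image; apply: eq_bigr => u _; rewrite mxE row_rowsub.
by rewrite -mulmxA mul_mx_adj mul_mx_scalar !mxE.
Qed.

(** The dimension count behind the genericity statements: [q] equations of full rank in the
    parameter [y], [q] unknowns [x], and one more equation h = 0 leave a set of [y] of positive
    codimension. Each maximal minor of T is treated by [incidence_minor], and the polynomials
    obtained are multiplied. *)
Lemma hypersurface_incidence D q (T : 'rV[R]_q -> 'M[R]_(D, q))
    (C : 'rV[R]_q -> 'rV[R]_q) (h : 'rV[R]_q -> R) :
  mxpolyf T -> mxpolyf C -> polyf h -> (exists x, h x != 0) ->
  exists2 P : mp D, P != 0 & forall x y, h x = 0 -> row_full (T x) ->
    y *m T x = C x -> meval (y 0) P = 0.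
Proof.
move=> pT pC ph hx.
have /fin_all_exists2 [P P0 hP] (k : {ffun 'I_q -> 'I_D}) :
    exists2 P : mp D, P != 0 & injectiveb k -> forall x y, h x = 0 ->
      rowsub k (T x) \in unitmx -> y *m T x = C x -> meval (y 0) P = 0.
  have [/injectiveP kinj|_] := boolP (injectiveb k).
    by have [P P0 hP] := incidence_minor kinj pT pC ph hx; exists P.
  by exists 1; rewrite ?oner_neq0.
exists (\prod_k P k); first exact/prodf_neq0.
move=> x y hx0 fT e; pose k := fullrankfun fT.
rewrite (bigD1 k) //= mevalM (hP k _ x y) ?mul0r ?fullrowsub_unit //.
exact/injectiveP/fullrankfun_inj.
Qed.

End Dependence.

Section LineRestriction.
Variable F : numFieldType.

(** A univariate polynomial carries the restriction of [P] to a line; its derivative at 0 is the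
    directional derivative, which links values on lines to the differentials defining tangent
    spaces. *)
Definition line_poly n (x v : 'I_n -> F) (P : mpoly n F) (q : {poly F}) :=
  (forall t, q.[t] = meval (fun i => x i + t * v i) P) /\
  q^`().[0] = \sum_i meval x (mderiv i P) * v i.

Lemma line_poly_add n (x v : 'I_n -> F) P Q p q :
  line_poly x v P p -> line_poly x v Q q -> line_poly x v (P + Q) (p + q).
Proof.
move=> [hp dp] [hq dq]; split=> [t|]; first by rewrite hornerD hp hq mevalD.
rewrite derivD hornerD dp dq -big_split /=; apply: eq_bigr => i _.
by rewrite mderivD mevalD mulrDl.
Qed.

Lemma line_poly_mul n (x v : 'I_n -> F) P Q p q :
  line_poly x v P p -> line_poly x v Q q -> line_poly x v (P * Q) (p * q).
Proof.
move=> [hp dp] [hq dq]; split=> [t|]; first by rewrite hornerM hp hq mevalM.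
have e R' : meval (fun i => x i + 0 * v i) R' = meval x R'.
  by apply: meval_eq => i; rewrite mul0r addr0.
rewrite derivM hornerD !hornerM dp dq hp hq !e mulr_suml mulr_sumr -big_split /=.
apply: eq_bigr => i _.
by rewrite mderivM mevalD !mevalM mulrDl mulrAC mulrA.
Qed.

Lemma line_polyC n (x v : 'I_n -> F) c : line_poly x v (mpolyC n c) c%:P.
Proof.
split=> [t|]; first by rewrite hornerC mevalC.
by rewrite derivC horner0 big1 // => i _; rewrite mderivC meval0 mul0r.
Qed.

Lemma line_polyX n (x v : 'I_n -> F) j :
  line_poly x v (mpolyX F (mnm1 j)) ((x j)%:P + 'X * (v j)%:P).
Proof.
split=> [t|].
  by rewrite hornerD hornerC hornerM hornerX hornerC mevalXU.
rewrite derivD derivC add0r derivM derivX derivC mulr0 addr0 mul1r hornerC.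
rewrite (bigD1 j) //= mderivX mnm1E eqxx scale1r.
have -> : mnm_sub (mnm1 j) (mnm1 j) = mnm0.
  by apply/mnmP => k; rewrite mnmBE subnn mnm0E.
rewrite mpolyX0 meval1 mul1r.
rewrite big1 ?addr0 // => i ij.
by rewrite mderivX mnm1E eq_sym (negPf ij) scale0r meval0 mul0r.
Qed.

Lemma line_poly_ex n (x v : 'I_n -> F) P : exists q, line_poly x v P q.
Proof.
elim/mpolyind: P => [|c m P _ _ [q hq]].
  by exists 0%:P; rewrite -[0 : mpoly n F]mpolyC0; apply: line_polyC.
suff [p hp] : exists p, line_poly x v (mpolyX F m) p.
  exists (c%:P * p + q); apply: line_poly_add => //.
  by rewrite -mul_mpolyC; apply: line_poly_mul => //; apply: line_polyC.
rewrite mpolyXE_id; apply: (big_ind (fun P => exists p, line_poly x v P p)).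
- by exists 1%:P; rewrite -mpolyC1; apply: line_polyC.
- by move=> P1 P2 [p1 h1] [p2 h2]; exists (p1 * p2); apply: line_poly_mul.
- move=> i _; elim: (m i) => [|k [p hp]].
    by exists 1%:P; rewrite expr0 -mpolyC1; apply: line_polyC.
  by eexists; rewrite exprS; apply: line_poly_mul (line_polyX _ _ _) hp.
Qed.

Lemma poly_cofinite_eq0 (q : {poly F}) (h : {poly F}) :
  h != 0 -> (forall t, h.[t] != 0 -> q.[t] = 0) -> q = 0.
Proof.
move=> h0 qh; apply/eqP; apply: contraNT h0 => q0.
have /eqP : q * h = 0.
  apply/eqP; apply: contraT => nz.
  pose s := [seq (k%:R : F) | k <- iota 0 (size (q * h))].
  suff : (size s < size (q * h)%R)%N by rewrite size_map size_iota ltnn.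
  apply: max_poly_roots => //.
    apply/allP => t _; rewrite /root hornerM.
    by have [->|/qh ->] := eqVneq h.[t] 0; rewrite ?mulr0 ?mul0r.
  rewrite map_inj_uniq ?iota_uniq // => a b /eqP.
  by rewrite eqr_nat => /eqP.
by rewrite mulf_eq0 (negPf q0).
Qed.

(** If all values vanish, then so do all values of all derivatives, these being derivatives along
    coordinate lines; the values of the derivatives at 0 are the coefficients times factorials. *)
Lemma meval_neq0 n (P : mpoly n F) : P != 0 -> exists y, meval y P != 0.
Proof.
move=> P0; have [//|none] := boolp.pselect (exists y, meval y P != 0).
have {none} z y : meval y P = 0.
  by apply/eqP; apply: contraT => h; case: none; exists y.
have dz i (Q : mpoly n F) : (forall y, meval y Q = 0) ->
    forall y, meval y (mderiv i Q) = 0.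
  move=> zQ y; have [q [hq dq]] := line_poly_ex y (fun k => (k == i)%:R) Q.
  have q0 : q = 0.
    apply: (@poly_cofinite_eq0 _ 1); first exact: oner_neq0.
    by move=> t _; rewrite hq.
  move: dq; rewrite q0 deriv0 horner0 (bigD1 i) //= eqxx mulr1.
  rewrite big1 ?addr0 // => k /negPf ->; rewrite mulr0 //.
have dzm m y : meval y (mderivm m P) = 0.
  rewrite mderivm_foldr; elim: (flatten _) y => //= i s IH y; exact: dz.
case/eqP: P0; apply/mpolyP => m; rewrite mcoeff0.
have meval0p (Q : mpoly n F) : meval (fun=> 0) Q = mcoeff mnm0 Q.
  rewrite {1}[Q]mpolyE raddf_sum /=.
  have e k : meval (fun=> 0) (mcoeff k Q *: mpolyX F k) =
      mcoeff mnm0 (mcoeff k Q *: mpolyX F k).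
    rewrite mevalZ mevalX mcoeffZ mcoeffX; congr (_ * _).
    have [->|nz] := eqVneq k mnm0.
      by rewrite big1 // => i _; rewrite mnm0E expr0.
    have [i ki] : exists i, k i != 0%N.
      apply/existsP; apply: contraNT nz; rewrite negb_exists => /forallP h.
      by apply/eqP/mnmP => i; rewrite mnm0E; apply/eqP; have := h i; rewrite negbK.
    by rewrite (bigD1 i) //= expr0n (negPf ki) mul0r.
  by rewrite (eq_bigr _ (fun k _ => e k)) -raddf_sum -mpolyE.
have := dzm m (fun=> 0); rewrite meval0p mcoeff_mderivm addm0 => /eqP.
rewrite -mulr_natr mulf_eq0 pnatr_eq0 => /orP [/eqP //|].
have : (0 < \prod_(i < n) (m i) ^_ (m i))%N.
  by apply: prodn_gt0 => i; rewrite ffactnn fact_gt0.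
by rewrite lt0n => /negPf ->.
Qed.
End LineRestriction.

End PolynomialFunctions.

(** * Norm estimates and polynomial difference quotients *)

Module Norms.
Import structures.
Import all_boot all_order all_algebra.
Import boolp classical_sets functions reals topology normedtype sequences.
Import ring lra.
Import PolynomialFunctions.
Import Order.TTheory GRing.Theory Num.Theory.
Import numFieldNormedType.Exports.
Local Open Scope classical_set_scope.
Local Open Scope ring_scope.

(** Completeness and norm are combined here; the Banach fixed point theorem asks for both. *)
HB.instance Definition _ (R : realType) m n := Complete.on 'M[R]_(m, n).

Section Norms.
Variable R : realType.

Lemma mx_entry_le a b (A : 'M[R]_(a, b)) i j : `|A i j| <= `|A|.
Proof.
rewrite [leRHS]/Num.norm /= mx_normrE; apply/bigmax_geP; right => /=.
by exists (i, j).
Qed.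

Lemma mx_norm_le a b (A : 'M[R]_(a, b)) e :
  0 <= e -> (forall i j, `|A i j| <= e) -> `|A| <= e.
Proof.
move=> e0 h; rewrite [leLHS]/Num.norm /= mx_normrE.
by apply/bigmax_leP; split => // -[i j] _; apply: h.
Qed.

Lemma mx_norm_lt a b (A : 'M[R]_(a, b)) e :
  0 < e -> (forall i j, `|A i j| < e) -> `|A| < e.
Proof.
move=> e0 h; rewrite [ltLHS]/Num.norm /= mx_normrE.
by apply/bigmax_ltP; split => // -[i j] _; apply: h.
Qed.

Lemma mx_norm_mul a n b (A : 'M[R]_(a, n)) (B : 'M[R]_(n, b)) :
  `|A *m B| <= n%:R * `|A| * `|B|.
Proof.
apply: mx_norm_le; first by rewrite !mulr_ge0.
move=> i j; rewrite mxE; apply: le_trans (ler_norm_sum _ _ _) _.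
rewrite -mulrA -[n in n%:R]card_ord -sum1_card natr_sum mulr_suml.
apply: ler_sum => k _; rewrite mul1r normrM.
by apply: ler_pM => //; apply: mx_entry_le.
Qed.

Lemma fin_pos_min (I : finType) (d : I -> R) :
  (forall i, 0 < d i) -> exists2 e, 0 < e & forall i, e <= d i.
Proof.
move=> d0; have s0 : 0 <= \sum_i (d i)^-1.
  by apply: sumr_ge0 => i _; rewrite invr_ge0 ltW.
exists (\sum_i (d i)^-1 + 1)^-1; first by rewrite invr_gt0 ltr_wpDl.
move=> i; rewrite -[leRHS]invrK lef_pV2 ?posrE ?invr_gt0 ?ltr_wpDl //.
rewrite (bigD1 i) //= -addrA lerDl addr_ge0 //.
by apply: sumr_ge0 => j _; rewrite invr_ge0 ltW.
Qed.

Lemma polyf_cont n (f : 'rV[R]_n -> R) : polyf f -> continuous f.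
Proof.
elim=> {f}.
- by move=> c; apply: cst_continuous.
- by move=> i; apply: coord_continuous.
- by move=> f g _ cf _ cg x; exact: continuousD (cf x) (cg x).
- by move=> f g _ cf _ cg x; exact: continuousM (cf x) (cg x).
- by move=> f g _ cf /funext <-.
Qed.

Lemma polyf_near n (f : 'rV[R]_n -> R) x0 e : polyf f -> 0 < e ->
  exists2 d, 0 < d & forall x, `|x - x0| < d -> `|f x - f x0| < e.
Proof.
move=> /polyf_cont /(_ x0) cf e0.
move/cvgrPdist_lt: cf => /(_ e e0) /nbhs_ballP [d /= d0 hd].
exists d => // x xd; rewrite distrC; apply: hd.
by rewrite -ball_normE /= distrC.
Qed.

Lemma mxpolyf_near n a b (A : 'rV[R]_n -> 'M[R]_(a, b)) x0 e :
  mxpolyf A -> 0 < e ->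
  exists2 d, 0 < d & forall x, `|x - x0| < d -> `|A x - A x0| < e.
Proof.
move=> pA e0.
have /fin_all_exists2 [d d0 hd] (ij : 'I_a * 'I_b) : exists2 d, 0 < d &
    forall x, `|x - x0| < d -> `|A x ij.1 ij.2 - A x0 ij.1 ij.2| < e.
  exact: polyf_near.
have [d' d'0 le] := fin_pos_min d0; exists d' => // x xd.
apply: mx_norm_lt => // i j; rewrite !mxE.
by apply: (hd (i, j)); apply: lt_le_trans xd (le _).
Qed.

Lemma polyf_near_sgr n (f : 'rV[R]_n -> R) x0 : polyf f -> f x0 != 0 ->
  exists2 d, 0 < d & forall x, `|x - x0| < d -> Num.sg (f x) = Num.sg (f x0).
Proof.
move=> pf f0; have /(polyf_near x0 pf) [d d0 hd] : 0 < `|f x0| by rewrite normr_gt0.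
exists d => // x /hd; move: f0; rewrite neq_lt => /orP [] f0.
  rewrite (ltr0_norm f0) ltr_norml => /andP [_ h].
  by rewrite !ltr0_sg // -(ltrD2r (- f x0)) add0r.
rewrite (gtr0_norm f0) ltr_norml => /andP [h _].
by rewrite !gtr0_sg // -(ltrD2r (- f x0)) add0r.
Qed.

Lemma norm_row_mx_sub n k (x x' : 'rV[R]_n) (y y' : 'rV[R]_k) e :
  `|x - x'| < e -> `|y - y'| < e -> `|row_mx x y - row_mx x' y'| < e.
Proof.
move=> hx hy; rewrite opp_row_mx add_row_mx; apply: mx_norm_lt.
  exact: le_lt_trans (normr_ge0 _) hx.
move=> i j; case: (splitP j) => u e'.
  rewrite (_ : j = lshift k u) ?row_mxEl; last exact: val_inj.
  exact: le_lt_trans (mx_entry_le _ _ _) hx.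
rewrite (_ : j = rshift n u) ?row_mxEr; last exact: val_inj.
exact: le_lt_trans (mx_entry_le _ _ _) hy.
Qed.

(* The average over the two orders of the factors keeps the quotient symmetric. *)
Lemma polyf_quotient n (f : 'rV[R]_n -> R) : polyf f ->
  exists q : 'rV[R]_(n + n) -> 'cV[R]_n, [/\ mxpolyf q,
    forall x y, q (row_mx x y) = q (row_mx y x)
    & forall x y, f x - f y = ((x - y) *m q (row_mx x y)) 0 0].
Proof.
have pl : mxpolyf (fun z : 'rV[R]_(n + n) => lsubmx z).
  by move=> i j; apply: polyf_ext (polyf_coord R (lshift n j)) _ => z; rewrite !mxE (ord1 i).
have pr : mxpolyf (fun z : 'rV[R]_(n + n) => rsubmx z).
  by move=> i j; apply: polyf_ext (polyf_coord R (rshift n j)) _ => z; rewrite !mxE (ord1 i).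
elim=> {f}.
- move=> c; exists (fun=> 0); split=> // [|x y]; first exact: mxpolyf_cst.
  by rewrite mulmx0 mxE subrr.
- move=> i; exists (fun=> delta_mx i 0); split=> // [|x y]; first exact: mxpolyf_cst.
  by rewrite -colE !mxE.
- move=> f g _ [p [pp sp hp]] _ [q [pq sq hq]].
  exists (fun z => p z + q z); split=> [|x y|x y]; first exact: mxpolyf_add.
    by rewrite sp sq.
  by rewrite mulmxDr mxE -hp -hq; ring.
- move=> f g pf [p [pp sp hp]] pg [q [pq sq hq]].
  have p1 := polyf_comp pf (pl 0); have p2 := polyf_comp pf (pr 0).
  have p3 := polyf_comp pg (pl 0); have p4 := polyf_comp pg (pr 0).
  exists (fun z => (2^-1 * (g (lsubmx z) + g (rsubmx z))) *: p z +
                   (2^-1 * (f (lsubmx z) + f (rsubmx z))) *: q z).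
  split=> [|x y|x y].
  + by apply: mxpolyf_add; apply: mxpolyf_scale => //; apply: polyf_mul;
      [apply: polyf_cst | apply: polyf_add | apply: polyf_cst | apply: polyf_add].
  + by rewrite !row_mxKl !row_mxKr sp sq [g x + _]addrC [f x + _]addrC.
  rewrite !row_mxKl !row_mxKr mulmxDr -!scalemxAr !mxE.
  have := hp x y; have := hq x y; rewrite !mxE => <- <-; by field.
- by move=> f g _ [q [pq sq hq]] e; exists q; split=> // x y; rewrite -(e x) -(e y) hq.
Qed.

(** This quotient replaces the differential: on the diagonal it is the Jacobian matrix, and for two
    zeros x and y of F it exhibits x - y as a kernel vector of Q(x, y). *)
Lemma mxpolyf_quotient n m (F : 'rV[R]_n -> 'rV[R]_m) : mxpolyf F ->
  exists Q : 'rV[R]_(n + n) -> 'M[R]_(n, m), [/\ mxpolyf Q,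
    forall x y, Q (row_mx x y) = Q (row_mx y x)
    & forall x y, F x - F y = (x - y) *m Q (row_mx x y)].
Proof.
move=> pF; have /fin_all_exists [q hq] j := polyf_quotient (pF 0 j).
exists (fun z => \matrix_(i, j) q j z i 0); split=> [i j|x y|x y].
- by case: (hq j) => pq _ _; apply: polyf_ext (pq i 0) _ => z; rewrite mxE.
- by apply/matrixP => i j; rewrite !mxE; case: (hq j) => _ -> _.
apply/rowP => j; have [_ _ h] := hq j.
by rewrite !mxE (h x y) mxE; apply: eq_bigr => i _; rewrite !mxE.
Qed.

End Norms.

End Norms.

(** * The implicit function theorem by contraction *)

Module ImplicitFunction.
Import structures.
Import all_boot all_order all_algebra.
Import boolp classical_sets functions reals interval_inference topology normedtype sequences realfun.
Import ring lra.
Import PolynomialFunctions Norms.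
Import Order.TTheory GRing.Theory Num.Theory.
Import numFieldNormedType.Exports.
Local Open Scope classical_set_scope.
Local Open Scope ring_scope.

(** The list makes the finiteness of [A] part of the statement; the value [n] is then determined by
    [A] and [sigma]. *)
Definition has_count (R : nmodType) (T : eqType) (A : T -> Prop) (sigma : T -> R) (n : R) :=
  exists s : seq T, [/\ uniq s, forall x, x \in s <-> A x & \sum_(x <- s) sigma x = n].

Section ImplicitFunction.
Variable R : realType.

Lemma half_contraction_fixpoint m (f : 'rV[R]_m -> 'rV[R]_m) w0 r : 0 < r ->
  `|f w0 - w0| <= r / 2 ->
  (forall w w', `|w - w0| <= r -> `|w' - w0| <= r ->
     `|f w - f w'| <= 2^-1 * `|w - w'|) ->
  exists2 w, `|w - w0| <= r & f w = w.
Proof.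
move=> r0 hf0 hf; pose U := closed_ball w0 r.
have UE w : U w <-> `|w - w0| <= r.
  by rewrite /U closed_ballE // /closed_ball_ /= distrC.
have fU : set_fun U U f.
  move=> w /UE uw; apply/UE.
  have w0r : `|w0 - w0| <= r by rewrite subrr normr0 ltW.
  have h := hf _ _ uw w0r.
  have : `|f w - w0| <= `|f w - f w0| + `|f w0 - w0|.
    by rewrite -{1}(subrK (f w0) (f w)) -addrA ler_normD.
  move/le_trans; apply; apply: le_trans (lerD h hf0) _; lra.
have [] := @banach_fixed_point R 'rV[R]_m U (mkfun_fun fU).
- have q0 : 0 <= 2^-1 :> R by rewrite invr_ge0.
  exists (NngNum q0); split => /=; first by rewrite invf_lt1 ?ltr1n.
  by move=> [x y] [/= /UE ux /UE uy]; apply: hf.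
- exact: closed_ball_closed.
- by exists w0; apply/UE; rewrite subrr normr0 ltW.
by move=> p /UE up e; exists p.
Qed.

(** [T] is controlled on the interval only; composing it with the clamping [cl] gives a function
    continuous on the whole line, to which the intermediate value theorem applies. *)
Lemma IVT_lipschitz (T : R -> R) a b K v : a <= b ->
  (forall x y, a <= x <= b -> a <= y <= b -> `|T x - T y| <= K * `|x - y|) ->
  Num.min (T a) (T b) <= v <= Num.max (T a) (T b) ->
  exists2 x, a <= x <= b & T x = v.
Proof.
move=> ab hT hv; pose cl x := Num.max a (Num.min b x).
have clb x : a <= cl x <= b.
  by rewrite /cl le_max lexx /= ge_max ab ge_min lexx.
have cll x y : `|cl x - cl y| <= `|x - y|.
  have h1 := ler_norm (x - y); have h0 := normr_ge0 (x - y).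
  have h2 : y - x <= `|x - y| by rewrite distrC ler_norm.
  rewrite /cl ler_norml /Num.max /Num.min; apply/andP.
  by case: (ltP b x) => ?; case: (ltP b y) => ?; split; do 2?case: ltP => ?; lra.
have clE x : a <= x <= b -> cl x = x.
  by move=> /andP [ax xb]; rewrite /cl (min_idPr xb) (max_idPr ax).
have [||x _ e] := @IVT R (T \o cl) a b v ab.
- apply: continuous_subspaceT => x.
  apply/cvgrPdist_lt => e e0; near=> y.
  rewrite /= (le_lt_trans (hT _ _ (clb _) (clb _))) //.
  have : `|x - y| < e / (`|K| + 1) by near: y; apply: cvgr_dist_lt; rewrite ?divr_gt0 ?ltr_wpDl.
  rewrite ltr_pdivlMr ?ltr_wpDl // => h; apply: le_lt_trans h.
  have c := cll x y.
  have k1 := ler_norm K.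
  apply: (@le_trans _ _ (`|K| * `|cl x - cl y|)); first by rewrite ler_wpM2r.
  by rewrite mulrC ler_pM // lerDl.
- by rewrite /= !clE // lexx ab.
by exists (cl x).
Unshelve. all: by end_near. Qed.

Variable m : nat.
Implicit Types (z d : 'rV[R]_m.+1) (w : 'rV[R]_m) (l : 'I_m.+1).

(** A coordinate [l] serves as the parameter of a curve in dimension m + 1; [ins] puts its value
    back among the [m] others, which [col' l] extracts. *)
Definition ins l (s : R) w : 'rV[R]_m.+1 :=
  \row_i (if unlift l i is Some j then w 0 j else s).

Lemma ins_same l s w : ins l s w 0 l = s.
Proof. by rewrite mxE unlift_none. Qed.

Lemma col'_ins l s w : col' l (ins l s w) = w.
Proof. by apply/rowP => j; rewrite !mxE liftK. Qed.

Lemma ins_col' l z : ins l (z 0 l) (col' l z) = z.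
Proof. by apply/rowP => i; rewrite !mxE; case: unliftP => [j ->|->]; rewrite ?mxE. Qed.

Lemma insB l s s' w w' : ins l s w - ins l s' w' = ins l (s - s') (w - w').
Proof. by apply/rowP => i; rewrite !mxE; case: unlift => [j|]; rewrite ?mxE. Qed.

Lemma col'B l z z' : col' l (z - z') = col' l z - col' l z'.
Proof. by apply/rowP => i; rewrite !mxE. Qed.

Lemma ins_norm_lt l s w e : `|s| < e -> `|w| < e -> `|ins l s w| < e.
Proof.
move=> hs hw; apply: mx_norm_lt; first exact: le_lt_trans (normr_ge0 _) hs.
move=> i j; rewrite mxE; case: unlift => [k|//].
exact: le_lt_trans (mx_entry_le _ _ _) hw.
Qed.

Lemma mul_row'E l (d : 'rV[R]_m.+1) (M : 'M[R]_(m.+1, m)) :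
  d *m M = d 0 l *: row l M + col' l d *m row' l M.
Proof.
apply/rowP => j; rewrite !mxE (bigD1_ord l) //=; congr (_ + _).
by apply: eq_bigr => i _; rewrite !mxE.
Qed.

Variables (F : 'rV[R]_m.+1 -> 'rV[R]_m) (Q : 'rV[R]_(m.+1 + m.+1) -> 'M[R]_(m.+1, m)).
Hypothesis pQ : mxpolyf Q.
Hypothesis FQ : forall x y, F x - F y = (x - y) *m Q (row_mx x y).

(** When the partial Jacobian at [z0] is 1, the simplified Newton map w - F(w) contracts a small
    ball around [col' l z0] with factor 1/2. *)
Lemma implicit_exists1 l z0 : F z0 = 0 ->
  row' l (Q (row_mx z0 z0)) = 1%:M -> forall e, 0 < e ->
  exists2 dl, 0 < dl & forall s, `|s - z0 0 l| < dl ->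
    exists z, [/\ `|z - z0| < e, F z = 0 & z 0 l = s].
Proof.
move=> Fz0 Q1 e e0.
have pQl : mxpolyf (fun x => row' l (Q x)).
  by move=> i j; apply: polyf_ext (pQ (lift l i) j) _ => x; rewrite mxE.
have pQr : mxpolyf (fun x => row l (Q x)).
  by move=> i j; apply: polyf_ext (pQ l j) _ => x; rewrite mxE.
(* The norm is the maximum of the entries, so a product with a matrix of size m costs a factor m;
   this [c] yields the contraction factor 1/2. *)
pose c : R := (2 * m.+1%:R)^-1.
have c0 : 0 < c by rewrite invr_gt0 mulr_gt0.
have [d1 d10 h1] := mxpolyf_near (row_mx z0 z0) pQl c0.
have [d2 d20 h2] := mxpolyf_near (row_mx z0 z0) pQr (@ltr01 R).
have [r r0 [re rd1 rd2]] : exists2 r, 0 < r & [/\ r < e, r < d1 & r < d2].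
  exists (Num.min e (Num.min d1 d2) / 2); last first.
    have h := ltr_pdivrMr; split; rewrite ltr_pdivrMr // ?gt_min;
      do ?[rewrite !(ltr_pMr, ltr1n) // orbT ?orTb //]; lra.
  by rewrite divr_gt0 // !lt_min e0 d10 d20.
pose B := `|row l (Q (row_mx z0 z0))| + 1.
have B0 : 0 < B by rewrite ltr_wpDl.
(* [B] bounds the variation of F with the parameter, so that the first Newton step has length at
   most r / 2. *)
pose dl := Num.min r (r / (2 * B)).
have dl0 : 0 < dl by rewrite lt_min r0 divr_gt0 // mulr_gt0.
exists dl => // s; rewrite lt_min => /andP [sr sB].
have insP w : `|w - col' l z0| <= r -> forall eps, r < eps -> `|ins l s w - z0| < eps.
  move=> hw eps reps; rewrite -[X in _ - X](ins_col' l z0) insB.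
  by apply: ins_norm_lt; [apply: lt_trans sr reps | apply: le_lt_trans hw reps].
pose f w := w - F (ins l s w).
have [|w w' hw hw'|w hw fw] := @half_contraction_fixpoint m f (col' l z0) r r0.
- rewrite /f addrC addKr normrN -[F _]subr0 -Fz0 FQ (mul_row'E l).
  rewrite [col' l (_ - _)](_ : _ = 0) ?mul0mx ?addr0; last first.
    by rewrite col'B col'_ins subrr.
  rewrite normrZ mxE [in (- z0) 0 l]mxE ins_same.
  have := h2 (row_mx (ins l s (col' l z0)) z0).
  set N := row l (Q (row_mx (ins _ _ _) _)) => hN.
  have NB : `|N| <= B.
    have : `|N| <= `|N - row l (Q (row_mx z0 z0))| + `|row l (Q (row_mx z0 z0))|.
      by rewrite -{1}(subrK (row l (Q (row_mx z0 z0))) N) ler_normD.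
    move/le_trans; apply; rewrite /B addrC lerD2l ltW // hN //.
    apply: norm_row_mx_sub; first by apply: insP; rewrite ?subrr ?normr0 ?ltW.
    by rewrite subrr normr0.
  have := ler_pM (normr_ge0 _) (normr_ge0 _) (ltW sB) NB.
  move/le_trans; apply; rewrite (_ : r / (2 * B) * B = r / 2) //.
  by field; rewrite gt_eqF.
- have -> : f w - f w' = (w - w') *m (1%:M - row' l (Q (row_mx (ins l s w) (ins l s w')))).
    have := FQ (ins l s w) (ins l s w'); rewrite insB subrr (mul_row'E l).
    rewrite ins_same scale0r add0r col'_ins => e1.
    by rewrite mulmxBr mulmx1 -e1 /f; apply/rowP => i; rewrite !mxE; ring.
  apply: le_trans (mx_norm_mul _ _) _.
  have : `|row' l (Q (row_mx (ins l s w) (ins l s w'))) - row' l (Q (row_mx z0 z0))| < c.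
    by apply: h1; apply: norm_row_mx_sub; apply: insP.
  rewrite Q1 distrC => /ltW h; rewrite mulrAC mulrC [leRHS]mulrC.
  rewrite ler_wpM2l //.
  apply: (@le_trans _ _ (m%:R * c)); first by rewrite ler_wpM2l.
  by rewrite /c ler_pdivrMr ?mulr_gt0 // mulKf ?pnatr_eq0 // ler_nat.
exists (ins l s w); split; rewrite ?ins_same //; first exact: insP.
by apply/eqP; rewrite -oppr_eq0 -(addKr w (- F _)) -/(f w) fw addrC subrr.
Qed.

End ImplicitFunction.

End ImplicitFunction.

(** * Signed counts near regular points and folds *)

Module LocalCount.
Import structures.
Import all_boot all_order all_algebra.
Import boolp classical_sets functions reals interval_inference topology normedtype sequences realfun.
Import ring lra.
Import PolynomialFunctions Norms ImplicitFunction.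
Import Order.TTheory GRing.Theory Num.Theory.
Import numFieldNormedType.Exports.
Local Open Scope classical_set_scope.
Local Open Scope ring_scope.

Section LocalCount.
Variable R : realType.
Variable m : nat.
Implicit Types (z : 'rV[R]_m.+1) (l t : 'I_m.+1).

Lemma eq_ins l z z' : z 0 l = z' 0 l -> col' l z = col' l z' -> z = z'.
Proof. by move=> e1 e2; rewrite -(ins_col' l z) e1 e2 ins_col'. Qed.

(** The kernel vector of an (m + 1) x m matrix formed by its signed maximal minors, in the form
    given by Cramer's rule, with the sign normalized at entry [l]. *)
Definition minor_vec l (M : 'M[R]_(m.+1, m)) : 'rV[R]_m.+1 :=
  ins l (\det (row' l M)) (- (row l M *m \adj (row' l M))).

Lemma minor_vec_ker l M : minor_vec l M *m M = 0.
Proof.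
rewrite (mul_row'E l) /minor_vec ins_same col'_ins mulNmx -mulmxA mul_adj_mx.
by rewrite mul_mx_scalar subrr.
Qed.

(** Cramer's rule for the square matrix obtained by bordering [M] with the column e_t: its cofactors
    along that column are the minors, and the kernel vector is sent to a multiple of e_0. *)
Lemma det_row'_minor_vec l t M : \det (row' l M) != 0 ->
  \det (row' t M) = (-1) ^+ (l + t) * minor_vec l M 0 t.
Proof.
move=> dl; have := minor_vec_ker l M; have : minor_vec l M 0 l = \det (row' l M).
  by rewrite ins_same.
move: (minor_vec l M) => N Nl Nk.
pose X : 'M[R]_(1 + m) := row_mx (delta_mx t 0) M.
have cX i : cofactor X i 0 = (-1) ^+ i * \det (row' i M).
  rewrite /cofactor addn0; congr (_ * \det _); apply/matrixP => a b.
  rewrite !mxE; case: splitP => [j|j /= [e]].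
    by rewrite ord1.
  by congr (M _ _); apply: val_inj.
have X0 i : X i 0 = (i == t)%:R.
  rewrite mxE; case: splitP => [j _|j /= [e]]; last by [].
  by rewrite (ord1 j) mxE eqxx andbT.
have dX : \det X = (-1) ^+ t * \det (row' t M).
  rewrite (expand_det_col _ 0) (bigD1 t) //= cX X0 eqxx mul1r big1 ?addr0 //.
  by move=> i ti; rewrite X0 (negPf ti) mul0r.
have e1 : N *m X = N 0 t *: delta_mx 0 0.
  rewrite mul_mx_row Nk -colE; apply/rowP => j.
  rewrite !mxE; case: splitP => [k ej|k ej]; rewrite !mxE.
    by rewrite (_ : j == 0) ?mulr1 // -val_eqE /= ej (ord1 k).
  by rewrite (_ : j == 0 = false) ?mulr0 // -val_eqE /= ej.
have /(congr1 (fun v : 'rV__ => v 0 l)) : \det X *: N =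
    N 0 t *: (delta_mx 0 0 *m \adj X).
  by rewrite scalemxAl -e1 -mulmxA mul_mx_adj mul_mx_scalar.
rewrite [LHS]mxE [RHS]mxE -rowE !mxE cX dX Nl => e2.
have : (-1) ^+ t * \det (row' t M) = (-1) ^+ l * N 0 t.
  by apply: (mulIf dl); rewrite e2 mulrCA mulrA.
move/(congr1 (fun x => (-1) ^+ t * x)); rewrite !mulrA -!exprD addnn.
by rewrite -mul2n exprM sqrrN !expr1n mul1r addnC.
Qed.

Variables (F : 'rV[R]_m.+1 -> 'rV[R]_m) (Q : 'rV[R]_(m.+1 + m.+1) -> 'M[R]_(m.+1, m)).
Hypothesis pQ : mxpolyf Q.
Hypothesis Qsym : forall x y, Q (row_mx x y) = Q (row_mx y x).
Hypothesis FQ : forall x y, F x - F y = (x - y) *m Q (row_mx x y).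

(** On the diagonal this is the Jacobian determinant with respect to the coordinates other than [l].
    Off the diagonal it governs the difference of two zeros. *)
Definition minor_at l z z' := \det (row' l (Q (row_mx z z'))).
Definition minors_at l z z' := minor_vec l (Q (row_mx z z')).

Lemma polyf_minor l : polyf (fun Z => \det (row' l (Q Z))).
Proof.
apply: polyf_det => i j; apply: polyf_ext (pQ (lift l i) j) _ => x.
by rewrite mxE.
Qed.

Lemma mxpolyf_minors l : mxpolyf (fun Z => minor_vec l (Q Z)).
Proof.
have pQl : mxpolyf (fun x => row' l (Q x)).
  by move=> i j; apply: polyf_ext (pQ (lift l i) j) _ => x; rewrite mxE.
have pQr : mxpolyf (fun x => row l (Q x)).
  by move=> i j; apply: polyf_ext (pQ l j) _ => x; rewrite mxE.
move=> i j; rewrite (ord1 i); case: (unliftP l j) => [k ->|->].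
  have := mxpolyf_opp (mxpolyf_mul pQr (mxpolyf_adj pQl)).
  move/(_ 0 k)/polyf_ext; apply => x.
  have /rowP/(_ k) <- := col'_ins l (\det (row' l (Q x)))
    (- (row l (Q x) *m \adj (row' l (Q x)))).
  by rewrite [LHS]mxE.
by apply: polyf_ext (polyf_minor l) _ => x; rewrite ins_same.
Qed.

(** The chord between two points of a level set is a kernel vector of the difference quotient, hence
    proportional to the vector of minors. Where [minor_at l] does not vanish, a point of the level
    set is thus determined by its coordinate [l]. *)
Lemma minors_atE l z z' : F z = F z' ->
  minor_at l z z' *: (z - z') = (z 0 l - z' 0 l) *: minors_at l z z'.
Proof.
move=> e; have := FQ z z'; rewrite e subrr (mul_row'E l) => /esym/eqP.
rewrite addr_eq0 => /eqP e1.
apply: (@eq_ins l); first by rewrite [LHS]mxE [RHS]mxE ins_same !mxE mulrC.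
have -> s v : col' l (s *: v) = s *: col' l v :> 'rV[R]_m.
  by apply/rowP => i; rewrite !mxE.
have -> s v : col' l (s *: v) = s *: col' l v :> 'rV[R]_m.
  by apply/rowP => i; rewrite !mxE.
rewrite /minors_at col'_ins -mul_mx_scalar -mul_mx_adj mulmxA.
by rewrite -[_ *m row' l _]opprK -e1 scalerN mulNmx -scalemxAl !mxE.
Qed.

Lemma minor_near (g : 'rV[R]_(m.+1 + m.+1) -> R) z0 : polyf g ->
  g (row_mx z0 z0) != 0 -> exists2 d, 0 < d & forall z z',
  `|z - z0| < d -> `|z' - z0| < d -> Num.sg (g (row_mx z z')) = Num.sg (g (row_mx z0 z0)).
Proof.
move=> pg /(polyf_near_sgr pg) [d d0 hd]; exists d => // z z' hz hz'.
by apply: hd; apply: norm_row_mx_sub.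
Qed.

Lemma implicit_exists l z0 : F z0 = 0 -> minor_at l z0 z0 != 0 ->
  forall e, 0 < e ->
  exists2 dl, 0 < dl & forall s, `|s - z0 0 l| < dl ->
    exists z, [/\ `|z - z0| < e, F z = 0 & z 0 l = s].
Proof.
move=> Fz0 nz e e0; pose B := invmx (row' l (Q (row_mx z0 z0))).
have uB : row' l (Q (row_mx z0 z0)) \in unitmx by rewrite unitmxE unitfE.
have [||||d d0 hd] := @implicit_exists1 R m (fun z => F z *m B) (fun Z => Q Z *m B)
    _ _ l z0 _ _ e e0.
- by apply: mxpolyf_mul => //; apply: mxpolyf_cst.
- by move=> x y; rewrite -mulmxBl FQ mulmxA.
- by rewrite Fz0 mul0mx.
- rewrite -(mulmxV uB) -/B; apply/matrixP => i j; rewrite !mxE.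
  by apply: eq_bigr => k _; rewrite !mxE.
exists d => // s /hd [z [h1 h2 h3]]; exists z; split => //.
have : F z *m B *m row' l (Q (row_mx z0 z0)) = 0 by rewrite h2 mul0mx.
by rewrite -mulmxA mulVmx // mulmx1.
Qed.

(** Existence is the implicit function theorem; uniqueness is the chord identity [minors_atE] for
    two points with the same coordinate [t]. *)
Lemma local_count_regular t z0 : F z0 = 0 -> minor_at t z0 z0 != 0 ->
  forall e, 0 < e -> exists e', [/\ 0 < e', e' <= e & exists2 dl, 0 < dl &
    forall s, `|s - z0 0 t| < dl ->
    has_count (fun z => [/\ `|z - z0| < e', F z = 0 & z 0 t = s])
      (fun z => Num.sg (minor_at t z z)) (Num.sg (minor_at t z0 z0))].
Proof.
move=> Fz0 nz e e0; have [d d0 hd] := minor_near (polyf_minor t) nz.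
exists (Num.min e d); split; rewrite ?ge_min ?lexx //; first by rewrite lt_min e0.
have e'0 : 0 < Num.min e d by rewrite lt_min e0.
have [dl dl0 hdl] := implicit_exists Fz0 nz e'0.
exists dl => // s /hdl [z [zz Fz zs]].
have zd : `|z - z0| < d by apply: lt_le_trans zz _; rewrite ge_min lexx orbT.
exists [:: z]; split=> // [x|]; last by rewrite big_seq1; apply: hd.
rewrite inE; split=> [/eqP -> //|[xx Fx xs]]; apply/eqP.
have xd : `|x - z0| < d by apply: lt_le_trans xx _; rewrite ge_min lexx orbT.
have /(minors_atE t)/eqP : F x = F z by rewrite Fx.
rewrite xs zs subrr scale0r scaler_eq0 subr_eq0 => /orP [|/eqP //].
by rewrite -sgr_eq0 (hd _ _ xd zd) sgr_eq0 (negPf nz).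
Qed.

Lemma centered_itv (c e : R) : 0 < e ->
  [/\ c - e <= c + e <= c + e, c - e <= c - e <= c + e,
      c <= c + e, c - e <= c & c - e <= c <= c + e].
Proof. by move=> e0; split; try apply/andP; try split; lra. Qed.

Lemma centered_itv_norm (c e d y : R) : e < d -> c - e <= y <= c + e -> `|y - c| < d.
Proof. by move=> ed /andP [y1 y2]; rewrite ltr_norml; apply/andP; split; lra. Qed.

Lemma between_minmax (c s p x : R) : Num.sg (s - c) = x -> Num.sg (p - c) = x ->
  `|s - c| < `|p - c| -> Num.min c p <= s <= Num.max c p.
Proof.
move=> <- /eqP; have [h|h|->] := ltrgt0P (s - c); last by rewrite sgr0 sgr_cp0 => /eqP ->; rewrite normr0 ltxx.
  rewrite (gtr0_sg h) sgr_cp0 => h'; rewrite !gtr0_norm // => h2.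
  by rewrite ge_min le_max; apply/andP; split; apply/orP; [left|right]; lra.
rewrite (ltr0_sg h) sgr_cp0 => h'; rewrite !ltr0_norm // => h2.
by rewrite ge_min le_max; apply/andP; split; apply/orP; [right|left]; lra.
Qed.

Lemma same_sign_le0 (a b : R) : a + b < 0 -> 0 <= a * b -> a <= 0 /\ b <= 0.
Proof. by move=> h1 h2; split; nra. Qed.

Lemma same_sign_ge0 (a b : R) : 0 < a + b -> 0 <= a * b -> 0 <= a /\ 0 <= b.
Proof. by move=> h1 h2; split; nra. Qed.

Lemma sgr_mix (a b u v x : R) : x != 0 -> Num.sg a = x -> Num.sg b = x ->
  0 <= u -> 0 <= v -> 0 < u + v -> Num.sg (u * a + v * b) = x.
Proof.
move=> x0 ha hb u0 v0 uv; rewrite [a]numEsg [b]numEsg ha hb.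
rewrite mulrCA [v * _]mulrCA -mulrDr sgrM.
have a0 : 0 < `|a| by rewrite normr_gt0 -sgr_eq0 ha.
have b0 : 0 < `|b| by rewrite normr_gt0 -sgr_eq0 hb.
rewrite [Num.sg (_ + _)]gtr0_sg ?mulr1 -?ha ?sgr_id //.
move: u0; rewrite le_eqVlt => /orP [/eqP u0|u0].
  by move: uv; rewrite -u0 add0r mul0r add0r => v1; rewrite mulr_gt0.
by rewrite ltr_pwDl ?mulr_gt0 // mulr_ge0 // ltW.
Qed.

Lemma minors_at_ker l z0 v : v *m Q (row_mx z0 z0) = 0 -> v 0 l = 1 ->
  minors_at l z0 z0 = minor_at l z0 z0 *: v.
Proof.
move=> vk v1; apply: (@eq_ins l); first by rewrite ins_same mxE v1 mulr1.
rewrite /minors_at col'_ins.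
have /eqP := vk; rewrite (mul_row'E l) v1 scale1r addr_eq0 => /eqP ->.
rewrite mulNmx opprK -mulmxA mul_mx_adj mul_mx_scalar.
by apply/rowP => i; rewrite !mxE.
Qed.

Lemma minors_lipschitz l z0 : minor_at l z0 z0 != 0 -> exists2 d, 0 < d &
  exists K, forall z z', `|z - z0| < d -> `|z' - z0| < d -> F z = F z' ->
    `|z - z'| <= K * `|z 0 l - z' 0 l|.
Proof.
move=> nz; set d0 := minor_at l z0 z0 in nz.
have h0 : 0 < `|d0| / 2 by rewrite divr_gt0 // normr_gt0.
have [r1 r10 h1] := polyf_near (row_mx z0 z0) (polyf_minor l) h0.
have [r2 r20 h2] := mxpolyf_near (row_mx z0 z0) (mxpolyf_minors l) (@ltr01 R).
exists (Num.min r1 r2); first by rewrite lt_min r10.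
exists ((`|d0| / 2)^-1 * (`|minors_at l z0 z0| + 1)) => z z'.
rewrite !lt_min => /andP [z1 z2] /andP [z1' z2'] /(minors_atE l) e.
rewrite -mulrA ler_pdivlMl //.
have {}h1 := h1 _ (norm_row_mx_sub z1 z1').
have {}h2 := h2 _ (norm_row_mx_sub z2 z2').
apply: (@le_trans _ _ (`|minor_at l z z'| * `|z - z'|)).
  rewrite ler_wpM2r //.
  have : `|d0| <= `|minor_at l z z'| + `|minor_at l z z' - d0|.
    by rewrite -{1}(subKr (minor_at l z z') d0) ler_normB.
  rewrite -/(minor_at l z z') -/d0 in h1; lra.
rewrite -normrZ e normrZ mulrC ler_wpM2r //.
rewrite -/(minors_at l z z') in h2.
have : `|minors_at l z z'| <= `|minors_at l z z' - minors_at l z0 z0| + `|minors_at l z0 z0|.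
  by rewrite -{1}(subrK (minors_at l z0 z0) (minors_at l z z')) ler_normD.
by move/le_trans; apply; rewrite addrC lerD2l ltW.
Qed.

(* Symmetric first order expansion of the fold function [minors_at l z z' 0 t]
   around a zero of it on the diagonal. *)
Lemma fold_expansion l t z0 : minors_at l z0 z0 0 t = 0 ->
  exists2 P : 'rV[R]_(m.+1 + m.+1) -> 'cV[R]_m.+1, mxpolyf P &
  forall z z', minors_at l z z' 0 t =
    ((z - z0) *m P (row_mx z z')) 0 0 + ((z' - z0) *m P (row_mx z' z)) 0 0.
Proof.
move=> h0; set Z0 := row_mx z0 z0.
have [e [pe _ he]] := polyf_quotient (mxpolyf_minors l 0 t).
have pid : mxpolyf (fun Z : 'rV[R]_(m.+1 + m.+1) => row_mx Z Z0).
  by apply: mxpolyf_row_mx; [apply: mxpolyf_id | apply: mxpolyf_cst].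
have pl : mxpolyf (fun Z : 'rV[R]_(m.+1 + m.+1) => lsubmx Z).
  by move=> i j; apply: polyf_ext (polyf_coord R (lshift _ j)) _ => z; rewrite !mxE (ord1 i).
have pr : mxpolyf (fun Z : 'rV[R]_(m.+1 + m.+1) => rsubmx Z).
  by move=> i j; apply: polyf_ext (polyf_coord R (rshift _ j)) _ => z; rewrite !mxE (ord1 i).
have pe' := mxpolyf_comp pe pid.
pose p Z := usubmx (e (row_mx Z Z0)); pose q Z := dsubmx (e (row_mx Z Z0)).
have pp : mxpolyf p by move=> i j; apply: polyf_ext (pe' (lshift _ i) j) _ => z; rewrite !mxE.
have pq : mxpolyf q by move=> i j; apply: polyf_ext (pe' (rshift _ i) j) _ => z; rewrite !mxE.
have hpq z z' : minors_at l z z' 0 t =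
    ((z - z0) *m p (row_mx z z')) 0 0 + ((z' - z0) *m q (row_mx z z')) 0 0.
  have := he (row_mx z z') Z0; rewrite -/(minors_at l z z') -/(minors_at l z0 z0) h0 subr0.
  move=> ->; rewrite opp_row_mx add_row_mx -[e _]vsubmxK mul_row_col.
  by rewrite [LHS]mxE.
have hsym z z' : minors_at l z z' = minors_at l z' z by rewrite /minors_at Qsym.
exists (fun Z => 2^-1 *: (p Z + q (row_mx (rsubmx Z) (lsubmx Z)))).
  apply: mxpolyf_scale; first exact: polyf_cst.
  apply: mxpolyf_add => //; apply: (mxpolyf_comp pq).
  exact: mxpolyf_row_mx.
move=> z z'; have e1 := hpq z z'; have := hpq z' z; rewrite hsym => e2.
rewrite !row_mxKl !row_mxKr -!scalemxAr !mulmxDr !mxE -!/(mulmx _ _).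
rewrite !mxE in e1 e2; rewrite -[LHS](mulKf (_ : 2 != 0)) ?pnatr_eq0 //.
by rewrite -mulrDr; congr (_ * _); rewrite mulrDl mul1r {1}e1 e2; ring.
Qed.

(** By the expansion, [minor_at t] at z0 + s v is, up to sign, twice s times v P. A zero of v P at
    [z0] would make it o(s), against the lower bound c |s|. *)
Lemma fold_slope l t z0 (v : 'rV[R]_m.+1)
    (P : 'rV[R]_(m.+1 + m.+1) -> 'cV[R]_m.+1) : F z0 = 0 -> minor_at l z0 z0 != 0 -> mxpolyf P ->
  (forall z z', minors_at l z z' 0 t =
    ((z - z0) *m P (row_mx z z')) 0 0 + ((z' - z0) *m P (row_mx z' z)) 0 0) ->
  (exists c e1, [/\ 0 < c, 0 < e1 & forall s, `|s| < e1 ->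
     c * `|s| <= `|minor_at t (z0 + s *: v) (z0 + s *: v)|]) ->
  (v *m P (row_mx z0 z0)) 0 0 != 0.
Proof.
move=> Fz0 nz pP hP [c [e1 [c0 e10 hc]]]; apply/eqP => v0.
have pV : polyf (fun Z => (v *m P Z) 0 0).
  exact: (mxpolyf_mul (mxpolyf_cst _ v) pP).
(* v P occurs twice on the diagonal, so the bound c / 4 on it bounds the minor by c s / 2. *)
have c4 : 0 < c / 4 by rewrite divr_gt0.
have [r1 r10 h1] := polyf_near (row_mx z0 z0) pV c4.
have [r2 r20 h2] := minor_near (polyf_minor l) nz.
pose s := Num.min e1 (Num.min r1 r2) / (2 * (`|v| + 1)).
have m0 : 0 < Num.min e1 (Num.min r1 r2) by rewrite !lt_min e10 r10.
have v1 : 0 < `|v| + 1 by rewrite ltr_wpDl.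
have s0 : 0 < s by rewrite divr_gt0 // mulr_gt0.
have svl : s * (`|v| + 1) < Num.min e1 (Num.min r1 r2).
  rewrite /s invfM mulrA divfK ?gt_eqF // ltr_pdivrMr // ltr_pMr // ltr1n //.
have sl : s < Num.min e1 (Num.min r1 r2).
  by apply: le_lt_trans svl; rewrite ler_peMr ?lerDr // ltW.
have zs r : Num.min e1 (Num.min r1 r2) <= r -> `|z0 + s *: v - z0| < r.
  move=> le; rewrite addrC addKr normrZ gtr0_norm //.
  apply: le_lt_trans (lt_le_trans svl le); rewrite ler_wpM2l ?lerDl // ltW //.
set z := z0 + s *: v in zs.
have le1 : Num.min e1 (Num.min r1 r2) <= r1 by rewrite !ge_min lexx !orbT.
have le2 : Num.min e1 (Num.min r1 r2) <= r2 by rewrite !ge_min lexx !orbT.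
have := hc s; rewrite (gtr0_norm s0) => /(_ (lt_le_trans sl _)).
rewrite ge_min lexx => /(_ isT); rewrite -/z.
have nz1 : minor_at l z z != 0.
  rewrite -sgr_eq0 (h2 z z) ?zs // sgr_eq0 //.
rewrite /minor_at (@det_row'_minor_vec l t) // normrM normrX normrN1 expr1n mul1r.
have zz : z - z0 = s *: v by rewrite /z addrC addKr.
have zP Z : (s *: v *m P Z) 0 0 = s * (v *m P Z) 0 0 by rewrite -scalemxAl mxE.
rewrite -/(minors_at l z z) hP zz zP.
have := h1 _ (norm_row_mx_sub (zs _ le1) (zs _ le1)).
rewrite v0 subr0; set x := (v *m _) 0 0 => hx.
move=> hle; have : c * s <= s * (c / 2).
  apply: le_trans hle _; rewrite -mulrDr normrM (gtr0_norm s0).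
  rewrite ler_wpM2l ?(ltW s0) //; have := ler_normD x x; lra.
rewrite mulrC ler_pM2l //; lra.
Qed.

(** At a fold the zero curve, parametrized by its coordinate [l], touches the hyperplane of constant
    coordinate [t] and stays on one side of it. A nearby hyperplane on that side meets it twice,
    with opposite signs of [minor_at t]; on the other side there is no zero, and at the fold itself
    the sign is 0. The count is 0 in all cases. *)
Lemma local_count_fold l t z0 (v : 'rV[R]_m.+1) : F z0 = 0 -> minor_at l z0 z0 != 0 ->
  v *m Q (row_mx z0 z0) = 0 -> v 0 l = 1 -> v 0 t = 0 ->
  (exists c e1, [/\ 0 < c, 0 < e1 & forall s, `|s| < e1 ->
     c * `|s| <= `|minor_at t (z0 + s *: v) (z0 + s *: v)|]) ->
  forall e, 0 < e -> exists e', [/\ 0 < e', e' <= e & exists2 dl, 0 < dl &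
    forall s, `|s - z0 0 t| < dl ->
    has_count (fun z => [/\ `|z - z0| < e', F z = 0 & z 0 t = s])
      (fun z => Num.sg (minor_at t z z)) 0].
Proof.
move=> Fz0 nz vk vl vt hfold e e0.
have nuv := minors_at_ker vk vl.
have h00 : minors_at l z0 z0 0 t = 0 by rewrite nuv mxE vt mulr0.
have [P pP hP] := fold_expansion h00.
have slope := fold_slope Fz0 nz pP hP hfold.
(* Writing z - z0 as u times minors over a minor turns the expansion into u A(z, z') + u' A(z', z)
   up to a positive factor; [A] has constant sign near the fold. *)
pose A Z := \det (row' l (Q (row_mx (rsubmx Z) z0))) *
  (minor_vec l (Q (row_mx (lsubmx Z) z0)) *m P Z) 0 0.
have pl : mxpolyf (fun Z : 'rV[R]_(m.+1 + m.+1) => row_mx (lsubmx Z) z0).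
  apply: mxpolyf_row_mx; last exact: mxpolyf_cst.
  by move=> i j; apply: polyf_ext (polyf_coord R (lshift _ j)) _ => z; rewrite !mxE (ord1 i).
have pr : mxpolyf (fun Z : 'rV[R]_(m.+1 + m.+1) => row_mx (rsubmx Z) z0).
  apply: mxpolyf_row_mx; last exact: mxpolyf_cst.
  by move=> i j; apply: polyf_ext (polyf_coord R (rshift _ j)) _ => z; rewrite !mxE (ord1 i).
have pA : polyf A.
  apply: polyf_mul; first by apply: (polyf_comp (polyf_minor l)) => i; apply: pr.
  exact: (mxpolyf_mul (mxpolyf_comp (mxpolyf_minors l) pl) pP 0 0).
have AE z z' : A (row_mx z z') = minor_at l z' z0 * (minors_at l z z0 *m P (row_mx z z')) 0 0.
  by rewrite /A row_mxKl row_mxKr.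
have A0 : A (row_mx z0 z0) != 0.
  by rewrite AE nuv -scalemxAl mxE !mulf_neq0.
set d0 := minor_at l z0 z0 in nz nuv; set a0 := A (row_mx z0 z0) in A0.
have [r1 r10 h1] := minor_near (polyf_minor l) nz.
have [r2 r20 h2] := minor_near pA A0.
have [r3 r30 [K hK]] := minors_lipschitz nz.
pose e' := Num.min e (Num.min r1 (Num.min r2 r3)).
have e'0 : 0 < e' by rewrite !lt_min e0 r10 r20.
pose inb z := `|z - z0| < e' /\ F z = 0.
have sd z z' : inb z -> inb z' -> Num.sg (minor_at l z z') = Num.sg d0.
  move=> [hz _] [hz' _]; apply: h1.
    by apply: lt_le_trans hz _; rewrite !ge_min lexx !orbT.
  by apply: lt_le_trans hz' _; rewrite !ge_min lexx !orbT.
have sA z z' : inb z -> inb z' -> Num.sg (A (row_mx z z')) = Num.sg a0.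
  move=> [hz _] [hz' _]; apply: h2.
    by apply: lt_le_trans hz _; rewrite !ge_min lexx !orbT.
  by apply: lt_le_trans hz' _; rewrite !ge_min lexx !orbT.
have lipK z z' : inb z -> inb z' -> `|z - z'| <= K * `|z 0 l - z' 0 l|.
  move=> [hz Fz] [hz' Fz']; apply: hK; rewrite ?Fz //.
    by apply: lt_le_trans hz _; rewrite !ge_min lexx !orbT.
  by apply: lt_le_trans hz' _; rewrite !ge_min lexx !orbT.
have in0 : inb z0 by split; rewrite ?subrr ?normr0.
pose u z := z 0 l - z0 0 l.
have dz z z' : inb z -> inb z' ->
   minor_at l z z' *: (z - z') = (u z - u z') *: minors_at l z z'.
  move=> [_ Fz] [_ Fz']; rewrite minors_atE ?Fz //; congr (_ *: _).
  by rewrite /u; ring.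
have dzt z z' : inb z -> inb z' -> minor_at l z z' * (z 0 t - z' 0 t) =
    (u z - u z') * minors_at l z z' 0 t.
  move=> iz iz'; have := congr1 (fun w : 'rV__ => w 0 t) (dz _ _ iz iz').
  by rewrite [LHS]mxE [RHS]mxE => <-; rewrite !mxE.
have hA z z' : inb z -> inb z' -> minors_at l z z' 0 t * (minor_at l z z0 * minor_at l z' z0)
    = u z * A (row_mx z z') + u z' * A (row_mx z' z).
  move=> iz iz'; rewrite hP mulrDl.
  have key y y' : inb y -> ((y - z0) *m P (row_mx y y')) 0 0 * (minor_at l y z0 * minor_at l y' z0)
      = u y * A (row_mx y y').
    move=> iy; rewrite AE.
    have := dz y z0 iy in0; rewrite [u z0]/u subrr subr0.
    move/(congr1 (fun w => (w *m P (row_mx y y')) 0 0)); rewrite -!scalemxAl.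
    rewrite [LHS]mxE [RHS]mxE => e1.
    by rewrite mulrA [_ * minor_at l y z0]mulrC e1; ring.
  rewrite key //; congr (_ + _); rewrite [minor_at l z z0 * _]mulrC key //.
(* For two points on the same side of the fold, the entry [t] of the chord direction has the sign of
   u z + u z' times a constant. This yields both the injectivity of coordinate [t] on each side and
   the signs of the minors. *)
have sgh z z' : inb z -> inb z' -> u z + u z' != 0 -> 0 <= u z * u z' ->
   Num.sg (minors_at l z z' 0 t) = Num.sg a0 * Num.sg (u z + u z').
  move=> iz iz' nu uu.
  have dd : Num.sg (minor_at l z z0 * minor_at l z' z0) = 1.
    by rewrite sgrM !sd // -expr2 sqr_sg nz.
  rewrite -[LHS]mulr1 -dd -sgrM hA //.
  have ss := sA _ _ iz iz'; have ss' := sA _ _ iz' iz.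
  have x0 : Num.sg a0 != 0 by rewrite sgr_eq0.
  move: nu; rewrite neq_lt => /orP [] nu.
    have [u1 u2] := same_sign_le0 nu uu.
    rewrite (ltr0_sg nu) mulrN1 -[LHS]opprK -sgrN opprD -!mulNr; congr (- _).
    by apply: sgr_mix => //; rewrite ?oppr_ge0 // -opprD oppr_gt0.
  have [u1 u2] := same_sign_ge0 nu uu.
  by rewrite (gtr0_sg nu) mulr1; apply: sgr_mix.
have inj z z' : inb z -> inb z' -> z 0 t = z' 0 t -> u z + u z' != 0 ->
    0 <= u z * u z' -> z = z'.
  move=> iz iz' et nu uu; have e1 := dz _ _ iz iz'.
  have := dzt _ _ iz iz'; rewrite et subrr mulr0.
  move/esym/eqP; rewrite mulf_eq0 -[minors_at _ _ _ 0 t == 0]sgr_eq0.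
  rewrite sgh // mulf_eq0 !sgr_eq0 (negPf A0) (negPf nu) !orbF => /eqP e2.
  move/eqP: e1; rewrite e2 scale0r scaler_eq0 -sgr_eq0 sd // sgr_eq0 (negPf nz) /=.
  by rewrite subr_eq0 => /eqP.
(* The side of the hyperplane on which the curve lies. *)
pose ka := Num.sg d0 * Num.sg a0.
have st z : inb z -> u z != 0 -> Num.sg (z 0 t - z0 0 t) = ka.
  move=> iz nu; have := dzt _ _ iz in0 => /(congr1 Num.sg).
  have u0 : u z0 = 0 by rewrite /u subrr.
  rewrite !sgrM sd // u0 subr0 sgh ?u0 ?addr0 ?mulr0 // => e1.
  apply: (mulfI (_ : Num.sg d0 != 0)); first by rewrite sgr_eq0.
  have y2 (y : R) : y != 0 -> Num.sg y * Num.sg y = 1.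
    by move=> yn; rewrite -expr2 sqr_sg yn.
  by rewrite e1 /ka mulrCA y2 // mulr1 mulrA y2 // mul1r.
have sm z : inb z -> u z != 0 -> Num.sg (minor_at t z z) = (-1) ^+ (l + t) * Num.sg a0 * Num.sg (u z).
  move=> iz nu.
  have dn : \det (row' l (Q (row_mx z z))) != 0.
    by rewrite -sgr_eq0 -/(minor_at l z z) sd // sgr_eq0.
  have uu : u z + u z != 0 by rewrite -mulr2n mulrn_eq0.
  have := sgh z z iz iz uu (sqr_ge0 (u z)).
  have -> : Num.sg (u z + u z) = Num.sg (u z).
    by rewrite -mulr2n -mulr_natl sgrM gtr0_sg ?ltr0n ?mul1r.
  move=> e1.
  rewrite /minor_at (det_row'_minor_vec t dn) -/(minors_at l z z) sgrM e1 mulrA.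
  congr (_ * _ * _); rewrite -signr_odd.
  by case: (odd _); rewrite ?expr0 ?expr1 ?sgrN ?sgr1.
have [d1 d10 hd1] := implicit_exists Fz0 nz e'0.
(* [zf] parametrizes the curve by coordinate [l]; outside the range of the implicit function theorem
   its values are arbitrary. *)
have /boolp.choice [zf hzf] : forall s, exists z, `|s - z0 0 l| < d1 ->
    inb z /\ z 0 l = s.
  move=> s; have [/hd1 [z [? ? ?]]|_] := boolP (`|s - z0 0 l| < d1).
    by exists z.
  by exists z0.
pose eta := d1 / 2.
have eta0 : 0 < eta by rewrite divr_gt0.
have etad : eta < d1 by rewrite /eta ltr_pdivrMr // ltr_pMr // ltr1n.
have nb y : z0 0 l - eta <= y <= z0 0 l + eta -> `|y - z0 0 l| < d1.
  exact: centered_itv_norm.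
have [ip im il ir ic] := centered_itv (z0 0 l) eta0.
have zfc : zf (z0 0 l) = z0.
  have [|i1 e1] := hzf (z0 0 l); first by rewrite subrr normr0.
  apply/eqP; rewrite -subr_eq0 -normr_le0; apply: le_trans (lipK _ _ i1 in0) _.
  by rewrite e1 subrr normr0 mulr0.
have zfl x y : z0 0 l - eta <= x <= z0 0 l + eta -> z0 0 l - eta <= y <= z0 0 l + eta ->
    `|zf x 0 t - zf y 0 t| <= K * `|x - y|.
  move=> /nb /hzf [ix ex] /nb /hzf [iy ey].
  have -> : zf x 0 t - zf y 0 t = (zf x - zf y) 0 t by rewrite !mxE.
  by apply: le_trans (mx_entry_le _ _ _) _; rewrite -{2}ex -{2}ey lipK.
(* On each half of the curve, the intermediate value theorem gives a point with prescribed
   coordinate [t]. *)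
have side a b s : z0 0 l - eta <= a -> a <= b -> b <= z0 0 l + eta ->
    (a = z0 0 l /\ b = z0 0 l + eta) \/ (a = z0 0 l - eta /\ b = z0 0 l) ->
    Num.sg (s - z0 0 t) = ka ->
    `|s - z0 0 t| < `|zf (z0 0 l + eta) 0 t - z0 0 t| ->
    `|s - z0 0 t| < `|zf (z0 0 l - eta) 0 t - z0 0 t| ->
    exists x, a <= x <= b /\ zf x 0 t = s.
  move=> ha ab hb hab ss s1 s2.
  have [zp1 zp2] := hzf _ (nb _ ip); have [zm1 zm2] := hzf _ (nb _ im).
  have sp : Num.sg (zf (z0 0 l + eta) 0 t - z0 0 t) = ka.
    by apply: st => //; rewrite /u zp2 addrC addKr gt_eqF.
  have sm' : Num.sg (zf (z0 0 l - eta) 0 t - z0 0 t) = ka.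
    by apply: st => //; rewrite /u zm2 addrC addKr oppr_eq0 gt_eqF.
  have [||x xab xs] := @IVT_lipschitz _ (fun x => zf x 0 t) a b K s ab.
  - move=> x y /andP [x1 x2] /andP [y1 y2]; apply: zfl; apply/andP; split.
    + exact: le_trans ha x1.
    + exact: le_trans x2 hb.
    + exact: le_trans ha y1.
    + exact: le_trans y2 hb.
  - case: hab => -[-> ->]; rewrite zfc; first exact: between_minmax ss sp s1.
    by rewrite minC maxC; apply: between_minmax ss sm' s2.
  by exists x.
have [zp1 zp2] := hzf _ (nb _ ip); have [zm1 zm2] := hzf _ (nb _ im).
have up : u (zf (z0 0 l + eta)) != 0 by rewrite /u zp2 addrC addKr gt_eqF.
have um : u (zf (z0 0 l - eta)) != 0 by rewrite /u zm2 addrC addKr oppr_eq0 gt_eqF.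
have ka0 : ka != 0 by rewrite mulf_neq0 // sgr_eq0.
exists e'; split=> //; first by rewrite ge_min lexx.
exists (Num.min `|zf (z0 0 l + eta) 0 t - z0 0 t| `|zf (z0 0 l - eta) 0 t - z0 0 t|).
  by rewrite lt_min !normr_gt0; apply/andP; split; rewrite -sgr_eq0 st.
move=> s; rewrite lt_min => /andP [s1 s2].
have u0 : u z0 = 0 by rewrite /u subrr.
have ub z : u z = 0 -> inb z -> z = z0.
  move=> uz iz; apply/eqP; rewrite -subr_eq0 -normr_le0.
  by apply: le_trans (lipK _ _ iz in0) _; rewrite -/(u z) uz normr0 mulr0.
have [ss|ss] := eqVneq (Num.sg (s - z0 0 t)) ka; last first.
  have [s0|s0] := eqVneq s (z0 0 t); last first.
    exists [::]; split=> //; last by rewrite big_nil.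
    move=> x; split=> // -[x1 x2 x3]; have ix : inb x by [].
    have [ux|ux] := eqVneq (u x) 0.
      by move: s0; rewrite -x3 (ub _ ux ix) eqxx.
    by move: ss; rewrite -x3 st // eqxx.
  exists [:: z0]; split=> //; last first.
    rewrite big_seq1 /minor_at (det_row'_minor_vec t nz) -/(minors_at l z0 z0).
    by rewrite h00 mulr0 sgr0.
  move=> x; rewrite inE; split=> [/eqP ->|[x1 x2 x3]]; first by case: in0; split.
  have ix : inb x by []; have [ux|ux] := eqVneq (u x) 0; first by rewrite (ub _ ux ix).
  by have := st x ix ux; rewrite x3 s0 subrr sgr0 => /esym/eqP; rewrite (negPf ka0).
have [x [/andP [xl xr] xs]] : exists x, z0 0 l <= x <= z0 0 l + eta /\ zf x 0 t = s.
  by apply: side => //; left.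
have [y [/andP [yl yr] ys]] : exists x, z0 0 l - eta <= x <= z0 0 l /\ zf x 0 t = s.
  by apply: side => //; right.
have sn : s != z0 0 t by apply: contraNneq ka0 => se; rewrite -ss se subrr sgr0.
have [ix ex] : inb (zf x) /\ zf x 0 l = x.
  by apply/hzf/nb/andP; split; rewrite // (le_trans ir).
have [iy ey] : inb (zf y) /\ zf y 0 l = y.
  by apply/hzf/nb/andP; split; rewrite // (le_trans yr).
have ux : 0 < u (zf x).
  rewrite /u ex subr_gt0 lt_neqAle xl andbT.
  by apply: contraNneq sn => e1; rewrite -xs -e1 zfc.
have uy : u (zf y) < 0.
  rewrite /u ey subr_lt0 lt_neqAle yr andbT.
  by apply: contraNneq sn => e1; rewrite -ys e1 zfc.
exists [:: zf x; zf y]; split.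
- rewrite /= inE andbT; apply: contraTneq ux => ->; by rewrite -leNgt ltW.
- move=> w; rewrite !inE; split=> [/orP [] /eqP ->|[w1 w2 w3]].
  + by case: ix; split.
  + by case: iy; split.
  have iw : inb w by [].
  have [|uw|uw] := ltrgt0P (u w).
  + by move=> uw; apply/orP; left; apply/eqP; apply: inj; rewrite ?xs //;
      [rewrite gt_eqF // addr_gt0 | rewrite mulr_ge0 // ltW].
  + by apply/orP; right; apply/eqP; apply: inj; rewrite ?ys //;
      [rewrite lt_eqF // -oppr_gt0 opprD addr_gt0 ?oppr_gt0 | rewrite mulr_le0 // ltW].
  + by move: sn; rewrite -w3 (ub _ uw iw) eqxx.
rewrite big_cons big_seq1 (sm _ ix (lt0r_neq0 ux)) (sm _ iy (ltr0_neq0 uy)) (gtr0_sg ux) (ltr0_sg uy).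
by rewrite mulr1 mulrN1 subrr.
Qed.

End LocalCount.

End LocalCount.

(** * From local counts to the count on a compact set covered by charts *)

Module GlobalCount.
Import structures.
Import all_boot all_order all_algebra.
Import boolp classical_sets functions reals interval_inference topology normedtype sequences realfun.
Import ring lra.
Import PolynomialFunctions Norms ImplicitFunction LocalCount.
Import Order.TTheory GRing.Theory Num.Theory.
Import numFieldNormedType.Exports.
Local Open Scope classical_set_scope.
Local Open Scope ring_scope.

Section HasCount.
Variables (R : nmodType) (T : eqType).
Implicit Types (A B : T -> Prop) (s : T -> R).

Lemma has_count_uniq A s n n' : has_count A s n -> has_count A s n' -> n = n'.
Proof.
move=> [l [ul hl <-]] [l' [ul' hl' <-]]; apply: perm_big; apply: uniq_perm => // x.
by apply/idP/idP => /[dup]; [move/hl/hl'|move/hl'/hl].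
Qed.

Lemma has_count_ext A B s s' n : (forall x, A x <-> B x) ->
  (forall x, A x -> s x = s' x) -> has_count A s n -> has_count B s' n.
Proof.
move=> hAB hs [l [ul hl sl]]; exists l; split=> // [x|]; first by rewrite hl.
rewrite -sl big_seq [RHS]big_seq; apply: eq_bigr => x /hl /hs.
by move->.
Qed.

Lemma has_count_map (T' : eqType) (f : T -> T') (A : T -> Prop) (B : T' -> Prop) (s : T -> R)
    (s' : T' -> R) n :
  (forall x y, A x -> A y -> f x = f y -> x = y) ->
  (forall y, B y <-> exists2 x, A x & f x = y) ->
  (forall x, A x -> s' (f x) = s x) ->
  has_count A s n -> has_count B s' n.
Proof.
move=> fi hB hs [l [ul hl sl]]; exists (map f l); split.
- by rewrite map_inj_in_uniq // => x y /hl ax /hl ay; apply: fi.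
- move=> y; rewrite hB; split=> [/mapP [x /hl ax ->]|[x ax <-]]; first by exists x.
  by apply/map_f/hl.
rewrite big_map -sl big_seq [RHS]big_seq; apply: eq_bigr => x /hl.
exact: hs.
Qed.

Lemma has_count_bigU (I : eqType) (r : seq I) (U : I -> T -> Prop) A s n : uniq r ->
  (forall i j x, i \in r -> j \in r -> U i x -> U j x -> i = j) ->
  (forall x, A x -> exists2 i, i \in r & U i x) ->
  (forall i, i \in r -> has_count (fun x => A x /\ U i x) s (n i)) ->
  has_count A s (\sum_(i <- r) n i).
Proof.
elim: r A => [|i r IH] A /=.
  move=> _ _ hA _; exists [::]; split=> //; last by rewrite !big_nil.
  by move=> x; split=> // /hA [].
move=> /andP [ir ur] hU hA hc; rewrite big_cons.
have [l [ul hl <-]] := hc i (mem_head _ _).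
have [|||l' [ul' hl' <-]] := IH (fun x => A x /\ ~ U i x) ur.
- by move=> a b x ar br; apply: hU; rewrite inE ?ar ?br orbT.
- move=> x [/hA [j]]; rewrite inE => /orP [/eqP ->|jr] Uj nU //.
  by exists j.
- move=> j jr; have := hc j; rewrite inE jr orbT => /(_ isT).
  apply: has_count_ext => // x; split=> [[ax Ujx]|[[ax nU] Ujx]] //.
  split=> //; split=> // Uix; move: ir; rewrite (hU i j x) ?jr ?mem_head //.
  by rewrite inE jr orbT.
exists (l ++ l'); rewrite big_cat; split=> //.
  rewrite cat_uniq ul ul' andbT; apply/hasPn => x /hl' [ax nU].
  by apply/negP => /hl [].
move=> x; rewrite mem_cat; split=> [/orP [/hl []|/hl' []] //|ax].
have [Uix|nU] := pselect (U i x); apply/orP; [left|right].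
  exact/hl.
exact/hl'.
Qed.

End HasCount.

Section GlobalCount.
Variable R : realType.

(** A supremum argument for a relation instead of a function: the value at a time need not be chosen
    in advance, uniqueness propagates it. *)
Lemma locally_constant_segment (T : Type) (P : R -> T -> Prop) :
  (forall t n n', P t n -> P t n' -> n = n') ->
  (forall t, 0 <= t <= 1 -> exists n, exists2 d, 0 < d & forall s, `|s - t| < d -> P s n) ->
  exists2 n, P 0 n & P 1 n.
Proof.
move=> Pu Pl.
have [|n0 [d0 d00 h0]] := Pl 0; first by rewrite lexx ler01.
have P0 : P 0 n0 by apply: h0; rewrite subrr normr0.
exists n0 => //.
pose S := [set t : R | 0 <= t <= 1 /\ forall s, 0 <= s <= t -> P s n0].
have S0 : S 0.
  split; first by rewrite lexx ler01.
  by move=> s; rewrite -eq_le => /eqP <-.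
have Sub : ubound S 1 by move=> t [/andP []].
have hS : has_sup S by split; [exists 0 | exists 1].
pose T0 := sup S.
have T01 : 0 <= T0 <= 1.
  by rewrite /T0 (sup_upper_bound hS) //= sup_le_ub //; exists 0.
have [n [d dd hd]] := Pl _ T01.
have [t St tT] := sup_adherent dd hS; rewrite -/T0 in tT.
have tle : t <= T0 by apply: sup_upper_bound.
have en : n = n0.
  apply: (Pu t); last by case: St => /andP [t0 _]; apply; rewrite t0 lexx.
  by apply: hd; rewrite ltr_norml; apply/andP; split; lra.
have ext x : 0 <= x <= 1 -> x < T0 + d -> S x.
  move=> x01 xT; split=> // s /andP [s0 sx].
  have [st|ts] := leP s t; first by case: St => _; apply; rewrite s0.
  by rewrite -en; apply: hd; rewrite ltr_norml; apply/andP; split; lra.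
have [T1|T1] := ltP T0 1; last first.
  have [_] : S 1 by apply: ext; rewrite ?ler01 ?lexx //; lra.
  by apply; rewrite ler01 lexx.
have [x0 [x1 x2]] : exists x, T0 < x /\ (x <= 1 /\ x < T0 + d).
  exists (Num.min 1 (T0 + d / 2)); rewrite lt_min T1 ltrDl divr_gt0 // ge_min lexx.
  by split=> //; split=> //; rewrite gt_min; apply/orP; right; lra.
have Sx : S x0 by apply: ext => //; [|tauto]; case: x2 => -> _; rewrite andbT; lra.
by have := sup_upper_bound hS Sx; rewrite -/T0; lra.
Qed.

(** Properties of all sufficiently large finite lists. As index filter in the near-covering form of
    compactness, it turns local finiteness into one list valid on the whole compact set. *)
Definition seq_filter (T : eqType) : set_system (seq T) :=
  [set A | exists s0 : seq T, forall s : seq T, {subset s0 <= s} -> A s].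

Lemma seq_filterP (T : eqType) : Filter (@seq_filter T).
Proof.
split; first by exists [::].
- move=> A B [a ha] [b hb]; exists (a ++ b) => s h; split.
    by apply: ha => x xa; apply: h; rewrite mem_cat xa.
  by apply: hb => x xb; apply: h; rewrite mem_cat xb orbT.
- by move=> A B AB [a ha]; exists a => s /ha /AB.
Qed.

Lemma compact_isolated_finite (T : ptopologicalType) (K A : set T) : compact K ->
  (forall x, K x -> \forall y \near x, A y -> y = x) ->
  exists s : seq T, forall x, K x -> A x -> x \in s.
Proof.
move=> /compact_near_coveringP cK hA.
have := cK (seq T) _ (fun (s : seq T) x => A x -> x \in s) (seq_filterP T).
case=> [x Kx|s0 h].
  exists ([set y | A y -> y = x], [set s : seq T | x \in s]).
    split=> /=; first exact: hA.
    by exists [:: x] => s h; apply: h; rewrite mem_head.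
  by move=> [y s] /= [h1 h2] /h1 ->.
by exists s0 => x Kx; apply: h.
Qed.

End GlobalCount.

Section Atlas.
Variables (R : realType) (m q : nat) (K : set 'rV[R]_q) (C : finType).
Variables (dom : C -> set 'rV[R]_q) (chi : C -> 'rV[R]_q -> 'rV[R]_m).
Variables (psi : C -> 'rV[R]_m -> 'rV[R]_q).
Hypothesis cK : compact K.
Hypothesis odom : forall c P, K P -> dom c P -> \forall P' \near P, dom c P'.
Hypothesis cchi : forall c P, K P -> dom c P -> forall e, 0 < e ->
  \forall P' \near P, `|chi c P' - chi c P| < e.
Hypothesis cpsi : forall c x e, 0 < e -> exists2 d, 0 < d &
  forall x', `|x' - x| < d -> `|psi c x' - psi c x| < e.
Hypothesis psi_in : forall c x, K (psi c x) /\ dom c (psi c x).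
Hypothesis psiK : forall c x, chi c (psi c x) = x.
Hypothesis chiK : forall c P, K P -> dom c P -> psi c (chi c P) = P.
Hypothesis cover : forall P, K P -> exists c, dom c P.

Variables (t : 'I_m.+1) (f : C -> 'rV[R]_m.+1 -> 'rV[R]_m).
Variable Q : C -> 'rV[R]_(m.+1 + m.+1) -> 'M[R]_(m.+1, m).
Hypothesis pf : forall c, mxpolyf (f c).
Variables (Z : R -> set 'rV[R]_q) (sigma : R -> 'rV[R]_q -> R).
Hypothesis ZK : forall s P, Z s P -> K P.
Hypothesis Zf : forall c s x, Z s (psi c x) <-> f c (ins t s x) = 0.
Hypothesis sigmaf : forall c s x, f c (ins t s x) = 0 ->
  sigma s (psi c x) = Num.sg (minor_at (Q c) t (ins t s x) (ins t s x)).
Hypothesis local : forall c s x, 0 <= s <= 1 -> f c (ins t s x) = 0 -> exists n,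
  forall e, 0 < e -> exists e', [/\ 0 < e', e' <= e & exists2 dl, 0 < dl &
    forall s', `|s' - s| < dl ->
    has_count (fun z => [/\ `|z - ins t s x| < e', f c z = 0 & z 0 t = s'])
      (fun z => Num.sg (minor_at (Q c) t z z)) n].

Lemma col'_norm_lt (z : 'rV[R]_m.+1) e : `|z| < e -> `|col' t z| < e.
Proof.
move=> h; apply: mx_norm_lt; first exact: le_lt_trans h.
by move=> i j; rewrite mxE; apply: le_lt_trans h; apply: mx_entry_le.
Qed.

(** A zero is studied in one chart: a ball around its coordinate, pulled back by [chi c], is the
    neighbourhood [U], and [psi c] carries the count in the ball to the count in [U]. The value [n]
    does not depend on the size [e], so that neighbourhoods may be shrunk later. *)
Lemma atlas_local s P : 0 <= s <= 1 -> Z s P -> exists n, forall e, 0 < e ->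
  exists U, [/\ \forall P' \near P, U P',
    forall P', K P' -> U P' -> `|P' - P| < e & exists2 dl, 0 < dl &
    forall s', `|s' - s| < dl ->
      has_count (fun P' => Z s' P' /\ U P') (sigma s') n].
Proof.
move=> s01 ZP; have KP := ZK ZP; have [c dc] := cover KP.
pose x := chi c P; have xP : psi c x = P by apply: chiK.
have fx : f c (ins t s x) = 0 by apply/Zf; rewrite xP.
have [n hn] := local s01 fx; exists n => e e0.
have [d d0 hd] := cpsi c x e0.
have [e' [e'0 e'd [dl dl0 hdl]]] := hn d d0.
exists [set P' | dom c P' /\ `|chi c P' - x| < e']; split.
- have h1 := odom KP dc; have h2 := cchi KP dc e'0.
  by near=> P'; split; near: P'.
- move=> P' KP' [dP' h]; rewrite -(chiK KP' dP') -xP; apply: hd.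
  exact: lt_le_trans h e'd.
exists (Num.min dl e'); first by rewrite lt_min dl0.
move=> s'; rewrite lt_min => /andP [s1 s2].
apply: (has_count_map (f := fun z => psi c (col' t z))) (hdl s' s1).
- move=> z z' [_ _ zt] [_ _ zt'] /(congr1 (chi c)); rewrite !psiK => e1.
  by apply: (@eq_ins _ _ t) => //; rewrite zt zt'.
- move=> P'; split=> [[ZP' [dP' hP']]|[z [z1 z2 z3] <-]].
    have KP' := ZK ZP'; exists (ins t s' (chi c P')); last by rewrite col'_ins chiK.
    split; rewrite ?ins_same //; first by rewrite insB; apply: ins_norm_lt.
    by apply/Zf; rewrite chiK.
  have ez : z = ins t s' (col' t z) by rewrite -z3 ins_col'.
  split; first by apply/Zf; rewrite -ez.
  split; first by case: (psi_in c (col' t z)).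
  rewrite psiK -[x](col'_ins t s) -col'B; exact: col'_norm_lt.
move=> z [z1 z2 z3]; have ez : z = ins t s' (col' t z) by rewrite -z3 ins_col'.
by rewrite sigmaf -?ez.
Unshelve. all: by end_near. Qed.

Lemma atlas_nonzero s P : K P -> ~ Z s P ->
  exists2 A, \forall P' \near P, A P' & exists2 d, 0 < d &
  forall P' s', A P' -> `|s' - s| < d -> K P' -> ~ Z s' P'.
Proof.
move=> KP nZ; have [c dc] := cover KP; pose x := chi c P.
have xP : psi c x = P by apply: chiK.
have fx : f c (ins t s x) != 0.
  by apply/eqP => fx; apply: nZ; rewrite -xP; apply/Zf.
have h0 : 0 < `|f c (ins t s x)| by rewrite normr_gt0.
have [d d0 hd] := mxpolyf_near (ins t s x) (pf c) h0.
exists [set P' | dom c P' /\ `|chi c P' - x| < d].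
  have h1 := odom KP dc; have h2 := cchi KP dc d0.
  by near=> P'; split; near: P'.
exists d => // P' s' [dP' h1] h2 KP' ZP'.
have fz : f c (ins t s' (chi c P')) = 0 by apply/Zf; rewrite chiK.
have hlt := ins_norm_lt t h2 h1.
by have := hd (ins t s' (chi c P')); rewrite fz sub0r normrN ltxx insB => /(_ hlt).
Unshelve. all: by end_near. Qed.

Lemma seq_separation (P : 'rV[R]_q) (l : seq 'rV[R]_q) : exists2 e, 0 < e &
  forall P', P' \in l -> P' != P -> e <= `|P' - P|.
Proof.
elim: l => [|a l [e e0 he]]; first by exists 1.
exists (if a == P then e else Num.min e `|a - P|).
  by case: eqVneq => // aP; rewrite lt_min e0 normr_gt0 subr_eq0.
move=> P'; rewrite inE => /orP [/eqP ->|/he h] nP.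
  by rewrite (negPf nP) ge_min lexx orbT.
by case: eqVneq => aP; rewrite ?h // ge_min h.
Qed.

(** Near a zero the local count lists finitely many zeros, so a smaller neighbourhood contains no
    other one. *)
Lemma atlas_isolated s P : 0 <= s <= 1 -> K P ->
  \forall P' \near P, (K P' /\ Z s P') -> P' = P.
Proof.
move=> s01 KP; have [ZP|nZ] := pselect (Z s P); last first.
  have [A hA [d d0 h]] := atlas_nonzero KP nZ.
  near=> P' => -[KP' ZP']; exfalso.
  by apply: (h P' s) => //; rewrite ?subrr ?normr0 //; near: P'.
have [n hn] := atlas_local s01 ZP.
have [U [nU _ [dl dl0 hdl]]] := hn 1 ltr01.
have [|l [_ hl _]] := hdl s; first by rewrite subrr normr0.
have [e e0 he] := seq_separation P l.
have [V [nV hV _]] := hn e e0.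
near=> P' => -[KP' ZP'].
have Pl : P' \in l by apply/hl; split => //; near: P'.
have PV : V P' by near: P'.
apply/eqP; apply: contraT => /(he _ Pl).
by rewrite leNgt hV.
Unshelve. all: by end_near. Qed.

(** The signed count is locally constant in [s]: the finitely many zeros at [s] have disjoint
    neighbourhoods with locally constant counts, and by compactness no zero lies outside them for
    nearby parameters. *)
Theorem atlas_count : exists n, has_count (Z 0) (sigma 0) n /\ has_count (Z 1) (sigma 1) n.
Proof.
have [||n h0 h1] := @locally_constant_segment R _ (fun s n => has_count (Z s) (sigma s) n).
- by move=> s n n'; apply: has_count_uniq.
- move=> s s01.
  have [l0 hl0] := compact_isolated_finite cK (fun P KP => atlas_isolated s01 KP).
  pose l := [seq P <- undup l0 | `[< Z s P >]].
  have ul : uniq l by rewrite filter_uniq // undup_uniq.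
  have hl P : P \in l <-> Z s P.
    rewrite mem_filter mem_undup; split=> [/andP [h _]|ZP]; first exact: asboolW h.
    by rewrite asboolT //=; apply: hl0 (ZK ZP) (conj (ZK ZP) ZP).
  have [e e0 he] : exists2 e, 0 < e & forall P P', P \in l -> P' \in l -> P' != P -> e <= `|P' - P|.
    elim: (l) => [|a l' [e e0 he]]; first by exists 1.
    have [e2 e20 he2] := seq_separation a l'.
    exists (Num.min e e2); first by rewrite lt_min e0.
    move=> P P'; rewrite !inE => /orP [/eqP ->|Pl] /orP [/eqP ->|P'l] nP.
    - by rewrite eqxx in nP.
    - by rewrite ge_min he2 ?orbT.
    - by rewrite ge_min distrC he2 ?orbT // eq_sym.
    - by rewrite ge_min he.
  (* Half of a lower bound for the mutual distances makes the neighbourhoods of distinct zeros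
     disjoint. *)
  have e2 : 0 < e / 2 by rewrite divr_gt0.
  have /boolp.choice [G hG] P : exists G : R * set 'rV[R]_q * R, P \in l ->
     [/\ \forall P' \near P, G.1.2 P',
    forall P', K P' -> G.1.2 P' -> `|P' - P| < e / 2, 0 < G.2 &
    forall s', `|s' - s| < G.2 ->
      has_count (fun P' => Z s' P' /\ G.1.2 P') (sigma s') G.1.1].
    have [/hl ZP|_] := boolP (P \in l); last by exists (0, set0, 0).
    have [n hn] := atlas_local s01 ZP; have [U [h1 h2 [dl h3 h4]]] := hn _ e2.
    by exists (n, U, dl).
  have [d1 d10 hd1] : exists2 d, 0 < d & forall P, P \in l -> d <= (G P).2.
    have : forall P, P \in l -> 0 < (G P).2 by move=> P /hG [].
    elim: (l) => [|a l' IH] hp; first by exists 1.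
    have [P Pl|d d0 hd] := IH; first by apply: hp; rewrite inE Pl orbT.
    exists (Num.min d (G a).2); first by rewrite lt_min d0 hp ?mem_head.
    by move=> P; rewrite inE => /orP [/eqP ->|/hd h]; rewrite ge_min ?lexx ?orbT ?h.
  (* No zero escapes: a point off the zero set has a neighbourhood free of zeros for all nearby
     parameters, and compactness makes this uniform. *)
  have : \forall s' \near s, K `<=` (fun P => Z s' P -> exists2 i, i \in l & (G i).1.2 P).
    have /compact_near_coveringP cK' := cK.
    apply: (cK' R (nbhs s) (fun s' P => Z s' P -> exists2 i, i \in l & (G i).1.2 P)).
    move=> P KP.
    have [ZP|nZ] := pselect (Z s P).
      have Pl : P \in l by apply/hl.
      have [h1 _ _ _] := hG P Pl.
      exists ((G P).1.2, setT); first by split => //; apply: filterT.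
      by move=> [P' s'] /= [h _] _; exists P.
    have [A hA [d d0 h]] := atlas_nonzero KP nZ.
    exists (A, [set s' | `|s' - s| < d]).
      split => //=; apply/nbhs_ballP; exists d => // y.
      by rewrite -ball_normE /= distrC.
    by move=> [P' s'] /= [h1 h2] ZP'; case: (h P' s' h1 h2 (ZK ZP')).
  move=> /nbhs_ballP [d2 /= d20 hd2].
  exists (\sum_(P <- l) (G P).1.1); exists (Num.min d1 d2); first by rewrite lt_min d10.
  move=> s'; rewrite lt_min => /andP [s1 s2].
  apply: (has_count_bigU (U := fun P P' => K P' /\ (G P).1.2 P')) => //.
  + move=> i j x il jl [Kx Ui] [_ Uj]; apply/eqP; apply: contraT => ij.
    have [_ hi _ _] := hG i il; have [_ hj _ _] := hG j jl.
    have := he j i jl il ij; rewrite leNgt -(subrK x i) -addrA.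
    rewrite (le_lt_trans (ler_normD _ _)) //.
    have := ltrD (hi x Kx Ui) (hj x Kx Uj); rewrite -splitr [`|x - i|]distrC //.
  + move=> x Zx; have Kx := ZK Zx.
    have [|i il Ui] := hd2 s' _ x Kx Zx; last by exists i.
    by rewrite -ball_normE /= distrC.
  + move=> i il; have [_ _ _ hc] := hG i il.
    have := hc s' (lt_le_trans s1 (hd1 i il)).
    apply: has_count_ext => // x; split=> [[Zx Ux]|[Zx [_ Ux]]] //.
    by split => //; split => //; apply: ZK Zx.
by exists n.
Qed.

End Atlas.

End GlobalCount.

(** * Graded matrices and coordinates on their blocks *)

Module Graded.
Import structures.
Import all_boot all_order all_algebra.
Import ring lra.
Import Order.TTheory GRing.Theory Num.Theory.
Local Open Scope ring_scope.

(** In a rank factorization E = C V, idempotency forces V C = 1, whose trace is the rank. *)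
Lemma mxrank_idem (F : fieldType) n (E : 'M[F]_n) : E *m E = E -> (\rank E)%:R = \tr E.
Proof.
move=> EE; have [B hB] := row_fullP (col_base_full E).
have key r (V : 'M_(r, n)) (C : 'M_(n, r)) (D : 'M_(r, n)) : D *m C = 1%:M ->
    row_free V -> C *m V = E -> r%:R = \tr E.
  move=> hD fV eE; rewrite -eE mxtrace_mulC.
  suff -> : V *m C = 1%:M by rewrite mxtrace1.
  have e : C *m (V *m C *m V) = C *m V by have := EE; rewrite -eE !mulmxA.
  apply: (row_free_inj fV); rewrite mul1mx.
  by rewrite -[LHS]mul1mx -hD -mulmxA e mulmxA hD mul1mx.
exact: key hB (row_base_free E) (mulmx_base E).
Qed.

Section Graded.
Variables (R : fieldType) (p : nat) (X : eqType) (cl : 'I_p -> X) (arr : rel X).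
Variable b : pred 'I_p.
Implicit Types A B : 'M[R]_p.

(** The class [cl i] is the quiver vertex of the basis vector [i]. Matrices act on row vectors from
    the right, so an entry (i, j) goes from vertex [cl i] to [cl j]: [in0] keeps the vertices and
    [in1] follows the arrows. *)
Definition cproj (x : X) : 'M[R]_p := \matrix_(i, j) ((i == j) && (cl i == x))%:R.
Definition in0 A := forall x, cproj x *m A = A *m cproj x.
Definition in1 A := forall i j, ~~ arr (cl i) (cl j) -> A i j = 0.
Definition mask1 A : 'M[R]_p := \matrix_(i, j) (if arr (cl i) (cl j) then A i j else 0).
(** The coordinate subspace spanned by the indices in [b], a graded subspace of the prescribed
    dimension vector; up to permutations it is the base point of all charts. *)
Definition P0 : 'M[R]_p := \matrix_(i, j) ((i == j) && b i)%:R.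
Definition Q0 : 'M[R]_p := 1%:M - P0.

Lemma mul_cproj x A i j : (cproj x *m A) i j = (cl i == x)%:R * A i j.
Proof.
rewrite mxE (bigD1 i) //= mxE eqxx big1 ?addr0 // => k ki.
by rewrite mxE eq_sym (negPf ki) mul0r.
Qed.

Lemma mul_cprojr x A i j : (A *m cproj x) i j = A i j * (cl j == x)%:R.
Proof.
rewrite mxE (bigD1 j) //= mxE eqxx big1 ?addr0 // => k ki.
by rewrite mxE (negPf ki) mulr0.
Qed.

Lemma in0P A : in0 A <-> forall i j, cl i != cl j -> A i j = 0.
Proof.
split=> [h i j ij|h x].
  have /matrixP/(_ i j) := h (cl i); rewrite mul_cproj mul_cprojr eqxx mul1r.
  by rewrite eq_sym (negPf ij) mulr0.
apply/matrixP => i j; rewrite mul_cproj mul_cprojr mulrC.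
have [->//|ij] := eqVneq (cl i) (cl j).
by rewrite h // !mul0r.
Qed.

Lemma in0_mul A B : in0 A -> in0 B -> in0 (A *m B).
Proof. by move=> hA hB x; rewrite mulmxA hA -mulmxA hB mulmxA. Qed.

Lemma in0_add A B : in0 A -> in0 B -> in0 (A + B).
Proof. by move=> hA hB x; rewrite mulmxDr mulmxDl hA hB. Qed.

Lemma in0_opp A : in0 A -> in0 (- A).
Proof. by move=> hA x; rewrite mulmxN mulNmx hA. Qed.

Lemma in0_scale a A : in0 A -> in0 (a *: A).
Proof. by move=> hA x; rewrite -scalemxAr -scalemxAl hA. Qed.

Lemma in0_1 : in0 1%:M.
Proof. by move=> x; rewrite mulmx1 mul1mx. Qed.

Lemma in0_sub A B : in0 A -> in0 B -> in0 (A - B).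
Proof. by move=> hA hB; apply: in0_add => //; apply: in0_opp. Qed.

Lemma in0_tr A : in0 A -> in0 A^T.
Proof. by move/in0P => h; apply/in0P => i j ij; rewrite mxE h // eq_sym. Qed.

Lemma in0_inv A : A \in unitmx -> in0 A -> in0 (invmx A).
Proof.
move=> uA hA x; apply: (can_inj (mulKmx uA)); rewrite mulmxA -hA -mulmxA.
by rewrite mulmxV // mulmx1 mulmxA mulmxV // mul1mx.
Qed.

Lemma in0_P0 : in0 P0.
Proof.
apply/in0P => i j ij; rewrite mxE; have [e|//] := eqVneq i j.
by rewrite e eqxx in ij.
Qed.

Lemma in0_Q0 : in0 Q0.
Proof. by apply: in0_sub; [apply: in0_1 | apply: in0_P0]. Qed.

Lemma in0_in1 A B : in0 A -> in1 B -> in1 (A *m B).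
Proof.
move=> /in0P hA hB i j nij; rewrite mxE big1 // => k _.
have [e|ne] := eqVneq (cl i) (cl k); last by rewrite hA // mul0r.
by rewrite hB ?mulr0 // -e.
Qed.

Lemma in1_in0 A B : in1 A -> in0 B -> in1 (A *m B).
Proof.
move=> hA /in0P hB i j nij; rewrite mxE big1 // => k _.
have [e|ne] := eqVneq (cl k) (cl j); last by rewrite hB // mulr0.
by rewrite hA ?mul0r // e.
Qed.

Lemma in1_mask A : in1 (mask1 A).
Proof. by move=> i j nij; rewrite mxE (negPf nij). Qed.

Lemma mask1_id A : in1 A -> mask1 A = A.
Proof. by move=> h; apply/matrixP => i j; rewrite mxE; case: ifPn => // /h ->. Qed.

Lemma mask1D A B : mask1 (A + B) = mask1 A + mask1 B.
Proof. by apply/matrixP => i j; rewrite !mxE; case: ifP; rewrite ?addr0. Qed.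

Lemma mask1Z a A : mask1 (a *: A) = a *: mask1 A.
Proof. by apply/matrixP => i j; rewrite !mxE; case: ifP; rewrite ?mulr0. Qed.

Lemma mul_P0 A i j : (P0 *m A) i j = (b i)%:R * A i j.
Proof.
rewrite mxE (bigD1 i) //= mxE eqxx big1 ?addr0 // => k ki.
by rewrite mxE eq_sym (negPf ki) mul0r.
Qed.

Lemma mul_P0r A i j : (A *m P0) i j = A i j * (b j)%:R.
Proof.
rewrite mxE (bigD1 j) //= mxE eqxx big1 ?addr0 // => k ki.
by rewrite mxE (negPf ki) mulr0.
Qed.

Lemma mul_Q0r A i j : (A *m Q0) i j = A i j * (~~ b j)%:R.
Proof.
rewrite mulmxBr mulmx1 [LHS]mxE [X in _ + X]mxE mul_P0r.
by case: (b j); rewrite ?mulr1 ?mulr0 ?subrr ?subr0.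
Qed.

Lemma P0P0 : P0 *m P0 = P0.
Proof.
apply/matrixP => i j; rewrite mul_P0 !mxE.
by case: (b i); rewrite ?mul1r ?mul0r ?andbF.
Qed.

Lemma P0Q0 : P0 *m Q0 = 0.
Proof. by rewrite mulmxBr mulmx1 P0P0 subrr. Qed.

Lemma Q0P0 : Q0 *m P0 = 0.
Proof. by rewrite mulmxBl mul1mx P0P0 subrr. Qed.

Lemma Q0Q0 : Q0 *m Q0 = Q0.
Proof. by rewrite {1}/Q0 mulmxBl mul1mx P0Q0 subr0. Qed.

Lemma P0T : P0^T = P0.
Proof.
by apply/matrixP => i j; rewrite !mxE eq_sym; case: eqP => [->|].
Qed.

Lemma Q0T : Q0^T = Q0.
Proof. by rewrite /Q0 linearB /= trmx1 P0T. Qed.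

Section Coordinates.
Variables (m : nat) (ix : 'I_m -> 'I_p * 'I_p).
Hypothesis ixI : injective ix.

Definition mxof (x : 'rV[R]_m) : 'M[R]_p :=
  \sum_k x 0 k *: delta_mx (ix k).1 (ix k).2.
Definition coord A : 'rV[R]_m := \row_k A (ix k).1 (ix k).2.

Lemma mxofE x k : mxof x (ix k).1 (ix k).2 = x 0 k.
Proof.
rewrite summxE (bigD1 k) //= big1 ?addr0 => [|l lk]; rewrite !mxE ?eqxx ?mulr1 //.
case: eqP => [e1|]; last by rewrite mulr0.
case: eqP => [e2|]; last by rewrite mulr0.
case/eqP: lk; apply: ixI; move: e1 e2.
by case: (ix k) (ix l) => [a c] [a' c'] /= -> ->.
Qed.

Lemma mxofK : cancel mxof coord.
Proof. by move=> x; apply/rowP => k; rewrite mxE mxofE. Qed.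

Lemma mxof_out x i j : (forall k, ix k != (i, j)) -> mxof x i j = 0.
Proof.
move=> h; rewrite summxE big1 // => k _; rewrite !mxE.
have := h k; case: (ix k) => a c /= ne.
case: eqP => [e1|_]; last by rewrite mulr0.
case: eqP => [e2|_]; last by rewrite mulr0.
by rewrite e1 e2 eqxx in ne.
Qed.

Lemma coordK A : (forall i j, (forall k, ix k != (i, j)) -> A i j = 0) ->
  mxof (coord A) = A.
Proof.
move=> h; apply/matrixP => i j.
have [/existsP [k /eqP e]|] := boolP [exists k, ix k == (i, j)].
  by have := mxofE (coord A) k; rewrite mxE e.
by rewrite negb_exists => /forallP ne; rewrite h // mxof_out.
Qed.

Lemma mxofD x y : mxof (x + y) = mxof x + mxof y.
Proof. by rewrite -big_split; apply: eq_bigr => k _; rewrite mxE scalerDl. Qed.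

Lemma mxofZ a x : mxof (a *: x) = a *: mxof x.
Proof. by rewrite scaler_sumr; apply: eq_bigr => k _; rewrite mxE scalerA. Qed.

Lemma coordD A B : coord (A + B) = coord A + coord B.
Proof. by apply/rowP => k; rewrite !mxE. Qed.

Lemma coordZ a A : coord (a *: A) = a *: coord A.
Proof. by apply/rowP => k; rewrite !mxE. Qed.

End Coordinates.

Variables (m : nat) (tix eix : 'I_m -> 'I_p * 'I_p).
Hypothesis tixI : injective tix.
Hypothesis eixI : injective eix.
Hypothesis tixP : forall i j, (exists k, tix k = (i, j)) <-> [&& b i, ~~ b j & cl i == cl j].
Hypothesis eixP : forall i j, (exists k, eix k = (i, j)) <-> [&& b i, ~~ b j & arr (cl i) (cl j)].

(** The entries listed by [tix] are coordinates on the tangent space at [P0], those listed by [eix]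
    coordinates on the fibre of the bundle. The common index type ['I_m] expresses that dimension
    and rank agree. *)
Lemma tmx_support x : P0 *m mxof tix x *m Q0 = mxof tix x.
Proof.
apply/matrixP => i j; rewrite mul_Q0r mul_P0.
have [/existsP [k /eqP e]|] := boolP [exists k, tix k == (i, j)].
  have /and3P [-> -> _] : [&& b i, ~~ b j & cl i == cl j] by apply/tixP; exists k.
  by rewrite mulr1 mul1r.
rewrite negb_exists => /forallP h.
by rewrite (mxof_out _ h) mulr0 mul0r.
Qed.

Lemma in0_tmx x : in0 (mxof tix x).
Proof.
apply/in0P => i j ij; apply: mxof_out => k; apply: contraNneq ij => e.
have /and3P [_ _ //] : [&& b i, ~~ b j & cl i == cl j] by apply/tixP; exists k.
Qed.

Lemma P0_tmx x : P0 *m mxof tix x = mxof tix x.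
Proof. by rewrite -tmx_support !mulmxA P0P0. Qed.

Lemma tmx_P0 x : mxof tix x *m P0 = 0.
Proof. by rewrite -tmx_support -mulmxA Q0P0 mulmx0. Qed.

Lemma tmx_Q0 x : mxof tix x *m Q0 = mxof tix x.
Proof. by rewrite -tmx_support -mulmxA Q0Q0. Qed.

Lemma Q0_tmx x : Q0 *m mxof tix x = 0.
Proof. by rewrite -tmx_support !mulmxA Q0P0 !mul0mx. Qed.

Lemma tmx_tmx x y : mxof tix x *m mxof tix y = 0.
Proof. by rewrite -(tmx_Q0 x) -mulmxA Q0_tmx mulmx0. Qed.

Lemma tmx_coordK A : in0 A -> P0 *m A *m Q0 = A -> mxof tix (coord tix A) = A.
Proof.
move=> /in0P h0 hs; apply: coordK => // i j h.
have [c|] := boolP [&& b i, ~~ b j & cl i == cl j].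
  by have /tixP [k e] := c; have := h k; rewrite e eqxx.
rewrite -hs mul_Q0r mul_P0; case: (b i); rewrite ?mul0r //=.
by case: (b j); rewrite ?mulr0 //= => /h0 ->; rewrite mulr0 mul0r.
Qed.

Lemma emx_coordK A : in1 A -> P0 *m A *m Q0 = A -> mxof eix (coord eix A) = A.
Proof.
move=> h1 hs; apply: coordK => // i j h.
have [c|] := boolP [&& b i, ~~ b j & arr (cl i) (cl j)].
  by have /eixP [k e] := c; have := h k; rewrite e eqxx.
rewrite -hs mul_Q0r mul_P0; case: (b i); rewrite ?mul0r //=.
by case: (b j); rewrite ?mulr0 //= => /h1 ->; rewrite mulr0 mul0r.
Qed.

Lemma coord_eix_PQ A : coord eix (P0 *m A *m Q0) = coord eix A.
Proof.
apply/rowP => k; rewrite [LHS]mxE [RHS]mxE mul_Q0r mul_P0.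
have /and3P [-> -> _] : [&& b (eix k).1, ~~ b (eix k).2 & arr (cl (eix k).1) (cl (eix k).2)].
  by apply/eixP; exists k; case: (eix k).
by rewrite mulr1 mul1r.
Qed.

Lemma coord_eix_eq0 A : in1 A -> coord eix A = 0 <-> P0 *m A *m Q0 = 0.
Proof.
move=> h1; split=> [c0|e0].
  rewrite -[LHS]emx_coordK ?coord_eix_PQ ?c0 //.
  - by rewrite /mxof big1 // => k _; rewrite mxE scale0r.
  - by apply: in1_in0; [apply: in0_in1 => //; apply: in0_P0 | apply: in0_Q0].
  - by rewrite !mulmxA P0P0 -!mulmxA Q0Q0.
by rewrite -coord_eix_PQ e0; apply/rowP => k; rewrite !mxE.
Qed.

Lemma emx_support x : P0 *m mxof eix x *m Q0 = mxof eix x.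
Proof.
apply/matrixP => i j; rewrite mul_Q0r mul_P0.
have [/existsP [k /eqP e]|] := boolP [exists k, eix k == (i, j)].
  have /and3P [-> -> _] : [&& b i, ~~ b j & arr (cl i) (cl j)] by apply/eixP; exists k.
  by rewrite mulr1 mul1r.
rewrite negb_exists => /forallP h.
by rewrite (mxof_out _ h) mulr0 mul0r.
Qed.

Lemma in1_emx x : in1 (mxof eix x).
Proof.
move=> i j ij; apply: mxof_out => k; apply: contraNneq ij => e.
have /and3P [_ _ //] : [&& b i, ~~ b j & arr (cl i) (cl j)] by apply/eixP; exists k.
Qed.

Lemma unip_inv x : (1%:M + mxof tix x) *m (1%:M - mxof tix x) = 1%:M.
Proof. by rewrite mulmxBr mulmx1 mulmxDl mul1mx tmx_tmx addr0 addrK. Qed.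

End Graded.

End Graded.

(** * Orthogonal projections and graph charts *)

Module Projections.
Import structures.
Import all_boot all_order all_algebra.
Import ring lra.
Import Graded.
Import Order.TTheory GRing.Theory Num.Theory.
Local Open Scope ring_scope.

Lemma unitmx_inj (F : fieldType) n (A : 'M[F]_n) :
  (forall v : 'rV_n, v *m A = 0 -> v = 0) -> A \in unitmx.
Proof.
move=> h; rewrite -row_free_unit -kermx_eq0; apply/rowV0P => v /sub_kermxP.
exact: h.
Qed.

Lemma mul_tr_eq0 (R : realFieldType) n (v : 'rV[R]_n) : v *m v^T = 0 -> v = 0.
Proof.
move/matrixP/(_ 0 0); rewrite !mxE => s0.
have s0' : \sum_i v 0 i ^+ 2 = 0.
  by rewrite -[RHS]s0; apply: eq_bigr => i _; rewrite mxE expr2.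
apply/rowP => i; rewrite mxE; apply/eqP; rewrite -sqrf_eq0; apply/eqP.
exact: (psumr_eq0P (fun i _ => sqr_ge0 (v 0 i)) s0').
Qed.

Section Spans.
Variables (F : fieldType) (p : nat) (b : pred 'I_p).
Local Notation P0 := (P0 F b).
Local Notation Q0 := (Q0 F b).
Implicit Types P g H : 'M[F]_p.

(** The rows of [g] selected by [b] are a frame of the row space of [P]. *)
Definition spans P g := P0 *m g *m P = P0 *m g /\ exists K, P = K *m P0 *m g.

(** In the basis [g] the row space of [P] becomes the coordinate subspace [P0], and stability under
    [H] is the vanishing of one block of the conjugate of [H]. *)
Lemma spans_zero P g H : g \in unitmx -> spans P g ->
  P *m H *m (1%:M - P) = 0 <-> P0 *m (g *m H *m invmx g) *m Q0 = 0.
Proof.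
move=> ug [e1 [K e2]].
have PQ : P *m invmx g *m Q0 = 0.
  by rewrite e2 -!mulmxA [g *m _]mulmxA mulmxV // mul1mx P0Q0 mulmx0.
split=> h.
  have eH : P *m H = P *m H *m P.
    by move/eqP: h; rewrite mulmxBr mulmx1 subr_eq0 => /eqP.
  have e3 : P0 *m g *m H = P0 *m g *m (P *m H *m P).
    by rewrite -eH mulmxA e1.
  by rewrite !mulmxA e3 -!mulmxA [P *m (_ *m Q0)]mulmxA PQ !mulmx0.
have e3 : P0 *m g *m H *m (1%:M - P) = 0.
  have -> : P0 *m g *m H = P0 *m (g *m H *m invmx g) *m P0 *m g.
    have s1 : P0 + Q0 = 1%:M by rewrite addrC subrK.
    have e4 : P0 *m (g *m H *m invmx g) *m P0 = P0 *m (g *m H *m invmx g).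
      by rewrite -[RHS]mulmx1 -s1 mulmxDr h addr0.
    by rewrite e4 -!mulmxA mulVmx // mulmx1.
  by rewrite mulmxBr mulmx1 -!mulmxA [P0 *m (g *m P)]mulmxA e1 subrr.
by rewrite [in P *m H]e2 -!mulmxA; move: e3; rewrite -!mulmxA => ->; rewrite mulmx0.
Qed.

Lemma spans_eq P P' g : P^T = P -> P'^T = P' -> spans P g -> spans P' g -> P = P'.
Proof.
move=> sP sP' [e1 [K e2]] [e1' [K' e2']].
have h1 : P *m P' = P by rewrite {1}e2 -!mulmxA [P0 *m _]mulmxA e1' mulmxA -e2.
have h2 : P' *m P = P' by rewrite {1}e2' -!mulmxA [P0 *m _]mulmxA e1 mulmxA -e2'.
by rewrite -sP -h1 trmx_mul sP sP' h2.
Qed.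

End Spans.

Section Charts.
Variables (R : realFieldType) (p : nat) (X : eqType) (cl : 'I_p -> X).
Variable b : pred 'I_p.
Variables (m : nat) (tix : 'I_m -> 'I_p * 'I_p).
Hypothesis tixI : injective tix.
Hypothesis tixP : forall i j, (exists k, tix k = (i, j)) <-> [&& b i, ~~ b j & cl i == cl j].
Local Notation P0 := (P0 R b).
Local Notation Q0 := (Q0 R b).
Local Notation phi := (@mxof R p m tix).
Local Notation in0 := (@in0 R p X cl).

Definition frameU x := P0 + phi x.
(** On the [P0] block this is U U^T for the frame U = [frameU x] of the graph of [x]; the identity
    on the other block keeps it invertible. *)
Definition gram x := 1%:M + phi x *m (phi x)^T.
Definition projn x := (frameU x)^T *m invmx (gram x) *m frameU x.

Lemma frameUE x : frameU x = P0 *m (1%:M + phi x).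
Proof. by rewrite mulmxDr mulmx1 (P0_tmx tixP). Qed.

Lemma gram_unit x : gram x \in unitmx.
Proof.
apply: unitmx_inj => v; rewrite mulmxDr mulmx1 mulmxA => e.
have : v *m v^T + (v *m phi x) *m (v *m phi x)^T = 0.
  by rewrite trmx_mul mulmxA -mulmxDl e mul0mx.
move/matrixP/(_ 0 0); rewrite !mxE => /eqP; rewrite paddr_eq0; first last.
- by apply: sumr_ge0 => i _; rewrite !mxE -expr2 sqr_ge0.
- by apply: sumr_ge0 => i _; rewrite !mxE -expr2 sqr_ge0.
move=> /andP [/eqP h _]; apply: mul_tr_eq0; apply/matrixP => i j.
by rewrite !ord1 !mxE.
Qed.

Lemma gram_sym x : (gram x)^T = gram x.
Proof. by rewrite linearD /= trmx1 trmx_mul trmxK. Qed.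

Lemma in0_gram x : in0 (gram x).
Proof.
have h := in0_tmx tixP x.
by apply: in0_add; [apply: in0_1 | apply: in0_mul => //; apply: in0_tr].
Qed.

Lemma tmxT_Q0 x : (phi x)^T *m Q0 = 0.
Proof. by rewrite -(Q0T R b) -trmx_mul (Q0_tmx tixP) trmx0. Qed.

Lemma tmxT_P0 x : (phi x)^T *m P0 = (phi x)^T.
Proof. by rewrite -{1}(P0T R b) -trmx_mul (P0_tmx tixP). Qed.

Lemma P0_tmxT x : P0 *m (phi x)^T = 0.
Proof. by rewrite -(P0T R b) -trmx_mul (tmx_P0 tixP) trmx0. Qed.

Lemma gram_Q0 x : gram x *m Q0 = Q0.
Proof. by rewrite mulmxDl mul1mx -mulmxA tmxT_Q0 mulmx0 addr0. Qed.

Lemma invgram_Q0 x : invmx (gram x) *m Q0 = Q0.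
Proof. by rewrite -{1}(gram_Q0 x) mulKmx ?gram_unit. Qed.

Lemma gram_P0C x : gram x *m P0 = P0 *m gram x.
Proof.
rewrite mulmxDl mulmxDr mul1mx mulmx1 -mulmxA tmxT_P0 mulmxA.
by rewrite (P0_tmx tixP).
Qed.

Lemma invgram_P0C x : invmx (gram x) *m P0 = P0 *m invmx (gram x).
Proof.
apply: (can_inj (mulKmx (gram_unit x))); rewrite mulmxA mulmxV ?gram_unit // mul1mx.
by rewrite mulmxA gram_P0C -mulmxA mulmxV ?gram_unit // mulmx1.
Qed.

Lemma frameU_mulT x : frameU x *m (frameU x)^T = P0 *m gram x.
Proof.
rewrite /frameU linearD /= (P0T R b) mulmxDl !mulmxDr P0_tmxT (tmx_P0 tixP).
by rewrite (P0P0 R b) addr0 add0r mulmx1 mulmxA (P0_tmx tixP).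
Qed.

Lemma P0_frameU x : P0 *m frameU x = frameU x.
Proof. by rewrite /frameU mulmxDr (P0P0 R b) (P0_tmx tixP). Qed.

Lemma frameU_projn x : frameU x *m projn x = frameU x.
Proof.
rewrite /projn !mulmxA frameU_mulT -[P0 *m _ *m invmx _]mulmxA mulmxV ?gram_unit //.
by rewrite mulmx1 P0_frameU.
Qed.

Lemma projn_sym x : (projn x)^T = projn x.
Proof. by rewrite /projn !trmx_mul trmxK trmx_inv gram_sym mulmxA. Qed.

Lemma projn_idem x : projn x *m projn x = projn x.
Proof. by rewrite {1}/projn -mulmxA frameU_projn. Qed.

Lemma in0_frameU x : in0 (frameU x).
Proof. by apply: in0_add; [apply: in0_P0 | apply: in0_tmx]. Qed.

(** The points of the product of Grassmannians: graded orthogonal projections, whose trace at each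
    vertex fixes the dimension there. *)
Definition isproj P := [/\ in0 P, P^T = P, P *m P = P &
  forall x, \tr (cproj R cl x *m P) = \tr (cproj R cl x *m P0)].

Lemma isproj_conj (c P : 'M[R]_p) : in0 c -> c *m c^T = 1%:M ->
  isproj P -> isproj (c^T *m P *m c).
Proof.
move=> c0 cc [h1 h2 h3 h4]; split.
- by apply: in0_mul => //; apply: in0_mul => //; apply: in0_tr.
- by rewrite !trmx_mul trmxK h2 mulmxA.
- by rewrite -!mulmxA [c *m (c^T *m _)]mulmxA cc mul1mx [P *m (P *m _)]mulmxA h3.
move=> x; rewrite -h4 mxtrace_mulC -!mulmxA -c0 mxtrace_mulC -!mulmxA cc mulmx1.
by rewrite mxtrace_mulC.
Qed.

Lemma isproj_projn x : isproj (projn x).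
Proof.
have hU := in0_frameU x.
split; [|exact: projn_sym|exact: projn_idem|].
  apply: in0_mul => //; apply: in0_mul; first exact: in0_tr.
  by apply: in0_inv; [apply: gram_unit | apply: in0_gram].
move=> y; rewrite mxtrace_mulC /projn -!mulmxA -hU mxtrace_mulC -!mulmxA.
rewrite frameU_mulT mxtrace_mulC -!mulmxA mulmxV ?gram_unit //.
by rewrite mulmx1.
Qed.

Lemma spans_projn (c : 'M[R]_p) x : c *m c^T = 1%:M ->
  spans b (c^T *m projn x *m c) ((1%:M + phi x) *m c).
Proof.
move=> cc; have e : P0 *m ((1%:M + phi x) *m c) = frameU x *m c by rewrite mulmxA -frameUE.
split.
  rewrite e; move: (frameU_projn x); move: (projn x) (frameU x) => P u uP.
  by rewrite -!mulmxA [c *m (c^T *m _)]mulmxA cc mul1mx [u *m (_ *m c)]mulmxA uP.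
exists (c^T *m (frameU x)^T *m invmx (gram x)).
by rewrite -[_ *m P0 *m _]mulmxA e /projn !mulmxA.
Qed.

Lemma mxrank_isproj P : isproj P -> \rank P = \rank P0.
Proof.
move=> [h1 h2 h3 h4]; apply/eqP; rewrite -(eqr_nat R) !mxrank_idem ?P0P0 //.
have tr_split (A : 'M[R]_p) : \tr A = \sum_(y <- undup (codom cl)) \tr (cproj R cl y *m A).
  rewrite /mxtrace exchange_big /=; apply: eq_bigr => i _.
  under eq_bigr do rewrite mul_cproj.
  rewrite -mulr_suml (bigD1_seq (cl i)) ?undup_uniq ?mem_undup ?codom_f //= eqxx.
  rewrite big1 ?addr0 ?mul1r // => y /negPf ne.
  by rewrite eq_sym ne.
by rewrite tr_split [X in _ == X]tr_split; apply/eqP/eq_bigr => y _.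
Qed.

(** In a chart the [P0] block of the projection is the inverse Gram matrix; padded with [Q0] it can
    be inverted on the whole space, and the off-diagonal block divided by it is the chart
    coordinate. *)
Definition chart_mx (c P : 'M[R]_p) := P0 *m (c *m P *m c^T) *m P0 + Q0.
Definition chart_coord (c P : 'M[R]_p) :=
  coord tix (invmx (chart_mx c P) *m (P0 *m (c *m P *m c^T) *m Q0)).

Lemma conj_orthK (c A : 'M[R]_p) : c *m c^T = 1%:M -> c *m (c^T *m A *m c) *m c^T = A.
Proof.
by move=> cc; rewrite !mulmxA cc mul1mx -mulmxA cc mulmx1.
Qed.

Lemma chart_mx_projn (c : 'M[R]_p) x : c *m c^T = 1%:M ->
  chart_mx c (c^T *m projn x *m c) = invmx (gram x).
Proof.
move=> cc; rewrite /chart_mx conj_orthK // /projn.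
have e1 : P0 *m (frameU x)^T = P0.
  by rewrite /frameU linearD /= (P0T R b) mulmxDr P0P0 P0_tmxT addr0.
have e2 : frameU x *m P0 = P0.
  by rewrite /frameU mulmxDl P0P0 (tmx_P0 tixP) addr0.
rewrite !mulmxA e1 -mulmxA e2 -invgram_P0C -mulmxA P0P0.
rewrite -{1}(invgram_Q0 x) -mulmxDr.
by rewrite [P0 + Q0]addrC subrK mulmx1.
Qed.

Lemma chart_coord_projn (c : 'M[R]_p) x : c *m c^T = 1%:M ->
  chart_coord c (c^T *m projn x *m c) = x.
Proof.
move=> cc; rewrite /chart_coord chart_mx_projn // invmxK conj_orthK // /projn.
have e1 : P0 *m (frameU x)^T = P0.
  by rewrite /frameU linearD /= (P0T R b) mulmxDr P0P0 P0_tmxT addr0.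
have e2 : frameU x *m Q0 = phi x.
  by rewrite /frameU mulmxDl P0Q0 (tmx_Q0 tixP) add0r.
rewrite !mulmxA -[_ *m frameU x *m Q0]mulmxA e2 -[gram x *m P0 *m _]mulmxA e1.
rewrite -[gram x *m P0 *m _]mulmxA -invgram_P0C mulmxA mulmxV ?gram_unit // mul1mx.
by rewrite (P0_tmx tixP) mxofK.
Qed.

(** The rows P0 S of the conjugated projection span its row space as soon as their [P0] block is
    invertible, by equality of ranks; normalized by that block they are the frame of a graph. *)
Lemma projn_chart_coord (c P : 'M[R]_p) : in0 c -> c *m c^T = 1%:M -> isproj P ->
  chart_mx c P \in unitmx -> c^T *m projn (chart_coord c P) *m c = P.
Proof.
move=> c0 cc hP uA; have cc' : c^T *m c = 1%:M by apply: mulmx1C.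
pose S := c *m P *m c^T; have hS : isproj S.
  have := @isproj_conj c^T P; rewrite trmxK; apply => //; exact: in0_tr.
suff -> : projn (chart_coord c P) = S.
  by rewrite /S !mulmxA cc' mul1mx -mulmxA cc' mulmx1.
set A := chart_mx c P in uA *.
have PA : P0 *m A = A *m P0.
  rewrite /A /chart_mx mulmxDr mulmxDl !mulmxA P0P0 P0Q0 -!mulmxA P0P0.
  by rewrite (Q0P0 R b).
have PiA : P0 *m invmx A = invmx A *m P0.
  apply: (can_inj (mulKmx uA)); rewrite mulmxA -PA -mulmxA mulmxV // mulmx1.
  by rewrite mulmxA mulmxV // mul1mx.
have ex : phi (chart_coord c P) = invmx A *m (P0 *m S *m Q0).
  rewrite /chart_coord -/S -/A; apply: (tmx_coordK (cl := cl)) => //.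
    have hS0 : in0 S by case: hS.
    apply: in0_mul.
      apply: in0_inv => //; apply: in0_add; last exact: in0_Q0.
      by apply: in0_mul; [apply: in0_mul => //|]; apply: in0_P0.
    by apply: in0_mul; [apply: in0_mul => //; apply: in0_P0 | apply: in0_Q0].
  rewrite !mulmxA PiA -!mulmxA [P0 *m (P0 *m _)]mulmxA P0P0.
  by rewrite Q0Q0.
have eU : frameU (chart_coord c P) = invmx A *m (P0 *m S).
  apply: (can_inj (mulKmx uA)); rewrite mulKVmx // /frameU ex mulmxDr mulKVmx //.
  have -> : A *m P0 = P0 *m S *m P0.
    by rewrite /A /chart_mx -/S mulmxDl (Q0P0 R b) addr0 -mulmxA P0P0.
  by rewrite -mulmxDr [P0 + Q0]addrC subrK mulmx1.
have [s1 s2 s3 s4] := hS.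
set x := chart_coord c P in eU ex *.
have US : frameU x *m S = frameU x by rewrite eU -mulmxA -[P0 *m S *m S]mulmxA s3.
have rU : (\rank P0 <= \rank (frameU x))%N.
  have <- : frameU x *m P0 = P0 by rewrite /frameU mulmxDl P0P0 (tmx_P0 tixP) addr0.
  exact: mxrankM_maxl.
have sub : (frameU x <= S)%MS by rewrite -US submxMl.
have : (S <= frameU x)%MS.
  by rewrite -(mxrank_leqif_sup sub) eqn_leq mxrankS //= (mxrank_isproj hS).
move=> /submxP [K eK].
apply: (@spans_eq _ _ b _ _ (1%:M + phi x)) => //; first exact: projn_sym.
  by have := @spans_projn 1%:M x; rewrite trmx1 !mulmx1 mul1mx; apply.
split; first by rewrite -frameUE US.
by exists K; rewrite -mulmxA -frameUE.
Qed.

End Charts.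

End Projections.

(** * The permuted charts cover the product of Grassmannians *)

Module ChartCover.
Import structures.
Import all_boot all_order all_algebra all_fingroup.
Import ring lra.
Import Graded Projections.
Import Order.TTheory GRing.Theory Num.Theory.
Local Open Scope ring_scope.

Section Cover.
Variables (F : numFieldType) (p : nat) (X : eqType) (cl : 'I_p -> X).
Variable b : pred 'I_p.
Local Notation P0 := (P0 F b).
Local Notation cproj := (cproj F cl).

(** The pairs ([cl i], [b i]) and ([cl i], [I i]) occur with the same multiplicities, hence differ
    by a permutation of the indices. *)
Lemma perm_two_preds (I : pred 'I_p) :
  (forall x, #|[pred i | (cl i == x) && b i]| = #|[pred i | (cl i == x) && I i]|) ->
  exists s : 'S_p, forall i, cl (s i) = cl i /\ I (s i) = b i.
Proof.
move=> h; pose t1 := [tuple (cl i, b i) | i < p]; pose t2 := [tuple (cl i, I i) | i < p].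
have /tuple_permP [s es] : perm_eq t1 t2.
  apply/allP => -[x a] _ /=; rewrite !count_map; apply/eqP.
  have key (J : pred 'I_p) : count (preim (fun i => (cl i, J i)) (pred1 (x, true))) (enum 'I_p)
      = #|[pred i | (cl i == x) && J i]|.
    rewrite cardE size_filter -enumT; apply: eq_count => i /=.
    by rewrite -[in RHS]topredE /= xpair_eqE eqb_id.
  have tot (J : pred 'I_p) : (count (preim (fun i => (cl i, J i)) (pred1 (x, true))) (enum 'I_p)
      + count (preim (fun i => (cl i, J i)) (pred1 (x, false))) (enum 'I_p))%N
      = count (fun i => cl i == x) (enum 'I_p).
    rewrite -count_predUI [X in (_ + X)%N](_ : _ = 0%N) ?addn0.
      by apply: eq_count => i /=; rewrite !xpair_eqE; case: (J i); rewrite ?andbT ?andbF ?orbF.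
    apply/eqP; rewrite -leqn0 leqNgt -has_count; apply/hasPn => i _ /=.
    by rewrite !xpair_eqE; case: (J i); rewrite ?andbF.
  have e : count (preim (fun i => (cl i, b i)) (pred1 (x, true))) (enum 'I_p)
      = count (preim (fun i => (cl i, I i)) (pred1 (x, true))) (enum 'I_p).
    by rewrite key h -key.
  rewrite -enumT; case: a; first exact: e.
  by have := tot b; rewrite -(tot I) e => /addnI.
exists s => i; have : tnth t1 i = tnth [tuple tnth t2 (s i0) | i0 < p] i.
  by congr tnth; apply: val_inj.
by rewrite !tnth_mktuple => -[-> ->].
Qed.

Lemma trace_P0 x : \tr (cproj x *m P0) = #|[pred i | (cl i == x) && b i]|%:R.
Proof.
rewrite /mxtrace -sum1_card natr_sum [RHS]big_mkcond /=; apply: eq_bigr => i _.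
rewrite mul_cproj mxE eqxx -[in RHS]topredE /=.
by case: (cl i == x) (b i) => [] [] /=; rewrite ?mulr1 ?mulr0 ?mul0r.
Qed.

(** At each vertex a maximal set of independent rows of [P] is as large as the part of [b] there, by
    the trace condition. A permutation preserving the vertices moves [b] onto these rows. *)
Lemma cover_perm (P : 'M[F]_p) : in0 cl P -> P *m P = P ->
  (forall x, \tr (cproj x *m P) = \tr (cproj x *m P0)) ->
  exists s : 'S_p, (forall i, cl (s i) = cl i) /\
    forall v : 'rV_p, v *m P0 *m perm_mx s *m P = 0 -> v *m P0 = 0.
Proof.
move=> P_0 PP trP; pose A x := cproj x *m P; pose f x := maxrankfun (A x).
pose I := [pred i | i \in codom (f (cl i))].
have Aout x i : cl i != x -> row i (A x) = 0.
  by move=> /negPf ne; apply/rowP => j; rewrite mxE /A mul_cproj ne mul0r mxE.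
have fcl x k : cl (f x k) = x.
  apply/eqP; apply: contraT => /Aout r0.
  have : (delta_mx 0 k : 'rV[F]_(\rank (A x))) *m rowsub (f x) (A x) = 0 *m rowsub (f x) (A x).
    by rewrite mul0mx -rowE row_rowsub r0.
  move/(row_free_inj (maxrowsub_free (A x)))/rowP/(_ k).
  by rewrite !mxE !eqxx => /eqP; rewrite oner_eq0.
have Icnt x : #|[pred i | (cl i == x) && b i]| = #|[pred i | (cl i == x) && I i]|.
  have -> : #|[pred i | (cl i == x) && I i]| = \rank (A x).
    rewrite -[RHS]card_ord -(card_codom (@maxrankfun_inj _ _ _ (A x))).
    apply: eq_card => i; rewrite -[in LHS]topredE /= -/(f x).
    have [<-//|ne] := eqVneq (cl i) x.
    by symmetry; apply/negP => /codomP [k e]; rewrite e fcl eqxx in ne.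
  apply/eqP; rewrite -(eqr_nat F) -trace_P0 -trP mxrank_idem //.
  have cc : cproj x *m cproj x = cproj x.
    by apply/matrixP => i j; rewrite mul_cproj mxE; case: (cl i == x); rewrite ?andbF ?mul1r ?mul0r.
  by rewrite -mulmxA [P *m (_ *m _)]mulmxA -P_0 -mulmxA PP mulmxA cc.
have [s hs] := perm_two_preds Icnt; exists s; split=> [i|v]; first by case: (hs i).
set u := v *m P0 *m perm_mx s => uP.
have uE j : u 0 j = v 0 (s^-1%g j) * (b (s^-1%g j))%:R.
  have -> : u = col_perm s^-1 (v *m P0) by rewrite col_permE invgK.
  rewrite [LHS]mxE mxE (bigD1 (s^-1%g j)) //= mxE eqxx big1 ?addr0 // => k kj.
  by rewrite mxE (negPf kj) mulr0.
have suppI j : ~~ I j -> u 0 j = 0.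
  move=> nI; rewrite uE; have [_ e] := hs (s^-1%g j).
  by rewrite permKV in e; rewrite -e (negPf nI) mulr0.
suff u0 : u = 0.
  by rewrite -[LHS]mulmx1 -perm_mx1 -(mulgV s) perm_mxM mulmxA -/u u0 mul0mx.
apply/rowP => j; rewrite [RHS]mxE; have [Ij|/suppI//] := boolP (I j).
have /codomP [k ek] := Ij; set x := cl j in ek.
pose y : 'rV_(\rank (A x)) := \row_k u 0 (f x k).
have : y *m rowsub (f x) (A x) = 0 *m rowsub (f x) (A x).
  rewrite mul0mx; transitivity (u *m A x); last by rewrite mulmxA -[u *m _ *m P]mulmxA P_0 mulmxA uP mul0mx.
  apply/rowP => l; rewrite !mxE.
  rewrite (bigID (mem (codom (f x)))) /= [X in _ = _ + X]big1 ?addr0; last first.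
    move=> i ni; have [e|ne] := eqVneq (cl i) x; last by rewrite /A mul_cproj (negPf ne) mul0r mulr0.
    by rewrite suppI ?mul0r //= e.
  rewrite (reindex_onto (f x) (fun i => odflt k [pick k' | f x k' == i])) /=.
    apply: eq_big => [k'|k' _]; last by rewrite !mxE.
    rewrite codom_f /=; case: pickP => [k'' /eqP/maxrankfun_inj ->|/(_ k')]; last by rewrite eqxx.
    by rewrite eqxx.
  move=> i /codomP [k' ->]; case: pickP => [k'' /eqP //|/(_ k')]; by rewrite eqxx.
move/(row_free_inj (maxrowsub_free (A x)))/rowP/(_ k).
by rewrite !mxE -ek.
Qed.

End Cover.

End ChartCover.

(** * Negligible parameter sets and transversality of jets *)

Module Genericity.
Import structures.
Import all_boot all_order all_algebra.
Import ring lra.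
Import reals.
Import -(notations) mpoly.
Import PolynomialFunctions Norms ImplicitFunction LocalCount.
Import Order.TTheory GRing.Theory Num.Theory.
Local Open Scope ring_scope.

Section Negligible.
Variable R : realFieldType.

(** Algebraic substitute for measure zero: finite unions of negligible sets are negligible, and no
    negligible set is the whole space. *)
Definition negligible D (B : 'rV[R]_D -> Prop) :=
  exists2 P : mpoly D R, P != 0 & forall y, B y -> meval (y 0) P = 0.

Lemma negligible_sub D (B B' : 'rV[R]_D -> Prop) :
  (forall y, B y -> B' y) -> negligible B' -> negligible B.
Proof. by move=> h [P P0 hP]; exists P => // y /h /hP. Qed.

Lemma negligible_bigU D (I : finType) (B : I -> 'rV[R]_D -> Prop) :
  (forall i, negligible (B i)) -> negligible (fun y => exists i, B i y).
Proof.
move=> /fin_all_exists2 [P P0 hP]; exists (\prod_i P i); first exact/prodf_neq0.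
move=> y [i /hP h]; rewrite (bigD1 i) //= mevalM.
by rewrite h mul0r.
Qed.

Lemma negligible_or D (B B' : 'rV[R]_D -> Prop) :
  negligible B -> negligible B' -> negligible (fun y => B y \/ B' y).
Proof.
move=> [P P0 hP] [P' P0' hP']; exists (P * P'); first by rewrite mulf_neq0.
by move=> y [/hP h|/hP' h]; rewrite mevalM h ?mul0r ?mulr0.
Qed.

Lemma negligible_avoid D (B : 'rV[R]_D -> Prop) : negligible B -> exists y, ~ B y.
Proof.
move=> [P P0 hP]; have [y hy] := meval_neq0 P0; exists (\row_i y i) => /hP e.
case/eqP: hy; rewrite -[RHS]e; apply: meval_eq => i; by rewrite mxE.
Qed.

Lemma negligible_incidence D q (T : 'rV[R]_q -> 'M[R]_(D, q))
    (C : 'rV[R]_q -> 'rV[R]_q) (h : 'rV[R]_q -> R) :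
  mxpolyf T -> mxpolyf C -> polyf h -> (exists x, h x != 0) ->
  negligible (fun y => exists x, [/\ h x = 0, row_full (T x) & y *m T x = C x]).
Proof.
move=> pT pC ph hx; have [P P0 hP] := hypersurface_incidence pT pC ph hx.
by exists P => // y [x [h1 h2 h3]]; apply: hP h1 h2 h3.
Qed.

Lemma row_full_surj D q (T : 'M[R]_(D, q)) :
  (forall w : 'rV_q, exists y, y *m T = w) -> row_full T.
Proof.
move=> h; rewrite -sub1mx; apply/row_subP => i.
by have [y <-] := h (row i 1%:M); apply: submxMl.
Qed.

End Negligible.

Section Jets.
Variable R : realType.

Lemma poly_fun_inj (p q : {poly R}) : (forall e, p.[e] = q.[e]) -> p = q.
Proof.
move=> h; apply/eqP; rewrite -subr_eq0; apply/eqP.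
apply: (@poly_cofinite_eq0 _ _ 1); first exact: oner_neq0.
by move=> t _; rewrite hornerD hornerN h subrr.
Qed.

Lemma polyf_lsub n k i : polyf (fun z : 'rV[R]_(n + k) => lsubmx z 0 i).
Proof. by apply: polyf_ext (polyf_coord R (lshift k i)) _ => z; rewrite mxE. Qed.

Lemma polyf_rsub n k i : polyf (fun z : 'rV[R]_(n + k) => rsubmx z 0 i).
Proof. by apply: polyf_ext (polyf_coord R (rshift n i)) _ => z; rewrite mxE. Qed.

Lemma mxpolyf_lsub n k : mxpolyf (fun z : 'rV[R]_(n + k) => lsubmx z).
Proof. by move=> i j; rewrite ord1; apply: polyf_lsub. Qed.

Lemma mxpolyf_rsub n k : mxpolyf (fun z : 'rV[R]_(n + k) => rsubmx z).
Proof. by move=> i j; rewrite ord1; apply: polyf_rsub. Qed.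

(** The Taylor coefficients of orders 1 and 2 along a line are polynomial in the point and the
    direction; they are read off the univariate polynomial of the restriction. *)
Lemma polyf_jet n (f : 'rV[R]_n -> R) : polyf f ->
  exists f1 f2 : 'rV[R]_(n + n) -> R, [/\ polyf f1, polyf f2 &
  forall x v, exists p : {poly R}, [/\ forall e, f (x + e *: v) = p.[e],
    p`_1 = f1 (row_mx x v) & p`_2 = f2 (row_mx x v)]].
Proof.
elim=> {f}.
- move=> c; exists (fun=> 0), (fun=> 0); split; try exact: polyf_cst.
  by move=> x v; exists c%:P; rewrite !coefC; split=> // e; rewrite hornerC.
- move=> i; exists (fun z => rsubmx z 0 i), (fun=> 0); split.
  + exact: polyf_rsub.
  + exact: polyf_cst.
  + move=> x v; exists ((x 0 i)%:P + (v 0 i) *: 'X); split.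
    * by move=> e; rewrite hornerD hornerC hornerZ hornerX !mxE mulrC.
    * by rewrite coefD coefC coefZ coefX row_mxKr add0r mulr1.
    * by rewrite coefD coefC coefZ coefX mulr0 addr0.
- move=> f g pf [f1 [f2 [pf1 pf2 hf]]] pg [g1 [g2 [pg1 pg2 hg]]].
  exists (fun z => f1 z + g1 z), (fun z => f2 z + g2 z); split; try exact: polyf_add.
  move=> x v; have [p [ep p1 p2]] := hf x v; have [q [eq q1 q2]] := hg x v.
  by exists (p + q); split=> [e||]; rewrite ?hornerD ?coefD ?ep ?eq ?p1 ?p2 ?q1 ?q2.
- move=> f g pf [f1 [f2 [pf1 pf2 hf]]] pg [g1 [g2 [pg1 pg2 hg]]].
  have pfl : polyf (fun z : 'rV_(n + n) => f (lsubmx z)).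
    by apply: (polyf_comp pf); apply: mxpolyf_lsub.
  have pgl : polyf (fun z : 'rV_(n + n) => g (lsubmx z)).
    by apply: (polyf_comp pg); apply: mxpolyf_lsub.
  exists (fun z => f (lsubmx z) * g1 z + f1 z * g (lsubmx z)),
   (fun z => f (lsubmx z) * g2 z + f1 z * g1 z + f2 z * g (lsubmx z)); split.
  + by do !apply: polyf_add; apply: polyf_mul.
  + by do !apply: polyf_add; apply: polyf_mul.
  move=> x v; have [p [ep p1 p2]] := hf x v; have [q [eq q1 q2]] := hg x v.
  have p0 : p`_0 = f x by rewrite -horner_coef0 -ep scale0r addr0.
  have q0 : q`_0 = g x by rewrite -horner_coef0 -eq scale0r addr0.
  exists (p * q); rewrite !row_mxKl; split.
  + by move=> e; rewrite hornerM ep eq.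
  + by rewrite coefM !big_ord_recr big_ord0 /= add0r p0 p1 q0 q1.
  + by rewrite coefM !big_ord_recr big_ord0 /= add0r p0 p1 p2 q0 q1 q2.
- move=> f g pf [f1 [f2 [pf1 pf2 hf]]] e; exists f1, f2; split=> // x v.
  by have [p [ep p1 p2]] := hf x v; exists p; split=> // t; rewrite -e.
Qed.

(** [a1] and [a2] are Taylor coefficients, so that [a2] is half the second derivative. *)
Definition jet2 n m (f : 'rV[R]_n -> 'rV[R]_m) x v (a1 a2 : 'rV[R]_m) :=
  forall j, exists p : {poly R},
    [/\ forall e, f (x + e *: v) 0 j = p.[e], p`_1 = a1 0 j & p`_2 = a2 0 j].

Lemma jet2_uniq n m (f : 'rV[R]_n -> 'rV[R]_m) x v a1 a2 b1 b2 :
  jet2 f x v a1 a2 -> jet2 f x v b1 b2 -> a1 = b1 /\ a2 = b2.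
Proof.
move=> h h'; split; apply/rowP => j; have [p [e p1 p2]] := h j;
  have [q [e' q1 q2]] := h' j; have pq : p = q by apply: poly_fun_inj => t; rewrite -e -e'.
  by rewrite -p1 -q1 pq.
by rewrite -p2 -q2 pq.
Qed.

Lemma mxpolyf_jet n D m (Phi : 'rV[R]_n -> 'M[R]_(D, m)) : mxpolyf Phi ->
  exists Phi1 Phi2 : 'rV[R]_(n + n) -> 'M[R]_(D, m), [/\ mxpolyf Phi1, mxpolyf Phi2 &
  forall y x v, jet2 (fun x => y *m Phi x) x v (y *m Phi1 (row_mx x v)) (y *m Phi2 (row_mx x v))].
Proof.
move=> pP; have /fin_all_exists2 : forall ij : 'I_D * 'I_m, exists2 F :
   ('rV[R]_(n + n) -> R) * ('rV[R]_(n + n) -> R), polyf F.1 /\ polyf F.2 &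
  forall x v, exists p : {poly R}, [/\ forall e, Phi (x + e *: v) ij.1 ij.2 = p.[e],
    p`_1 = F.1 (row_mx x v) & p`_2 = F.2 (row_mx x v)].
  by move=> [i j]; have [f1 [f2 [h1 h2 h3]]] := polyf_jet (pP i j); exists (f1, f2).
move=> [F pF hF].
exists (fun z => \matrix_(i, j) (F (i, j)).1 z), (fun z => \matrix_(i, j) (F (i, j)).2 z).
split.
- by move=> i j; have [h _] := pF (i, j); apply: polyf_ext h _ => z; rewrite mxE.
- by move=> i j; have [_ h] := pF (i, j); apply: polyf_ext h _ => z; rewrite mxE.
move=> y x v j; have /fin_all_exists [p hp] := fun i => hF (i, j) x v.
exists (\sum_i y 0 i *: p i); split.
- move=> e; rewrite mxE horner_sum; apply: eq_bigr => i _.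
  by have [h _ _] := hp i; rewrite hornerZ -h.
- rewrite coef_sum mxE; apply: eq_bigr => i _.
  by have [_ h _] := hp i; rewrite coefZ h mxE.
- rewrite coef_sum mxE; apply: eq_bigr => i _.
  by have [_ _ h] := hp i; rewrite coefZ h mxE.
Qed.

Lemma jet2_ex n m (f : 'rV[R]_n -> 'rV[R]_m) : mxpolyf f ->
  forall x v, exists a1 a2, jet2 f x v a1 a2.
Proof.
move=> pf x v; have [F1 [F2 [_ _ h]]] := mxpolyf_jet pf.
exists (1%:M *m F1 (row_mx x v)), (1%:M *m F2 (row_mx x v)) => j.
have [p [e p1 p2]] := h 1%:M x v j; exists p; split=> // t.
by rewrite -e mul1mx.
Qed.

(** The difference quotient along a line is a polynomial in the line parameter, whose value at 0 is
    both the first coefficient and v Q(x, x). *)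
Lemma jet2_quotient n m (f : 'rV[R]_n -> 'rV[R]_m) Q x v a1 a2 : mxpolyf Q ->
  (forall x y, f x - f y = (x - y) *m Q (row_mx x y)) ->
  jet2 f x v a1 a2 -> a1 = v *m Q (row_mx x x).
Proof.
move=> pQ fQ h; apply/rowP => j; have [p [ep p1 _]] := h j.
have pg : polyf (fun z : 'rV_(n + n) => (v *m Q z) 0 j).
  by apply: (mxpolyf_mul _ pQ); apply: mxpolyf_cst.
have [g1 [g2 [_ _ hg]]] := polyf_jet pg.
have [q [eq _ _]] := hg (row_mx x x) (row_mx v 0).
have e : p - (p`_0)%:P = 'X * q.
  apply: poly_fun_inj => t; rewrite hornerD hornerN hornerC hornerM hornerX.
  rewrite -ep -eq scale_row_mx add_row_mx scaler0 addr0.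
  have := ep 0; rewrite horner_coef0 scale0r addr0 => <-.
  have /rowP/(_ j) := fQ (x + t *: v) x; rewrite [x + _]addrC addrK -scalemxAl.
  by rewrite [LHS]mxE [X in _ + X = _]mxE [RHS]mxE.
rewrite -p1; have /(congr1 (fun p : {poly R} => p`_1)) := e.
rewrite coefB coefC subr0 coefXM /= => ->.
by rewrite -horner_coef0 -eq scale0r addr0.
Qed.

Definition jacobian n m (f : 'rV[R]_n -> 'rV[R]_m) x (A : 'M[R]_(n, m)) :=
  forall v, exists a2, jet2 f x v (v *m A) a2.

Lemma jacobian_quotient n m (f : 'rV[R]_n -> 'rV[R]_m) Q x : mxpolyf f -> mxpolyf Q ->
  (forall x y, f x - f y = (x - y) *m Q (row_mx x y)) -> jacobian f x (Q (row_mx x x)).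
Proof.
move=> pf pQ fQ v; have [a1 [a2 h]] := jet2_ex pf x v.
by exists a2; rewrite -(jet2_quotient pQ fQ h).
Qed.

Lemma jacobian_ex n m (f : 'rV[R]_n -> 'rV[R]_m) : mxpolyf f -> 
  forall x, exists A, jacobian f x A.
Proof.
move=> pf x; have [Q [pQ _ fQ]] := mxpolyf_quotient pf.
by exists (Q (row_mx x x)); apply: jacobian_quotient.
Qed.

Lemma jacobian_uniq n m (f : 'rV[R]_n -> 'rV[R]_m) x A B :
  jacobian f x A -> jacobian f x B -> A = B.
Proof.
move=> hA hB; apply/row_matrixP => i; rewrite !rowE.
have [a ha] := hA (delta_mx 0 i); have [c hc] := hB (delta_mx 0 i).
by have [] := jet2_uniq ha hc.
Qed.

Lemma jet2_jacobian n m (f : 'rV[R]_n -> 'rV[R]_m) x A v a1 a2 :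
  jacobian f x A -> jet2 f x v a1 a2 -> a1 = v *m A.
Proof. by move=> /(_ v) [a h] h'; have [] := jet2_uniq h' h. Qed.

Lemma comp_shift_coef1 (p : {poly R}) s : (p \Po ('X + s%:P))`_1 = p^`().[s].
Proof.
have -> : (p \Po ('X + s%:P))`_1 = (p \Po ('X + s%:P))^`()`_0.
  by rewrite coef_deriv mulr1n.
rewrite deriv_comp derivD derivX derivC addr0 mulr1 -horner_coef0 horner_comp.
by rewrite hornerD hornerX hornerC add0r.
Qed.

Lemma comp_scale_coef (p : {poly R}) c k : (p \Po (c *: 'X))`_k = c ^+ k * p`_k.
Proof.
have -> : p \Po (c *: 'X) = \poly_(i < size p) (c ^+ i * p`_i).
  apply: poly_fun_inj => e; rewrite horner_comp hornerZ hornerX horner_poly horner_coef.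
  by apply: eq_bigr => i _; rewrite exprMn mulrCA mulrA.
by rewrite coef_poly; case: ltnP => // h; rewrite (nth_default _ h) mulr0.
Qed.

End Jets.

Section JetSurjective.
Variables (R : realType) (D m : nat) (Phi : 'rV[R]_m -> 'M[R]_(D, m)).
Hypothesis pPhi : mxpolyf Phi.

(** The family prescribes 2-jets order by order, each stage leaving the lower orders at zero.
    Squares v_a^2 suffice in order 2, since a single direction is tested at a time. *)
Definition jet_surjective :=
  [/\ forall x (w : 'rV_m), exists y, y *m Phi x = w,
      forall x a w, exists2 y, y *m Phi x = 0 &
        forall v, exists a2, jet2 (fun x => y *m Phi x) x v (v 0 a *: w) a2
    & forall x a w, exists2 y, y *m Phi x = 0 &
        forall v, jet2 (fun x => y *m Phi x) x v 0 (v 0 a ^+ 2 *: w)].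

Hypothesis JS : jet_surjective.
Variables (Phi1 Phi2 : 'rV[R]_(m + m) -> 'M[R]_(D, m)).
Hypothesis pPhi1 : mxpolyf Phi1.
Hypothesis pPhi2 : mxpolyf Phi2.
Hypothesis jPhi : forall y x v, jet2 (fun x => y *m Phi x) x v
  (y *m Phi1 (row_mx x v)) (y *m Phi2 (row_mx x v)).

Lemma pyPhi (y : 'rV_D) : mxpolyf (fun x => y *m Phi x).
Proof. by apply: mxpolyf_mul => //; apply: mxpolyf_cst. Qed.

Lemma jet1_surj x w B : exists2 y, y *m Phi x = w &
  forall v, y *m Phi1 (row_mx x v) = v *m B.
Proof.
have [J0 J1 _] := JS; have [y ey] := J0 x w.
have [A hA] := jacobian_ex (pyPhi y) x.
have /fin_all_exists2 [z z0 hz] a := J1 x a (row a (B - A)).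
exists (y + \sum_a z a).
  by rewrite mulmxDl mulmx_suml big1 ?addr0 // => a _; rewrite z0.
move=> v; rewrite mulmxDl mulmx_suml (jet2_jacobian hA (jPhi _ _ _)).
rewrite (eq_bigr (fun a => v 0 a *: row a (B - A))).
  by rewrite -mulmx_sum_row mulmxBr addrC subrK.
by move=> a _; have [a2 h] := hz a v; have [<- _] := jet2_uniq h (jPhi _ _ _).
Qed.

Lemma jet2_surj x (v : 'rV_m) i w B c : v 0 i = 1 -> exists y, [/\ y *m Phi x = w,
  forall u, y *m Phi1 (row_mx x u) = u *m B & y *m Phi2 (row_mx x v) = c].
Proof.
move=> vi; have [y y0 y1] := jet1_surj x w B; have [_ _ J2] := JS.
have [z z0 hz] := J2 x i (c - y *m Phi2 (row_mx x v)).
exists (y + z); split.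
- by rewrite mulmxDl z0 addr0.
- by move=> u; rewrite mulmxDl y1; have [<- _] := jet2_uniq (hz u) (jPhi _ _ _); rewrite addr0.
by rewrite mulmxDl; have [_ <-] := jet2_uniq (hz v) (jPhi _ _ _);
   rewrite vi expr1n scale1r addrC subrK.
Qed.

Variables (y0 y1 : 'rV[R]_D).

(** The factor s(1 - s) keeps the end sections fixed and lets the parameter [a] act at all other
    times. *)
Definition path_at (a : 'rV[R]_D) s := (1 - s) *: y0 + s *: y1 + (s * (1 - s)) *: a.

(** A nonzero vector is normalized to have entry [j] equal to 1. The slot [j] of [u] is thereby free
    and can store another unknown. *)
Definition one_at j (u : 'rV[R]_m) : 'rV[R]_m := \row_k (if k == j then 1 else u 0 k).

Lemma mxpolyf_one_at n j (u : 'rV[R]_n -> 'rV[R]_m) : mxpolyf u -> mxpolyf (fun z => one_at j (u z)).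
Proof.
move=> pu i k; apply: (@polyf_ext _ _ (fun z => if k == j then 1 else u z 0 k)).
  by case: (k == j); [apply: polyf_cst | apply: pu].
by move=> z; rewrite mxE.
Qed.

(** Entry [k] of y times this matrix is the derivative of the section in direction e_k paired with
    [l]: all entries vanish when [l] annihilates the image of the Jacobian. *)
Definition contr (x l : 'rV[R]_m) : 'M[R]_(D, m) :=
  \matrix_(i, k) (Phi1 (row_mx x (delta_mx 0 k)) *m l^T) i 0.

Lemma mul_contr (y : 'rV_D) x l k :
  (y *m contr x l) 0 k = (y *m Phi1 (row_mx x (delta_mx 0 k)) *m l^T) 0 0.
Proof.
rewrite -mulmxA [LHS]mxE [RHS]mxE; apply: eq_bigr => i _.
by congr (_ * _); rewrite mxE.
Qed.

Lemma mxpolyf_contr n (x l : 'rV[R]_n -> 'rV[R]_m) : mxpolyf x -> mxpolyf l ->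
  mxpolyf (fun z => contr (x z) (l z)).
Proof.
move=> px pl i k; apply: (@polyf_ext _ _
   (fun z => (Phi1 (row_mx (x z) (delta_mx 0 k)) *m (l z)^T) i 0)); last by move=> z; rewrite [RHS]mxE.
apply: mxpolyf_mul; last exact: mxpolyf_tr.
by apply: (mxpolyf_comp pPhi1); apply: mxpolyf_row_mx => //; apply: mxpolyf_cst.
Qed.

(** Isolates the parameter [a], giving the affine form that [negligible_incidence] expects. *)
Lemma path_eq0 a s n (M : 'M[R]_(D, n)) : path_at a s *m M = 0 ->
  a *m ((s * (1 - s)) *: M) = - ((1 - s) *: y0 + s *: y1) *m M.
Proof.
rewrite /path_at mulmxDl => /eqP; rewrite addrC addr_eq0 => /eqP e.
by rewrite mulNmx -e -scalemxAr -scalemxAl.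
Qed.

Lemma tr_scale n (c : R) (l : 'rV[R]_n) : (c *: l)^T = c *: l^T.
Proof. by apply/matrixP => i j; rewrite !mxE. Qed.

Lemma rV_neq0 n (l : 'rV[R]_n) : l != 0 -> exists j, l 0 j != 0.
Proof.
move/eqP=> l0; apply/existsP; apply: contra_notT l0; rewrite negb_exists => /forallP hk.
by apply/rowP => k; rewrite [RHS]mxE; apply/eqP; rewrite -[_ == _]negbK hk.
Qed.

Lemma nonzero_pairing j (f : 'rV[R]_m) : f != 0 -> exists l : 'rV[R]_m, l 0 j = 1 /\ f *m l^T != 0.
Proof.
move=> /rV_neq0 [k fk].
have pair (a : 'I_m) : (f *m (delta_mx 0 a)^T) 0 0 = f 0 a.
  rewrite mxE (bigD1 a) //= !mxE !eqxx mulr1 big1 ?addr0 // => k' ne.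
  by rewrite !mxE (negPf ne) andbF mulr0.
have nz (l : 'rV[R]_m) : (f *m l^T) 0 0 != 0 -> f *m l^T != 0.
  by apply: contraNneq => ->; rewrite mxE.
have [fj|fj] := eqVneq (f 0 j) 0.
  have kj : k != j by apply: contraNneq fk => ->; rewrite fj.
  exists (delta_mx 0 j + delta_mx 0 k); rewrite !mxE !eqxx (eq_sym j) (negPf kj) addr0; split=> //.
  by apply: nz; rewrite linearD /= mulmxDr mxE !pair fj add0r.
by exists (delta_mx 0 j); rewrite !mxE !eqxx; split=> //; apply: nz; rewrite pair.
Qed.

(** Excludes zeros of the path at which a covector [l] annihilates the derivatives in both x and s.
    The unknowns (s, x, l), with [l] normalized, number 2m; there are 2m equations affine in [a] and
    one more for the s-derivative. The latter is free of [a]: s^2 y1 - (1 - s)^2 y0 is s(1 - s)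
    times the derivative of the path minus (1 - 2s) times the path. *)
Lemma negligible_corank2 : (exists x, y0 *m Phi x != 0) ->
  negligible (fun a => exists s x (l : 'rV_m), [/\ s != 0, s != 1, l != 0,
    path_at a s *m Phi x = 0 &
    (forall v, path_at a s *m Phi1 (row_mx x v) *m l^T = 0) /\
    (s ^+ 2 *: y1 - (1 - s) ^+ 2 *: y0) *m Phi x *m l^T = 0]).
Proof.
move=> ex0.
have key (j : 'I_m) : negligible (fun a => exists s x (l : 'rV_m), [/\ s != 0, s != 1, l 0 j = 1,
    path_at a s *m Phi x = 0 &
    (forall v, path_at a s *m Phi1 (row_mx x v) *m l^T = 0) /\
    (s ^+ 2 *: y1 - (1 - s) ^+ 2 *: y0) *m Phi x *m l^T = 0]).
  pose X (z : 'rV[R]_(m + m)) := lsubmx z; pose L (z : 'rV[R]_(m + m)) := one_at j (rsubmx z).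
  pose S (z : 'rV[R]_(m + m)) := rsubmx z 0 j.
  pose M z := row_mx (Phi (X z)) (contr (X z) (L z)).
  pose h z := ((S z ^+ 2 *: y1 - (1 - S z) ^+ 2 *: y0) *m Phi (X z) *m (L z)^T) 0 0.
  have pX : mxpolyf X by apply: mxpolyf_lsub.
  have pL : mxpolyf L by apply: mxpolyf_one_at; apply: mxpolyf_rsub.
  have pS : polyf S by apply: polyf_rsub.
  have pS1 : polyf (fun z => 1 - S z) by apply: polyf_sub => //; apply: polyf_cst.
  have pPX : mxpolyf (fun z => Phi (X z)) by apply: (mxpolyf_comp pPhi).
  have pM : mxpolyf M by apply: mxpolyf_row_mx => //; apply: mxpolyf_contr.
  have := @negligible_incidence _ _ _ (fun z => (S z * (1 - S z)) *: M z)
    (fun z => - ((1 - S z) *: y0 + S z *: y1) *m M z) h.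
  case.
  - by apply: mxpolyf_scale => //; apply: polyf_mul.
  - apply: mxpolyf_mul => //; apply: mxpolyf_opp; apply: mxpolyf_add;
      by apply: mxpolyf_scale => //; apply: mxpolyf_cst.
  - apply: mxpolyf_mul; last exact: mxpolyf_tr.
    apply: mxpolyf_mul => //; apply: mxpolyf_sub.
      by apply: mxpolyf_scale; [apply: polyf_mul | apply: mxpolyf_cst].
    by apply: mxpolyf_scale; [apply: polyf_mul | apply: mxpolyf_cst].
  (* At s = 0 the extra equation reduces to - y0 Phi(x) l^T, which is not identically zero. *)
  - have [x] := ex0; set f0 := y0 *m Phi x => f00.
    have [l [lj hl]] := nonzero_pairing j f00.
    exists (row_mx x (\row_k (if k == j then 0 else l 0 k))).
    set z := row_mx _ _.
    have eX : X z = x by rewrite /X row_mxKl.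
    have eS : S z = 0 by rewrite /S row_mxKr mxE eqxx.
    have eL : L z = l.
      by rewrite /L row_mxKr; apply/rowP => k; rewrite !mxE; case: eqP => // ->.
    have -> : h z = - (f0 *m l^T) 0 0.
      rewrite /h eX eS eL expr0n /= scale0r sub0r subr0 expr1n scale1r.
      by rewrite !mulNmx mxE.
    rewrite oppr_eq0; apply: contraNneq hl => e; apply/eqP/matrixP => a b.
    by rewrite !ord1 e mxE.
  move=> P P0 hP; exists P => // a [s [x [l [s0 s1 lj f0 [A0 h0]]]]]; apply: hP.
  pose z := row_mx x (\row_k (if k == j then s else l 0 k)).
  have eX : X z = x by rewrite /X row_mxKl.
  have eS : S z = s by rewrite /S row_mxKr mxE eqxx.
  have eL : L z = l.
    by rewrite /L row_mxKr; apply/rowP => k; rewrite !mxE; case: eqP => // ->.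
  exists z; rewrite /h /M eX eS eL; split; first by rewrite h0 mxE.
    have ns : s * (1 - s) != 0 by rewrite mulf_neq0 // subr_eq0 eq_sym.
    apply: row_full_surj => w.
    have [y ey hy] := @jet1_surj x (lsubmx w) (\matrix_(k, k') (rsubmx w 0 k * (k' == j)%:R)).
    exists ((s * (1 - s))^-1 *: y); rewrite -scalemxAr -scalemxAl scalerA divff // scale1r.
    rewrite mul_mx_row ey -[RHS]hsubmxK; congr row_mx; apply/rowP => k.
    rewrite mul_contr hy -rowE mxE (bigD1 j) //= !mxE lj eqxx mulr1 mulr1.
    by rewrite big1 ?addr0 // => k' /negPf ne; rewrite !mxE ne mulr0 mul0r.
  apply: path_eq0; rewrite mul_mx_row f0.
  rewrite (_ : _ *m contr x l = 0) ?row_mx0 //; apply/rowP => k.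
  by rewrite mul_contr A0 !mxE.
apply: (@negligible_sub _ _ _ (fun a => exists j, exists s x (l : 'rV_m), [/\ s != 0, s != 1, l 0 j = 1,
    path_at a s *m Phi x = 0 &
    (forall v, path_at a s *m Phi1 (row_mx x v) *m l^T = 0) /\
    (s ^+ 2 *: y1 - (1 - s) ^+ 2 *: y0) *m Phi x *m l^T = 0])); last exact: negligible_bigU.
move=> a [s [x [l [s0 s1 /rV_neq0 [j lj] f0 [A0 h0]]]]].
exists j, s, x, ((l 0 j)^-1 *: l); split=> //; first by rewrite mxE mulVf.
split.
- by move=> v; rewrite tr_scale -scalemxAr A0 scaler0.
- by rewrite tr_scale -scalemxAr h0 scaler0.
Qed.

(** Excludes folds whose second derivative along the kernel vector [v], paired with the cokernel
    vector [l], vanishes. With A the Jacobian, there are 3m - 1 unknowns (s, x, v, l) and 3m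
    independent conditions affine in [a]: v A = 0 and A l = 0 share the relation v A l = 0, and the
    second order condition takes the place freed. *)
Lemma negligible_degenerate_fold :
  negligible (fun a => exists s x (v l : 'rV_m), [/\ s != 0, s != 1, v != 0, l != 0 &
    [/\ path_at a s *m Phi x = 0,
    path_at a s *m Phi1 (row_mx x v) = 0,
    (forall u, path_at a s *m Phi1 (row_mx x u) *m l^T = 0) &
    path_at a s *m Phi2 (row_mx x v) *m l^T = 0]]).
Proof.
have key (ij : 'I_m * 'I_m) : negligible (fun a => exists s x (v l : 'rV_m),
    [/\ s != 0, s != 1, v 0 ij.1 = 1, l 0 ij.2 = 1 &
    [/\ path_at a s *m Phi x = 0,
    path_at a s *m Phi1 (row_mx x v) = 0,
    (forall u, path_at a s *m Phi1 (row_mx x u) *m l^T = 0) &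
    path_at a s *m Phi2 (row_mx x v) *m l^T = 0]]).
  case: ij => i j /=.
  pose X (z : 'rV[R]_(m + (m + m))) := lsubmx z.
  pose U (z : 'rV[R]_(m + (m + m))) := lsubmx (rsubmx z).
  pose W (z : 'rV[R]_(m + (m + m))) := rsubmx (rsubmx z).
  pose V z := one_at i (U z); pose L z := one_at j (W z).
  pose S z := W z 0 j.
  (* The condition A l = 0 in direction [i] follows from the others and v A = 0, as v_i = 1; its
     column is replaced by the second order condition. *)
  pose E z : 'M[R]_(D, m) := \matrix_(d, k) if k == i then (Phi2 (row_mx (X z) (V z)) *m (L z)^T) d 0
                  else contr (X z) (L z) d k.
  pose M z := row_mx (Phi (X z)) (row_mx (Phi1 (row_mx (X z) (V z))) (E z)).
  pose h z := U z 0 i.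
  have pX : mxpolyf X by apply: mxpolyf_lsub.
  have pU : mxpolyf U.
    by apply: (mxpolyf_comp (A := fun z : 'rV_(m + m) => lsubmx z)); [apply: mxpolyf_lsub | apply: mxpolyf_rsub].
  have pW : mxpolyf W.
    by apply: (mxpolyf_comp (A := fun z : 'rV_(m + m) => rsubmx z)); [apply: mxpolyf_rsub | apply: mxpolyf_rsub].
  have pV : mxpolyf V by apply: mxpolyf_one_at.
  have pL : mxpolyf L by apply: mxpolyf_one_at.
  have pS : polyf S by apply: pW.
  have pXV : mxpolyf (fun z => row_mx (X z) (V z)) by apply: mxpolyf_row_mx.
  have pE : mxpolyf E.
    move=> d k; apply: (@polyf_ext _ _ (fun z => if k == i then (Phi2 (row_mx (X z) (V z)) *m (L z)^T) d 0
                  else contr (X z) (L z) d k)); last by move=> z; rewrite [RHS]mxE.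
    case: (k == i); last exact: mxpolyf_contr.
    by apply: mxpolyf_mul; [apply: (mxpolyf_comp pPhi2) | apply: mxpolyf_tr].
  have pM : mxpolyf M.
    apply: mxpolyf_row_mx; first exact: (mxpolyf_comp pPhi).
    by apply: mxpolyf_row_mx => //; apply: (mxpolyf_comp pPhi1).
  have pS1 : polyf (fun z => 1 - S z) by apply: polyf_sub => //; apply: polyf_cst.
  have := @negligible_incidence _ _ _ (fun z => (S z * (1 - S z)) *: M z)
    (fun z => - ((1 - S z) *: y0 + S z *: y1) *m M z) h.
  case.
  - by apply: mxpolyf_scale => //; apply: polyf_mul.
  - apply: mxpolyf_mul => //; apply: mxpolyf_opp; apply: mxpolyf_add;
      by apply: mxpolyf_scale => //; apply: mxpolyf_cst.
  - exact: pU.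
  - exists (row_mx 0 (row_mx (const_mx 1) 0)).
    by rewrite /h /U row_mxKr row_mxKl mxE oner_eq0.
  move=> P P0 hP; exists P => // a [s [x [v [l [s0 s1 vi lj [f0 v0 A0 c0]]]]]]; apply: hP.
  pose z := row_mx x (row_mx (\row_k (if k == i then 0 else v 0 k)) (\row_k (if k == j then s else l 0 k))).
  have eX : X z = x by rewrite /X row_mxKl.
  have eS : S z = s by rewrite /S /W !row_mxKr mxE eqxx.
  have eL : L z = l.
    by rewrite /L /W !row_mxKr; apply/rowP => k; rewrite !mxE; case: eqP => // ->.
  have eV : V z = v.
    by rewrite /V /U row_mxKr row_mxKl; apply/rowP => k; rewrite !mxE; case: eqP => // ->.
  have mulE (y : 'rV_D) k : (y *m E z) 0 k = if k == i then (y *m Phi2 (row_mx x v) *m l^T) 0 0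
      else (y *m Phi1 (row_mx x (delta_mx 0 k)) *m l^T) 0 0.
    case: ifP => ki; [rewrite -mulmxA | rewrite -mul_contr]; rewrite [LHS]mxE [RHS]mxE;
      by apply: eq_bigr => d _; congr (_ * _); rewrite [LHS]mxE ki eX eL ?eV.
  exists z; split; first by rewrite /h /U row_mxKr row_mxKl mxE eqxx.
    rewrite eS /M; have ns : s * (1 - s) != 0 by rewrite mulf_neq0 // subr_eq0 eq_sym.
    apply: row_full_surj => w.
    pose w1 := lsubmx (rsubmx w); pose w2 := rsubmx (rsubmx w).
    pose rk k : 'rV[R]_m := w2 0 k *: delta_mx 0 j.
    (* The prescribed first derivative: rows other than [i] realize the pairings with [l], and row
       [i] is adjusted to make v B = w1. *)
    pose B : 'M[R]_m := \matrix_(k, k') (if k == i then (w1 - \sum_(a | a != i) v 0 a *: rk a) else rk k) 0 k'.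
    have vB : v *m B = w1.
      apply/rowP => k'; rewrite mxE (bigD1 i) //= vi mul1r mxE eqxx !mxE summxE.
      rewrite [X in _ + X](_ : _ = \sum_(a | a != i) (v 0 a *: rk a) 0 k') ?subrK //.
      by apply: eq_bigr => a1 /negPf ne; rewrite !mxE ne !mxE.
    have [y [ey hy cy]] := @jet2_surj x v i (lsubmx w) B (w2 0 i *: delta_mx 0 j) vi.
    exists ((s * (1 - s))^-1 *: y); rewrite -scalemxAr -scalemxAl scalerA divff // scale1r.
    have lj1 (c : R) : ((c *: (delta_mx 0 j : 'rV_m)) *m l^T) 0 0 = c.
      by rewrite -scalemxAl -rowE !mxE lj mulr1.
    rewrite !mul_mx_row eX eV ey hy vB -[RHS]hsubmxK -[rsubmx w]hsubmxK.
    congr row_mx; congr row_mx; apply/rowP => k; rewrite mulE; case: ifP => [/eqP ->|ki].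
      by rewrite cy lj1.
    rewrite hy -rowE (_ : row k B = rk k) ?lj1 //.
    by apply/rowP => k'; rewrite !mxE ki !mxE.
  rewrite eS; apply: path_eq0; rewrite !mul_mx_row eX eV f0 v0.
  rewrite (_ : _ *m E z = 0) ?row_mx0 //; apply/rowP => k.
  by rewrite mulE A0 c0 !mxE if_same.
apply: (@negligible_sub _ _ _ (fun a => exists ij : 'I_m * 'I_m, exists s x (v l : 'rV_m),
    [/\ s != 0, s != 1, v 0 ij.1 = 1, l 0 ij.2 = 1 &
    [/\ path_at a s *m Phi x = 0,
    path_at a s *m Phi1 (row_mx x v) = 0,
    (forall u, path_at a s *m Phi1 (row_mx x u) *m l^T = 0) &
    path_at a s *m Phi2 (row_mx x v) *m l^T = 0]])); last exact: negligible_bigU.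
move=> a [s [x [v [l [s0 s1 /rV_neq0 [i vi] /rV_neq0 [j lj] [f0 v0 A0 c0]]]]]].
have [e1 e2] : path_at a s *m Phi1 (row_mx x ((v 0 i)^-1 *: v)) = (v 0 i)^-1 *: (path_at a s *m Phi1 (row_mx x v)) /\
   path_at a s *m Phi2 (row_mx x ((v 0 i)^-1 *: v)) = (v 0 i)^-1 ^+ 2 *: (path_at a s *m Phi2 (row_mx x v)).
  apply: jet2_uniq (jPhi _ _ _) _ => k; have [p [ep p1 p2]] := jPhi (path_at a s) x v k.
  exists (p \Po ((v 0 i)^-1 *: 'X)); split.
  - by move=> e; rewrite horner_comp hornerZ hornerX -ep scalerA [e * _]mulrC.
  - by rewrite comp_scale_coef expr1 p1 [RHS]mxE.
  - by rewrite comp_scale_coef p2 [RHS]mxE.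
exists (i, j), s, x, ((v 0 i)^-1 *: v), ((l 0 j)^-1 *: l); split=> //=; rewrite ?mxE ?mulVf //.
split=> //.
- by rewrite e1 v0 scaler0.
- by move=> u; rewrite tr_scale -scalemxAr A0 scaler0.
- by rewrite e2 tr_scale -scalemxAr -scalemxAl c0 !scaler0.
Qed.

End JetSurjective.

End Genericity.

(** * The signed count along a generic path, in one chart *)

Module PathCount.
Import structures.
Import all_boot all_order all_algebra.
Import ring lra.
Import boolp classical_sets functions reals interval_inference topology normedtype sequences realfun.
Import -(notations) mpoly.
Import PolynomialFunctions Norms ImplicitFunction LocalCount Genericity.
Import Order.TTheory GRing.Theory Num.Theory.
Import numFieldNormedType.Exports.
Local Open Scope classical_set_scope.
Local Open Scope ring_scope.

(** Replacing row [i] of [A] by v A, a combination of the rows with coefficient 1 at [i], does not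
    change the determinant. *)
Lemma det_row_comb (R : comNzRingType) n (A B : 'M[R]_n) i (v : 'rV_n) c : v 0 i = 1 ->
  (forall k k', k != i -> A k k' = B k k') -> v *m A = c *: row i B -> \det A = c * \det B.
Proof.
move=> vi AB e; have := congr1 (fun w => (w *m \adj A) 0 i) e.
rewrite -mulmxA mul_mx_adj mul_mx_scalar [LHS]mxE vi mulr1 => ->.
rewrite -scalemxAl [LHS]mxE; congr (_ * _).
rewrite [LHS]mxE (expand_det_row B i); apply: eq_bigr => j _.
rewrite !mxE /cofactor; congr (_ * (_ * \det _)).
by apply/matrixP => k k'; rewrite !mxE AB // eq_sym neq_lift.
Qed.

Lemma det0_ker (F : fieldType) n (A : 'M[F]_n) : \det A = 0 ->
  exists2 l : 'rV_n, l != 0 & A *m l^T = 0.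
Proof.
move=> d0; have /eqP/det0P [l l0 lA] : \det A^T = 0 by rewrite det_tr.
exists l => //; apply: trmx_inj; by rewrite trmx_mul trmxK lA trmx0.
Qed.

Lemma polyf_horner (R : realFieldType) n (f : 'rV[R]_n -> R) (p : {poly R}) :
  polyf f -> polyf (fun x => p.[f x]).
Proof.
move=> pf; apply: (@polyf_ext _ _ (fun x => \sum_(i < size p) p`_i * f x ^+ i)).
  apply: polyf_sum => i; apply: polyf_mul; first exact: polyf_cst.
  elim: (nat_of_ord i) => [|k IH].
    exact: (polyf_ext (polyf_cst n 1)).
  by apply: (polyf_ext (polyf_mul pf IH)) => x; rewrite exprS.
by move=> x; rewrite horner_coef.
Qed.

Section PathLocal.
Variables (R : realType) (D m : nat) (Phi : 'rV[R]_m -> 'M[R]_(D, m)).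
Variables (Phi1 Phi2 : 'rV[R]_(m + m) -> 'M[R]_(D, m)).
Hypothesis pPhi : mxpolyf Phi.
Hypothesis jPhi : forall y x v, jet2 (fun x => y *m Phi x) x v
  (y *m Phi1 (row_mx x v)) (y *m Phi2 (row_mx x v)).
Variables (y0 y1 a : 'rV[R]_D) (t : 'I_m.+1).
Local Notation yt := (path_at y0 y1 a).
Definition path_eq (z : 'rV[R]_m.+1) : 'rV[R]_m := yt (z 0 t) *m Phi (col' t z).

Hypothesis nfold : forall s x (v l : 'rV_m), s != 0 -> s != 1 -> v != 0 -> l != 0 ->
   yt s *m Phi x = 0 -> yt s *m Phi1 (row_mx x v) = 0 ->
   (forall u, yt s *m Phi1 (row_mx x u) *m l^T = 0) ->
   yt s *m Phi2 (row_mx x v) *m l^T = 0 -> False.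
Hypothesis ncork : forall s x (l : 'rV_m), s != 0 -> s != 1 -> l != 0 ->
   yt s *m Phi x = 0 ->
   (forall v, yt s *m Phi1 (row_mx x v) *m l^T = 0) ->
   (s ^+ 2 *: y1 - (1 - s) ^+ 2 *: y0) *m Phi x *m l^T = 0 -> False.
Hypothesis nd0 : forall x A, y0 *m Phi x = 0 -> jacobian (fun x => y0 *m Phi x) x A -> A \in unitmx.
Hypothesis nd1 : forall x A, y1 *m Phi x = 0 -> jacobian (fun x => y1 *m Phi x) x A -> A \in unitmx.

Lemma mxpolyf_path_eq : mxpolyf path_eq.
Proof.
have pt : polyf (fun z : 'rV[R]_m.+1 => z 0 t) by apply: polyf_coord.
have pt1 : polyf (fun z : 'rV[R]_m.+1 => 1 - z 0 t) by apply: polyf_sub => //; apply: polyf_cst.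
apply: mxpolyf_mul.
  apply: mxpolyf_add; last by apply: mxpolyf_scale; [apply: polyf_mul | apply: mxpolyf_cst].
  by apply: mxpolyf_add; apply: mxpolyf_scale => //; apply: mxpolyf_cst.
apply: (mxpolyf_comp pPhi) => i j; rewrite ord1.
by apply: polyf_ext (polyf_coord R (lift t j)) _ => z; rewrite mxE.
Qed.

Lemma path_eq_ins s x : path_eq (ins t s x) = yt s *m Phi x.
Proof. by rewrite /path_eq ins_same col'_ins. Qed.

Variable Q : 'rV[R]_(m.+1 + m.+1) -> 'M[R]_(m.+1, m).
Hypothesis pQ : mxpolyf Q.
Hypothesis Qsym : forall x y, Q (row_mx x y) = Q (row_mx y x).
Hypothesis FQ : forall x y, path_eq x - path_eq y = (x - y) *m Q (row_mx x y).

Lemma ins0_mul (v : 'rV[R]_m) (M : 'M[R]_(m.+1, m)) : ins t 0 v *m M = v *m row' t M :> 'rV[R]_m.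
Proof. by rewrite (mul_row'E t) ins_same col'_ins scale0r add0r. Qed.

Lemma ins_line s (x v : 'rV[R]_m) e : ins t s x + e *: ins t 0 v = ins t s (x + e *: v).
Proof.
apply/rowP => i; rewrite !mxE; case: unlift => [j|]; rewrite ?mxE //.
by rewrite mulr0 addr0.
Qed.

Lemma path_jacobian s x :
  jacobian (fun x => yt s *m Phi x) x (row' t (Q (row_mx (ins t s x) (ins t s x)))).
Proof.
pose Qs (w : 'rV[R]_(m + m)) := row' t (Q (row_mx (ins t s (lsubmx w)) (ins t s (rsubmx w)))).
have pins n (g : 'rV[R]_n -> 'rV[R]_m) : mxpolyf g -> mxpolyf (fun z => ins t s (g z)).
  move=> pg i j; rewrite ord1; case: (unliftP t j) => [k ->|->].
    by apply: polyf_ext (pg 0 k) _ => z; rewrite mxE liftK.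
  by apply: polyf_ext (polyf_cst _ s) _ => z; rewrite ins_same.
have := @jacobian_quotient _ _ _ (fun x => yt s *m Phi x) Qs x.
rewrite /Qs row_mxKl row_mxKr; apply.
- by apply: mxpolyf_mul => //; apply: mxpolyf_cst.
- have pQ' : mxpolyf (fun w : 'rV_(m + m) => Q (row_mx (ins t s (lsubmx w)) (ins t s (rsubmx w)))).
    apply: (mxpolyf_comp pQ); apply: mxpolyf_row_mx; apply: pins.
      exact: mxpolyf_lsub.
    exact: mxpolyf_rsub.
  by move=> i j; apply: polyf_ext (pQ' (lift t i) j) _ => z; rewrite [RHS]mxE.
move=> x1 x2; rewrite row_mxKl row_mxKr -!path_eq_ins FQ insB subrr.
exact: ins0_mul.
Qed.

Lemma path_row s x : row t (Q (row_mx (ins t s x) (ins t s x))) =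
  (y1 - y0 + (1 - 2 * s) *: a) *m Phi x.
Proof.
have -> M : row t M = ins t 1 0 *m M :> 'rV[R]_m.
  by rewrite (mul_row'E t) ins_same col'_ins scale1r mul0mx addr0.
symmetry; apply: (jet2_quotient (f := path_eq) (a2 := - a *m Phi x)) => // j.
pose c := y1 - y0 + (1 - 2 * s) *: a.
exists (((yt s *m Phi x) 0 j)%:P + (c *m Phi x) 0 j *: 'X + (- a *m Phi x) 0 j *: 'X^2); split.
- move=> e; have -> : ins t s x + e *: ins t 1 0 = ins t (s + e) x.
    apply/rowP => i; rewrite !mxE; case: unlift => [k|]; rewrite ?mxE ?mulr0 ?addr0 //.
    by rewrite mulr1.
  rewrite path_eq_ins !hornerE /=.
  have -> : yt (s + e) = yt s + e *: c + e ^+ 2 *: (- a).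
    by apply/rowP => k; rewrite /path_at /c !mxE; ring.
  have ex (A B C : 'rV[R]_D) (M : 'M[R]_(D, m)) : ((A + e *: B + e ^+ 2 *: C) *m M) 0 j =
      (A *m M) 0 j + e * (B *m M) 0 j + e ^+ 2 * (C *m M) 0 j.
    rewrite !mulmxDl -!scalemxAl; move: (A *m M) (B *m M) (C *m M) => u1 u2 u3.
    by rewrite !mxE.
  by rewrite ex -/c; move: ((yt s *m _) 0 j) ((c *m _) 0 j) ((- a *m _) 0 j) => u1 u2 u3; ring.
- by rewrite !coefD coefC !coefZ coefX coefXn /= mulr1 mulr0 add0r addr0.
- by rewrite !coefD coefC !coefZ coefX coefXn /= mulr1 mulr0 !add0r.
Qed.

Let zs (s : R) (x v : 'rV[R]_m) (e : R) := ins t s x + e *: ins t 0 v.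

(** Along the kernel line of a fold, v times the Jacobian is the derivative of the section,
    divisible by the line parameter e because value and first derivative vanish at 0. So the minor
    is e det B(e), and [nfold] gives det B(0) <> 0. *)
Lemma path_fold_minor s x i (v : 'rV_m) : s != 0 -> s != 1 -> yt s *m Phi x = 0 ->
  v 0 i = 1 -> v *m row' t (Q (row_mx (ins t s x) (ins t s x))) = 0 ->
  exists c e1, [/\ 0 < c, 0 < e1 & forall e, `|e| < e1 ->
     c * `|e| <= `|minor_at Q t (ins t s x + e *: ins t 0 v) (ins t s x + e *: ins t 0 v)|].
Proof.
set A0 := row' t _ => s0 s1 f0 vi vA.
have v0 : v != 0 by apply: contraTneq (oner_neq0 R) => v0; rewrite -vi v0 mxE eqxx.
have /fin_all_exists [p hp] := fun j => jPhi (yt s) x v j.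
have jA := path_jacobian s x; rewrite -/A0 in jA.
have P1 u : yt s *m Phi1 (row_mx x u) = u *m A0 by apply: jet2_jacobian jA (jPhi _ _ _).
have p0 j : (p j)`_0 = 0.
  by have [h _ _] := hp j; rewrite -horner_coef0 -h scale0r addr0 f0 mxE.
have p1 j : (p j)`_1 = 0 by have [_ h _] := hp j; rewrite h P1 vA mxE.
pose q j : {poly R} := \poly_(k < size (p j)) (p j)`_(k.+2).
have pq j : p j = 'X^2 * q j.
  apply/polyP => k; rewrite coefXnM coef_poly; case: k => [|[|k]] //=; rewrite ?subn2 //=.
  case: ltnP => // h; rewrite nth_default //.
  by apply: leq_trans h _; rewrite !leqW.
pose mu j := 2 *: q j + 'X * (q j)^`().
have dp j e : (p j)^`().[e] = e * (mu j).[e].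
  rewrite pq derivM derivXn /= /mu !hornerE /=.
  ring.
pose A (e : R) := row' t (Q (row_mx (zs s x v e) (zs s x v e))).
(* Row [i] of the Jacobian is replaced by the quotient of v A(e) by e; at e = 0 it is twice the
   second Taylor coefficient. *)
pose B (w : 'rV[R]_1) : 'M[R]_m := \matrix_(k, k') if k == i then (mu k').[w 0 0] else A (w 0 0) k k'.
have pB : polyf (fun w => \det (B w)).
  apply: polyf_det => k k'.
  apply: (@polyf_ext _ _ (fun w => if k == i then (mu k').[w 0 0] else A (w 0 0) k k')).
    case: (k == i); first by apply: polyf_horner; apply: polyf_coord.
    have pz : mxpolyf (fun w : 'rV[R]_1 => zs s x v (w 0 0)).
      apply: mxpolyf_add; first exact: mxpolyf_cst.
      by apply: mxpolyf_scale; [apply: polyf_coord | apply: mxpolyf_cst].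
    have pQw : mxpolyf (fun w : 'rV[R]_1 => Q (row_mx (zs s x v (w 0 0)) (zs s x v (w 0 0)))).
      by apply: (mxpolyf_comp pQ); apply: mxpolyf_row_mx.
    by apply: polyf_ext (pQw (lift t k) k') _ => w; rewrite [RHS]mxE.
  by move=> w; rewrite [RHS]mxE.
have A00 : A 0 = A0 by rewrite /A /zs scale0r addr0.
have B0 : \det (B 0) != 0.
  apply/eqP => /det0_ker [l l0 Bl].
  have rB k : (B 0 *m l^T) k 0 = 0 by rewrite Bl mxE.
  have rA k : k != i -> (A0 *m l^T) k 0 = 0.
    move=> /negPf ki; rewrite -[RHS](rB k) !mxE; apply: eq_bigr => k' _.
    by rewrite [in RHS]mxE ki [(0 : 'rV_1) 0 0]mxE A00.
  have Al : A0 *m l^T = 0.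
    apply/matrixP => k z; rewrite ord1 [RHS]mxE; have [->|/rA //] := eqVneq k i.
    have : (v *m (A0 *m l^T)) 0 0 = 0 by rewrite mulmxA vA mul0mx mxE.
    rewrite mxE (bigD1 i) //= vi mul1r big1 ?addr0 // => k' ne.
    by rewrite rA // mulr0.
  apply: (nfold s0 s1 v0 l0 f0); first by rewrite P1.
    by move=> u; rewrite P1 -mulmxA Al mulmx0.
  apply/matrixP => k k'; rewrite !ord1 [RHS]mxE.
  have := rB i; rewrite !mxE (eq_bigr (fun k => 2 * ((yt s *m Phi2 (row_mx x v)) 0 k * l^T k 0))).
    by rewrite -mulr_sumr => /eqP; rewrite mulf_eq0 pnatr_eq0 /= => /eqP.
  move=> j1 _; rewrite [in LHS]mxE eqxx [(0 : 'rV_1) 0 0]mxE /mu !hornerE /= horner_coef0 coef_poly.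
  have [_ _ h] := hp j1; rewrite -h; congr (_ * _ * _).
  by case: ltnP => // h'; rewrite nth_default // !leqW.
have dA e : minor_at Q t (zs s x v e) (zs s x v e) = e * \det (B (const_mx e)).
  apply: (det_row_comb vi) => [k k' /negPf ki|]; first by rewrite [RHS]mxE ki !mxE.
  rewrite -ins0_mul; symmetry; apply: (jet2_quotient pQ FQ (a2 := \row_j (p j \Po ('X + e%:P))`_2)) => j.
  exists (p j \Po ('X + e%:P)); split; last by rewrite mxE.
    move=> c; have [h _ _] := hp j; rewrite horner_comp hornerD hornerX hornerC -h.
    by rewrite /zs -addrA -scalerDl ins_line path_eq_ins [e + c]addrC.
  by rewrite comp_shift_coef1 dp !mxE eqxx.
have d2 : 0 < `|\det (B 0)| / 2 by rewrite divr_gt0 ?normr_gt0.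
have [e1 e10 he1] := polyf_near 0 pB d2.
exists (`|\det (B 0)| / 2), e1; split=> // e ee.
rewrite dA normrM mulrC ler_wpM2l //.
have := he1 (const_mx e); rewrite subr0 => h.
have {}h : `|\det (B (const_mx e)) - \det (B 0)| < `|\det (B 0)| / 2.
  by apply: h; apply: mx_norm_lt => // k k'; rewrite mxE.
have := ler_distD (\det (B (const_mx e))) (\det (B 0)) 0; rewrite !subr0 distrC => h'.
move: h h'; move: `|\det (B 0)| `|_ - _| `|\det _| => u1 u2 u3; lra.
Qed.

(** A zero with invertible x-Jacobian counts with its sign. Otherwise s is interior, the ends being
    nondegenerate, and the zero is a fold in the direction of a kernel vector, contributing 0. *)
Lemma path_local s x : 0 <= s <= 1 -> yt s *m Phi x = 0 -> exists n,
  forall e, 0 < e -> exists e', [/\ 0 < e', e' <= e & exists2 dl, 0 < dl &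
    forall s', `|s' - s| < dl ->
    has_count (fun z => [/\ `|z - ins t s x| < e', path_eq z = 0 & z 0 t = s'])
      (fun z => Num.sg (minor_at Q t z z)) n].
Proof.
move=> s01 f0; have F0 : path_eq (ins t s x) = 0 by rewrite path_eq_ins.
pose A := row' t (Q (row_mx (ins t s x) (ins t s x))).
have jA : jacobian _ x A := path_jacobian s x.
have [dA|dA] := eqVneq (\det A) 0; last first.
  exists (Num.sg (\det A)) => e e0.
  by have := local_count_regular pQ FQ F0 dA e0; rewrite ins_same.
have y00 : yt 0 = y0 by rewrite /path_at subr0 scale1r !scale0r mul0r scale0r !addr0.
have y11 : yt 1 = y1 by rewrite /path_at subrr scale0r scale1r mulr0 scale0r addr0 add0r.
have s0 : s != 0.
  apply/eqP => s0; move: jA f0; rewrite s0 y00 => jA f0.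
  by have := nd0 f0 jA; rewrite unitmxE dA unitr0.
have s1 : s != 1.
  apply/eqP => s1; move: jA f0; rewrite s1 y11 => jA f0.
  by have := nd1 f0 jA; rewrite unitmxE dA unitr0.
have /eqP/det0P [v v0 vA] := dA; have [i vi] := rV_neq0 v0.
pose u := (v 0 i)^-1 *: v.
have ui : u 0 i = 1 by rewrite mxE mulVf.
have uA : u *m A = 0 by rewrite -scalemxAl vA scaler0.
have uQ : ins t 0 u *m Q (row_mx (ins t s x) (ins t s x)) = 0 by rewrite ins0_mul.
exists 0 => e e0.
have := @local_count_fold _ _ _ _ pQ Qsym FQ (lift t i) t (ins t s x) (ins t 0 u) F0.
rewrite [ins t s x 0 t]ins_same; apply=> //.
(* Otherwise a covector would annihilate the whole (m + 1) x m Jacobian, which [ncork] forbids. *)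
- apply/eqP => /det0_ker [l l0].
  set M := Q _ in uQ *; move=> Ml.
  have rl : row (lift t i) M *m l^T = 0.
    move: uQ; rewrite (mul_row'E (lift t i)) mxE liftK ui scale1r => /(congr1 (mulmx^~ l^T)).
    by rewrite mulmxDl -mulmxA Ml mulmx0 addr0 mul0mx.
  have Ml0 : M *m l^T = 0.
    apply/row_matrixP => k; rewrite row_mul row0; case: (unliftP (lift t i) k) => [k' ->|->//].
    have -> : row (lift (lift t i) k') M = row k' (row' (lift t i) M).
      by apply/rowP => z; rewrite !mxE.
    by rewrite -row_mul Ml row0.
  have Al : A *m l^T = 0.
    apply/row_matrixP => k; rewrite row_mul row0.
    have -> : row k A = row (lift t k) M by apply/rowP => z; rewrite !mxE.
    by rewrite -row_mul Ml0 row0.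
  apply: (ncork s0 s1 l0 f0) => [w|].
    by rewrite (jet2_jacobian jA (jPhi _ _ _)) -mulmxA Al mulmx0.
  have : row t M *m l^T = 0 by rewrite -row_mul Ml0 row0.
  rewrite path_row => h.
  (* At a zero the excluded combination is s(1 - s) times the s-derivative of the path. *)
  have -> : s ^+ 2 *: y1 - (1 - s) ^+ 2 *: y0 =
     (s * (1 - s)) *: (y1 - y0 + (1 - 2 * s) *: a) - (1 - 2 * s) *: yt s.
    rewrite /path_at; apply/rowP => z; rewrite !mxE; ring.
  rewrite mulmxBl -!scalemxAl f0 scaler0 subr0 -scalemxAl.
  by rewrite h scaler0.
- by rewrite mxE liftK.
- by rewrite ins_same.
exact: (path_fold_minor s0 s1 f0 ui uA).
Qed.

End PathLocal.

End PathCount.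

(** * Determinants of the operators A -> K A K' *)

Module LinearOperators.
Import structures.
Import all_boot all_order all_algebra all_fingroup.
Import ring lra.
Import Graded Projections.
Import Order.TTheory GRing.Theory Num.Theory.
Local Open Scope ring_scope.

Section LinCoord.
Variables (R : realFieldType) (p : nat) (X : eqType) (cl : 'I_p -> X) (rl : rel X).
Variables (b : pred 'I_p) (m : nat) (ix : 'I_m -> 'I_p * 'I_p).
Hypothesis ixI : injective ix.
Hypothesis ixP : forall i j, (exists k, ix k = (i, j)) <-> [&& b i, ~~ b j & rl (cl i) (cl j)].
Local Notation P0 := (P0 R b).
Local Notation Q0 := (Q0 R b).
Local Notation mxof := (@mxof R p m ix).
Local Notation coord := (@coord R p m ix).
Local Notation in0 := (@in0 R p X cl).
Local Notation in1 := (@in1 R p X cl rl).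
Implicit Types (A B K : 'M[R]_p) (L : 'M[R]_p -> 'M[R]_p).

Definition supp A := in1 A /\ P0 *m A *m Q0 = A.

Lemma supp_mxof x : supp (mxof x).
Proof. by split; [apply: (in1_emx ixP) | apply: (emx_support ixP)]. Qed.

Lemma supp_coordK A : supp A -> mxof (coord A) = A.
Proof. by move=> [h1 h2]; apply: (emx_coordK ixI ixP). Qed.

Lemma supp_mul K A K' : in0 K -> P0 *m K = K *m P0 -> in0 K' -> P0 *m K' = K' *m P0 ->
  supp A -> supp (K *m A *m K').
Proof.
move=> h0 hK h0' hK' [h1 h2]; split; first by apply: in1_in0 => //; apply: in0_in1.
have hQ : K' *m Q0 = Q0 *m K' by rewrite mulmxBr mulmxBl mulmx1 mul1mx hK'.
by rewrite -[RHS]/(K *m A *m K') -[in RHS]h2 !mulmxA hK -!mulmxA hQ.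
Qed.

Lemma supp_add A B : supp A -> supp B -> supp (A + B).
Proof.
move=> [h1 h2] [h1' h2']; split; first by move=> i j ij; rewrite mxE h1 ?h1' ?addr0.
by rewrite [P0 *m (A + B)]mulmxDr mulmxDl h2 h2'.
Qed.

Definition linop L := (forall a A B, L (a *: A + B) = a *: L A + L B) /\
  (forall A, supp A -> supp (L A)).
Definition opmx L : 'M[R]_m := \matrix_(k, l) coord (L (mxof (delta_mx 0 k))) 0 l.

Lemma opmxE L x : linop L -> x *m opmx L = coord (L (mxof x)).
Proof.
move=> [lL _].
have L0 : L 0 = 0.
  by apply: (addIr (L 0)); rewrite add0r; have := lL 1 0 0; rewrite !scale1r addr0.
have LD A B : L (A + B) = L A + L B by have := lL 1 A B; rewrite !scale1r.
have LZ c A : L (c *: A) = c *: L A by have := lL c A 0; rewrite !addr0 L0 addr0.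
have cD : {morph coord : A B / A + B} := @coordD R p m ix.
have c0 : coord 0 = 0 by apply/rowP => k; rewrite !mxE.
have x0 : mxof 0 = 0 by rewrite /Graded.mxof big1 // => k _; rewrite mxE scale0r.
rewrite {2}[x]row_sum_delta (big_morph mxof (@mxofD R p m ix) x0).
rewrite (big_morph L LD L0) (big_morph coord cD c0) mulmx_sum_row.
apply: eq_bigr => k _; rewrite mxofZ LZ coordZ; congr (_ *: _).
by apply/rowP => l; rewrite mxE mxE.
Qed.

Lemma opmx_comp L L' : linop L -> linop L' -> opmx (L' \o L) = opmx L *m opmx L'.
Proof.
move=> hL hL'; apply/row_matrixP => k; rewrite !rowE mulmxA !opmxE //.
  by rewrite supp_coordK //; apply: hL.2; apply: supp_mxof.
split; first by move=> a A B; rewrite /= hL.1 hL'.1.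
by move=> A sA; apply: hL'.2; apply: hL.2.
Qed.

Lemma linop_comp L L' : linop L -> linop L' -> linop (L' \o L).
Proof.
move=> hL hL'; split; first by move=> a A B; rewrite /= hL.1 hL'.1.
by move=> A sA; apply: hL'.2; apply: hL.2.
Qed.

Lemma opmx_id L : linop L -> (forall A, supp A -> L A = A) -> opmx L = 1%:M.
Proof.
move=> hL h; apply/row_matrixP => k; rewrite !rowE opmxE // h ?mulmx1; last exact: supp_mxof.
exact: mxofK.
Qed.

Lemma opmx_ext L L' : (forall A, supp A -> L A = L' A) -> opmx L = opmx L'.
Proof. by move=> h; apply/matrixP => k l; rewrite !mxE h //; apply: supp_mxof. Qed.

Lemma linop_mul K K' : in0 K -> P0 *m K = K *m P0 -> in0 K' -> P0 *m K' = K' *m P0 ->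
  linop (fun A => K *m A *m K').
Proof.
move=> h1 h2 h3 h4; split; last by move=> A; apply: supp_mul.
by move=> a A B; rewrite mulmxDr mulmxDl -scalemxAr -scalemxAl.
Qed.

(* If L is the composite of two conjugate operators, its determinant is a square. *)
Lemma det_opmx_square L L1 L2 T T' : linop L -> linop L1 -> linop L2 -> linop T -> linop T' ->
  (forall A, supp A -> L A = L2 (L1 A)) ->
  (forall A, supp A -> L2 A = T' (L1 (T A))) -> (forall A, supp A -> T (T' A) = A) ->
  \det (opmx L) = \det (opmx L1) ^+ 2.
Proof.
move=> hL h1 h2 hT hT' eL e2 eT.
rewrite (opmx_ext (L' := L2 \o L1) eL) opmx_comp // det_mulmx.
have -> : opmx L2 = opmx T *m opmx L1 *m opmx T'.
  by rewrite -!opmx_comp //; [exact: opmx_ext | apply: linop_comp].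
have := congr1 determinant (opmx_id (linop_comp hT' hT) eT).
rewrite opmx_comp // !det_mulmx det1 => e.
by rewrite expr2 [in RHS]mulrC -[in RHS](mulr1 (_ * _)) -e; ring.
Qed.

Variables (tau : 'S_p) (half : pred 'I_p).
Hypothesis tau_cl : forall i, cl (tau i) = cl i.
Hypothesis tau_b : forall i, b (tau i) = b i.
Hypothesis tau_half : forall i, half (tau i) = ~~ half i.

Let E := (Graded.P0 R half).
Let E' := (Graded.Q0 R half).
Let T : 'M[R]_p := perm_mx tau.

Lemma in0_perm (s : 'S_p) : (forall i, cl (s i) = cl i) -> in0 (perm_mx s).
Proof.
move=> h; apply/in0P => i j ij; rewrite !mxE; case: eqP => // e.
by rewrite -e h eqxx in ij.
Qed.

Lemma perm_mxK (s : 'S_p) : perm_mx s *m (perm_mx s)^T = 1%:M :> 'M[R]_p.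
Proof. by rewrite tr_perm_mx -perm_mxM mulgV perm_mx1. Qed.

Lemma perm_mxKV (s : 'S_p) : (perm_mx s)^T *m perm_mx s = 1%:M :> 'M[R]_p.
Proof. by rewrite tr_perm_mx -perm_mxM mulVg perm_mx1. Qed.

Let T0 : in0 T. Proof. exact: in0_perm. Qed.

Let TP : P0 *m T = T *m P0.
Proof.
apply/matrixP => i j; rewrite mul_P0 mul_P0r !mxE; case: eqP => [<-|_]; last by rewrite mulr0 mul0r.
by rewrite tau_b mulrC.
Qed.

Let TTP : P0 *m T^T = T^T *m P0.
Proof. by apply: trmx_inj; rewrite !trmx_mul trmxK P0T TP. Qed.

Let EP : P0 *m E = E *m P0.
Proof.
apply/matrixP => i j; rewrite mul_P0 mul_P0 !mxE; case: eqP => _; rewrite ?mulr0 //=.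
by rewrite mulrC.
Qed.

Let E'P : P0 *m E' = E' *m P0.
Proof. by rewrite /E' mulmxBr mulmxBl mulmx1 mul1mx EP. Qed.

Let ET : E *m T = T *m E'.
Proof.
apply/matrixP => i j; rewrite mul_P0 mul_Q0r !mxE; case: eqP => [<-|_]; last by rewrite mulr0 mul0r.
by rewrite tau_half negbK mulrC.
Qed.

Let E0 : in0 E. Proof. exact: in0_P0. Qed.
Let E'0 : in0 E'. Proof. exact: in0_Q0. Qed.
Let s1 : E + E' = 1%:M. Proof. by rewrite addrC subrK. Qed.

Let E'T : E' *m T = T *m E.
Proof.
have e : E = 1%:M - E' by rewrite -s1 addrK.
by rewrite e mulmxBr mulmx1 -ET /E' mulmxBl mul1mx.
Qed.

Let TT : T *m T^T = 1%:M. Proof. exact: perm_mxK. Qed.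

(** Multiplication by [K] acts separately on the columns of the two halves exchanged by [tau], and
    right multiplication by the permutation matrix conjugates one action into the other. This is
    where the doubling is used. *)
Lemma det_left_square K : in0 K -> P0 *m K = K *m P0 ->
  \det (opmx (fun A => K *m A)) = \det (opmx (fun A => K *m A *m E + A *m E')) ^+ 2.
Proof.
move=> K0 KP; have i1 := in0_1 R cl; have P1 : P0 *m 1%:M = 1%:M *m P0 by rewrite mulmx1 mul1mx.
have lin D D' : in0 D -> P0 *m D = D *m P0 -> in0 D' -> P0 *m D' = D' *m P0 ->
    linop (fun A => K *m A *m D + A *m D').
  move=> h1 h2 h3 h4; split=> [a A B|A sA].
    by rewrite !mulmxDr !mulmxDl -!scalemxAr -!scalemxAl scalerDr addrACA.
  by apply: supp_add; [apply: supp_mul | rewrite -[A]mul1mx; apply: supp_mul].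
apply: (@det_opmx_square _ _ (fun A => K *m A *m E' + A *m E) (fun A => A *m T) (fun A => A *m T^T)).
- split=> [a A B|A sA]; first by rewrite mulmxDr -scalemxAr.
  by rewrite -[K *m A]mulmx1; apply: supp_mul.
- exact: lin.
- exact: lin.
- split=> [a A B|A sA]; first by rewrite mulmxDl -scalemxAl.
  by rewrite -[A]mul1mx; apply: supp_mul.
- split=> [a A B|A sA]; first by rewrite mulmxDl -scalemxAl.
  by rewrite -[A]mul1mx; apply: supp_mul => //; apply: in0_tr.
- move=> A sA; rewrite mulmxDr !mulmxDl -!mulmxA (P0Q0 R half) (Q0Q0 R half) (P0P0 R half) (Q0P0 R half).
  by rewrite !mulmx0 add0r addr0 addrC -mulmxDr -mulmxDr s1 mulmx1.
- move=> A sA; rewrite mulmxDl -!mulmxA.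
  by rewrite ![T *m (_ *m T^T)]mulmxA -ET -E'T -!mulmxA TT !mulmx1.
by move=> A sA; rewrite -mulmxA perm_mxKV mulmx1.
Qed.

Lemma det_right_square K : in0 K -> P0 *m K = K *m P0 ->
  \det (opmx (fun A => A *m K)) = \det (opmx (fun A => E *m A *m K + E' *m A)) ^+ 2.
Proof.
move=> K0 KP; have i1 := in0_1 R cl; have P1 : P0 *m 1%:M = 1%:M *m P0 by rewrite mulmx1 mul1mx.
have lin D D' : in0 D -> P0 *m D = D *m P0 -> in0 D' -> P0 *m D' = D' *m P0 ->
    linop (fun A => D *m A *m K + D' *m A).
  move=> h1 h2 h3 h4; split=> [a A B|A sA].
    by rewrite !mulmxDr mulmxDl -!scalemxAr -!scalemxAl scalerDr addrACA.
  apply: supp_add; first exact: supp_mul. by rewrite -[D' *m A]mulmx1; apply: supp_mul.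
apply: (@det_opmx_square _ _ (fun A => E' *m A *m K + E *m A) (fun A => T^T *m A) (fun A => T *m A)).
- split=> [a A B|A sA]; first by rewrite mulmxDl -scalemxAl.
  by rewrite -[A]mul1mx; apply: supp_mul.
- exact: lin.
- exact: lin.
- split=> [a A B|A sA]; first by rewrite mulmxDr -scalemxAr.
  by rewrite -[_ *m A]mulmx1; apply: supp_mul => //; apply: in0_tr.
- split=> [a A B|A sA]; first by rewrite mulmxDr -scalemxAr.
  by rewrite -[_ *m A]mulmx1; apply: supp_mul.
- move=> A sA; rewrite !mulmxDr mulmxDl !mulmxA.
  rewrite (Q0P0 R half) (Q0Q0 R half) (P0P0 R half) (P0Q0 R half).
  by rewrite !mul0mx add0r addr0 -mulmxDl -mulmxDl addrC s1 mul1mx.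
- move=> A sA; rewrite mulmxDr !mulmxA.
  by rewrite -ET -E'T -![_ *m T *m T^T]mulmxA TT !mulmx1.
by move=> A sA; rewrite mulmxA perm_mxKV mul1mx.
Qed.

(** Each one-sided factor has a square as determinant, so the product is nonnegative; the inverse
    operator excludes 0. *)
Lemma det_sandwich_gt0 K K' : K \in unitmx -> K' \in unitmx ->
  in0 K -> P0 *m K = K *m P0 -> in0 K' -> P0 *m K' = K' *m P0 ->
  0 < \det (opmx (fun A => K *m A *m K')).
Proof.
move=> uK uK' K0 KP K0' KP'; have i1 := in0_1 R cl.
have P1 : P0 *m 1%:M = 1%:M *m P0 by rewrite mulmx1 mul1mx.
have invC D : D \in unitmx -> P0 *m D = D *m P0 -> P0 *m invmx D = invmx D *m P0.
  move=> uD DP; apply: (can_inj (mulKmx uD)); rewrite mulmxA -DP -mulmxA mulmxV // mulmx1.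
  by rewrite mulmxA mulmxV // mul1mx.
have lL D : in0 D -> P0 *m D = D *m P0 -> linop (fun A => D *m A).
  move=> h1 h2; split=> [a A B|A sA]; first by rewrite mulmxDr -scalemxAr.
  by rewrite -[_ *m A]mulmx1; apply: supp_mul.
have lR D : in0 D -> P0 *m D = D *m P0 -> linop (fun A => A *m D).
  move=> h1 h2; split=> [a A B|A sA]; first by rewrite mulmxDl -scalemxAl.
  by rewrite -[A]mul1mx; apply: supp_mul.
rewrite (opmx_ext (L' := (fun A => A *m K') \o (fun A => K *m A))) //.
rewrite opmx_comp ?lL ?lR //; try by [apply: lL | apply: lR].
rewrite det_mulmx det_left_square // det_right_square //.
rewrite -exprMn lt0r sqr_ge0 andbT exprMn -det_left_square // -det_right_square // -det_mulmx.
rewrite -opmx_comp; try by [apply: lL | apply: lR].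
suff : opmx ((fun A => A *m K') \o (fun A => K *m A)) *m
   opmx (fun A => invmx K *m A *m invmx K') = 1%:M.
  by case/mulmx1_unit; rewrite unitmxE unitfE.
have h : linop (fun A => invmx K *m A *m invmx K').
  by apply: linop_mul; rewrite ?invC //; apply: in0_inv.
rewrite -opmx_comp //; last by apply: linop_comp; [apply: lL | apply: lR].
apply: opmx_id => [|A sA /=]; first by do 2?apply: linop_comp => //; [apply: lL | apply: lR].
by rewrite !mulmxA mulVmx // mul1mx -mulmxA mulmxV // mulmx1.
Qed.

End LinCoord.

End LinearOperators.

(** * Quadratic sections read in charts *)

Module ChartEquations.
Import structures.
Import all_boot all_order all_algebra all_fingroup.
Import ring lra.
Import reals.
Import PolynomialFunctions Norms Graded Projections ChartCover Genericity LinearOperators.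
Import Order.TTheory GRing.Theory Num.Theory.
Local Open Scope ring_scope.

Lemma dot_mxvec (R : comNzRingType) a b (A B : 'M[R]_(a, b)) :
  (mxvec A *m (mxvec B)^T) 0 0 = \sum_i \sum_j A i j * B i j.
Proof.
rewrite mxE (reindex _ (curry_mxvec_bij _ _)) /= pair_bigA /=.
by apply: eq_bigr => -[i j] _ /=; rewrite mxE !mxvecE.
Qed.

Section Monomials.
Variables (R : realFieldType) (p : nat) (X : eqType) (cl : 'I_p -> X) (arr : rel X).
Local Notation N1 := (1 + p * p)%N.
Local Notation in1 := (@in1 R p X cl arr).

(* All monomials of degree at most 2 in the entries of P, homogenized by a. *)
Definition xi (a : R) (P : 'M[R]_p) : 'rV[R]_N1 := row_mx a%:M (mxvec P).
Definition mon a P : 'rV[R]_(N1 * N1) := mxvec ((xi a P)^T *m xi a P).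
(** The vector [y] lists the coefficients of a matrix of quadratic forms in (a, P), cut down to the
    arrows by [mask1]. Homogeneity in (a, P) allows denominators to be cleared in charts. *)
Definition sect (y : 'rV[R]_(N1 * N1 * (p * p))) a P : 'M[R]_p :=
  mask1 cl arr (vec_mx (mon a P *m vec_mx y)).

Lemma sectZ y a P : sect y a (a *: P) = a ^+ 2 *: sect y 1 P.
Proof.
have e : xi a (a *: P) = a *: xi 1 P.
  by rewrite /xi scale_row_mx linearZ /= scale_scalar_mx mulr1.
rewrite /sect /mon e -mask1Z; congr mask1.
have -> : (a *: xi 1 P)^T = a *: (xi 1 P)^T by apply/matrixP => i j; rewrite !mxE.
by rewrite -scalemxAr -scalemxAl scalerA linearZ /= -scalemxAl linearZ.
Qed.

Lemma sect_lin c y y' a P : sect (c *: y + y') a P = c *: sect y a P + sect y' a P.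
Proof.
by rewrite /sect linearP /= mulmxDr -scalemxAr linearP /= mask1D mask1Z.
Qed.

Lemma in1_sect y a P : in1 (sect y a P).
Proof. exact: in1_mask. Qed.

(** The section equal to a product of two linear forms [al] and [be] times the constant matrix [Z],
    see [sect_test]. *)
Definition test_sect (al be : 'cV[R]_N1) (Z : 'M[R]_p) : 'rV[R]_(N1 * N1 * (p * p)) :=
  mxvec ((mxvec (al *m be^T))^T *m mxvec Z).

Lemma sect_test al be Z a P : in1 Z ->
  sect (test_sect al be Z) a P = ((xi a P *m al) 0 0 * (xi a P *m be) 0 0) *: Z.
Proof.
move=> hZ; rewrite /sect /test_sect mxvecK mulmxA.
have -> : mon a P *m (mxvec (al *m be^T))^T = ((xi a P *m al) 0 0 * (xi a P *m be) 0 0)%:M.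
  rewrite [LHS]mx11_scalar dot_mxvec; congr (_%:M).
  rewrite !mxE big_distrlr /=; apply: eq_bigr => i _; apply: eq_bigr => j _.
  have o0 : ord0 = 0 :> 'I_1 by apply: val_inj.
  by move: (xi a P) => u; rewrite !mxE !big_ord1 !mxE !o0; ring.
by rewrite mul_scalar_mx linearZ /= mxvecK mask1Z mask1_id.
Qed.

Definition form0 : 'cV[R]_N1 := col_mx 1 0.
(** The linear form P -> (L P N) i j, as a coefficient vector on [xi]. *)
Definition form_of (L N : 'M[R]_p) i j : 'cV[R]_N1 :=
  col_mx 0 (lin1_mx (mxvec \o mulmxr N \o mulmx L \o vec_mx) *m delta_mx (mxvec_index i j) 0).

Lemma xi_form0 a P : (xi a P *m form0) 0 0 = a.
Proof. by rewrite mul_row_col mulmx0 addr0 mulmx1 mxE. Qed.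

Lemma xi_form_of L N i j a P : (xi a P *m form_of L N i j) 0 0 = (L *m P *m N) i j.
Proof.
by rewrite mul_row_col mulmx0 add0r mulmxA mul_rV_lin1 /= mxvecK -colE mxE mxvecE.
Qed.

Lemma mxpolyf_sect n y (a : 'rV[R]_n -> R) (P : 'rV[R]_n -> 'M[R]_p) :
  polyf a -> mxpolyf P -> mxpolyf (fun x => sect y (a x) (P x)).
Proof.
move=> pa pP; have px : mxpolyf (fun x => xi (a x) (P x)).
  apply: mxpolyf_row_mx; last exact: mxpolyf_mxvec.
  by move=> i j; rewrite !ord1; apply: polyf_ext pa _ => x; rewrite mxE eqxx mulr1n.
have pm : mxpolyf (fun x => vec_mx (mon (a x) (P x) *m vec_mx y) : 'M[R]_p).
  apply: mxpolyf_vec_mx; apply: mxpolyf_mul; last exact: mxpolyf_cst.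
  by apply: mxpolyf_mxvec; apply: mxpolyf_mul => //; apply: mxpolyf_tr.
move=> i j; apply: (@polyf_ext _ _ (fun x => if arr (cl i) (cl j)
   then (vec_mx (mon (a x) (P x) *m vec_mx y) : 'M[R]_p) i j else 0)).
  by case: (arr _ _); [apply: pm | apply: polyf_cst].
by move=> x; rewrite [RHS]mxE.
Qed.

End Monomials.

Section ChartEquations.
Variables (R : realType) (p : nat) (X : eqType) (cl : 'I_p -> X) (arr : rel X).
Variables (b : pred 'I_p) (m : nat) (tix eix : 'I_m -> 'I_p * 'I_p).
Hypothesis tixI : injective tix.
Hypothesis eixI : injective eix.
Hypothesis tixP : forall i j, (exists k, tix k = (i, j)) <-> [&& b i, ~~ b j & cl i == cl j].
Hypothesis eixP : forall i j, (exists k, eix k = (i, j)) <-> [&& b i, ~~ b j & arr (cl i) (cl j)].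
Local Notation P0 := (P0 R b).
Local Notation Q0 := (Q0 R b).
Local Notation phi := (@mxof R p m tix).
Local Notation emx := (@mxof R p m eix).
Local Notation ecoord := (@coord R p m eix).
Local Notation in0 := (@in0 R p X cl).
Local Notation in1 := (@in1 R p X cl arr).
Local Notation frameU := (@frameU R p b m tix).
Local Notation gram := (@gram R p m tix).
Local Notation projn := (@projn R p b m tix).
Local Notation D := ((1 + p * p) * (1 + p * p) * (p * p))%N.

(** Charts are indexed by the permutations of the basis that preserve the vertices: each is the
    graph chart at the permuted base point. *)
Definition class_perm := {s : 'S_p | [forall i, cl (s i) == cl i]}.
Definition gmx (c : class_perm) : 'M[R]_p := perm_mx (val c).

Lemma gmx0 c : in0 (gmx c).
Proof. by apply: in0_perm => i; apply/eqP; case: c => s /= /forallP. Qed.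

Lemma gmxK c : gmx c *m (gmx c)^T = 1%:M. Proof. exact: perm_mxK. Qed.
Lemma gmxKV c : (gmx c)^T *m gmx c = 1%:M. Proof. exact: perm_mxKV. Qed.

Definition gramd x := \det (gram x).
Definition nproj x := (frameU x)^T *m \adj (gram x) *m frameU x.
Definition chartP c x := (gmx c)^T *m projn x *m gmx c.

Lemma gramd_neq0 x : gramd x != 0.
Proof. by have := gram_unit tix x; rewrite unitmxE unitfE. Qed.

Lemma adj_gram x : \adj (gram x) = gramd x *: invmx (gram x).
Proof. by rewrite /invmx (gram_unit tix) scalerA mulfV ?gramd_neq0 // scale1r. Qed.

Lemma nprojE x : nproj x = gramd x *: projn x.
Proof. by rewrite /nproj adj_gram -scalemxAr -scalemxAl. Qed.

(* The equation P X(P) (1 - P) = 0 read in a chart, with denominators cleared. *)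
Definition cheq c y x : 'rV[R]_m :=
  ecoord (frameU x *m gmx c *m sect cl arr y (gramd x) ((gmx c)^T *m nproj x *m gmx c) *m
    (gmx c)^T *m (1%:M - phi x)).

Definition local_sect c (S : 'M[R]_p) x := frameU x *m gmx c *m S *m (gmx c)^T *m (1%:M - phi x).

Lemma cheqE c y x :
  cheq c y x = gramd x ^+ 2 *: ecoord (local_sect c (sect cl arr y 1 (chartP c x)) x).
Proof.
rewrite /cheq nprojE -scalemxAr -scalemxAl sectZ -scalemxAr -!scalemxAl coordZ.
by rewrite /local_sect.
Qed.

Lemma local_sect_in1 c S x : in1 S -> in1 (local_sect c S x).
Proof.
move=> S1; apply: in1_in0; last first.
  by apply: in0_sub; [apply: in0_1 | apply: (in0_tmx tixP)].
apply: in1_in0; last by apply: in0_tr; apply: gmx0.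
by apply: in0_in1 => //; apply: in0_mul; [apply: (in0_frameU tixP) | apply: gmx0].
Qed.

Lemma chart_unit c x : (1%:M + phi x) *m gmx c \in unitmx.
Proof.
rewrite unitmx_mul; have [h1 _] := mulmx1_unit (unip_inv tixP x); rewrite h1.
by have [h2 _] := mulmx1_unit (gmxK c).
Qed.

Lemma chart_inv c x : invmx ((1%:M + phi x) *m gmx c) = (gmx c)^T *m (1%:M - phi x).
Proof.
apply: (can_inj (mulKmx (chart_unit c x))); rewrite mulmxV ?chart_unit //.
by rewrite -mulmxA [gmx c *m (_ *m _)]mulmxA gmxK mul1mx (unip_inv tixP).
Qed.

Lemma cheq_eq0 c y x : cheq c y x = 0 <->
  chartP c x *m sect cl arr y 1 (chartP c x) *m (1%:M - chartP c x) = 0.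
Proof.
have S1 := @in1_sect R p X cl arr y 1 (chartP c x).
rewrite cheqE; move: (sect _ _ _ _ _) S1 => S S1.
rewrite (spans_zero _ (chart_unit c x) (spans_projn tixP x (gmxK c))) chart_inv.
have <- : P0 *m local_sect c S x *m Q0 = P0 *m ((1%:M + phi x) *m gmx c *m S *m ((gmx c)^T *m (1%:M - phi x))) *m Q0.
  by rewrite /local_sect (frameUE tixP) !mulmxA (P0P0 R b).
rewrite -(coord_eix_eq0 eixI eixP (local_sect_in1 c x S1)).
split=> [/eqP|->]; last by rewrite scaler0.
by rewrite scaler_eq0 expf_eq0 (negPf (gramd_neq0 x)) => /eqP.
Qed.

Lemma mxpolyf_phi : mxpolyf phi.
Proof.
apply: mxpolyf_sum => k; apply: mxpolyf_scale; first exact: polyf_coord.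
exact: mxpolyf_cst.
Qed.

Lemma mxpolyf_frameU : mxpolyf frameU.
Proof. by apply: mxpolyf_add; [apply: mxpolyf_cst | apply: mxpolyf_phi]. Qed.

Lemma mxpolyf_gram : mxpolyf gram.
Proof.
apply: mxpolyf_add; first exact: mxpolyf_cst.
by apply: mxpolyf_mul; [|apply: mxpolyf_tr]; apply: mxpolyf_phi.
Qed.

Lemma polyf_gramd : polyf gramd.
Proof. exact: polyf_det mxpolyf_gram. Qed.

Lemma mxpolyf_nproj : mxpolyf nproj.
Proof.
apply: mxpolyf_mul; last exact: mxpolyf_frameU.
by apply: mxpolyf_mul; [apply: mxpolyf_tr; apply: mxpolyf_frameU | apply: mxpolyf_adj; apply: mxpolyf_gram].
Qed.

Lemma mxpolyf_chart_nproj c : mxpolyf (fun x => (gmx c)^T *m nproj x *m gmx c).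
Proof.
by apply: mxpolyf_mul; [apply: mxpolyf_mul => //; first apply: mxpolyf_cst; apply: mxpolyf_nproj | apply: mxpolyf_cst].
Qed.

Lemma mxpolyf_cheq c y : mxpolyf (cheq c y).
Proof.
move=> i k; rewrite ord1.
have h : mxpolyf (fun x => frameU x *m gmx c *m
   sect cl arr y (gramd x) ((gmx c)^T *m nproj x *m gmx c) *m (gmx c)^T *m (1%:M - phi x)).
  apply: mxpolyf_mul; last by apply: mxpolyf_sub; [apply: mxpolyf_cst | apply: mxpolyf_phi].
  apply: mxpolyf_mul; last exact: mxpolyf_cst.
  apply: mxpolyf_mul; first by apply: mxpolyf_mul; [apply: mxpolyf_frameU | apply: mxpolyf_cst].
  by apply: mxpolyf_sect; [apply: polyf_gramd | apply: mxpolyf_chart_nproj].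
by apply: polyf_ext (h (eix k).1 (eix k).2) _ => x; rewrite [RHS]mxE.
Qed.

Lemma cheq_lin c a y y' x : cheq c (a *: y + y') x = a *: cheq c y x + cheq c y' x.
Proof.
rewrite /cheq sect_lin; move: (frameU x *m gmx c) ((gmx c)^T) (1%:M - phi x) (sect _ _ y _ _) (sect _ _ y' _ _).
by move=> A B C S S'; rewrite mulmxDr !mulmxDl -scalemxAr -!scalemxAl coordD coordZ.
Qed.

Definition cheqmx c x : 'M[R]_(D, m) := \matrix_(i, k) cheq c (delta_mx 0 i) x 0 k.

Lemma cheqmxE c y x : y *m cheqmx c x = cheq c y x.
Proof.
have c0 : cheq c 0 x = 0.
  by have := cheq_lin c (-1) 0 0 x; rewrite scaler0 addr0 scaleN1r addNr.
have cD y' y'' : cheq c (y' + y'') x = cheq c y' x + cheq c y'' x.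
  by have := cheq_lin c 1 y' y'' x; rewrite !scale1r.
rewrite {2}[y]row_sum_delta (big_morph (fun y => cheq c y x) cD c0) mulmx_sum_row.
apply: eq_bigr => k _; have := cheq_lin c (y 0 k) (delta_mx 0 k) 0 x; rewrite !addr0 c0 addr0 => ->.
by congr (_ *: _); apply/rowP => l; rewrite mxE mxE.
Qed.

Lemma mxpolyf_cheqmx c : mxpolyf (cheqmx c).
Proof.
by move=> i k; apply: polyf_ext (mxpolyf_cheq c (delta_mx 0 i) 0 k) _ => x; rewrite [RHS]mxE.
Qed.

Lemma cheq_test c al be w x : let P := (gmx c)^T *m nproj x *m gmx c in
  cheq c (test_sect al be ((gmx c)^T *m emx w *m gmx c)) x =
  ((xi (gramd x) P *m al) 0 0 * (xi (gramd x) P *m be) 0 0) *: w.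
Proof.
move=> P; rewrite /cheq -/P sect_test; last first.
  by apply: in1_in0; [apply: in0_in1 (in1_emx eixP w); apply: in0_tr|]; apply: gmx0.
rewrite -scalemxAr -!scalemxAl coordZ; congr (_ *: _).
rewrite -[frameU x *m gmx c *m _]mulmxA -[frameU x *m (gmx c *m _) *m (gmx c)^T]mulmxA conj_orthK ?gmxK //.
have e1 : P0 *m emx w = emx w by rewrite -(emx_support eixP) !mulmxA (P0P0 R b).
have e2 : emx w *m Q0 = emx w by rewrite -(emx_support eixP) -mulmxA (Q0Q0 R b).
have -> : frameU x *m emx w = emx w.
  by rewrite /Projections.frameU mulmxDl e1 -e1 mulmxA (tmx_P0 tixP) mul0mx addr0.
have -> : emx w *m (1%:M - phi x) = emx w.
  by rewrite mulmxBr mulmx1 -{2}e2 -mulmxA (Q0_tmx tixP) mulmx0 subr0.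
exact: mxofK.
Qed.

Lemma phi_line x v e : phi (x + e *: v) - phi x = e *: phi v.
Proof. by rewrite mxofD mxofZ addrC addKr. Qed.

Lemma frame_diff x y : frameU y *m ((1%:M - phi x) *m Q0) = phi y - phi x.
Proof.
have -> : (1%:M - phi x) *m Q0 = Q0 - phi x by rewrite mulmxBl mul1mx (tmx_Q0 tixP).
have e3 : frameU y *m Q0 = phi y by rewrite /Projections.frameU mulmxDl (P0Q0 R b) (tmx_Q0 tixP) add0r.
have e4 : frameU y *m phi x = phi x.
  by rewrite /Projections.frameU mulmxDl (P0_tmx tixP) (tmx_tmx tixP) addr0.
by rewrite mulmxDr mulmxN e3 e4.
Qed.

(** Evaluated in the chart, the form is an entry of the coordinate difference to [x0], up to the
    factor gram(x0) adj(gram(x)), which at x = x0 is the scalar [gramd x0]. It serves as a local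
    coordinate vanishing at [x0]. *)
Lemma frame_test c x0 x k :
  let P := (gmx c)^T *m nproj x *m gmx c in
  (xi (gramd x) P *m form_of (gram x0 *m P0 *m gmx c) ((gmx c)^T *m (1%:M - phi x0) *m Q0)
    (tix k).1 (tix k).2) 0 0 =
  (gram x0 *m \adj (gram x) *m (phi x - phi x0)) (tix k).1 (tix k).2.
Proof.
rewrite /= xi_form_of; congr (fun_of_matrix _ _ _).
have e1 : gmx c *m ((gmx c)^T *m nproj x *m gmx c) = nproj x *m gmx c by rewrite !mulmxA gmxK mul1mx.
have e2 : nproj x *m gmx c *m ((gmx c)^T *m (1%:M - phi x0) *m Q0) = nproj x *m (1%:M - phi x0) *m Q0.
  by rewrite !mulmxA -[nproj x *m _ *m _]mulmxA gmxK mulmx1.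
rewrite -[gram x0 *m P0 *m gmx c *m _]mulmxA e1 -[gram x0 *m P0 *m _ *m _]mulmxA e2.
rewrite -!mulmxA; congr (_ *m _); rewrite /nproj !mulmxA.
have -> : P0 *m (frameU x)^T = P0.
  by rewrite /Projections.frameU linearD /= (P0T R b) mulmxDr (P0P0 R b) (P0_tmxT tixP) addr0.
rewrite adj_gram -!scalemxAl -!scalemxAr -!scalemxAl; congr (_ *: _).
rewrite -(invgram_P0C tixP) -!mulmxA [P0 *m (frameU x *m _)]mulmxA (P0_frameU tixP).
by congr (_ *m _); rewrite frame_diff.
Qed.

(** The square of the form 1 gives all values, 1 times a local coordinate the first derivatives, and
    the square of a local coordinate the second derivatives. Degree 2 in (1, P) is what makes room
    for the last. *)
Lemma cheq_jet_surjective c : jet_surjective (cheqmx c).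
Proof.
have nz x : gramd x ^+ 2 != 0 by rewrite expf_neq0 ?gramd_neq0.
(* [r] is the local coordinate along a line, divided by the line parameter. *)
have sE x a : exists r : 'rV_m -> {poly R}, forall v, (r v).[0] = gramd x * v 0 a /\
   forall e, e * (r v).[e] = (gram x *m \adj (gram (x + e *: v)) *m (phi (x + e *: v) - phi x)) (tix a).1 (tix a).2.
  suff h (v : 'rV[R]_m) : exists r : {poly R}, r.[0] = gramd x * v 0 a /\
   forall e, e * r.[e] = (gram x *m \adj (gram (x + e *: v)) *m (phi (x + e *: v) - phi x)) (tix a).1 (tix a).2.
    by have [r hr] := boolp.choice h; exists r => v; apply: hr.
  have pg : mxpolyf (fun z => gram x *m \adj (gram z) *m phi v).
    apply: mxpolyf_mul; last exact: mxpolyf_cst.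
    by apply: mxpolyf_mul; [apply: mxpolyf_cst | apply: mxpolyf_adj; apply: mxpolyf_gram].
  have [f1 [f2 [_ _ hf]]] := polyf_jet (pg (tix a).1 (tix a).2).
  have [r [er _ _]] := hf x v; exists r; split.
    rewrite -er scale0r addr0 adj_gram -scalemxAr mulmxV ?(gram_unit tix) //.
    by rewrite -scalemxAl mul1mx mxE mxofE.
  by move=> e; rewrite -er phi_line -scalemxAr [RHS]mxE.
have dE x v : exists d : {poly R}, d.[0] = gramd x /\ forall e, d.[e] = gramd (x + e *: v).
  have [f1 [f2 [_ _ hf]]] := polyf_jet polyf_gramd; have [d [ed _ _]] := hf x v.
  by exists d; split=> [|e]; rewrite -ed // scale0r addr0.
have wE x (w : 'rV[R]_m) : gramd x ^+ 2 *: ((gramd x ^+ 2)^-1 *: w) = w.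
  by rewrite scalerA mulfV // scale1r.
pose fa x a := form_of (gram x *m P0 *m gmx c) ((gmx c)^T *m (1%:M - phi x) *m Q0) (tix a).1 (tix a).2.
split.
- move=> x w; exists (test_sect (form0 R p) (form0 R p) ((gmx c)^T *m emx ((gramd x ^+ 2)^-1 *: w) *m gmx c)).
  by rewrite cheqmxE cheq_test !xi_form0 -expr2 wE.
- move=> x a w; have [r hr] := sE x a.
  exists (test_sect (form0 R p) (fa x a) ((gmx c)^T *m emx ((gramd x ^+ 2)^-1 *: w) *m gmx c)).
    by rewrite cheqmxE cheq_test frame_test subrr mulmx0 [fun_of_matrix 0 _ _]mxE mulr0 scale0r.
  move=> v; have [r0 er] := hr v; have [d [d0 ed]] := dE x v.
  exists (\row_j ((((gramd x ^+ 2)^-1 *: w) 0 j) *: ('X * (d * r v)))`_2) => j.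
  exists ((((gramd x ^+ 2)^-1 *: w) 0 j) *: ('X * (d * r v))); split; last by rewrite [RHS]mxE.
    move=> e; rewrite cheqmxE cheq_test frame_test xi_form0 -er -ed [LHS]mxE.
    by rewrite hornerZ !hornerM hornerX; ring.
  rewrite coefZ coefXM /= -horner_coef0 hornerM d0 r0 !mxE.
  by field; rewrite gramd_neq0.
move=> x a w; have [r hr] := sE x a.
exists (test_sect (fa x a) (fa x a) ((gmx c)^T *m emx ((gramd x ^+ 2)^-1 *: w) *m gmx c)).
  by rewrite cheqmxE cheq_test frame_test subrr mulmx0 [fun_of_matrix 0 _ _]mxE mulr0 scale0r.
move=> v; have [r0 er] := hr v => j.
exists ((((gramd x ^+ 2)^-1 *: w) 0 j) *: ('X * ('X * (r v * r v)))); split.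
- move=> e; rewrite cheqmxE cheq_test frame_test -er [LHS]mxE.
  by rewrite hornerZ !hornerM hornerX; ring.
- by rewrite coefZ !coefXM /= mulr0 mxE.
rewrite coefZ !coefXM /= -horner_coef0 hornerM r0 !mxE.
by field; rewrite gramd_neq0.
Qed.

End ChartEquations.

End ChartEquations.

(** * Changes of charts and the relative orientation *)

Module Orientation.
Import structures.
Import all_boot all_order all_algebra all_fingroup.
Import boolp classical_sets functions reals interval_inference topology normedtype sequences realfun.
Import ring lra.
Import PolynomialFunctions Norms Graded Projections ChartCover Genericity LinearOperators ChartEquations.
Import Order.TTheory GRing.Theory Num.Theory.
Import numFieldNormedType.Exports.
Local Open Scope classical_set_scope.
Local Open Scope ring_scope.

Section RationalContinuity.
Variable R : realType.

Lemma ratf_near n a b (d : 'rV[R]_n -> R) (A : 'rV[R]_n -> 'M[R]_(a, b)) x0 e :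
  polyf d -> mxpolyf A -> d x0 != 0 -> 0 < e -> exists2 dl, 0 < dl & forall x, `|x - x0| < dl ->
    `|(d x)^-1 *: A x - (d x0)^-1 *: A x0| < e.
Proof.
move=> pd pA d0 e0.
have cont (ij : 'I_a * 'I_b) : {for x0, continuous (fun x => (d x)^-1 * A x ij.1 ij.2)}.
  apply: continuousM; last exact: (polyf_cont (pA ij.1 ij.2)).
  by apply: continuousV => //; apply: (polyf_cont pd).
have /fin_all_exists2 [dl dl0 hdl] (ij : 'I_a * 'I_b) : exists2 dl, 0 < dl & forall x, `|x - x0| < dl ->
    `|(d x)^-1 * A x ij.1 ij.2 - (d x0)^-1 * A x0 ij.1 ij.2| < e.
  have := cont ij => /cvgrPdist_lt/(_ e e0)/nbhs_normP [dl /= dl0 hdl].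
  exists dl => // x hx; rewrite distrC; apply: hdl.
  by rewrite /ball_ /= distrC.
have [dm dm0 hdm] := fin_pos_min dl0.
exists dm => // x hx; apply: mx_norm_lt => // i j.
rewrite !mxE; apply: (hdl (i, j)).
exact: lt_le_trans hx (hdm (i, j)).
Qed.

(** An identity valid for nonzero parameters passes to the parameter 0 by continuity; the parameter
    is a 1 x 1 row so that [polyf] applies. *)
Lemma rational_limit n (G : 'rV[R]_n -> R) (d : 'rV[R]_1 -> R) (A : 'rV[R]_1 -> 'rV[R]_n) :
  polyf G -> polyf d -> mxpolyf A -> d 0 != 0 ->
  (forall t : R, t != 0 -> d (const_mx t) != 0 -> G ((d (const_mx t))^-1 *: A (const_mx t)) = 0) ->
  G ((d 0)^-1 *: A 0) = 0.
Proof.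
move=> pG pd pA d0 h; apply/eqP; apply: contraT => nz.
have [e1 e10 he1] := polyf_near_sgr pG nz.
have [e2 e20 he2] := ratf_near pd pA d0 e10.
have [e3 e30 he3] := polyf_near_sgr pd d0.
pose t := Num.min e2 e3 / 2.
have m0 : 0 < Num.min e2 e3 by rewrite lt_min e20.
have t0 : 0 < t by rewrite divr_gt0.
have tm : t < Num.min e2 e3 by rewrite ltr_pdivrMr // mulr2n mulrDr mulr1 ltrDl.
have nt : `|(const_mx t : 'rV[R]_1) - 0| < Num.min e2 e3.
  by rewrite subr0; apply: mx_norm_lt => // i j; rewrite mxE gtr0_norm.
have := he1 _ (he2 _ (lt_le_trans nt _)); rewrite h; last 2 first.
- by rewrite gt_eqF.
- have := he3 _ (lt_le_trans nt _); rewrite ge_min lexx orbT => /(_ isT) e.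
  by rewrite -sgr_eq0 e sgr_eq0.
rewrite ge_min lexx => /(_ isT) /esym/eqP; rewrite sgr0 sgr_eq0 => e.
by rewrite e in nz.
Qed.

End RationalContinuity.

Section Coherence.
Variables (R : realType) (p : nat) (X : eqType) (cl : 'I_p -> X) (arr : rel X).
Variables (b : pred 'I_p) (m : nat) (tix eix : 'I_m -> 'I_p * 'I_p).
Hypothesis tixI : injective tix.
Hypothesis eixI : injective eix.
Hypothesis tixP : forall i j, (exists k, tix k = (i, j)) <-> [&& b i, ~~ b j & cl i == cl j].
Hypothesis eixP : forall i j, (exists k, eix k = (i, j)) <-> [&& b i, ~~ b j & arr (cl i) (cl j)].
Variables (tau : 'S_p) (half : pred 'I_p).
Hypothesis tau_cl : forall i, cl (tau i) = cl i.
Hypothesis tau_b : forall i, b (tau i) = b i.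
Hypothesis tau_half : forall i, half (tau i) = ~~ half i.
Local Notation P0 := (P0 R b).
Local Notation Q0 := (Q0 R b).
Local Notation phi := (@mxof R p m tix).
Local Notation tcoord := (@coord R p m tix).
Local Notation emx := (@mxof R p m eix).
Local Notation ecoord := (@coord R p m eix).
Local Notation in0 := (@in0 R p X cl).
Local Notation in1 := (@in1 R p X cl arr).
Local Notation frameU := (@frameU R p b m tix).
Local Notation gram := (@gram R p m tix).
Local Notation projn := (@projn R p b m tix).
Local Notation D := ((1 + p * p) * (1 + p * p) * (p * p))%N.
Local Notation gmx := (@gmx R p X cl).
Local Notation cheq := (@cheq R p X cl arr b m tix eix).
Local Notation chartP := (@chartP R p X cl b m tix).
Local Notation gramd := (@gramd R p m tix).
Local Notation opE := (@opmx R p m eix).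
Local Notation opT := (@opmx R p m tix).

Section TwoCharts.
Variables c c' : class_perm cl.
Let g := gmx c.
Let g' := gmx c'.

(* If h and h' are the two chart frames, then h = q h' with q block triangular;
   kap and (the inverse of) lam are its diagonal blocks. *)
Definition kap x := frameU x *m (g *m g'^T) *m P0 + Q0.
Definition lam x := Q0 *m (g' *m g^T) *m (1%:M - phi x) *m Q0 + P0.
(** The coordinates of the same point in the chart [c'], as a block matrix: the frame of [c]
    rewritten in the basis of [c'] and normalized by its first block. *)
Definition trans x := invmx (kap x) *m (frameU x *m (g *m g'^T) *m Q0).

Lemma P0C_kap x : P0 *m kap x = kap x *m P0.
Proof.
rewrite /kap mulmxDr mulmxDl !mulmxA (P0_frameU tixP) (P0Q0 R b) (Q0P0 R b).
by rewrite -[in RHS]mulmxA (P0P0 R b).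
Qed.

Lemma P0C_lam x : P0 *m lam x = lam x *m P0.
Proof.
rewrite /lam mulmxDr mulmxDl !mulmxA (P0Q0 R b) !mul0mx -[in RHS]mulmxA (Q0P0 R b).
by rewrite mulmx0.
Qed.

Lemma in0_gg : in0 (g *m g'^T).
Proof. by apply: in0_mul; [|apply: in0_tr]; apply: gmx0. Qed.

Lemma in0_gg' : in0 (g' *m g^T).
Proof. by apply: in0_mul; [|apply: in0_tr]; apply: gmx0. Qed.

Lemma in0_kap x : in0 (kap x).
Proof.
apply: in0_add; last exact: in0_Q0.
apply: in0_mul; last exact: in0_P0.
by apply: in0_mul; [apply: (in0_frameU tixP) | apply: in0_gg].
Qed.

Lemma in0_lam x : in0 (lam x).
Proof.
apply: in0_add; last exact: in0_P0.
apply: in0_mul; last exact: in0_Q0.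
apply: in0_mul; last by apply: in0_sub; [apply: in0_1 | apply: (in0_tmx tixP)].
by apply: in0_mul; [apply: in0_Q0 | apply: in0_gg'].
Qed.

Lemma P0C_inv A : A \in unitmx -> P0 *m A = A *m P0 -> P0 *m invmx A = invmx A *m P0.
Proof.
move=> uA PA; apply: (can_inj (mulKmx uA)); rewrite mulmxA -PA -mulmxA mulmxV // mulmx1.
by rewrite mulmxA mulmxV // mul1mx.
Qed.

Lemma phi_trans x : kap x \in unitmx -> phi (tcoord (trans x)) = trans x.
Proof.
move=> uk; apply: (tmx_coordK tixI tixP).
  apply: in0_mul; first by apply: in0_inv => //; apply: in0_kap.
  apply: in0_mul; last exact: in0_Q0.
  by apply: in0_mul; [apply: (in0_frameU tixP) | apply: in0_gg].
rewrite /trans mulmxA (P0C_inv uk (P0C_kap x)) -!mulmxA (Q0Q0 R b).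
by rewrite [P0 *m (frameU x *m _)]mulmxA (P0_frameU tixP).
Qed.

Lemma frame_trans x x' : kap x \in unitmx -> phi x' = trans x ->
  frameU x *m g = kap x *m (frameU x' *m g').
Proof.
move=> uk ex'.
have s1 : P0 + Q0 = 1%:M by rewrite addrC subrK.
have e : kap x *m frameU x' = frameU x *m (g *m g'^T).
  rewrite /Projections.frameU ex' mulmxDr /trans mulKVmx //.
  have -> : kap x *m P0 = frameU x *m (g *m g'^T) *m P0.
    by rewrite /kap mulmxDl (Q0P0 R b) addr0 -!mulmxA (P0P0 R b).
  by rewrite -mulmxDr s1 mulmx1.
rewrite mulmxA e -!mulmxA /g' gmxKV mulmx1.
by [].
Qed.

Lemma coframe_trans x x' : kap x \in unitmx -> phi x' = trans x ->
  g^T *m (1%:M - phi x) *m Q0 = g'^T *m (1%:M - phi x') *m Q0 *m lam x.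
Proof.
move=> uk ex'; set V := g^T *m (1%:M - phi x) *m Q0.
have Q1 : Q0 *m lam x = Q0 *m (g' *m V).
  by rewrite /lam mulmxDr (Q0P0 R b) addr0 /V !mulmxA (Q0Q0 R b).
have UV : frameU x' *m (g' *m V) = 0.
  apply: (can_inj (mulKmx uk)); rewrite mulmx0 [frameU x' *m _]mulmxA mulmxA -(frame_trans uk ex').
  rewrite /V !mulmxA -[frameU x *m g *m _]mulmxA /g gmxK mulmx1.
  rewrite (frameUE tixP) -[P0 *m _ *m (_ - _)]mulmxA (unip_inv tixP) mulmx1.
  exact: P0Q0.
rewrite -[RHS]mulmxA Q1 -mulmxA [_ *m (Q0 *m _)]mulmxA.
have -> : (1%:M - phi x') *m Q0 *m (g' *m V) = g' *m V.
  have e : P0 *m (g' *m V) = - phi x' *m (g' *m V).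
    by apply/eqP; rewrite mulNmx -addr_eq0 -mulmxDl; apply/eqP.
  rewrite mulmxBl mul1mx (tmx_Q0 tixP) mulmxDl -e -mulmxDl.
  by rewrite subrK mul1mx.
by rewrite mulmxA /g' gmxKV mul1mx.
Qed.

(** An exact finite difference formula, from pairing the frame at one point with the coframe at the
    other. It shows that the derivative of the change of charts is inverse to A -> kap A lam. *)
Lemma trans_diff x0 x0' x x' : kap x0 \in unitmx -> kap x \in unitmx ->
  phi x0' = trans x0 -> phi x' = trans x ->
  kap x *m (phi x' - phi x0') *m lam x0 = phi x - phi x0.
Proof.
move=> uk0 uk e0 e.
have diff y y0 : frameU y *m (1%:M - phi y0) *m Q0 = phi y - phi y0.
  by rewrite -mulmxA (frame_diff tixP).
have := coframe_trans uk0 e0 => /(congr1 (mulmx (frameU x *m g))).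
rewrite {2}(frame_trans uk e) !mulmxA -[frameU x *m g *m _]mulmxA /g gmxK mulmx1 diff => ->.
rewrite -[_ *m g' *m g'^T]mulmxA /g' gmxK mulmx1 -!mulmxA [_ *m (Q0 *m _)]mulmxA.
by rewrite [frameU x' *m _]mulmxA [_ *m (_ *m Q0)]mulmxA diff.
Qed.

Lemma chartP_trans x x' : kap x \in unitmx -> phi x' = trans x -> chartP c x = chartP c' x'.
Proof.
move=> uk e; have [h1 h2] := spans_projn tixP x (gmxK R c).
have [h1' h2'] := spans_projn tixP x' (gmxK R c').
have sy (d : class_perm cl) z : (chartP d z)^T = chartP d z.
  by rewrite /ChartEquations.chartP trmx_mul [(_ *m projn z)^T]trmx_mul projn_sym trmxK mulmxA.
apply: (@spans_eq _ _ b _ _ ((1%:M + phi x) *m g)) => //.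
have eU : P0 *m ((1%:M + phi x) *m g) = kap x *m (P0 *m ((1%:M + phi x') *m g')).
  by rewrite ![P0 *m (_ *m _)]mulmxA -!(frameUE tixP) (frame_trans uk e).
rewrite -/(chartP c' x') in h1' h2'.
split; first by rewrite eU -[kap x *m _ *m _]mulmxA h1'.
have [K eK] := h2'; rewrite -[K *m P0 *m _]mulmxA in eK; exists (K *m invmx (kap x)).
rewrite -[_ *m P0 *m _]mulmxA eU.
have -> : K *m invmx (kap x) *m (kap x *m (P0 *m ((1%:M + phi x') *m g'))) = K *m (P0 *m ((1%:M + phi x') *m g')).
  by rewrite !mulmxA -[K *m _ *m kap x]mulmxA mulVmx // mulmx1.
exact: eK.
Qed.

(** Up to the squares of the denominators, the fibre coordinates change by the same sandwich of
    [kap] and [lam] that governs the tangent coordinates. *)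
Lemma cheq_trans y x x' : kap x \in unitmx -> phi x' = trans x ->
  gramd x' ^+ 2 *: emx (cheq c y x) = gramd x ^+ 2 *: (kap x *m emx (cheq c' y x') *m lam x).
Proof.
move=> uk e; rewrite !cheqE -(chartP_trans uk e).
have := @in1_sect R p X cl arr y 1 (chartP c x); move: (sect _ _ _ _ _) => S S1.
have key (d : class_perm cl) z : emx (ecoord (local_sect b tix d S z)) = P0 *m local_sect b tix d S z *m Q0.
  rewrite -(coord_eix_PQ eixP); apply: (emx_coordK eixI eixP).
    apply: in1_in0; last exact: in0_Q0.
    have h := local_sect_in1 tixP d z S1.
    have h0 := @in0_P0 R p X cl b.
    exact: (in0_in1 h0 h).
  by rewrite !mulmxA (P0P0 R b) -!mulmxA (Q0Q0 R b).
rewrite !mxofZ !key -scalemxAr -!scalemxAl !scalerA mulrC; congr (_ *: _).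
rewrite /local_sect !mulmxA !(P0_frameU tixP).
have -> : frameU x *m gmx c *m S *m (gmx c)^T *m (1%:M - phi x) *m Q0 =
   frameU x *m g *m (S *m (g^T *m (1%:M - phi x) *m Q0)) by rewrite !mulmxA.
rewrite (coframe_trans uk e) (frame_trans uk e) -!mulmxA.
by rewrite [P0 *m (frameU x' *m _)]mulmxA (P0_frameU tixP).
Qed.

(** Two frames of the same row space differ by an invertible factor, which on the [P0] block is
    [kap]. *)
Lemma kap_unit x x' : chartP c x = chartP c' x' -> kap x \in unitmx /\ phi x' = trans x.
Proof.
move=> eP; have [h1 [K eK]] := spans_projn tixP x (gmxK R c).
have [h1' [K' eK']] := spans_projn tixP x' (gmxK R c').
rewrite -/(chartP c x) -/(chartP c' x') in h1 eK h1' eK'.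
have [u eu] : {u | u = frameU x *m g} by exists (frameU x *m g).
have [u' eu'] : {u | u = frameU x' *m g'} by exists (frameU x' *m g').
have hu : u *m chartP c x = u.
  by move: h1; rewrite eu !mulmxA -(frameUE tixP).
have hu' : u' *m chartP c x = u'.
  by move: h1'; rewrite eu' eP !mulmxA -(frameUE tixP).
have eK2 : chartP c x = K *m u.
  by rewrite {1}eK -mulmxA [P0 *m _]mulmxA -(frameUE tixP) eu.
have eK2' : chartP c x = K' *m u'.
  by rewrite eP {1}eK' -mulmxA [P0 *m _]mulmxA -(frameUE tixP) eu'.
have Pu : P0 *m u = u by rewrite eu mulmxA (P0_frameU tixP).
have Pu' : P0 *m u' = u' by rewrite eu' mulmxA (P0_frameU tixP).
have uT : u *m u^T = P0 *m gram x.
  by rewrite eu trmx_mul mulmxA -[_ *m g *m g^T]mulmxA /g gmxK mulmx1 (frameU_mulT tixP).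
have uu' : u = u *m K' *m u' by rewrite -mulmxA -eK2' hu.
have u'u : u' = u' *m K *m u by rewrite -mulmxA -eK2 hu'.
have e2 : u' *m g'^T *m P0 = P0.
  by rewrite eu' -[_ *m g' *m _]mulmxA /g' gmxK mulmx1 /Projections.frameU mulmxDl (P0P0 R b) (tmx_P0 tixP) addr0.
have ek : kap x *m u' = u.
  have ukT : u *m g'^T *m P0 = u *m K' *m P0 by rewrite {1}uu' -!mulmxA [u' *m _]mulmxA e2.
  have Qu : Q0 *m u' = 0 by rewrite -Pu' mulmxA (Q0P0 R b) mul0mx.
  have fu : frameU x *m (g *m g'^T) *m P0 = u *m g'^T *m P0 by rewrite eu !mulmxA.
  by rewrite /kap mulmxDl Qu addr0 fu ukT -[_ *m P0 *m u']mulmxA Pu' -uu'.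
have uk : kap x \in unitmx.
  have e3 : (P0 *m (u' *m K *m P0) *m P0 + Q0) *m kap x = 1%:M.
    have kP : kap x *m P0 = u *m g'^T *m P0.
      by rewrite /kap mulmxDl (Q0P0 R b) addr0 -!mulmxA (P0P0 R b) eu !mulmxA.
    have kQ : kap x *m Q0 = Q0.
      by rewrite /kap mulmxDl (Q0Q0 R b) -mulmxA (P0Q0 R b) mulmx0 add0r.
    have -> : kap x = u *m g'^T *m P0 + Q0.
      by rewrite -kP -[X in _ + X]kQ -mulmxDr addrC subrK mulmx1.
    rewrite mulmxDr [in X in X + _]mulmxDl [in X in _ + X]mulmxDl.
    have -> : Q0 *m (u *m g'^T *m P0) = 0 by rewrite -Pu !mulmxA (Q0P0 R b) !mul0mx.
    rewrite (Q0Q0 R b) -[_ *m P0 *m Q0]mulmxA (P0Q0 R b) mulmx0 add0r addr0.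
    have -> : P0 *m (u' *m K *m P0) *m P0 *m (u *m g'^T *m P0) = P0.
      rewrite -!mulmxA [P0 *m (u *m _)]mulmxA Pu [P0 *m (u *m _)]mulmxA Pu.
      by rewrite [K *m _]mulmxA [u' *m _]mulmxA [u' *m _]mulmxA -u'u [u' *m _]mulmxA e2 (P0P0 R b).
    by rewrite addrC subrK.
  by have [] := mulmx1_unit e3.
split=> //; apply: (can_inj (mulKmx uk)); rewrite /trans mulKVmx //.
have -> : phi x' = u' *m g'^T *m Q0.
  by rewrite eu' -[_ *m g' *m _]mulmxA /g' gmxK mulmx1 /Projections.frameU mulmxDl (P0Q0 R b) (tmx_Q0 tixP) add0r.
by rewrite !mulmxA ek eu -!mulmxA.
Qed.

End TwoCharts.

Lemma lam_unit c c' x x' : chartP c x = chartP c' x' -> lam c c' x \in unitmx.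
Proof.
move=> e; have [uk ex'] := kap_unit e; have [uk' ex] := kap_unit (esym e).
have V := coframe_trans uk ex'; have V' := coframe_trans uk' ex.
have s1 : P0 + Q0 = 1%:M by rewrite addrC subrK.
have Pl (d d' : class_perm cl) z : P0 *m lam d d' z = P0.
  by rewrite /lam mulmxDr !mulmxA (P0Q0 R b) !mul0mx add0r (P0P0 R b).
suff h : lam c' c x' *m lam c c' x = 1%:M by have [] := mulmx1_unit h.
rewrite -[LHS]mul1mx -{1}s1 mulmxDl mulmxA Pl Pl -[RHS]s1; congr (_ + _).
have vQ : (1%:M + phi x) *m gmx c *m ((gmx c)^T *m (1%:M - phi x) *m Q0) = Q0.
  rewrite !mulmxA -[(1%:M + phi x) *m gmx c *m _]mulmxA gmxK mulmx1.
  by rewrite (unip_inv tixP) mul1mx.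
have e4 : (gmx c)^T *m (1%:M - phi x) *m Q0 *m (lam c' c x' *m lam c c' x) =
    (gmx c)^T *m (1%:M - phi x) *m Q0 by rewrite mulmxA -V' -V.
by rewrite -{1}vQ -[_ *m (lam _ _ _ *m _)]mulmxA e4 vQ.
Qed.

(** Differentiating the change of charts at a zero intertwines [A] and [A'] by two sandwich
    operators, on the tangent space and on the fibre, both of positive determinant; the remaining
    factors are powers of squares of the denominators. *)
Lemma jacobian_sign c c' x x' y A A' : chartP c x = chartP c' x' -> cheq c y x = 0 ->
  jacobian (cheq c y) x A -> jacobian (cheq c' y) x' A' -> Num.sg (\det A) = Num.sg (\det A').
Proof.
move=> eP f0 jA jA'; have [uk ex'] := kap_unit eP; have ul := lam_unit eP.
have f0' : cheq c' y x' = 0.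
  by apply/(cheq_eq0 eixI tixP eixP); rewrite -eP; apply/(cheq_eq0 eixI tixP eixP).
set k0 := kap c c' x in uk *; set l0 := lam c c' x in ul *.
have [Q [pQ _ fQ]] := mxpolyf_quotient (@mxpolyf_cheq R p X cl arr b m tix eix c y).
have [Q' [pQ' _ fQ']] := mxpolyf_quotient (@mxpolyf_cheq R p X cl arr b m tix eix c' y).
have eA : A = Q (row_mx x x).
  by apply: jacobian_uniq jA _; apply: jacobian_quotient => //; apply: mxpolyf_cheq.
have eA' : A' = Q' (row_mx x' x').
  by apply: jacobian_uniq jA' _; apply: jacobian_quotient => //; apply: mxpolyf_cheq.
have kC : P0 *m k0 = k0 *m P0 := P0C_kap c c' x.
have lC : P0 *m l0 = l0 *m P0 := P0C_lam c c' x.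
have k00 : in0 k0 := in0_kap c c' x.
have l00 : in0 l0 := in0_lam c c' x.
have dT : 0 < \det (opT (fun A => k0 *m A *m l0)).
  exact: (det_sandwich_gt0 (rl := fun u v => u == v) tixI tixP tau_cl tau_b tau_half).
have dE : 0 < \det (opE (fun A => k0 *m A *m l0)).
  exact: (det_sandwich_gt0 eixI eixP tau_cl tau_b tau_half).
have lT := linop_mul (fun u v => u == v) k00 kC l00 lC.
have lE := linop_mul arr k00 kC l00 lC.
have key (dl : 'rV[R]_m) : gramd x' ^+ 2 *: (dl *m opT (fun A => k0 *m A *m l0) *m A) =
    gramd x ^+ 2 *: (dl *m A' *m opE (fun A => k0 *m A *m l0)).
  set v := dl *m opT _.
  have pv : phi v = k0 *m phi dl *m l0.
    rewrite /v (opmxE _ _ lT).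
    have tixP' : forall i j, (exists k, tix k = (i, j)) <-> [&& b i, ~~ b j & (fun u v => u == v) (cl i) (cl j)] by exact: tixP.
    apply: (supp_coordK tixI tixP'); apply: lT.2.
    exact: (supp_mxof tixP').
  pose xt (t : R) := x + t *: v.
  pose d (t : 'rV[R]_1) := \det (kap c c' (xt (t 0 0))).
  pose W (t : 'rV[R]_1) := tcoord (\adj (kap c c' (xt (t 0 0))) *m phi v *m invmx l0).
  pose B (t : 'rV[R]_1) : 'rV[R]_(1 + m) := row_mx (d t *: t) (W t).
  (* [H] compares the two equations along a line, after division by the parameter t; it is
     polynomial in t and in the displacement w in the second chart, hence makes sense at t = 0. *)
  pose H (u : 'rV[R]_(1 + m)) := let t := lsubmx u 0 0 in let w := rsubmx u in
    gramd (x' + t *: w) ^+ 2 *: emx (v *m Q (row_mx (xt t) x)) -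
    gramd (xt t) ^+ 2 *: (kap c c' (xt t) *m emx (w *m Q' (row_mx (x' + t *: w) x')) *m lam c c' (xt t)).
  have pxt n (f : 'rV[R]_n -> R) : polyf f -> mxpolyf (fun z => xt (f z)).
    move=> pf; apply: mxpolyf_add; first exact: mxpolyf_cst.
    by apply: mxpolyf_scale => //; apply: mxpolyf_cst.
  have pkap n (z : 'rV[R]_n -> 'rV[R]_m) : mxpolyf z -> mxpolyf (fun u => kap c c' (z u)).
    move=> pz; apply: mxpolyf_add; last exact: mxpolyf_cst.
    apply: mxpolyf_mul; last exact: mxpolyf_cst.
    apply: mxpolyf_mul; last exact: mxpolyf_cst.
    exact: (mxpolyf_comp (mxpolyf_frameU R b tix) pz).
  have plam n (z : 'rV[R]_n -> 'rV[R]_m) : mxpolyf z -> mxpolyf (fun u => lam c c' (z u)).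
    move=> pz; apply: mxpolyf_add; last exact: mxpolyf_cst.
    apply: mxpolyf_mul; last exact: mxpolyf_cst.
    apply: mxpolyf_mul; first exact: mxpolyf_cst.
    apply: mxpolyf_sub; first exact: mxpolyf_cst.
    exact: (mxpolyf_comp (mxpolyf_phi R tix) pz).
  have pemx n (z : 'rV[R]_n -> 'rV[R]_m) : mxpolyf z -> mxpolyf (fun u => emx (z u)).
    by move=> pz; exact: (mxpolyf_comp (mxpolyf_phi R eix) pz).
  have pgr n (z : 'rV[R]_n -> 'rV[R]_m) : mxpolyf z -> polyf (fun u => gramd (z u) ^+ 2).
    by move=> pz; apply: polyf_mul; apply: (polyf_comp (polyf_gramd R tix)) => i; apply: pz.
  have pt : polyf (fun u : 'rV[R]_(1 + m) => lsubmx u 0 0) by apply: polyf_lsub.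
  have pw : mxpolyf (fun u : 'rV[R]_(1 + m) => rsubmx u) by apply: mxpolyf_rsub.
  have pxw : mxpolyf (fun u : 'rV[R]_(1 + m) => x' + lsubmx u 0 0 *: rsubmx u).
    by apply: mxpolyf_add; [apply: mxpolyf_cst | apply: mxpolyf_scale].
  have pH : mxpolyf H.
    apply: mxpolyf_sub; apply: mxpolyf_scale; try exact: pgr; try exact: (pgr _ _ (pxt _ _ pt)).
      apply: pemx; apply: mxpolyf_mul; first exact: mxpolyf_cst.
      by apply: (mxpolyf_comp pQ); apply: mxpolyf_row_mx; [apply: pxt | apply: mxpolyf_cst].
    apply: mxpolyf_mul; last by apply: plam; apply: pxt.
    apply: mxpolyf_mul; first by apply: pkap; apply: pxt.
    apply: pemx; apply: mxpolyf_mul => //.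
    by apply: (mxpolyf_comp pQ'); apply: mxpolyf_row_mx => //; apply: mxpolyf_cst.
  have pt1 : polyf (fun t : 'rV[R]_1 => t 0 0) by apply: polyf_coord.
  have pd : polyf d by apply: polyf_det; apply: pkap; apply: pxt.
  have pW : mxpolyf W.
    have h : mxpolyf (fun t : 'rV[R]_1 => \adj (kap c c' (xt (t 0 0))) *m phi v *m invmx l0).
      apply: mxpolyf_mul; last exact: mxpolyf_cst.
      apply: mxpolyf_mul; last exact: mxpolyf_cst.
      by apply: mxpolyf_adj; apply: pkap; apply: pxt.
    by move=> i j; apply: polyf_ext (h (tix j).1 (tix j).2) _ => t; rewrite [RHS]mxE.
  have pB : mxpolyf B by apply: mxpolyf_row_mx => //; apply: mxpolyf_scale => //; apply: mxpolyf_id.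
  have x0 : xt 0 = x by rewrite /xt scale0r addr0.
  have d00 : d 0 = \det k0 by rewrite /d mxE x0.
  have d0 : d 0 != 0 by rewrite d00 -unitfE -unitmxE.
  have Hsmall t : t != 0 -> d (const_mx t) != 0 ->
      H ((d (const_mx t))^-1 *: B (const_mx t)) = 0.
    move=> t0 dt; set xx := xt t.
    have ut : kap c c' xx \in unitmx by rewrite unitmxE unitfE; move: dt; rewrite /d mxE.
    pose w := tcoord (invmx (kap c c' xx) *m phi v *m invmx l0).
    have eB : (d (const_mx t))^-1 *: B (const_mx t) = row_mx (const_mx t) w.
      rewrite /B scale_row_mx scalerA mulVf // scale1r; congr row_mx.
      rewrite /W /w -coordZ /d mxE -/xx; congr coord.
      by rewrite scalemxAl scalemxAl /invmx ut.
    have pwE : phi w = invmx (kap c c' xx) *m phi v *m invmx l0.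
      apply: (tmx_coordK tixI tixP).
        apply: in0_mul; last exact: in0_inv.
        apply: in0_mul; last exact: (in0_tmx tixP).
        by apply: in0_inv => //; apply: in0_kap.
      rewrite !mulmxA (P0C_inv ut (P0C_kap c c' xx)) -[_ *m P0 *m phi v]mulmxA (P0_tmx tixP).
      have -> : invmx (kap c c' xx) *m phi v *m invmx l0 *m Q0 = invmx (kap c c' xx) *m phi v *m (invmx l0 *m Q0) by rewrite mulmxA.
      have -> : invmx l0 *m Q0 = Q0 *m invmx l0.
        by rewrite mulmxBr mulmxBl mulmx1 mul1mx (P0C_inv ul lC).
      by rewrite mulmxA -[_ *m phi v *m Q0]mulmxA (tmx_Q0 tixP).
    rewrite eB /H row_mxKl row_mxKr mxE -/xx.
    have pxx : phi (x' + t *: w) = trans c c' xx.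
      rewrite -(phi_trans ut).
      have := trans_diff uk ut ex' (phi_trans ut).
      rewrite (_ : phi xx - phi x = t *: phi v); last by rewrite /xx /xt mxofD mxofZ addrC addKr.
      move=> h; rewrite mxofD mxofZ pwE.
      have : phi (tcoord (trans c c' xx)) - phi x' = t *: (invmx (kap c c' xx) *m phi v *m invmx l0).
        by rewrite scalemxAl scalemxAr -h -/l0 !mulmxA mulVmx // mul1mx -mulmxA mulmxV // mulmx1.
      by move=> <-; rewrite addrC subrK.
    have := cheq_trans y ut pxx.
    have -> : cheq c y xx = t *: (v *m Q (row_mx xx x)).
      by have := fQ xx x; rewrite f0 subr0 => ->; rewrite /xx /xt addrC addKr scalemxAl.
    have -> : cheq c' y (x' + t *: w) = t *: (w *m Q' (row_mx (x' + t *: w) x')).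
      by have := fQ' (x' + t *: w) x'; rewrite f0' subr0 => ->; rewrite addrC addKr scalemxAl.
    rewrite !mxofZ -scalemxAr -scalemxAl scalerA mulrC -scalerA [in RHS]scalerA [in RHS]mulrC -[in RHS]scalerA.
    by move/(scalerI t0) => ->; rewrite subrr.
  have H0 : H ((d 0)^-1 *: B 0) = 0.
    apply/matrixP => i j; rewrite [RHS]mxE.
    apply: (rational_limit (pH i j) pd pB d0) => t t0 dt.
    by rewrite Hsmall // mxE.
  have eB0 : (d 0)^-1 *: B 0 = row_mx 0 dl.
    rewrite /B scale_row_mx !scaler0; congr row_mx.
    rewrite /W mxE x0 -/k0 -coordZ scalemxAl scalemxAl d00.
    have -> : (\det k0)^-1 *: \adj k0 = invmx k0 by rewrite /invmx uk.
    by rewrite pv !mulmxA mulVmx // mul1mx -mulmxA mulmxV // mulmx1 (mxofK tixI).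
  move: H0; rewrite eB0 /H row_mxKl row_mxKr mxE x0 scale0r addr0 -eA -eA' -/k0 -/l0.
  move/eqP; rewrite subr_eq0 => /eqP /(congr1 ecoord).
  by rewrite !coordZ (mxofK eixI) (opmxE _ _ lE).
have Meq : gramd x' ^+ 2 *: (opT (fun A => k0 *m A *m l0) *m A) =
   gramd x ^+ 2 *: (A' *m opE (fun A => k0 *m A *m l0)).
  apply/row_matrixP => i; rewrite !rowE -!scalemxAr; have := key (delta_mx 0 i).
  by rewrite !mulmxA.
have := congr1 determinant Meq; rewrite !detZ !det_mulmx => /(congr1 Num.sg).
have sq (z : R) n : z != 0 -> Num.sg ((z ^+ 2) ^+ n) = 1.
  by move=> z0; rewrite gtr0_sg // exprn_gt0 // exprn_even_gt0.
rewrite !sgrM !sq ?gramd_neq0 // !mul1r (gtr0_sg dT) (gtr0_sg dE).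
by rewrite mul1r mulr1.
Qed.

(** The sign is attached to the point [chartP c x] rather than to its coordinates; agreement between
    charts makes the choice possible, and points that are not zeros get the value 0. *)
Lemma orientation_ex : exists sgn : 'rV[R]_D -> 'rV[R]_(p * p) -> R, forall y c x A,
  cheq c y x = 0 -> jacobian (cheq c y) x A -> sgn y (mxvec (chartP c x)) = Num.sg (\det A).
Proof.
have h (yv : 'rV[R]_D * 'rV[R]_(p * p)) : exists s : R, forall c x A,
    cheq c yv.1 x = 0 -> jacobian (cheq c yv.1) x A -> mxvec (chartP c x) = yv.2 -> s = Num.sg (\det A).
  have [[c [x [A [f0 jA e]]]]|n] := pselect (exists c x A, [/\ cheq c yv.1 x = 0,
      jacobian (cheq c yv.1) x A & mxvec (chartP c x) = yv.2]).
    exists (Num.sg (\det A)) => c' x' A' f0' jA' e'.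
    by apply: (jacobian_sign _ f0 jA jA'); apply: (can_inj mxvecK); rewrite e e'.
  by exists 0 => c x A f0 jA e; case: n; exists c, x, A.
have [s hs] := choice h; exists (fun y v => s (y, v)) => y c x A f0 jA.
exact: (hs (y, mxvec (chartP c x)) c x A).
Qed.

End Coherence.

End Orientation.

(** * Invariance of the signed number of zeros *)

Module SignedCount.
Import structures.
Import all_boot all_order all_algebra all_fingroup.
Import boolp classical_sets functions reals interval_inference topology normedtype sequences realfun matrix_normedtype.
Import ring lra.
Import PolynomialFunctions Norms ImplicitFunction LocalCount GlobalCount Graded Projections ChartCover Genericity PathCount LinearOperators ChartEquations Orientation.
Import Order.TTheory GRing.Theory Num.Theory.
Import numFieldNormedType.Exports.
Local Open Scope classical_set_scope.
Local Open Scope ring_scope.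

Section SignedCount.
Variables (R : realType) (p : nat) (X : eqType) (cl : 'I_p -> X) (arr : rel X).
Variables (b : pred 'I_p) (m : nat) (tix eix : 'I_m -> 'I_p * 'I_p).
Hypothesis tixI : injective tix.
Hypothesis eixI : injective eix.
Hypothesis tixP : forall i j, (exists k, tix k = (i, j)) <-> [&& b i, ~~ b j & cl i == cl j].
Hypothesis eixP : forall i j, (exists k, eix k = (i, j)) <-> [&& b i, ~~ b j & arr (cl i) (cl j)].
Variables (tau : 'S_p) (half : pred 'I_p).
Hypothesis tau_cl : forall i, cl (tau i) = cl i.
Hypothesis tau_b : forall i, b (tau i) = b i.
Hypothesis tau_half : forall i, half (tau i) = ~~ half i.
Local Notation P0 := (P0 R b).
Local Notation Q0 := (Q0 R b).
Local Notation D := ((1 + p * p) * (1 + p * p) * (p * p))%N.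
Local Notation gmx := (@gmx R p X cl).
Local Notation cheq := (@cheq R p X cl arr b m tix eix).
Local Notation cheqmx := (@cheqmx R p X cl arr b m tix eix).
Local Notation chartP := (@chartP R p X cl b m tix).
Local Notation isproj := (@isproj R p X cl b).
Local Notation C := (class_perm cl).

Definition proj_set : set 'rV[R]_(p * p) := [set v | isproj (vec_mx v)].

Lemma proj_entry_le1 (P : 'M[R]_p) i j : isproj P -> `|P i j| <= 1.
Proof.
move=> [_ PT PP _].
have d k : P k k = \sum_l P k l ^+ 2.
  have /matrixP/(_ k k) := PP; rewrite mxE => <-; apply: eq_bigr => l _.
  by rewrite expr2; congr (_ * _); have /matrixP/(_ k l) := PT; rewrite mxE.
have le k l : P k l ^+ 2 <= P k k.
  by rewrite d (bigD1 l) //= lerDl; apply: sumr_ge0 => l' _; rewrite sqr_ge0.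
have := le i j; have := le i i => h1 h2.
have h0 : 0 <= P i i by apply: le_trans h2; rewrite sqr_ge0.
have h3 : P i i <= 1.
  have [->|nz] := eqVneq (P i i) 0; first exact: ler01.
  by move: h1; rewrite expr2 -[leRHS]mulr1 ler_pM2l // lt0r nz.
by rewrite -(@ler_pXn2r _ 2) ?nnegrE ?expr1n ?real_normK ?num_real //; apply: le_trans h2 h3.
Qed.

Lemma closed_polyf n (f : 'rV[R]_n -> R) : polyf f -> closed [set v | f v = 0].
Proof.
move=> pf; have -> : [set v | f v = 0] = f @^-1` [set 0] by apply/seteqP; split.
apply: preimage_closed; last exact: closed_eq.
by move=> x _; exact: polyf_cont.
Qed.

Lemma compact_proj_set : compact proj_set.
Proof.
apply: bounded_closed_compact.
  exists 1; split; first exact: num_real.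
  move=> M M1 v hv; apply: mx_norm_le; first by rewrite ltW // (lt_trans ltr01).
  move=> i j; rewrite ord1; apply: ltW; apply: le_lt_trans M1.
  have [[k l] /= ->] : exists kl, j = mxvec_index kl.1 kl.2.
    by have [f _ fK] := curry_mxvec_bij p p; exists (f j); rewrite -[LHS]fK; case: (f j).
  by have := proj_entry_le1 k l hv; rewrite mxE.
(* All polynomial functions vanishing on the set are taken at once; the defining equations are among
   them, so their common zero set is the set itself, which is therefore closed. *)
pose S := [set f : 'rV[R]_(p * p) -> R | polyf f /\ forall v, proj_set v -> f v = 0].
suff -> : proj_set = \bigcap_(f in S) [set v | f v = 0].
  by apply: closed_bigI => f [pf _]; apply: closed_polyf.
have pv : mxpolyf (fun v : 'rV[R]_(p * p) => vec_mx v : 'M[R]_p).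
  by apply: mxpolyf_vec_mx; apply: mxpolyf_id.
have pvl A : mxpolyf (fun v : 'rV[R]_(p * p) => A *m vec_mx v : 'M[R]_p).
  by apply: mxpolyf_mul => //; apply: mxpolyf_cst.
apply/seteqP; split=> [v hv f [_ h]|v hv]; first exact: h.
have mx0 (A B : 'rV[R]_(p * p) -> 'M[R]_p) : mxpolyf A -> mxpolyf B ->
    (forall w, proj_set w -> A w = B w) -> A v = B v.
  move=> pA pB AB; apply/matrixP => i j; apply/eqP; rewrite -subr_eq0; apply/eqP.
  apply: (hv (fun w => A w i j - B w i j)); split; first exact: polyf_sub.
  by move=> w /AB ->; rewrite subrr.
split.
- move=> x; apply: (mx0 (fun w => cproj R cl x *m vec_mx w) (fun w => vec_mx w *m cproj R cl x)) => //.
    by apply: mxpolyf_mul => //; apply: mxpolyf_cst.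
  by move=> w [].
- by apply: (mx0 (fun w => (vec_mx w)^T) (fun w => vec_mx w)) => //; [apply: mxpolyf_tr | move=> w []].
- by apply: (mx0 (fun w => vec_mx w *m vec_mx w) (fun w => vec_mx w)) => //; [apply: mxpolyf_mul | move=> w []].
move=> x; apply/eqP; rewrite -subr_eq0; apply/eqP.
apply: (hv (fun w => \tr (cproj R cl x *m vec_mx w) - \tr (cproj R cl x *m P0))); split.
  apply: polyf_sub; last exact: polyf_cst.
  by apply: polyf_sum => i; apply: pvl.
by move=> w [_ _ _ h]; rewrite h subrr.
Qed.

Definition chart_dom (c : C) : set 'rV[R]_(p * p) :=
  [set v | chart_mx b (gmx c) (vec_mx v) \in unitmx].
Definition chart_chi (c : C) (v : 'rV[R]_(p * p)) : 'rV[R]_m := chart_coord b tix (gmx c) (vec_mx v).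
Definition chart_psi (c : C) x : 'rV[R]_(p * p) := mxvec (chartP c x).

Lemma mxpolyf_chart_conj c : mxpolyf (fun v : 'rV[R]_(p * p) => gmx c *m vec_mx v *m (gmx c)^T).
Proof.
apply: mxpolyf_mul; last exact: mxpolyf_cst.
by apply: mxpolyf_mul; [apply: mxpolyf_cst | apply: mxpolyf_vec_mx; apply: mxpolyf_id].
Qed.

Lemma mxpolyf_chart_mx c : mxpolyf (fun v => chart_mx b (gmx c) (vec_mx v)).
Proof.
apply: mxpolyf_add; last exact: mxpolyf_cst.
apply: mxpolyf_mul; last exact: mxpolyf_cst.
by apply: mxpolyf_mul; [apply: mxpolyf_cst | apply: mxpolyf_chart_conj].
Qed.

Lemma near_of_ball n (v : 'rV[R]_n) (Q : 'rV[R]_n -> Prop) d : 0 < d ->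
  (forall w, `|w - v| < d -> Q w) -> \forall w \near v, Q w.
Proof.
move=> d0 h; apply/nbhs_normP; exists d => //= w hw; apply: h.
by rewrite distrC.
Qed.

Lemma chart_dom_open c v : chart_dom c v -> \forall w \near v, chart_dom c w.
Proof.
rewrite /chart_dom /= unitmxE unitfE => nz.
have [d d0 hd] := polyf_near_sgr (polyf_det (mxpolyf_chart_mx c)) nz.
apply: (near_of_ball d0) => w /hd e.
by rewrite /= unitmxE unitfE -sgr_eq0 e sgr_eq0.
Qed.

Lemma chart_chi_cont c v e : chart_dom c v -> 0 < e ->
  \forall w \near v, `|chart_chi c w - chart_chi c v| < e.
Proof.
move=> dv e0; pose d w := \det (chart_mx b (gmx c) (vec_mx w)).
pose A w := coord tix (\adj (chart_mx b (gmx c) (vec_mx w)) *m (P0 *m (gmx c *m vec_mx w *m (gmx c)^T) *m Q0)).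
have eA w : chart_dom c w -> chart_chi c w = (d w)^-1 *: A w.
  rewrite /chart_dom /= => uw; rewrite /chart_chi /chart_coord /A -coordZ; congr coord.
  by rewrite scalemxAl /invmx uw.
have pA : mxpolyf A.
  have h : mxpolyf (fun w => \adj (chart_mx b (gmx c) (vec_mx w)) *m (P0 *m (gmx c *m vec_mx w *m (gmx c)^T) *m Q0)).
    apply: mxpolyf_mul; first by apply: mxpolyf_adj; apply: mxpolyf_chart_mx.
    apply: mxpolyf_mul; last exact: mxpolyf_cst.
    by apply: mxpolyf_mul; [apply: mxpolyf_cst | apply: mxpolyf_chart_conj].
  by move=> i j; apply: polyf_ext (h (tix j).1 (tix j).2) _ => w; rewrite [RHS]mxE.
have d0 : d v != 0 by move: dv; rewrite /chart_dom /= unitmxE unitfE.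
have [dl dl0 hdl] := ratf_near (polyf_det (mxpolyf_chart_mx c)) pA d0 e0.
have h1 := chart_dom_open dv.
have h2 : \forall w \near v, `|(d w)^-1 *: A w - (d v)^-1 *: A v| < e by apply: (near_of_ball dl0).
by near=> w; rewrite !eA //; near: w.
Unshelve. all: by end_near. Qed.

Lemma chart_psi_cont c x e : 0 < e -> exists2 d, 0 < d &
  forall x', `|x' - x| < d -> `|chart_psi c x' - chart_psi c x| < e.
Proof.
move=> e0; pose A x := mxvec ((gmx c)^T *m nproj b tix x *m gmx c).
have eA y : chart_psi c y = (gramd tix y)^-1 *: A y.
  rewrite /chart_psi /A nprojE -scalemxAr -scalemxAl linearZ /= scalerA mulVf ?gramd_neq0 //.
  by rewrite scale1r.
have pA : mxpolyf A by apply: mxpolyf_mxvec; apply: mxpolyf_chart_nproj.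
have [dl dl0 hdl] := ratf_near (polyf_gramd R tix) pA (gramd_neq0 tix x) e0.
by exists dl => // y /hdl; rewrite !eA.
Qed.

Lemma isproj_chartP c x : isproj (chartP c x).
Proof.
by apply: isproj_conj; [apply: gmx0 | apply: gmxK | apply: (isproj_projn tixP)].
Qed.

Lemma chart_psi_in c x : proj_set (chart_psi c x) /\ chart_dom c (chart_psi c x).
Proof.
rewrite /proj_set /chart_dom /chart_psi /= mxvecK; split; first exact: isproj_chartP.
rewrite (chart_mx_projn tixP x (gmxK R c)) unitmx_inv.
exact: gram_unit.
Qed.

Lemma chart_psiK c x : chart_chi c (chart_psi c x) = x.
Proof. by rewrite /chart_chi /chart_psi mxvecK (chart_coord_projn tixI tixP x (gmxK R c)). Qed.

Lemma chart_chiK c v : proj_set v -> chart_dom c v -> chart_psi c (chart_chi c v) = v.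
Proof.
move=> hv dv; apply: (can_inj vec_mxK); rewrite mxvecK.
exact: (projn_chart_coord tixI tixP (gmx0 R c) (gmxK R c) hv dv).
Qed.

Lemma chart_cover v : proj_set v -> exists c, chart_dom c v.
Proof.
move=> [h1 h2 h3 h4]; have [s [scl hs]] := cover_perm h1 h3 h4.
have sc : [forall i, cl (s i) == cl i] by apply/forallP => i; rewrite scl.
exists (Sub s sc : C); rewrite /chart_dom /=; apply: unitmx_inj => u.
rewrite /chart_mx /ChartEquations.gmx SubK mulmxDr => e.
set S := perm_mx s *m vec_mx v *m (perm_mx s)^T in e.
have uQ : u *m Q0 = 0.
  have := congr1 (mulmx^~ Q0) e; rewrite mulmxDl mul0mx -!mulmxA (P0Q0 R b) (Q0Q0 R b).
  by rewrite !mulmx0 add0r.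
have uS : u *m P0 *m perm_mx s *m vec_mx v = 0.
  have uPS : u *m P0 *m S *m P0 = 0 by move: e; rewrite uQ addr0 !mulmxA.
  apply: mul_tr_eq0; rewrite !trmx_mul h2 (P0T R b).
  have -> : u *m P0 *m perm_mx s *m vec_mx v *m (vec_mx v *m ((perm_mx s)^T *m (P0 *m u^T))) =
      u *m P0 *m S *m P0 *m u^T.
    by rewrite /S !mulmxA -[_ *m vec_mx v *m vec_mx v]mulmxA h3.
  by rewrite uPS mul0mx.
by rewrite -[u]mulmx1 -(subrK P0 1%:M) addrC mulmxDr -/Q0 uQ addr0 (hs _ uS).
Qed.

Definition zero_set (y : 'rV[R]_D) : set 'rV[R]_(p * p) := [set v | isproj (vec_mx v) /\
  vec_mx v *m sect cl arr y 1 (vec_mx v) *m (1%:M - vec_mx v) = 0].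

Definition nondegenerate (y : 'rV[R]_D) := forall c x A, cheq c y x = 0 ->
  jacobian (cheq c y) x A -> A \in unitmx.

Definition orientation (sgn : 'rV[R]_D -> 'rV[R]_(p * p) -> R) := forall y c x A,
  cheq c y x = 0 -> jacobian (cheq c y) x A -> sgn y (chart_psi c x) = Num.sg (\det A).

Lemma zero_set_chart c y x : zero_set y (chart_psi c x) <-> cheq c y x = 0.
Proof.
rewrite (cheq_eq0 eixI tixP eixP) /zero_set /= /chart_psi mxvecK.
by split=> [[]|h] //; split => //; apply: isproj_chartP.
Qed.

(** A section vanishing identically in a chart has Jacobian 0, which is invertible only in dimension
    0. This supplies the nonvanishing assumed in [negligible_corank2]. *)
Lemma nondegenerate_neq0 c y : nondegenerate y -> (exists x, y *m cheqmx c x != 0) \/ m = 0%N.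
Proof.
move=> nd; have [|n] := pselect (exists x, y *m cheqmx c x != 0); first by left.
have z x : cheq c y x = 0.
  by apply/eqP; apply: contraT => h; case: n; exists x; rewrite cheqmxE.
right; have j0 : jacobian (cheq c y) 0 0.
  move=> v; exists 0 => j; exists 0; split=> [e||]; rewrite ?coef0 ?mulmx0.
  - by rewrite z [LHS]mxE horner0.
  - by rewrite [RHS]mxE.
  by rewrite [RHS]mxE.
have := nd c 0 0 (z 0) j0.
case: (m) => // m'; rewrite unitmxE det0 unitfE eqxx //.
Qed.

(** One perturbation [a] is generic for all the finitely many charts at once; along the resulting
    path each zero is regular or a nondegenerate fold, and [atlas_count] transports the count from
    [y0] to [y1]. *)
Theorem signed_count_eq sgn y0 y1 : orientation sgn -> nondegenerate y0 -> nondegenerate y1 ->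
  exists n, has_count (zero_set y0) (sgn y0) n /\ has_count (zero_set y1) (sgn y1) n.
Proof.
move=> hsgn nd0 nd1.
have JS c : jet_surjective (cheqmx c) by exact: cheq_jet_surjective.
have pPhi c : mxpolyf (cheqmx c) by apply: mxpolyf_cheqmx.
have /choice [J hJ] : forall c : C, exists F : ('rV[R]_(m + m) -> 'M[R]_(D, m)) * ('rV[R]_(m + m) -> 'M[R]_(D, m)),
  [/\ mxpolyf F.1, mxpolyf F.2 & forall y x v, jet2 (fun x => y *m cheqmx c x) x v
     (y *m F.1 (row_mx x v)) (y *m F.2 (row_mx x v))].
  by move=> c; have [F1 [F2 h]] := mxpolyf_jet (pPhi c); exists (F1, F2).
have [a ha] : exists a, forall c : C,
  (forall s x (v l : 'rV_m), s != 0 -> s != 1 -> v != 0 -> l != 0 ->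
    path_at y0 y1 a s *m cheqmx c x = 0 -> path_at y0 y1 a s *m (J c).1 (row_mx x v) = 0 ->
    (forall u, path_at y0 y1 a s *m (J c).1 (row_mx x u) *m l^T = 0) ->
    path_at y0 y1 a s *m (J c).2 (row_mx x v) *m l^T = 0 -> False) /\
  (forall s x (l : 'rV_m), s != 0 -> s != 1 -> l != 0 ->
    path_at y0 y1 a s *m cheqmx c x = 0 ->
    (forall v, path_at y0 y1 a s *m (J c).1 (row_mx x v) *m l^T = 0) ->
    (s ^+ 2 *: y1 - (1 - s) ^+ 2 *: y0) *m cheqmx c x *m l^T = 0 -> False).
  pose B1 (c : C) (a : 'rV[R]_D) := exists s x (v l : 'rV_m), [/\ s != 0, s != 1, v != 0, l != 0 &
    [/\ path_at y0 y1 a s *m cheqmx c x = 0, path_at y0 y1 a s *m (J c).1 (row_mx x v) = 0,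
    (forall u, path_at y0 y1 a s *m (J c).1 (row_mx x u) *m l^T = 0) &
    path_at y0 y1 a s *m (J c).2 (row_mx x v) *m l^T = 0]].
  pose B2 (c : C) (a : 'rV[R]_D) := exists s x (l : 'rV_m), [/\ s != 0, s != 1, l != 0,
    path_at y0 y1 a s *m cheqmx c x = 0 &
    (forall v, path_at y0 y1 a s *m (J c).1 (row_mx x v) *m l^T = 0) /\
    (s ^+ 2 *: y1 - (1 - s) ^+ 2 *: y0) *m cheqmx c x *m l^T = 0].
  have nB : negligible (fun a => exists c, B1 c a \/ B2 c a).
    apply: negligible_bigU => c; have [h1 h2 h3] := hJ c; apply: negligible_or.
      exact: negligible_degenerate_fold.
    have [ex|m0] := nondegenerate_neq0 c nd0; first exact: negligible_corank2.
    (* For m = 0 there is no nonzero covector, so the condition is empty. *)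
    apply: (negligible_sub _ (@negligible_bigU R D 'I_0 (fun _ _ => True) _)); last by case.
    move=> y [s [x [l [_ _ l0 _ _]]]]; case/eqP: l0.
    apply/rowP => -[j hj]; exfalso; move: hj; by rewrite m0 ltn0.
  have [a na] := negligible_avoid nB; exists a => c; split.
    move=> s x v l h1 h2 h3 h4 h5 h6 h7 h8; apply: na; exists c; left.
    by exists s, x, v, l; split.
  move=> s x l h1 h2 h3 h4 h5 h6; apply: na; exists c; right.
  by exists s, x, l; split.
have ec c y : (fun x => y *m cheqmx c x) = cheq c y by apply/funext => x; apply: cheqmxE.
pose f c := path_eq (cheqmx c) y0 y1 a ord0.
have pf c : mxpolyf (f c) by apply: mxpolyf_path_eq.
have /choice [Q hQ] := fun c => mxpolyf_quotient (pf c).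
have nd0' c x A : y0 *m cheqmx c x = 0 -> jacobian (fun x => y0 *m cheqmx c x) x A -> A \in unitmx.
  by rewrite cheqmxE ec; apply: nd0.
have nd1' c x A : y1 *m cheqmx c x = 0 -> jacobian (fun x => y1 *m cheqmx c x) x A -> A \in unitmx.
  by rewrite cheqmxE ec; apply: nd1.
have jac c s x : jacobian (cheq c (path_at y0 y1 a s)) x
    (row' ord0 (Q c (row_mx (ins ord0 s x) (ins ord0 s x)))).
  have [h1 h2 h3] := hQ c; rewrite -ec.
  exact: (path_jacobian (pPhi c) h1 h3 s x).
have fins c s x : f c (ins ord0 s x) = cheq c (path_at y0 y1 a s) x.
  by rewrite /f path_eq_ins cheqmxE.
have := @atlas_count R m (p * p) proj_set C chart_dom chart_chi chart_psi compact_proj_set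
  (fun c P _ => @chart_dom_open c P) (fun c P _ dv e e0 => @chart_chi_cont c P e dv e0) chart_psi_cont
  chart_psi_in chart_psiK chart_chiK chart_cover ord0 f Q pf
  (fun s => zero_set (path_at y0 y1 a s)) (fun s => sgn (path_at y0 y1 a s)).
have y00 : path_at y0 y1 a 0 = y0 by rewrite /path_at subr0 scale1r !scale0r mul0r scale0r !addr0.
have y11 : path_at y0 y1 a 1 = y1 by rewrite /path_at subrr scale0r scale1r mulr0 scale0r addr0 add0r.
rewrite y00 y11; apply.
- by move=> s P [].
- by move=> c s x; rewrite fins; apply: zero_set_chart.
- by move=> c s x; rewrite fins => f0; apply: (hsgn _ _ _ _ f0 (jac c s x)).
move=> c s x s01; rewrite fins => f0; have [h1 h2 h3] := hQ c; have [ha1 ha2] := ha c.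
have [_ _ j3] := hJ c.
apply: (path_local (pPhi c) j3 ha1 ha2 (@nd0' c) (@nd1' c) h1 h2 h3 s01).
by rewrite cheqmxE.
Qed.

End SignedCount.

End SignedCount.

(** * First order variation of the equation at a zero *)

Module FirstOrder.
Import structures.
Import all_boot all_order all_algebra all_fingroup.
Import reals.
Import ring lra.
Import PolynomialFunctions Norms Graded Projections Genericity LinearOperators ChartEquations.
Import Order.TTheory GRing.Theory Num.Theory.
Local Open Scope ring_scope.

Section FirstOrder.
Variables (R : realType) (n : nat).
Implicit Types (x v : 'rV[R]_n).

(** First order jets along a line, with the value included so that the product rule composes. *)
Definition sjet (f : 'rV[R]_n -> R) x v a0 a1 :=
  exists p : {poly R}, [/\ forall e, f (x + e *: v) = p.[e], p`_0 = a0 & p`_1 = a1].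
Definition mjet a b (F : 'rV[R]_n -> 'M[R]_(a, b)) x v (A0 A1 : 'M[R]_(a, b)) :=
  forall i j, sjet (fun x => F x i j) x v (A0 i j) (A1 i j).

Lemma sjet_cst x v c : sjet (fun=> c) x v c 0.
Proof. by exists c%:P; rewrite !coefC; split=> // e; rewrite hornerC. Qed.

Lemma sjet_add x v f g a0 a1 b0 b1 : sjet f x v a0 a1 -> sjet g x v b0 b1 ->
  sjet (fun x => f x + g x) x v (a0 + b0) (a1 + b1).
Proof.
move=> [p [ep p0 p1]] [q [eq q0 q1]]; exists (p + q).
by rewrite !coefD p0 p1 q0 q1; split=> // e; rewrite hornerD ep eq.
Qed.

Lemma sjet_mul x v f g a0 a1 b0 b1 : sjet f x v a0 a1 -> sjet g x v b0 b1 ->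
  sjet (fun x => f x * g x) x v (a0 * b0) (a0 * b1 + a1 * b0).
Proof.
move=> [p [ep p0 p1]] [q [eq q0 q1]]; exists (p * q).
rewrite !coefM !big_ord_recr !big_ord0 /= !add0r p0 p1 q0 q1.
by split=> // e; rewrite hornerM ep eq.
Qed.

Lemma sjet_sum (I : Type) (r : seq I) (f : I -> 'rV[R]_n -> R) x v a0 a1 :
  (forall i, sjet (f i) x v (a0 i) (a1 i)) ->
  sjet (fun x => \sum_(i <- r) f i x) x v (\sum_(i <- r) a0 i) (\sum_(i <- r) a1 i).
Proof.
move=> h; elim: r => [|i r [p [ep p0 p1]]].
  exists 0; rewrite !big_nil !coef0; split=> // e; by rewrite big_nil horner0.
have [q [eq q0 q1]] := h i; exists (q + p); rewrite !big_cons !coefD p0 p1 q0 q1.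
by split=> // e; rewrite big_cons hornerD eq ep.
Qed.

Lemma sjet_uniq f x v a0 a1 b0 b1 : sjet f x v a0 a1 -> sjet f x v b0 b1 -> a0 = b0 /\ a1 = b1.
Proof.
move=> [p [ep p0 p1]] [q [eq q0 q1]].
have pq : p = q by apply: poly_fun_inj => e; rewrite -ep -eq.
by rewrite -p0 -p1 -q0 -q1 pq.
Qed.

Lemma sjet_ext f g x v a0 a1 : (forall x, f x = g x) -> sjet f x v a0 a1 -> sjet g x v a0 a1.
Proof. by move=> fg [p [ep p0 p1]]; exists p; split=> // e; rewrite -fg. Qed.

Lemma sjet_ex f x v : polyf f -> exists a1, sjet f x v (f x) a1.
Proof.
move=> pf; have [f1 [f2 [_ _ h]]] := polyf_jet pf; have [p [ep p1 p2]] := h x v.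
by exists p`_1, p; split=> //; rewrite -horner_coef0 -ep scale0r addr0.
Qed.

Lemma mjet_uniq a b (F : 'rV[R]_n -> 'M[R]_(a, b)) x v A0 A1 B0 B1 :
  mjet F x v A0 A1 -> mjet F x v B0 B1 -> A0 = B0 /\ A1 = B1.
Proof.
by move=> h h'; split; apply/matrixP => i j; have [] := sjet_uniq (h i j) (h' i j).
Qed.

Lemma mjet_ext a b (F G : 'rV[R]_n -> 'M[R]_(a, b)) x v A0 A1 : (forall x, F x = G x) ->
  mjet F x v A0 A1 -> mjet G x v A0 A1.
Proof. by move=> FG h i j; apply: sjet_ext (h i j) => z; rewrite FG. Qed.

Lemma mjet_ex a b (F : 'rV[R]_n -> 'M[R]_(a, b)) x v : mxpolyf F -> exists A1, mjet F x v (F x) A1.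
Proof.
move=> pF; have /fin_all_exists [A1 hA] : forall ij : 'I_a * 'I_b, exists a1,
   sjet (fun x => F x ij.1 ij.2) x v (F x ij.1 ij.2) a1 by move=> ij; apply: sjet_ex.
by exists (\matrix_(i, j) A1 (i, j)) => i j; rewrite mxE; apply: (hA (i, j)).
Qed.

Lemma mjet_cst a b (A : 'M[R]_(a, b)) x v : mjet (fun=> A) x v A 0.
Proof. by move=> i j; rewrite mxE; apply: sjet_cst. Qed.

Lemma mjet_add a b (F G : 'rV[R]_n -> 'M[R]_(a, b)) x v A0 A1 B0 B1 : mjet F x v A0 A1 ->
  mjet G x v B0 B1 -> mjet (fun x => F x + G x) x v (A0 + B0) (A1 + B1).
Proof.
move=> hF hG i j; rewrite !mxE; apply: sjet_ext (sjet_add (hF i j) (hG i j)) => z.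
by rewrite mxE.
Qed.

Lemma mjet_mul a b c (F : 'rV[R]_n -> 'M[R]_(a, b)) (G : 'rV[R]_n -> 'M[R]_(b, c)) x v A0 A1 B0 B1 :
  mjet F x v A0 A1 -> mjet G x v B0 B1 -> mjet (fun x => F x *m G x) x v (A0 *m B0) (A0 *m B1 + A1 *m B0).
Proof.
move=> hF hG i j; rewrite !mxE -big_split /=.
apply: sjet_ext (sjet_sum _ (fun k => sjet_mul (hF i k) (hG k j))) => z.
by rewrite mxE.
Qed.

Lemma mjet_tr a b (F : 'rV[R]_n -> 'M[R]_(a, b)) x v A0 A1 : mjet F x v A0 A1 ->
  mjet (fun x => (F x)^T) x v A0^T A1^T.
Proof. by move=> h i j; rewrite !mxE; apply: sjet_ext (h j i) => z; rewrite mxE. Qed.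

Lemma mjet_scale a b f (F : 'rV[R]_n -> 'M[R]_(a, b)) x v a0 a1 A0 A1 : sjet f x v a0 a1 ->
  mjet F x v A0 A1 -> mjet (fun x => f x *: F x) x v (a0 *: A0) (a0 *: A1 + a1 *: A0).
Proof.
move=> hf hF i j; rewrite !mxE; apply: sjet_ext (sjet_mul hf (hF i j)) => z.
by rewrite mxE.
Qed.

Lemma mjet_linear a b c d (L : 'M[R]_(a, b) -> 'M[R]_(c, d)) F x v A0 A1 :
  (forall s A B, L (s *: A + B) = s *: L A + L B) ->
  mjet F x v A0 A1 -> mjet (fun x => L (F x)) x v (L A0) (L A1).
Proof.
move=> lL hF.
have L0 : L 0 = 0 by have := lL (-1) 0 0; rewrite scaler0 addr0 scaleN1r addNr.
have LD A B : L (A + B) = L A + L B by have := lL 1 A B; rewrite !scale1r.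
have LZ s A : L (s *: A) = s *: L A by have := lL s A 0; rewrite !addr0 L0 addr0.
have Lsum A k l : L A k l = \sum_(ij <- enum (('I_a * 'I_b)%type : finType)) A ij.1 ij.2 * L (delta_mx ij.1 ij.2) k l.
  rewrite big_enum /= {1}[A]matrix_sum_delta pair_bigA /= (big_morph L LD L0) summxE.
  by apply: eq_bigr => ij _; rewrite LZ mxE.
move=> k l; rewrite !Lsum.
have -> : \sum_(ij <- enum (('I_a * 'I_b)%type : finType)) A1 ij.1 ij.2 * L (delta_mx ij.1 ij.2) k l =
  \sum_(ij <- enum (('I_a * 'I_b)%type : finType)) (A0 ij.1 ij.2 * 0 + A1 ij.1 ij.2 * L (delta_mx ij.1 ij.2) k l).
  by apply: eq_bigr => ij _; rewrite mulr0 add0r.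
apply: sjet_ext (sjet_sum _ (fun ij => sjet_mul (hF ij.1 ij.2) (sjet_cst x v (L (delta_mx ij.1 ij.2) k l)))) => z.
by rewrite Lsum.
Qed.

End FirstOrder.

(** With N the derivative of P and d1 that of the denominator d, the hypothesis is the derivative of
    (d P)(d P) = d (d P); the terms in d1 cancel. *)
Lemma jet_idem_alg (R : realFieldType) n d d1 (P N : 'M[R]_n) : d != 0 -> P *m P = P ->
  (d *: P) *m (d1 *: P + d *: N) + (d1 *: P + d *: N) *m (d *: P) =
    d *: (d1 *: P + d *: N) + d1 *: (d *: P) -> N *m P + P *m N = N.
Proof.
move=> d0 PP; rewrite !mulmxDr !mulmxDl -!scalemxAr -!scalemxAl PP.
move: (P *m N) (N *m P) => Y Z e; apply/matrixP => i j.
have /matrixP/(_ i j) := e; rewrite !mxE; move: (Y i j) (Z i j) (P i j) (N i j) => y z q r e1.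
by apply: (mulfI (mulf_neq0 d0 d0)); lra.
Qed.

(** The same for the frame identity u (d P) = d u, with w the derivative of u. *)
Lemma jet_frame_alg (R : realFieldType) a n d d1 (P N : 'M[R]_n) (u w : 'M[R]_(a, n)) : d != 0 ->
  u *m P = u -> u *m (d1 *: P + d *: N) + w *m (d *: P) = d *: w + d1 *: u ->
  u *m N = w *m (1%:M - P).
Proof.
move=> d0 uP; rewrite !mulmxDr -!scalemxAr uP mulmx1 mulmxN.
move: (u *m N) (w *m P) => Y Z e; apply/matrixP => i j.
have /matrixP/(_ i j) := e; rewrite !mxE; move: (Y i j) (Z i j) (u i j) (w i j) => y z q r e1.
by apply: (mulfI d0); lra.
Qed.

Section JacobianFormula.
Variables (R : realType) (p : nat) (X : eqType) (cl : 'I_p -> X) (arr : rel X).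
Variables (b : pred 'I_p) (m : nat) (tix eix : 'I_m -> 'I_p * 'I_p).
Hypothesis tixI : injective tix.
Hypothesis eixI : injective eix.
Hypothesis tixP : forall i j, (exists k, tix k = (i, j)) <-> [&& b i, ~~ b j & cl i == cl j].
Hypothesis eixP : forall i j, (exists k, eix k = (i, j)) <-> [&& b i, ~~ b j & arr (cl i) (cl j)].
Local Notation P0 := (P0 R b).
Local Notation Q0 := (Q0 R b).
Local Notation phi := (@mxof R p m tix).
Local Notation ecoord := (@coord R p m eix).
Local Notation in0 := (@in0 R p X cl).
Local Notation in1 := (@in1 R p X cl arr).
Local Notation frameU := (@frameU R p b m tix).
Local Notation gmx := (@gmx R p X cl).
Local Notation cheq := (@cheq R p X cl arr b m tix eix).
Local Notation chartP := (@chartP R p X cl b m tix).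
Local Notation gramd := (@gramd R p m tix).
Local Notation nproj := (@nproj R p b m tix).

Lemma chartP_sym c x : (chartP c x)^T = chartP c x.
Proof. by have [_ ->] := isproj_conj (gmx0 R c) (gmxK R c) (isproj_projn tixP x). Qed.

Lemma chartP_idem c x : chartP c x *m chartP c x = chartP c x.
Proof. by have [_ _ ->] := isproj_conj (gmx0 R c) (gmxK R c) (isproj_projn tixP x). Qed.

Lemma frame_chartP c x : frameU x *m gmx c *m chartP c x = frameU x *m gmx c.
Proof.
have [h _] := spans_projn tixP x (gmxK R c); move: h.
by rewrite -/(chartP c x) !mulmxA -(frameUE tixP).
Qed.

Lemma chartP_frame c x : exists K, chartP c x = K *m (frameU x *m gmx c).
Proof.
have [_ [K]] := spans_projn tixP x (gmxK R c); rewrite -/(chartP c x) => eK; exists K.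
by rewrite {1}eK -mulmxA [P0 *m (_ *m _)]mulmxA -(frameUE tixP).
Qed.

Lemma nproj_conj c x : (gmx c)^T *m nproj x *m gmx c = gramd x *: chartP c x.
Proof. by rewrite nprojE -scalemxAr -scalemxAl. Qed.

Section AtPoint.
Variables (c : class_perm cl) (x v : 'rV[R]_m).
Let g := gmx c.
Let P := chartP c x.
Definition chart_h := (1%:M + phi x) *m g.
Definition chart_hi := g^T *m (1%:M - phi x).
(** The tangent vector as a homomorphism from the row space of [P] to its orthogonal complement; the
    derivative of the projection itself is the sum of this matrix and its transpose. *)
Definition tangent := P *m (chart_hi *m phi v *m chart_h) *m (1%:M - P).

Lemma chart_hK : chart_h *m chart_hi = 1%:M.
Proof.
by rewrite /chart_h /chart_hi !mulmxA -[_ *m g *m g^T]mulmxA /g gmxK mulmx1 (unip_inv tixP).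
Qed.

Lemma mjet_phi : mjet phi x v (phi x) (phi v).
Proof.
move=> i j; exists ((phi x i j)%:P + (phi v i j) *: 'X); split.
- by move=> e; rewrite mxofD mxofZ !mxE !hornerE mulrC.
- by rewrite coefD coefC coefZ coefX mulr0 addr0.
by rewrite coefD coefC coefZ coefX mulr1 add0r.
Qed.

Lemma mjet_frameU : mjet frameU x v (frameU x) (phi v).
Proof. by rewrite -[phi v]add0r; apply: mjet_add; [apply: mjet_cst | apply: mjet_phi]. Qed.

Lemma phi_h : phi v *m chart_h = phi v *m g.
Proof. by rewrite /chart_h mulmxA mulmxDr mulmx1 (tmx_tmx tixP) addr0. Qed.

Lemma hi_phi : chart_hi *m phi v = g^T *m phi v.
Proof. by rewrite /chart_hi -mulmxA mulmxBl mul1mx (tmx_tmx tixP) subr0. Qed.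

(** Differentiating idempotency, symmetry and absorption of the frame determines the derivative of
    the projection: the first two split it into P dP and its transpose, the last computes P dP. *)
Lemma proj_jet : exists d1 n1, [/\ sjet gramd x v (gramd x) d1,
  mjet (fun x => g^T *m nproj x *m g) x v (gramd x *: P) n1 &
  n1 = d1 *: P + gramd x *: (tangent + tangent^T)].
Proof.
have [d1 hd] := sjet_ex x v (polyf_gramd R tix).
have [n1 hn] := mjet_ex x v (mxpolyf_chart_nproj R b tix c).
exists d1, n1; split=> //; first by rewrite -nproj_conj.
have hn0 : mjet (fun x => g^T *m nproj x *m g) x v (gramd x *: P) n1 by rewrite -nproj_conj.
have d0 := gramd_neq0 tix x; set d := gramd x in d0 hn0 *.
have hU : mjet (fun z => frameU z *m g) x v (frameU x *m g) (phi v *m g).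
  by have := mjet_mul mjet_frameU (mjet_cst g x v); rewrite mulmx0 add0r.
have UN z : frameU z *m g *m (g^T *m nproj z *m g) = gramd z *: (frameU z *m g).
  by rewrite nproj_conj -scalemxAr frame_chartP.
have NN z : (g^T *m nproj z *m g) *m (g^T *m nproj z *m g) = gramd z *: (g^T *m nproj z *m g).
  by rewrite nproj_conj -scalemxAr -scalemxAl chartP_idem.
have NT z : (g^T *m nproj z *m g)^T = g^T *m nproj z *m g.
  by rewrite nproj_conj; apply/matrixP => i j; rewrite mxE [LHS]mxE [RHS]mxE -{2}chartP_sym [X in _ = _ * X]mxE.
have [_ e1] := mjet_uniq (mjet_mul hU hn0) (mjet_ext (fun z => esym (UN z)) (mjet_scale hd hU)).
have [_ e2] := mjet_uniq (mjet_mul hn0 hn0) (mjet_ext (fun z => esym (NN z)) (mjet_scale hd hn0)).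
have [_ e3] := mjet_uniq (mjet_tr hn0) (mjet_ext (fun z => esym (NT z)) hn0).
pose dP := d^-1 *: (n1 - d1 *: P).
have en : n1 = d1 *: P + d *: dP by rewrite /dP scalerA mulfV // scale1r addrC subrK.
have sP : dP^T = dP.
  have tD (A B : 'M[R]_p) c1 c2 : (c1 *: (A - c2 *: B))^T = c1 *: (A^T - c2 *: B^T).
    by apply/matrixP => i j; rewrite !mxE.
  by rewrite /dP tD e3 chartP_sym.
have iP : dP *m P + P *m dP = dP.
  by apply: (jet_idem_alg (d1 := d1) d0 (chartP_idem c x)); rewrite -en.
have uP : frameU x *m g *m dP = phi v *m g *m (1%:M - P).
  by apply: (jet_frame_alg (d1 := d1) d0 (frame_chartP c x)); rewrite -en.
have PdP : P *m dP = tangent.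
  have [K] := chartP_frame c x; rewrite -/P -/g => eK.
  have eh : frameU x *m g = P0 *m chart_h by rewrite /chart_h mulmxA -(frameUE tixP).
  have e4 : frameU x *m g *m (chart_hi *m phi v *m chart_h) = phi v *m g.
    have gen (h hi w : 'M[R]_p) : h *m hi = 1%:M -> P0 *m h *m (hi *m w *m h) = P0 *m w *m h.
      by move=> e; rewrite !mulmxA -[P0 *m h *m hi]mulmxA e mulmx1.
    by rewrite eh (gen _ _ _ chart_hK) (P0_tmx tixP) phi_h.
  have e5 : P *m (chart_hi *m phi v *m chart_h) = K *m (phi v *m g) by have := congr1 (mulmx K) e4; rewrite mulmxA -eK.
  by rewrite /tangent e5 -[RHS]mulmxA -uP [RHS]mulmxA -eK.
rewrite {1}en -[in LHS]iP; congr (_ + _ *: _); rewrite addrC -{1}PdP; congr (_ + _).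
by rewrite -PdP trmx_mul sP chartP_sym.
Qed.

Lemma P0_chart_h : P0 *m chart_h = frameU x *m g.
Proof. by rewrite /chart_h mulmxA -(frameUE tixP). Qed.

Lemma chart_spans : spans b P chart_h.
Proof. exact: (spans_projn tixP x (gmxK R c)). Qed.

Lemma chart_h_unit : chart_h \in unitmx.
Proof. by have [] := mulmx1_unit chart_hK. Qed.

Lemma chart_h_inv : invmx chart_h = chart_hi.
Proof. by apply: (can_inj (mulKmx chart_h_unit)); rewrite mulmxV ?chart_h_unit // chart_hK. Qed.

Lemma in0_chart_h : in0 chart_h.
Proof.
apply: in0_mul; last exact: gmx0.
by apply: in0_add; [apply: in0_1 | apply: (in0_tmx tixP)].
Qed.

Lemma in0_chart_hi : in0 chart_hi.
Proof.
apply: in0_mul; first by apply: in0_tr; apply: gmx0.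
by apply: in0_sub; [apply: in0_1 | apply: (in0_tmx tixP)].
Qed.

Lemma P_hi_Q0 : P *m chart_hi *m Q0 = 0.
Proof.
have [_ [K eK]] := chart_spans.
rewrite eK; move: chart_hK; move: chart_h chart_hi => h hi hh.
by rewrite -!mulmxA [h *m _]mulmxA hh mul1mx (P0Q0 R b) mulmx0.
Qed.

Lemma tangentK : P0 *m (chart_h *m tangent *m chart_hi) *m Q0 = phi v.
Proof.
have [e _] := chart_spans.
have -> : P0 *m (chart_h *m tangent *m chart_hi) *m Q0 =
    P0 *m chart_h *m P *m (chart_hi *m phi v *m chart_h) *m ((1%:M - P) *m chart_hi *m Q0).
  by rewrite /tangent !mulmxA.
rewrite e mulmxBl mul1mx mulmxBl P_hi_Q0 subr0.
have -> : P0 *m chart_h *m (chart_hi *m phi v *m chart_h) *m (chart_hi *m Q0) =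
   P0 *m (chart_h *m chart_hi) *m phi v *m (chart_h *m chart_hi) *m Q0 by rewrite !mulmxA.
by rewrite chart_hK !mulmx1 (P0_tmx tixP) (tmx_Q0 tixP).
Qed.

Lemma in0_P : in0 P.
Proof. by have [] := isproj_conj (gmx0 R c) (gmxK R c) (isproj_projn tixP x). Qed.

Lemma in0_tangent : in0 tangent.
Proof.
apply: in0_mul; last by apply: in0_sub; [apply: in0_1 | apply: in0_P].
apply: in0_mul; first exact: in0_P.
apply: in0_mul; last exact: in0_chart_h.
by apply: in0_mul; [apply: in0_chart_hi | apply: (in0_tmx tixP)].
Qed.

Lemma tangent_PQ : P *m tangent *m (1%:M - P) = tangent.
Proof.
have PP : P *m P = P := chartP_idem c x.
have QQ : (1%:M - P) *m (1%:M - P) = 1%:M - P.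
  by rewrite mulmxBr mulmx1 mulmxBl mul1mx PP subrr subr0.
have gen (A B C : 'M[R]_p) : A *m A = A -> C *m C = C -> A *m (A *m B *m C) *m C = A *m B *m C.
  by move=> AA CC; rewrite !mulmxA AA -!mulmxA CC.
exact: gen.
Qed.

(* First-order variation of the equation at a zero: the variation of the
   denominator is killed by the equation itself. *)
Lemma cheq_jet y S1 : cheq c y x = 0 ->
  (forall d1 n1, sjet gramd x v (gramd x) d1 ->
   mjet (fun z => g^T *m nproj z *m g) x v (gramd x *: P) n1 ->
   n1 = d1 *: P + gramd x *: (tangent + tangent^T) ->
   mjet (fun z => sect cl arr y (gramd z) (g^T *m nproj z *m g)) x v
     (gramd x ^+ 2 *: sect cl arr y 1 P) ((2 * gramd x * d1) *: sect cl arr y 1 P + gramd x ^+ 2 *: S1)) ->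
  forall A, jacobian (cheq c y) x A -> v *m A = gramd x ^+ 2 *:
    ecoord (phi v *m chart_h *m sect cl arr y 1 P *m chart_hi -
            chart_h *m sect cl arr y 1 P *m chart_hi *m phi v + chart_h *m S1 *m chart_hi).
Proof.
move=> f0 hS A jA; have [d1 [n1 [hd hn en]]] := proj_jet.
have {}hS := hS d1 n1 hd hn en.
have e0 : ecoord (local_sect b tix c (sect cl arr y 1 P) x) = 0.
  by apply/eqP; move/eqP: f0; rewrite cheqE scaler_eq0 expf_eq0 (negPf (gramd_neq0 tix x)).
move: hS e0; set S0 := sect cl arr y 1 P => hS e0.
have hU : mjet (fun z => frameU z *m g) x v (frameU x *m g) (phi v *m g).
  by have := mjet_mul mjet_frameU (mjet_cst g x v); rewrite mulmx0 add0r.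
have hV : mjet (fun z => 1%:M - phi z) x v (1%:M - phi x) (- phi v).
  have := mjet_add (mjet_cst 1%:M x v) (mjet_linear (L := fun A => - A) (fun s A B => _) mjet_phi).
  rewrite add0r; apply => s A0 B0; by rewrite opprD scalerN.
have hF := mjet_mul (mjet_mul (mjet_mul hU hS) (mjet_cst g^T x v)) hV.
move: hF; set F1 := (X in mjet _ x v _ X) => hF.
have eA : v *m A = ecoord F1.
  have [a2 ha] := jA v; apply/rowP => k; have [q [eq q1 _]] := ha k.
  have [q' [eq' _ q1']] := hF (eix k).1 (eix k).2.
  rewrite [RHS]mxE -q1' -q1; suff -> : q = q' by [].
  by apply: poly_fun_inj => e; rewrite -eq -eq' mxE.
have PQ B : ecoord (P0 *m B) = ecoord B.
  by rewrite -[LHS](coord_eix_PQ eixP) mulmxA (P0P0 R b) (coord_eix_PQ eixP).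
rewrite eA -[in RHS]PQ.
have -> : F1 = (2 * gramd x * d1) *: local_sect b tix c S0 x + gramd x ^+ 2 *:
    (P0 *m (phi v *m chart_h *m S0 *m chart_hi - chart_h *m S0 *m chart_hi *m phi v + chart_h *m S1 *m chart_hi)).
  have -> : P0 *m (phi v *m chart_h *m S0 *m chart_hi - chart_h *m S0 *m chart_hi *m phi v + chart_h *m S1 *m chart_hi) =
     phi v *m g *m S0 *m chart_hi - frameU x *m g *m S0 *m (g^T *m phi v) + frameU x *m g *m S1 *m chart_hi.
    rewrite mulmxDr mulmxBr phi_h -hi_phi -P0_chart_h !mulmxA (P0_tmx tixP).
    by [].
  rewrite /F1 /local_sect -/g /chart_hi.
  move: (frameU x *m g) (phi v *m g) (g^T) (phi v) (1%:M - phi x) => U V gT w Y.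
  rewrite mulmx0 add0r mulmxDr -!scalemxAr !mulmxDl -!scalemxAl !mulmxN.
  rewrite !mulmxA; move: (U *m S0 *m gT *m w) (U *m S0 *m gT *m Y) (U *m S1 *m gT *m Y) (V *m S0 *m gT *m Y) => a1 a2 a3 a4.
  by apply/matrixP => i j; rewrite !mxE; ring.
by rewrite coordD coordZ e0 scaler0 add0r coordZ.
Qed.

(** Conjugation by [chart_h] turns the block condition into one on P; stability of the row space
    under [S0] then replaces the conjugate of phi v by its tangent part. For S1 = 0 the solutions
    are the homomorphisms from the subrepresentation to the quotient. *)
Lemma cheq_jet_eq0 (S0 S1 : 'M[R]_p) : in1 S0 -> in1 S1 -> P *m S0 *m (1%:M - P) = 0 ->
  ecoord (phi v *m chart_h *m S0 *m chart_hi - chart_h *m S0 *m chart_hi *m phi v +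
    chart_h *m S1 *m chart_hi) = 0 <->
  tangent *m S0 *m (1%:M - P) - P *m S0 *m tangent + P *m S1 *m (1%:M - P) = 0.
Proof.
move=> S01 S11 z0; set G := _ + _.
have hh := in0_chart_h; have hi := in0_chart_hi; have hp := in0_tmx tixP v.
have G1 : in1 G.
  have i1 A B : in1 A -> in1 B -> in1 (A + B) by move=> a1 b1 i j ij; rewrite mxE a1 ?b1 ?addr0.
  have iN A : in1 A -> in1 (- A) by move=> a1 i j ij; rewrite mxE a1 ?oppr0.
  apply: (i1 _ _); last by apply: in1_in0 => //; apply: in0_in1.
  apply: (i1 _ _); first by apply: in1_in0 => //; apply: in0_in1 => //; apply: in0_mul.
  by apply: (iN _); apply: in1_in0 => //; apply: in1_in0 => //; apply: in0_in1.
rewrite (coord_eix_eq0 eixI eixP G1).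
pose Psi := chart_hi *m phi v *m chart_h.
have -> : G = chart_h *m (Psi *m S0 - S0 *m Psi + S1) *m chart_hi.
  have gen (h hi' w S S' : 'M[R]_p) : h *m hi' = 1%:M ->
      w *m h *m S *m hi' - h *m S *m hi' *m w + h *m S' *m hi' =
      h *m (hi' *m w *m h *m S - S *m (hi' *m w *m h) + S') *m hi'.
    move=> e; rewrite mulmxDr mulmxBr !mulmxDl mulNmx !mulmxA e mul1mx.
    by rewrite -[_ *m w *m h *m hi']mulmxA e mulmx1.
  exact: gen chart_hK.
rewrite -chart_h_inv -(spans_zero _ chart_h_unit chart_spans).
have eS : P *m S0 = P *m S0 *m P by move/eqP: z0; rewrite mulmxBr mulmx1 subr_eq0 => /eqP.
have eS' : P *m (Psi *m S0) *m (1%:M - P) = tangent *m S0 *m (1%:M - P).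
  have gen (B A S : 'M[R]_p) : B *m S *m (1%:M - B) = 0 ->
      B *m (A *m S) *m (1%:M - B) = B *m A *m (1%:M - B) *m S *m (1%:M - B).
    move=> e; rewrite -!mulmxA; congr (_ *m (_ *m _)).
    by rewrite [in RHS]mulmxBl mul1mx [B *m (S *m _)]mulmxA e subr0.
  exact: gen.
have eS'' : P *m (S0 *m Psi) *m (1%:M - P) = P *m S0 *m tangent.
  have gen (B A S : 'M[R]_p) : B *m S = B *m S *m B ->
      B *m (S *m A) *m (1%:M - B) = B *m S *m (B *m A *m (1%:M - B)).
    by move=> e; rewrite !mulmxA -e.
  exact: gen.
have dist (B S T U C : 'M[R]_p) : B *m (S - T + U) *m C = B *m S *m C - B *m T *m C + B *m U *m C.
  by rewrite mulmxDr mulmxBr !mulmxDl mulNmx.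
by rewrite dist eS' eS''.
Qed.

End AtPoint.
End JacobianFormula.

End FirstOrder.

(** * Doubled indices and complex matrices as real ones *)

Module ComplexStructure.
Import all_boot all_order all_algebra all_fingroup complex.
Import reals.
Import zify ring.
Import Graded Projections.
Import Order.TTheory GRing.Theory Num.Theory.
Local Open Scope ring_scope.

Section Doubling.
Variable q : nat.
(** The index set of C^q as a real space: [hd] is the complex index, [eps] tells the real copy from
    the imaginary one, and [fl] exchanges them. *)
Definition hd (i : 'I_(q + q)) : 'I_q := match split i with inl h => h | inr h => h end.
Definition eps (i : 'I_(q + q)) : bool := if split i is inr _ then true else false.
Definition emb (e : bool) (h : 'I_q) : 'I_(q + q) := if e then rshift q h else lshift q h.
Definition fl i := emb (~~ eps i) (hd i).

Lemma hd_emb e h : hd (emb e h) = h.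
Proof. by rewrite /hd /emb; case: e; [rewrite (unsplitK (inr h)) | rewrite (unsplitK (inl h))]. Qed.
Lemma eps_emb e h : eps (emb e h) = e.
Proof. by rewrite /eps /emb; case: e; [rewrite (unsplitK (inr h)) | rewrite (unsplitK (inl h))]. Qed.
Lemma emb_hd i : emb (eps i) (hd i) = i.
Proof. by rewrite /emb /eps /hd -[RHS]splitK; case: (split i). Qed.
Lemma hd_fl i : hd (fl i) = hd i. Proof. exact: hd_emb. Qed.
Lemma eps_fl i : eps (fl i) = ~~ eps i. Proof. exact: eps_emb. Qed.
Lemma flK : involutive fl.
Proof. by move=> i; rewrite /fl hd_emb eps_emb negbK emb_hd. Qed.
Lemma double_eq i j : hd i = hd j -> eps i = eps j -> i = j.
Proof. by move=> e e'; rewrite -(emb_hd i) e e' emb_hd. Qed.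
Definition flperm : 'S_(q + q) := perm (inv_inj flK).
Lemma flpermE i : flperm i = fl i. Proof. exact: permE. Qed.
Lemma embP (T : Type) (f g : 'I_(q + q) -> T) :
  (forall e h, f (emb e h) = g (emb e h)) -> f =1 g.
Proof. by move=> h i; rewrite -(emb_hd i). Qed.
End Doubling.

Section DoubleIndex.
Variables (q mc : nat) (ix : 'I_mc -> 'I_q * 'I_q).
(** A complex matrix entry occupies a 2 x 2 block of real entries; the outer bit of [k] selects the
    column copy and the inner one the row copy. *)
Definition ixR (k : 'I_((mc + mc) + (mc + mc))) : 'I_(q + q) * 'I_(q + q) :=
  (emb (eps (hd k)) (ix (hd (hd k))).1, emb (eps k) (ix (hd (hd k))).2).
Definition flL (k : 'I_((mc + mc) + (mc + mc))) := emb (eps k) (fl (hd k)).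
Lemma ixR_fl k : ixR (fl k) = ((ixR k).1, fl (ixR k).2).
Proof. by rewrite /ixR hd_fl eps_fl /= /fl hd_emb eps_emb. Qed.
Lemma ixR_flL k : ixR (flL k) = (fl (ixR k).1, (ixR k).2).
Proof. by rewrite /ixR /flL !hd_emb !eps_emb /= [in RHS]/fl hd_emb eps_emb. Qed.
Lemma ixR_inj : injective ix -> injective ixR.
Proof.
move=> ixI k k' [] e1 e2.
have h1 := congr1 (@hd _) e1; have h2 := congr1 (@hd _) e2; rewrite !hd_emb in h1 h2.
have h3 := congr1 (@eps _) e1; have h4 := congr1 (@eps _) e2; rewrite !eps_emb in h3 h4.
apply: double_eq => //; apply: double_eq => //; apply: ixI.
by rewrite [LHS]surjective_pairing h1 h2 -surjective_pairing.
Qed.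
Lemma ixRP i j : (exists k, ixR k = (i, j)) <-> exists k, ix k = (hd i, hd j).
Proof.
split=> [[k [<- <-]]|[k e]].
  by exists (hd (hd k)); rewrite !hd_emb -surjective_pairing.
exists (emb (eps j) (emb (eps i) k)).
by rewrite /ixR !hd_emb !eps_emb e /= !emb_hd.
Qed.
End DoubleIndex.

Section ComplexStructure.
Variable R : realType.
Local Notation C := (complex R).
Definition Jm a : 'M[R]_(a + a) := block_mx 0 1%:M (- 1%:M) 0.

Lemma mulJr a b (A : 'M[R]_(a, b + b)) i j :
  (A *m Jm b) i j = (if eps j then 1 else -1) * A i (fl j).
Proof.
move: j; apply: embP => e h; rewrite /fl hd_emb !eps_emb /emb.
rewrite -[A]hsubmxK /Jm mul_row_block !mulmx0 !mulmxN !mulmx1 add0r addr0; case: e => /=.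
  by rewrite row_mxEr row_mxEl mul1r.
by rewrite row_mxEl row_mxEr !mxE mulN1r.
Qed.
Lemma mulJl a b (A : 'M[R]_(a + a, b)) i j :
  (Jm a *m A) i j = (if eps i then -1 else 1) * A (fl i) j.
Proof.
move: i; apply: embP => e h; rewrite /fl hd_emb !eps_emb /emb.
rewrite -[A]vsubmxK /Jm mul_block_col !mul0mx !mulNmx !mul1mx add0r addr0; case: e => /=.
  by rewrite col_mxEd col_mxEu !mxE mulN1r.
by rewrite col_mxEu col_mxEd mul1r.
Qed.
Lemma JmT a : (Jm a)^T = - Jm a.
Proof. by rewrite /Jm tr_block_mx !trmx0 linearN /= trmx1 opp_block_mx !oppr0 opprK. Qed.
Lemma JmJ a : Jm a *m Jm a = - 1%:M.
Proof.
by rewrite /Jm mulmx_block !mulmx0 !mul0mx !mulmx1 !mul1mx !addr0 !add0r scalar_mx_block opp_block_mx !oppr0.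
Qed.

Section Coord.
Variables (q mc : nat) (tix eix : 'I_mc -> 'I_q * 'I_q).
Hypothesis tixI : injective tix.
Hypothesis eixI : injective eix.
Local Notation tR := (ixR tix).
Local Notation eR := (ixR eix).
Lemma coordJ (A : 'M[R]_(q + q)) : coord tR (A *m Jm q) = coord tR A *m Jm (mc + mc).
Proof.
apply/rowP => k; rewrite mulJr [LHS]mxE [X in _ = _ * X]mxE mulJr ixR_fl /=.
by rewrite [eps (emb _ _)]eps_emb.
Qed.
(** Identifies the tangent block with the fibre block through their common index set. It commutes
    with [Jm] on either side, although the two spaces are not otherwise related. *)
Definition shift_mx (A : 'M[R]_(q + q)) := mxof eR (coord tR A).
Lemma shift_mxE A k : shift_mx A (eR k).1 (eR k).2 = A (tR k).1 (tR k).2.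
Proof. by rewrite /shift_mx mxofE ?mxE //; apply: ixR_inj. Qed.
Lemma shift_out A i j : ~ (exists k, eR k = (i, j)) -> shift_mx A i j = 0.
Proof. by move=> h; apply: mxof_out => k; apply/eqP => e; apply: h; exists k. Qed.
Lemma shiftJr A : shift_mx (A *m Jm q) = shift_mx A *m Jm q.
Proof.
apply/matrixP => i j; rewrite mulJr; have [[k e]|ne] := boolp.pselect (exists k, eR k = (i, j)).
  have -> : i = (eR k).1 by rewrite e. have -> : j = (eR k).2 by rewrite e.
  have := shift_mxE A (fl k); rewrite !ixR_fl /= => ->.
  by rewrite shift_mxE mulJr /= !eps_emb.
rewrite !shift_out ?mulr0 // => -[k e]; apply: ne; exists (fl k); by rewrite ixR_fl e /= flK.
Qed.
Lemma shiftJl A : shift_mx (Jm q *m A) = Jm q *m shift_mx A.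
Proof.
apply/matrixP => i j; rewrite mulJl; have [[k e]|ne] := boolp.pselect (exists k, eR k = (i, j)).
  have -> : i = (eR k).1 by rewrite e. have -> : j = (eR k).2 by rewrite e.
  have := shift_mxE A (flL k); rewrite !ixR_flL /= => ->.
  by rewrite shift_mxE mulJl /= !eps_emb.
rewrite !shift_out ?mulr0 // => -[k e]; apply: ne; exists (flL k); by rewrite ixR_flL e /= flK.
Qed.
Lemma shift_lin a A B : shift_mx (a *: A + B) = a *: shift_mx A + shift_mx B.
Proof. by rewrite /shift_mx coordD coordZ mxofD mxofZ. Qed.
End Coord.

Definition re a b (Z : 'M[C]_(a, b)) : 'M[R]_(a, b) := map_mx (@complex.Re R) Z.
Definition im a b (Z : 'M[C]_(a, b)) : 'M[R]_(a, b) := map_mx (@complex.Im R) Z.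
(** Complex linear maps as real ones, for row vectors split into real and imaginary parts; the image
    is the set of matrices compatible with [Jm]. *)
Definition rho a b (Z : 'M[C]_(a, b)) : 'M[R]_(a + a, b + b) :=
  block_mx (re Z) (im Z) (- im Z) (re Z).
Definition cx a b (A : 'M[R]_(a + a, b + b)) : 'M[C]_(a, b) :=
  \matrix_(i, j) Complex (ulsubmx A i j) (ursubmx A i j).

Let ReD (x y : C) : complex.Re (x + y) = complex.Re x + complex.Re y.
Proof. by case: x y => [? ?] []. Qed.
Let ImD (x y : C) : complex.Im (x + y) = complex.Im x + complex.Im y.
Proof. by case: x y => [? ?] []. Qed.
Lemma reM a b c (Z : 'M[C]_(a, b)) (Z' : 'M[C]_(b, c)) :
  re (Z *m Z') = re Z *m re Z' - im Z *m im Z'.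
Proof.
apply/matrixP => i j; rewrite !mxE (big_morph _ ReD (erefl _)) -sumrB; apply: eq_bigr => k _.
by rewrite !mxE; case: (Z i k) (Z' k j) => [? ?] [].
Qed.
Lemma imM a b c (Z : 'M[C]_(a, b)) (Z' : 'M[C]_(b, c)) :
  im (Z *m Z') = re Z *m im Z' + im Z *m re Z'.
Proof.
apply/matrixP => i j; rewrite !mxE (big_morph _ ImD (erefl _)) -big_split; apply: eq_bigr => k _.
by rewrite !mxE; case: (Z i k) (Z' k j) => [? ?] [].
Qed.
Lemma rhoM a b c (Z : 'M[C]_(a, b)) (Z' : 'M[C]_(b, c)) : rho (Z *m Z') = rho Z *m rho Z'.
Proof.
rewrite /rho mulmx_block reM imM !mulNmx !mulmxN opprD; congr block_mx.
  by rewrite addrC.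
by rewrite addrC.
Qed.
Lemma rhoD a b (Z Z' : 'M[C]_(a, b)) : rho (Z + Z') = rho Z + rho Z'.
Proof.
have eR : re (Z + Z') = re Z + re Z' by apply/matrixP => i j; rewrite !mxE ReD.
have eI : im (Z + Z') = im Z + im Z' by apply/matrixP => i j; rewrite !mxE ImD.
by rewrite /rho eR eI add_block_mx opprD.
Qed.
Lemma rho1 a : rho (1%:M : 'M[C]_a) = 1%:M.
Proof.
have -> : rho (1%:M : 'M[C]_a) = block_mx 1%:M 0 0 1%:M.
  have e1 : re (1%:M : 'M[C]_a) = 1%:M by apply/matrixP => i j; rewrite !mxE; case: eqP.
  have e2 : im (1%:M : 'M[C]_a) = 0 by apply/matrixP => i j; rewrite !mxE; case: eqP.
  by rewrite /rho e1 e2 oppr0.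
by rewrite -scalar_mx_block.
Qed.
Lemma rhoK a b (Z : 'M[C]_(a, b)) : cx (rho Z) = Z.
Proof.
apply/matrixP => i j; rewrite mxE /rho block_mxKul block_mxKur !mxE; by case: (Z i j).
Qed.
Lemma rho_inj a b : injective (@rho a b). Proof. exact: can_inj (@rhoK a b). Qed.
Lemma rho0 a b : rho (0 : 'M[C]_(a, b)) = 0.
Proof. by have := rhoD (0 : 'M[C]_(a, b)) 0; rewrite addr0 => /eqP; rewrite eq_sym -subr_eq0 addrK => /eqP. Qed.
Lemma rhoN a b (Z : 'M[C]_(a, b)) : rho (- Z) = - rho Z.
Proof. by apply/eqP; rewrite -addr_eq0 -rhoD addNr rho0. Qed.
Lemma rhoB a b (Z Z' : 'M[C]_(a, b)) : rho (Z - Z') = rho Z - rho Z'.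
Proof. by rewrite rhoD rhoN. Qed.
Lemma rhoJ a b (Z : 'M[C]_(a, b)) : rho Z *m Jm b = Jm a *m rho Z.
Proof.
by rewrite /rho /Jm !mulmx_block !mulmx0 !mul0mx !mulmxN !mulNmx !mulmx1 !mul1mx !addr0 !add0r ?opprK.
Qed.
Lemma cxK a b (A : 'M[R]_(a + a, b + b)) : A *m Jm b = Jm a *m A -> rho (cx A) = A.
Proof.
have := submxK A; set u := ulsubmx A; set v := ursubmx A; set w := dlsubmx A; set z := drsubmx A => <-.
rewrite /Jm !mulmx_block !mulmx0 !mul0mx !mulmxN !mulNmx !mulmx1 !mul1mx !addr0 !add0r.
move=> /eq_block_mx [e1 e2 _ _]; rewrite -e1 -e2 /rho.
have e i j : cx (block_mx u v (- v) u) i j = Complex (u i j) (v i j) by rewrite mxE block_mxKul block_mxKur.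
congr block_mx.
- by apply/matrixP => i j; rewrite [LHS]mxE e.
- by apply/matrixP => i j; rewrite [LHS]mxE e.
- by congr (- _); apply/matrixP => i j; rewrite [LHS]mxE e.
by apply/matrixP => i j; rewrite [LHS]mxE e.
Qed.

(** Over C the realification is conjugate to a block triangular matrix with diagonal blocks Z and
    its conjugate, so that its determinant is |det Z|^2. *)
Lemma det_rho_ge0 a (Z : 'M[C]_a) : 0 <= \det (rho Z).
Proof.
pose tc b c := map_mx (real_complex R) : 'M[R]_(b, c) -> 'M[C]_(b, c).
pose I : C := Complex 0 1.
have II : I * I = -1 by rewrite -expr2 sqr_i.
pose X := tc _ _ (re Z); pose Y := tc _ _ (im Z).
have eZ : Z = X + I *: Y.
  apply/matrixP => i j; rewrite !mxE; case: (Z i j) => x y /=; apply/eqP.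
  by rewrite eq_complex /=; simpc; rewrite ?eqxx.
have eZb : map_mx (@conjc R) Z = X - I *: Y.
  apply/matrixP => i j; rewrite !mxE; case: (Z i j) => x y /=; apply/eqP.
  by rewrite eq_complex /=; simpc; rewrite ?eqxx.
have key : block_mx 1%:M 0 (- I *: 1%:M) 1%:M *m tc _ _ (rho Z) *m block_mx 1%:M 0 (I *: 1%:M) 1%:M =
   block_mx Z Y 0 (map_mx (@conjc R) Z).
  rewrite /tc /rho map_block_mx -/(tc _ _ _) map_mxN -/(tc a a (im Z)) -/Y -/(tc a a (re Z)) -/X.
  rewrite !mulmx_block !mulmx0 !mul0mx !mulmx1 !mul1mx !addr0 !add0r.
  rewrite -!scalemxAl -!scalemxAr !mulmx1 !mul1mx; congr block_mx.
  - by rewrite -eZ.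
  - have -> : - I *: X - Y + I *: (- I *: Y + X) = - (1 + I * I) *: Y.
      by apply/matrixP => i j; rewrite !mxE; ring.
    by rewrite II subrr oppr0 scale0r.
  by rewrite eZb scaleNr addrC.
have := congr1 determinant key.
rewrite !det_mulmx !det_lblock det_ublock !det1 !mul1r mulr1 /tc !det_map_mx => e.
by rewrite -ler0c e mulcJ_ge0.
Qed.
Lemma det_commJ_ge0 a (A : 'M[R]_(a + a)) : A *m Jm a = Jm a *m A -> 0 <= \det A.
Proof. by move=> /cxK <-; apply: det_rho_ge0. Qed.

Definition cxv a (v : 'rV[R]_(a + a)) : 'rV[C]_a := \row_j Complex (v 0 (lshift a j)) (v 0 (rshift a j)).
Lemma cxv_mul a b (v : 'rV[R]_(a + a)) (Z : 'M[C]_(a, b)) : cxv (v *m rho Z) = cxv v *m Z.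
Proof.
have e c (u : 'rV[R]_(c + c)) : re (cxv u) = lsubmx u /\ im (cxv u) = rsubmx u.
  by split; apply/rowP => j; rewrite !mxE.
have inj c (u u' : 'rV[C]_c) : re u = re u' -> im u = im u' -> u = u'.
  move=> /rowP h /rowP h'; apply/rowP => j; have := h j; have := h' j; rewrite !mxE.
  by case: (u 0 j) (u' 0 j) => [? ?] [? ?] /= -> ->.
have [e1 e2] := e _ (v *m rho Z); have [e3 e4] := e _ v.
apply: inj; rewrite ?e1 ?e2 ?reM ?imM e3 e4 -[v in LHS]hsubmxK /rho mul_row_block ?row_mxKl ?row_mxKr ?mulmxN //.
Qed.
Lemma cxv_eq0 a (v : 'rV[R]_(a + a)) : cxv v = 0 -> v = 0.
Proof.
move=> /rowP h; apply/rowP; apply: embP => e j; have := h j; rewrite !mxE => -[h1 h2].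
by case: e.
Qed.

Lemma rho_unit a (Z : 'M[C]_a) : Z \in unitmx -> rho Z \in unitmx.
Proof.
by move=> u; have := rhoM Z (invmx Z); rewrite mulmxV // rho1 => /esym /mulmx1_unit [].
Qed.
Lemma rank_rho a b (Z : 'M[C]_(a, b)) : \rank (rho Z) = (2 * \rank Z)%N.
Proof.
have e : rho (pid_mx (\rank Z) : 'M[C]_(a, b)) = block_mx (pid_mx (\rank Z)) 0 0 (pid_mx (\rank Z)).
  have e1 : re (pid_mx (\rank Z) : 'M[C]_(a, b)) = pid_mx (\rank Z).
    by apply/matrixP => i j; rewrite !mxE; case: (_ && _).
  have e2 : im (pid_mx (\rank Z) : 'M[C]_(a, b)) = 0.
    by apply/matrixP => i j; rewrite !mxE; case: (_ && _).
  by rewrite /rho e1 e2 oppr0.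
rewrite -{1}(mulmx_ebase Z) !rhoM.
have -> : \rank (rho (col_ebase Z) *m rho (pid_mx (\rank Z)) *m rho (row_ebase Z)) = \rank (rho (pid_mx (\rank Z) : 'M[C]_(a, b))).
  rewrite mxrankMfree ?row_free_unit ?rho_unit ?row_ebase_unit //.
  have fu : row_full (rho (col_ebase Z)) by rewrite row_full_unit rho_unit // col_ebase_unit.
  by rewrite (eqmxMfull _ fu).
by rewrite e rank_diag_block_mx !rank_pid_mx ?rank_leq_row ?rank_leq_col // mul2n addnn.
Qed.
Lemma rho_submx a a' b (Z : 'M[C]_(a, b)) (Z' : 'M[C]_(a', b)) : (rho Z <= rho Z')%MS = (Z <= Z')%MS.
Proof.
apply/idP/idP => [/submxP [D e]|/submxP [D ->]]; last by rewrite rhoM submxMl.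
rewrite submxE; apply/eqP/rho_inj; rewrite rhoM e -mulmxA -rhoM mulmx_coker ?rho0 ?mulmx0 ?rho0 //.
Qed.
End ComplexStructure.

End ComplexStructure.

(** * Perturbations equivariant under the rotations *)

Module Perturbations.
Import all_boot all_order all_algebra all_fingroup complex.
Import boolp reals.
Import zify ring lra.
Import mpoly.
Import PolynomialFunctions Graded Projections Genericity ChartEquations FirstOrder ComplexStructure.
Import Order.TTheory GRing.Theory Num.Theory.
Local Open Scope ring_scope.

Lemma polyf_both_neq0 (R : realFieldType) n (f g : 'rV[R]_n -> R) : polyf f -> polyf g ->
  (exists x, f x != 0) -> (exists x, g x != 0) -> exists x, f x != 0 /\ g x != 0.
Proof.
move=> /polyf_mpoly [P eP] /polyf_mpoly [Q eQ] [x fx] [x' gx].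
have P0 : P != 0 by apply: contraNneq fx => e; rewrite -eP e meval0.
have Q0 : Q != 0 by apply: contraNneq gx => e; rewrite -eQ e meval0.
have [y] := meval_neq0 (mulf_neq0 P0 Q0); rewrite mevalM mulf_eq0 negb_or => /andP [h1 h2].
exists (\row_i y i); rewrite -eP -eQ.
have -> : (\row_i y i) 0 = y by apply/funext => i; rewrite mxE.
by [].
Qed.

Lemma negligible_empty (R : realFieldType) n (B : 'rV[R]_n -> Prop) : (forall y, ~ B y) -> negligible B.
Proof. by move=> h; exists 1; [apply: oner_neq0 | move=> y /h]. Qed.

Lemma negligible_polyf (R : realFieldType) n (f : 'rV[R]_n -> R) : polyf f -> (exists s, f s != 0) ->
  negligible (fun s => f s = 0).
Proof.
move=> /polyf_mpoly [P eP] [s fs]; exists P; first by apply: contraNneq fs => e; rewrite -eP e meval0.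
by move=> y; rewrite eP.
Qed.

(** A maximal free family in the subspace spans it. The admissible perturbations thus become a
    parameter space to which the dimension count applies. *)
Lemma span_matrix (F : fieldType) D (S : 'rV[F]_D -> Prop) : S 0 ->
  (forall c y y', S y -> S y' -> S (c *: y + y')) ->
  exists n, exists B : 'M[F]_(n, D), forall y, S y <-> exists s, y = s *m B.
Proof.
move=> S0 Slin.
pose Q n := `[< exists B : 'M[F]_(n, D), row_free B /\ forall i, S (row i B) >].
have Q0 : exists n, Q n.
  exists 0%N; apply/asboolP; exists 0; split; last by case.
  by rewrite /row_free mxrank0.
have QD n : Q n -> (n <= D)%N.
  by move/asboolP => [B [fB _]]; rewrite -(eqP fB) rank_leq_col.
case: (ex_maxnP Q0 QD) => n /asboolP [B [fB hB]] mx; exists n, B => y; split=> [Sy|[s ->]].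
  apply/submxP; apply/negPn/negP => ny.
  suff /mx : Q (n + 1)%N by rewrite addn1 ltnn.
  apply/asboolP; exists (col_mx B y); split; last first.
    move=> i; have [j ->|j ->] := split_ordP i; first by rewrite rowKu.
    by rewrite rowKd (ord1 j) row_id.
  have lt : (B < B + y)%MS.
    rewrite ltmxE addsmxSl /=; apply: contra ny; apply: submx_trans; exact: addsmxSr.
  move: lt; rewrite ltmxErank => /andP [_]; rewrite (eqP fB) => lt.
  by rewrite addsmxE in lt; rewrite /row_free eqn_leq rank_leq_row /= [X in (X <= _)%N]addn1.
rewrite mulmx_sum_row; elim/big_ind: _ => //.
  by move=> u v Su Sv; rewrite -[u]scale1r; apply: Slin.
by move=> i _; rewrite -[_ *: _]addr0; apply: Slin.
Qed.

Section Special.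
Variables (R : realType) (q : nat) (X : eqType) (clC : 'I_q -> X) (arr : rel X).
Variables (bC : pred 'I_q) (mc : nat) (tixC eixC : 'I_mc -> 'I_q * 'I_q).
Hypothesis tixCI : injective tixC.
Hypothesis eixCI : injective eixC.
Hypothesis tixCP : forall i j, (exists k, tixC k = (i, j)) <-> [&& bC i, ~~ bC j & clC i == clC j].
Hypothesis eixCP : forall i j, (exists k, eixC k = (i, j)) <-> [&& bC i, ~~ bC j & arr (clC i) (clC j)].
Local Notation p := (q + q)%N.
Local Notation m := ((mc + mc) + (mc + mc))%N.
Definition clR (i : 'I_p) := clC (hd i).
Definition bR (i : 'I_p) := bC (hd i).
Local Notation cl := clR.
Local Notation b := bR.
Local Notation tix := (ixR tixC).
Local Notation eix := (ixR eixC).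
Local Notation D := ((1 + p * p) * (1 + p * p) * (p * p))%N.
Local Notation J := (Jm R q).
Local Notation P0 := (P0 R b).
Local Notation Q0 := (Q0 R b).
Local Notation in0 := (@in0 R p X cl).
Local Notation in1 := (@in1 R p X cl arr).
Local Notation sect := (@sect R p X cl arr).

Lemma tixI : injective tix. Proof. exact: ixR_inj. Qed.
Lemma eixI : injective eix. Proof. exact: ixR_inj. Qed.
Lemma tixP i j : (exists k, tix k = (i, j)) <-> [&& b i, ~~ b j & cl i == cl j].
Proof. by rewrite (ixRP _ i j) (tixCP _ _). Qed.
Lemma eixP i j : (exists k, eix k = (i, j)) <-> [&& b i, ~~ b j & arr (cl i) (cl j)].
Proof. by rewrite (ixRP _ i j) (eixCP _ _). Qed.

Lemma in0_J : in0 J.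
Proof.
apply/in0P => i j ne; rewrite -[J]mulmx1 mulJl mxE; case: eqP => [e|]; rewrite ?mulr0 //.
by case/eqP: ne; rewrite /clR -e hd_fl.
Qed.
Lemma P0J : P0 *m J = J *m P0.
Proof.
apply/matrixP => i j; rewrite mul_P0 mul_P0r -[J]mulmx1 mulJl mxE.
case: eqP => [e|]; last by rewrite mulr0 mulr0 mul0r.
by rewrite /bR -e hd_fl mulrC.
Qed.

Definition commJ (A : 'M[R]_p) := A *m J = J *m A.
Definition anti (A : 'M[R]_p) := A *m J = - (J *m A).
(** The part of [A] that anticommutes with J, and in [pls] the part that commutes; the signs are
    opposite to those for an involution because J^2 = -1. *)
Definition mns (A : 'M[R]_p) := 2^-1 *: (A + J *m A *m J).
Definition pls (A : 'M[R]_p) := 2^-1 *: (A - J *m A *m J).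
Definition nu (A : 'M[R]_p) := \sum_i \sum_j (mns A) i j ^+ 2.

Let JJ (A : 'M[R]_p) : J *m (J *m A) = - A.
Proof. by rewrite mulmxA JmJ mulNmx mul1mx. Qed.
Let JJr (A : 'M[R]_p) : A *m J *m J = - A.
Proof. by rewrite -mulmxA JmJ mulmxN mulmx1. Qed.
Let JJm (A : 'M[R]_p) : J *m J *m A = - A.
Proof. by rewrite JmJ mulNmx mul1mx. Qed.

Lemma pls_mns A : pls A + mns A = A.
Proof. by rewrite -scalerDr addrACA addNr addr0 -mulr2n -scaler_nat scalerA mulVf ?scale1r // pnatr_eq0. Qed.
Lemma mns_lin c A B : mns (c *: A + B) = c *: mns A + mns B.
Proof.
rewrite /mns mulmxDr mulmxDl -scalemxAr -scalemxAl !scalerDr !scalerA ![2^-1 * c]mulrC.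
by rewrite addrACA.
Qed.
Lemma mns_anti A : anti (mns A).
Proof.
rewrite /anti /mns -scalemxAl -scalemxAr -scalerN mulmxDl mulmxDr JJr !mulmxA JJm mulNmx opprD opprK.
by rewrite addrC.
Qed.
Lemma pls_comm A : commJ (pls A).
Proof.
rewrite /commJ /pls -scalemxAl -scalemxAr mulmxBl mulmxBr JJr !mulmxA JJm mulNmx !opprK.
by rewrite addrC.
Qed.
Lemma mns_comm A : commJ A -> mns A = 0.
Proof. by move=> e; rewrite /mns -e JJr subrr scaler0. Qed.
Lemma pls_anti A : anti A -> pls A = 0.
Proof.
move=> e; rewrite /pls; have -> : J *m A = - (A *m J) by rewrite e opprK.
by rewrite mulNmx JJr opprK subrr scaler0.
Qed.
Lemma pls_id A : commJ A -> pls A = A.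
Proof. by move=> e; rewrite -[RHS]pls_mns mns_comm // addr0. Qed.
Lemma comm_anti0 A : commJ A -> anti A -> A = 0.
Proof. by move=> /pls_id e /pls_anti; rewrite e. Qed.
Lemma mns_mul K A K' : commJ K -> commJ K' -> mns (K *m A *m K') = K *m mns A *m K'.
Proof.
move=> e e'; rewrite /mns -scalemxAr -scalemxAl mulmxDr mulmxDl; congr (_ *: (_ + _)).
by rewrite !mulmxA -e -!mulmxA e'.
Qed.
Lemma mns_mulJ A : mns (A *m J) = mns A *m J.
Proof. by rewrite -[A in LHS]mul1mx mns_mul ?mul1mx // /commJ ?mul1mx ?mulmx1. Qed.
Lemma in0_mns A : in0 A -> in0 (mns A).
Proof. by move=> h; apply: in0_scale; apply: in0_add => //; apply: in0_mul; [apply: in0_mul => // |]; apply: in0_J. Qed.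
Lemma in0_pls A : in0 A -> in0 (pls A).
Proof. by move=> h; apply: in0_scale; apply: in0_sub => //; apply: in0_mul; [apply: in0_mul => // |]; apply: in0_J. Qed.
Lemma in1_scale c A : in1 A -> in1 (c *: A).
Proof. by move=> h i j n; rewrite mxE h ?mulr0. Qed.
Lemma in1_add A B : in1 A -> in1 B -> in1 (A + B).
Proof. by move=> h h' i j n; rewrite mxE h ?h' ?addr0. Qed.
Lemma in1_opp A : in1 A -> in1 (- A).
Proof. by move=> h i j n; rewrite mxE h ?oppr0. Qed.
Lemma in1_JAJ A : in1 A -> in1 (J *m A *m J).
Proof. by move=> h; apply: in1_in0; [apply: in0_in1 => // | ]; apply: in0_J. Qed.
Lemma in1_mns A : in1 A -> in1 (mns A).
Proof. by move=> h; apply: in1_scale; apply: in1_add => //; apply: in1_JAJ. Qed.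
Lemma in1_pls A : in1 A -> in1 (pls A).
Proof. by move=> h; apply: in1_scale; apply: in1_add => //; apply: in1_opp; apply: in1_JAJ. Qed.
Lemma nu0 A : commJ A -> nu A = 0.
Proof. by move=> /mns_comm e; rewrite /nu e big1 // => i _; rewrite big1 // => j _; rewrite mxE expr0n. Qed.
Lemma nu_eq0 A : nu A = 0 -> mns A = 0.
Proof.
move/eqP; rewrite psumr_eq0; last by move=> i _; apply: sumr_ge0 => j _; apply: sqr_ge0.
move=> /allP h; apply/matrixP => i j; have := h i (mem_index_enum _) => /=.
rewrite psumr_eq0; last by move=> k _; apply: sqr_ge0.
by move=> /allP /(_ j (mem_index_enum _)) /=; rewrite sqrf_eq0 => /eqP ->; rewrite mxE.
Qed.
Lemma nuE A : nu A = \tr (mns A *m (mns A)^T).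
Proof. by apply: eq_bigr => i _; rewrite mxE; apply: eq_bigr => j _; rewrite [(mns A)^T _ _]mxE expr2. Qed.

(* The perturbations allowed: they vanish on the J-invariant subspaces and are
   equivariant under the rotations generated by J. *)
Definition Lop (L : 'M[R]_p -> 'M[R]_p) := [/\ forall s A B, L (s *: A + B) = s *: L A + L B,
  forall A, in1 (L A), forall A, commJ A -> L A = 0, forall A, anti A -> L (A *m J) = L A *m J &
  forall A, anti A -> anti (L A)].
(** Both terms are quadratic in (a, P): [nu P] is a sum of squares of linear forms, and [L P], being
    linear, is homogenized by [a]. *)
Definition Spec (y : 'rV[R]_D) Y L := [/\ in1 Y, commJ Y, Lop L &
  forall a P, sect y a P = nu P *: Y + a *: L P].

Lemma sect0 a P : sect 0 a P = 0.
Proof.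
have := sect_lin cl arr 1 (0 : 'rV[R]_D) 0 a P; rewrite !scale1r addr0 => /eqP.
by rewrite eq_sym -subr_eq0 addrK => /eqP.
Qed.
Lemma sectD y y' a P : sect (y + y') a P = sect y a P + sect y' a P.
Proof. by have := sect_lin cl arr 1 y y' a P; rewrite !scale1r. Qed.

Lemma Lop_sum L P : Lop L -> L P = \sum_i \sum_j P i j *: L (delta_mx i j).
Proof.
case=> lL _ L0 _ _.
have L00 : L 0 = 0 by apply: L0; rewrite /commJ mulmx0 mul0mx.
have LD A B : L (A + B) = L A + L B by have := lL 1 A B; rewrite !scale1r.
have LZ a A : L (a *: A) = a *: L A by have := lL a A 0; rewrite L00 !addr0.
rewrite {1}[P]matrix_sum_delta (big_morph L LD L00); apply: eq_bigr => i _.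
by rewrite (big_morph L LD L00); apply: eq_bigr => j _; rewrite LZ.
Qed.

Lemma Spec_ex Y L : in1 Y -> commJ Y -> Lop L -> exists y, Spec y Y L.
Proof.
move=> Y1 YJ oL; have [lL L1 _ _ _] := oL.
pose al i j : 'cV[R]_(1 + p * p) := 2^-1 *: (form_of 1%:M 1%:M i j + form_of J J i j).
have alE a P i j : (xi a P *m al i j) 0 0 = mns P i j.
  by rewrite -scalemxAr mulmxDr mxE [X in _ * X]mxE !xi_form_of mul1mx mulmx1 /mns [RHS]mxE [X in _ = _ * X]mxE.
exists (\sum_i \sum_j test_sect (al i j) (al i j) Y +
        \sum_i \sum_j test_sect (form0 R p) (form_of 1%:M 1%:M i j) (L (delta_mx i j))).
split=> // a P; have mo := big_morph (fun y => sect y a P) (fun y y' => sectD y y' a P) (sect0 a P).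
rewrite sectD !mo; congr (_ + _).
  rewrite /nu scaler_suml; apply: eq_bigr => i _; rewrite mo scaler_suml; apply: eq_bigr => j _.
  by rewrite sect_test // alE expr2.
rewrite (Lop_sum P oL) scaler_sumr; apply: eq_bigr => i _; rewrite mo scaler_sumr; apply: eq_bigr => j _.
by rewrite sect_test // xi_form0 xi_form_of mul1mx mulmx1 scalerA.
Qed.

Lemma Lop0 : Lop (fun=> 0).
Proof.
split=> //; rewrite ?scaler0 ?addr0 //.
- by move=> s A B; rewrite scaler0 addr0.
- by move=> A i j _; rewrite mxE.
- by move=> A _; rewrite mul0mx.
by move=> A _; rewrite /anti mul0mx mulmx0 oppr0.
Qed.

Lemma Spec_lin c y Y L y' Y' L' : Spec y Y L -> Spec y' Y' L' ->
  Spec (c *: y + y') (c *: Y + Y') (fun A => c *: L A + L' A).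
Proof.
move=> [Y1 YJ [lL L1 L0 LJ La] yE] [Y1' YJ' [lL' L1' L0' LJ' La'] yE']; split.
- by apply: in1_add => //; apply: in1_scale.
- by rewrite /commJ mulmxDl mulmxDr -scalemxAl -scalemxAr YJ YJ'.
- split.
  + move=> s A B; rewrite lL lL' !scalerDr !scalerA [c * s]mulrC; by rewrite addrACA.
  + by move=> A; apply: in1_add => //; apply: in1_scale.
  + by move=> A e; rewrite L0 // L0' // scaler0 addr0.
  + by move=> A e; rewrite LJ // LJ' // mulmxDl -scalemxAl.
  by move=> A e; rewrite /anti mulmxDl mulmxDr -scalemxAl -scalemxAr (La A e) (La' A e) scalerN opprD.
move=> a P; rewrite sect_lin yE yE' !scalerDr !scalerA [c * nu P]mulrC [c * a]mulrC.
by rewrite addrACA.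
Qed.

(** The part of [Z] commuting with J is reached through Y, since nu P <> 0, and the anticommuting
    part through L. *)
Lemma Spec_val P (Z : 'M[R]_p) : mns P != 0 -> in1 Z -> exists y Y L, Spec y Y L /\ sect y 1 P = Z.
Proof.
move=> nP Z1; have [i [j nz]] : exists i j, mns P i j != 0.
  apply: contrapT => h; case/eqP: nP; apply/matrixP => i j; rewrite [RHS]mxE; apply: contrapT => n.
  by apply: h; exists i, j; apply/eqP.
(* The pair ([al], [be]) is a complex coordinate of P_-, nonzero by the choice of (i, j); [r] is its
   squared modulus. *)
pose al := mns P i j; pose be := (mns P *m J) i j; pose r := al ^+ 2 + be ^+ 2.
have r0 : r != 0.
  by rewrite gt_eqF // ltr_wpDr ?sqr_ge0 // exprn_even_gt0.
have aZ : anti (mns Z) := mns_anti Z.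
(* The anticommuting part of [Z] divided by that complex number, so that the equivariant map [L]
   takes this part as its value at [P]. *)
pose Z' := r^-1 *: (mns Z *m (al%:M + be *: J)).
have aZ' : anti Z'.
  rewrite /Z'; move: (mns Z) aZ => V aV; rewrite /anti -scalemxAl -scalemxAr -scalerN; congr (_ *: _).
  have e : (al%:M + be *: J) *m J = J *m (al%:M + be *: J).
    by rewrite mulmxDl mulmxDr mul_scalar_mx mul_mx_scalar -scalemxAl -scalemxAr.
  by rewrite -mulmxA e mulmxA aV mulNmx -mulmxA.
pose L (A : 'M[R]_p) := (mns A) i j *: Z' - ((mns A) *m J) i j *: (Z' *m J).
have oL : Lop L.
  have Z1' : in1 Z'.
    apply: in1_scale; apply: in1_in0; first exact: in1_mns.
    apply: in0_add; last by apply: in0_scale; apply: in0_J.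
    by rewrite -scalemx1; apply: in0_scale; apply: in0_1.
  split.
  - move=> s A B; rewrite /L mns_lin mulmxDl -scalemxAl !mxE !scalerDl -!scalerA scalerBr opprD.
    by rewrite addrACA.
  - move=> A; apply: in1_add; first exact: in1_scale.
    by apply: in1_opp; apply: in1_scale; apply: in1_in0 => //; apply: in0_J.
  - by move=> A e; rewrite /L mns_comm // mul0mx !mxE !scale0r subrr.
  - move=> A e; rewrite /L mns_mulJ JJr; move: (Z') (mns A) => z M; rewrite mulmxBl -!scalemxAl JJr.
    have -> : (- M) i j = - M i j by rewrite mxE.
    by rewrite scaleNr scalerN !opprK addrC.
  move=> A e; rewrite /anti /L; move: (Z') aZ' (mns A) => z az M.
  have jz : J *m z = - (z *m J) by rewrite az opprK.
  have jzj : J *m (z *m J) = z by rewrite mulmxA jz mulNmx JJr opprK.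
  rewrite mulmxBl mulmxBr -!scalemxAl -!scalemxAr JJr jz jzj.
  by rewrite !scalerN opprD !opprK.
have nu_neq : nu P != 0 by apply: contra nP => /eqP /nu_eq0 ->.
have [y Sy] := @Spec_ex ((nu P)^-1 *: pls Z) L (in1_scale _ (in1_pls Z1))
  (ltac:(by rewrite /commJ -scalemxAl -scalemxAr (pls_comm Z))) oL.
exists y, ((nu P)^-1 *: pls Z), L; split=> //.
have [_ _ _ ->] := Sy; rewrite scalerA mulfV // !scale1r -[RHS]pls_mns; congr (_ + _).
have eT : al *: (al%:M + be *: J) - be *: ((al%:M + be *: J) *m J) = r%:M.
  rewrite mulmxDl mul_scalar_mx -scalemxAl JmJ /r; move: (Jm R q) => j0.
  by apply/matrixP => u v; rewrite !mxE; case: (u == v); rewrite /=; ring.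
rewrite /L -/al -/be /Z'; move: (mns Z) (al%:M + be *: J) eT => V T eT.
have -> : al *: (r^-1 *: (V *m T)) - be *: (r^-1 *: (V *m T) *m J) = r^-1 *: (V *m (al *: T - be *: (T *m J))).
  by rewrite mulmxBr -!scalemxAr -scalemxAl scalerBr !scalerA ![_ * r^-1]mulrC mulmxA.
by rewrite eT mul_mx_scalar scalerA mulVf // scale1r.
Qed.

Section Rotation.
Variable t : R.
Let k := (Num.sqrt (1 + t ^+ 2))^-1.
Let k2 : k ^+ 2 * (1 + t ^+ 2) = 1.
Proof.
have h : 0 < 1 + t ^+ 2 by rewrite ltr_pwDl ?ltr01 ?sqr_ge0.
by rewrite /k exprVn sqr_sqrtr ?ltW // mulVf // gt_eqF.
Qed.
(** A rotation with the tangent of the angle as parameter: conjugation by it is rational in [t],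
    with denominator 1 + t^2, and acts on anticommuting matrices by twice the angle, see
    [rot_scale_anti]. *)
Definition rot : 'M[R]_p := k *: (1%:M - t *: J).
Lemma rotT : rot^T = k *: (1%:M + t *: J).
Proof. by rewrite /rot linearZ /= linearB /= linearZ /= trmx1 JmT scalerN opprK. Qed.
Lemma rot_comm : commJ rot.
Proof. by rewrite /commJ /rot -scalemxAl -scalemxAr mulmxBl mulmxBr mul1mx mulmx1 -scalemxAl -scalemxAr. Qed.
Lemma rotT_comm : commJ rot^T.
Proof. by rewrite /commJ rotT -scalemxAl -scalemxAr mulmxDl mulmxDr mul1mx mulmx1 -scalemxAl -scalemxAr. Qed.
Lemma rotK : rot *m rot^T = 1%:M.
Proof.
rewrite rotT /rot -scalemxAl -scalemxAr scalerA -expr2 mulmxDr mulmx1 -scalemxAr mulmxBl mul1mx -scalemxAl JmJ.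
move: (Jm R q) => j0.
have -> : 1%:M - t *: j0 + t *: (j0 - t *: - 1%:M) = (1 + t ^+ 2) *: 1%:M.
  by apply/matrixP => u v; rewrite !mxE; ring.
by rewrite scalerA k2 scale1r.
Qed.
Lemma rotKV : rot^T *m rot = 1%:M. Proof. exact: mulmx1C rotK. Qed.
Lemma in0_rot : in0 rot.
Proof. by apply: in0_scale; apply: in0_sub; [apply: in0_1 | apply: in0_scale; apply: in0_J]. Qed.
Lemma mns_rot P : mns (rot^T *m P *m rot) = rot^T *m mns P *m rot.
Proof. by apply: mns_mul; [apply: rotT_comm | apply: rot_comm]. Qed.
Lemma anti_rot A : anti A -> rot^T *m A *m rot = k ^+ 2 *: ((1 - t ^+ 2) *: A - (2 * t) *: (A *m J)).
Proof.
move=> aA; rewrite rotT /rot -!scalemxAl -!scalemxAr scalerA -expr2; congr (_ *: _).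
rewrite mulmxDl mul1mx -scalemxAl; have -> : J *m A = - (A *m J) by rewrite aA opprK.
rewrite mulmxBr mulmx1 -scalemxAr mulmxDl -scalemxAl mulNmx JJr opprK.
by apply/matrixP => i j; rewrite !mxE; ring.
Qed.
Lemma rot_scale P : (1 + t ^+ 2) *: (rot^T *m P *m rot) = (1%:M + t *: J) *m P *m (1%:M - t *: J).
Proof. by rewrite rotT /rot -!scalemxAl -!scalemxAr !scalerA -mulrA -expr2 mulrC k2 scale1r. Qed.
Lemma rot_scale_anti A : anti A ->
  (1 + t ^+ 2) *: (rot^T *m A *m rot) = (1 - t ^+ 2) *: A - (2 * t) *: (A *m J).
Proof. by move=> aA; rewrite anti_rot // scalerA mulrC k2 scale1r. Qed.
Lemma nu_rot P : nu (rot^T *m P *m rot) = nu P.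
Proof.
rewrite !nuE mns_rot !trmx_mul trmxK; set A := mns P.
have -> : rot^T *m A *m rot *m (rot^T *m (A^T *m rot)) = rot^T *m (A *m A^T *m rot).
  by rewrite -!mulmxA [rot *m (rot^T *m _)]mulmxA rotK mul1mx.
by rewrite mxtrace_mulC -[(_ *m rot) *m _]mulmxA rotK mulmx1.
Qed.
Lemma Lop_rot L P : Lop L -> L (rot^T *m P *m rot) = rot^T *m L P *m rot.
Proof.
move=> [lL _ L0 LJ La].
have L00 : L 0 = 0 by apply: L0; rewrite /commJ mulmx0 mul0mx.
have LD A B : L (A + B) = L A + L B by have := lL 1 A B; rewrite !scale1r.
have LZ a A : L (a *: A) = a *: L A by have := lL a A 0; rewrite L00 !addr0.
have Lm A : L A = L (mns A) by rewrite -{1}(pls_mns A) LD (L0 _ (pls_comm A)) add0r.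
rewrite Lm mns_rot [L P]Lm; have aA := mns_anti P; move: (mns P) aA => A aA.
rewrite !anti_rot //; last exact: La.
by rewrite LZ LD -scaleNr !LZ LJ // scaleNr.
Qed.
Lemma Spec_rot y Y L a P : Spec y Y L -> sect y a (rot^T *m P *m rot) = rot^T *m sect y a P *m rot.
Proof.
move=> [_ YJ oL yE]; rewrite !yE nu_rot Lop_rot //.
have e : rot^T *m Y = Y *m rot^T.
  by rewrite rotT -scalemxAl -scalemxAr mulmxDl mulmxDr mul1mx mulmx1 -scalemxAl -scalemxAr YJ.
move: rotKV e; move: rot => c cK e.
by rewrite mulmxDr mulmxDl -!scalemxAr -!scalemxAl e -[Y *m c^T *m c]mulmxA cK mulmx1.
Qed.
End Rotation.
End Special.

End Perturbations.

(** * Generic absence of zeros that are not J-invariant *)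

Module MovedZeros.
Import all_boot all_order all_algebra all_fingroup complex.
Import boolp classical_sets reals.
Import zify ring lra.
Import PolynomialFunctions Graded Projections ChartCover Genericity ChartEquations Orientation SignedCount FirstOrder ComplexStructure Perturbations.
Import Order.TTheory GRing.Theory Num.Theory.
Local Open Scope ring_scope.

Section Special.
Variables (R : realType) (q : nat) (X : eqType) (clC : 'I_q -> X) (arr : rel X).
Variables (bC : pred 'I_q) (mc : nat) (tixC eixC : 'I_mc -> 'I_q * 'I_q).
Hypothesis tixCI : injective tixC.
Hypothesis eixCI : injective eixC.
Hypothesis tixCP : forall i j, (exists k, tixC k = (i, j)) <-> [&& bC i, ~~ bC j & clC i == clC j].
Hypothesis eixCP : forall i j, (exists k, eixC k = (i, j)) <-> [&& bC i, ~~ bC j & arr (clC i) (clC j)].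
Local Notation p := (q + q)%N.
Local Notation m := ((mc + mc) + (mc + mc))%N.
Local Notation cl := (clR clC).
Local Notation b := (bR bC).
Local Notation tix := (ixR tixC).
Local Notation eix := (ixR eixC).
Local Notation D := ((1 + p * p) * (1 + p * p) * (p * p))%N.
Local Notation J := (Jm R q).
Local Notation P0 := (P0 R b).
Local Notation Q0 := (Q0 R b).
Local Notation phi := (@mxof R p m tix).
Local Notation emx := (@mxof R p m eix).
Local Notation in0 := (@in0 R p X cl).
Local Notation in1 := (@in1 R p X cl arr).
Local Notation sect := (@sect R p X cl arr).
Local Notation isproj := (@isproj R p X cl b).
Local Notation gmx := (@gmx R p X cl).
Local Notation cheq := (@cheq R p X cl arr b m tix eix).
Local Notation cheqmx := (@cheqmx R p X cl arr b m tix eix).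
Local Notation chartP := (@chartP R p X cl b m tix).
Local Notation gramd := (@gramd R p m tix).
Local Notation nproj := (@nproj R p b m tix).
Local Notation Spec := (@Spec R q X clC arr).
Local Notation rot := (@rot R q).
Local Notation C := (class_perm cl).
Let tI : injective tix := tixI tixCI.
Let eI : injective eix := eixI eixCI.
Let tP := tixP tixCP.
Let eP := eixP eixCP.
Variable W : 'M[R]_p.
Hypothesis W1 : in1 W.
Hypothesis WJ : commJ W.
Definition yW : 'rV[R]_D := test_sect (form0 R p) (form0 R p) W.
Lemma sect_yW a P : sect yW a P = (a * a) *: W.
Proof. by rewrite /yW sect_test // !xi_form0. Qed.
Variables (n0 : nat) (B : 'M[R]_(n0, D)).
Hypothesis hB : forall y, (exists Y L, Spec y Y L) <-> exists s, y = s *m B.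
Definition ys s := yW + s *m B.
Lemma sect_ys s : exists Y L, Spec (s *m B) Y L /\
  forall a P, sect (ys s) a P = (a * a) *: W + (nu P *: Y + a *: L P).
Proof.
have /hB [Y [L S]] : exists s', s *m B = s' *m B by exists s.
by exists Y, L; split=> // a P; rewrite /ys sectD sect_yW; case: S => _ _ _ ->.
Qed.

Definition is_zero y (P : 'M[R]_p) := P *m sect y 1 P *m (1%:M - P) = 0.

Lemma zero_rot s t P : is_zero (ys s) P -> is_zero (ys s) ((rot t)^T *m P *m rot t).
Proof.
have [Y [L [S yE]]] := sect_ys s; rewrite /is_zero.
have -> : sect (ys s) 1 ((rot t)^T *m P *m rot t) = (rot t)^T *m sect (ys s) 1 P *m rot t.
  rewrite /ys !sectD (Spec_rot t _ _ S) !sect_yW mulmxDr mulmxDl; congr (_ + _).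
  have e : (rot t)^T *m W = W *m (rot t)^T.
    by rewrite rotT -scalemxAl -scalemxAr mulmxDl mulmxDr mul1mx mulmx1 -scalemxAl -scalemxAr WJ.
  by rewrite mulr1 !scale1r e -mulmxA rotKV mulmx1.
move: (rotK q t) (rotKV q t); move: (rot t) (sect _ _ _) => c A cc cc' z.
have -> : 1%:M - c^T *m P *m c = c^T *m (1%:M - P) *m c.
  by rewrite mulmxBr mulmxBl mulmx1 cc'.
have -> : c^T *m P *m c *m (c^T *m A *m c) *m (c^T *m (1%:M - P) *m c) =
  c^T *m (P *m (c *m c^T) *m A *m (c *m c^T) *m (1%:M - P)) *m c by rewrite !mulmxA.
by rewrite !cc !mulmx1 z mulmx0 mul0mx.
Qed.

(** At a point with P_- <> 0 the admissible perturbations take every value, by [Spec_val]; so the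
    equations have full rank in the parameter. *)
Lemma full_at c x : mns (chartP c x) != 0 -> row_full (B *m cheqmx c x).
Proof.
move=> nP; apply: row_full_surj => w.
pose h := chart_h tix c x; pose hi := chart_hi tix c x.
(* The factor and the conjugation undo the cleared denominators and the chart frames in [cheq]. *)
pose Z := (gramd x ^- 2) *: (hi *m emx w *m h).
have Z1 : in1 Z.
  apply: in1_scale; apply: in1_in0; last exact: (in0_chart_h tP).
  by apply: in0_in1; [apply: (in0_chart_hi tP) | apply: (in1_emx eP)].
have [y [Y [L [S e]]]] := Spec_val nP Z1.
have [s es] : exists s, y = s *m B by apply/hB; exists Y, L.
exists s; rewrite mulmxA -es cheqmxE cheqE e /local_sect.
have -> : frameU b tix x *m gmx c *m Z *m (gmx c)^T *m (1%:M - phi x) = P0 *m (h *m Z *m hi).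
  by rewrite (frameUE tP) /h /hi /chart_h /chart_hi !mulmxA.
rewrite /Z -scalemxAr -scalemxAl -scalemxAr coordZ scalerA mulfV; last by rewrite expf_neq0 // gramd_neq0.
have gen (u v E : 'M[R]_p) : u *m v = 1%:M -> u *m (v *m E *m u) *m v = E.
  by move=> e'; rewrite !mulmxA e' mul1mx -mulmxA e' mulmx1.
rewrite scale1r gen; last exact: (chart_hK tP).
have -> : P0 *m emx w = emx w.
  by rewrite -[emx w in LHS](emx_support eP) !mulmxA P0P0 (emx_support eP).
exact: mxofK.
Qed.

Definition hent (c : C) i j x := mns ((gmx c)^T *m nproj x *m gmx c) i j.
Lemma polyf_hent c i j : polyf (hent c i j).
Proof.
have h := mxpolyf_chart_nproj R b tix c.
apply: (mxpolyf_scale (polyf_cst _ _)); apply: mxpolyf_add; first exact: h.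
apply: mxpolyf_mul; last exact: mxpolyf_cst.
by apply: mxpolyf_mul; [apply: mxpolyf_cst | apply: h].
Qed.
Lemma hentE c i j x : hent c i j x = gramd x * mns (chartP c x) i j.
Proof.
rewrite /hent nproj_conj; have := mns_lin (gramd x) (chartP c x) 0.
by rewrite addr0 [mns 0]mns_comm ?addr0 ?/commJ ?mulmx0 ?mul0mx // => ->; rewrite mxE.
Qed.

Lemma chart_of (c : C) P : isproj P -> chart_mx b (gmx c) P \in unitmx -> exists x, chartP c x = P.
Proof.
move=> iP u; exists (chart_coord b tix (gmx c) P).
by apply: projn_chart_coord => //; [apply: gmx0 | apply: gmxK].
Qed.
Lemma isproj_cover P : isproj P -> exists c : C, chart_mx b (gmx c) P \in unitmx.
Proof.
move=> iP; have [|c] := @chart_cover R p X cl b (mxvec P); first by rewrite /proj_set /= mxvecK.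
by rewrite /chart_dom /= mxvecK; exists c.
Qed.
Lemma isproj_rot t P : isproj P -> isproj ((rot t)^T *m P *m rot t).
Proof. by move=> iP; apply: isproj_conj => //; [apply: in0_rot | apply: rotK]. Qed.

(** Whether a rotated projection lies in the chart [c] is decided by a polynomial in [t], nonzero as
    soon as one rotation does. Other rotations can thus be found in the same chart. *)
Lemma chart_rot_poly (c : C) P t : isproj P -> chart_mx b (gmx c) ((rot t)^T *m P *m rot t) \in unitmx ->
  exists f : 'rV[R]_1 -> R, [/\ polyf f, exists u, f u != 0 &
    forall u, f u != 0 -> chart_mx b (gmx c) ((rot (u 0 0))^T *m P *m rot (u 0 0)) \in unitmx].
Proof.
move=> iP u.
pose G (v : 'rV[R]_1) := (1%:M + v 0 0 *: J) *m P *m (1%:M - v 0 0 *: J).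
pose M v := P0 *m (gmx c *m G v *m (gmx c)^T) *m P0 + (1 + v 0 0 ^+ 2) *: Q0.
have ME v : M v = (1 + v 0 0 ^+ 2) *: chart_mx b (gmx c) ((rot (v 0 0))^T *m P *m rot (v 0 0)).
  rewrite /M /G -rot_scale /chart_mx; move: ((rot (v 0 0))^T *m P *m rot (v 0 0)) (1 + v 0 0 ^+ 2) (Graded.Q0 R b) => A s Qz.
  by rewrite [RHS]scalerDr -!(scalemxAr, scalemxAl).
have pc : polyf (fun v : 'rV[R]_1 => v 0 0) by apply: polyf_coord.
have nz (s : R) : 1 + s ^+ 2 != 0 by rewrite gt_eqF // ltr_pwDl ?ltr01 ?sqr_ge0.
exists (fun v => \det (M v)); split.
- apply: polyf_det; apply: mxpolyf_add.
    apply: mxpolyf_mul; last exact: mxpolyf_cst.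
    apply: mxpolyf_mul; first exact: mxpolyf_cst.
    apply: mxpolyf_mul; last exact: mxpolyf_cst.
    apply: mxpolyf_mul; first exact: mxpolyf_cst.
    apply: mxpolyf_mul.
      apply: mxpolyf_mul; last exact: mxpolyf_cst.
      by apply: mxpolyf_add; [apply: mxpolyf_cst | apply: mxpolyf_scale => //; apply: mxpolyf_cst].
    by apply: mxpolyf_sub; [apply: mxpolyf_cst | apply: mxpolyf_scale => //; apply: mxpolyf_cst].
  apply: mxpolyf_scale; last exact: mxpolyf_cst.
  by apply: polyf_add; [apply: polyf_cst | apply: polyf_mul].
- exists (const_mx t); rewrite ME mxE detZ mulf_neq0 ?expf_neq0 //.
  by move: u; rewrite unitmxE unitfE.
move=> v; rewrite ME detZ mulf_eq0 negb_or => /andP [_]; by rewrite unitmxE unitfE.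
Qed.

(** A quadratic equation in [t] with discriminant proportional to al^2 + be^2, hence always solvable
    over the reals. *)
Lemma entry_kill (al be : R) : al != 0 -> exists t, (1 - t ^+ 2) * al - 2 * t * be = 0.
Proof.
move=> a0; pose s := Num.sqrt (be ^+ 2 + al ^+ 2).
have s2 : s ^+ 2 = be ^+ 2 + al ^+ 2 by rewrite sqr_sqrtr // addr_ge0 ?sqr_ge0.
exists ((s - be) / al).
have -> : (1 - ((s - be) / al) ^+ 2) * al - 2 * ((s - be) / al) * be = (al ^+ 2 + be ^+ 2 - s ^+ 2) / al by field.
by rewrite s2 [al ^+ 2 + _]addrC subrr mul0r.
Qed.

Lemma mns_rot_entry t P i j :
  (1 + t ^+ 2) * mns ((rot t)^T *m P *m rot t) i j = (1 - t ^+ 2) * mns P i j - 2 * t * (mns P *m J) i j.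
Proof.
have := congr1 (fun A : 'M_p => A i j) (rot_scale_anti t (mns_anti P)).
rewrite mns_rot; move: (mns P) => A; move: ((rot t)^T *m A *m rot t) (A *m J) => M1 M2.
by rewrite !mxE => ->.
Qed.

(** A zero with P_- <> 0 is rotated until the entry (i, j) of P_- vanishes; it remains a zero with
    P_- <> 0. The [m] equations and this extra one, on [m] unknowns, admit solutions only for
    negligible parameters. *)
Lemma nofix_negligible : negligible (fun s => exists P, [/\ isproj P, is_zero (ys s) P & mns P != 0]).
Proof.
have nz (s : R) : 1 + s ^+ 2 != 0 by rewrite gt_eqF // ltr_pwDl ?ltr01 ?sqr_ge0.
pose Bad (k : C * ('I_p * 'I_p)) s := (exists x, hent k.1 k.2.1 k.2.2 x != 0) /\
  exists x, [/\ hent k.1 k.2.1 k.2.2 x = 0, row_full (B *m cheqmx k.1 x) &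
    s *m (B *m cheqmx k.1 x) = - cheq k.1 yW x].
apply: (@negligible_sub _ _ _ (fun s => exists k, Bad k s)); last first.
  apply: negligible_bigU => k; have [ex|nex] := pselect (exists x, hent k.1 k.2.1 k.2.2 x != 0).
    apply: (@negligible_sub _ _ _ (fun s => exists x, [/\ hent k.1 k.2.1 k.2.2 x = 0,
      row_full (B *m cheqmx k.1 x) & s *m (B *m cheqmx k.1 x) = - cheq k.1 yW x])); first by move=> y [].
    apply: negligible_incidence => //; last exact: polyf_hent.
      by apply: mxpolyf_mul; [apply: mxpolyf_cst | apply: mxpolyf_cheqmx].
    by apply: mxpolyf_opp; apply: mxpolyf_cheq.
  by apply: negligible_empty => y [].
move=> s [P [iP zP nP]].
have [i [j nij]] : exists i j, mns P i j != 0.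
  apply: contrapT => h; case/eqP: nP; apply/matrixP => i j; rewrite [RHS]mxE; apply: contrapT => n.
  by apply: h; exists i, j; apply/eqP.
have [t et] := entry_kill ((mns P *m J) i j) nij.
have iP' := isproj_rot t iP; have [c uc] := isproj_cover iP'.
have [x ex] := chart_of iP' uc.
have nP' : mns (chartP c x) != 0.
  rewrite ex mns_rot; apply: contra nP => /eqP e; apply/eqP.
  have : rot t *m ((rot t)^T *m mns P *m rot t) *m (rot t)^T = 0 by rewrite e mulmx0 mul0mx.
  by rewrite !mulmxA rotK mul1mx -mulmxA rotK mulmx1.
exists (c, (i, j)); split=> /=.
  (* The extra equation is not identically satisfied in the chart: another rotation of [P] lies
     there with a nonzero entry. *)
  have [f [pf [u fu] fP]] := chart_rot_poly iP uc.
  pose g (v : 'rV[R]_1) := (1 - v 0 0 * v 0 0) * mns P i j - 2 * v 0 0 * (mns P *m J) i j.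
  have pc : polyf (fun v : 'rV[R]_1 => v 0 0) by apply: polyf_coord.
  have pg : polyf g.
    apply: polyf_sub; apply: polyf_mul; try exact: polyf_cst.
      by apply: polyf_sub; [apply: polyf_cst | apply: polyf_mul].
    by apply: polyf_mul; first exact: polyf_cst.
  have [||v [fv gv]] := polyf_both_neq0 pf pg; first by exists u.
    have e0 : (0 : 'rV[R]_1) 0 0 = 0 by rewrite mxE.
    by exists 0; rewrite /g e0 !(mulr0, mul0r) !subr0 mul1r.
  have [x' ex'] := chart_of (isproj_rot _ iP) (fP _ fv).
  exists x'; rewrite hentE mulf_neq0 ?gramd_neq0 //.
  apply: contra gv => /eqP e; apply/eqP; rewrite /g -expr2 -mns_rot_entry -ex' e mulr0.
  by [].
exists x; split.
- rewrite hentE ex; have := mns_rot_entry t P i j; rewrite et => /eqP.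
  by rewrite mulf_eq0 (negPf (nz t)) /= => /eqP ->; rewrite mulr0.
- exact: full_at.
have z' : is_zero (ys s) (chartP c x) by rewrite ex; apply: zero_rot.
have e0 : cheq c (ys s) x = 0 by apply/(cheq_eq0 eI tP eP).
rewrite mulmxA cheqmxE.
have : cheq c (1 *: yW + s *m B) x = 1 *: cheq c yW x + cheq c (s *m B) x by apply: cheq_lin.
by rewrite !scale1r -/(ys s) e0 => /esym /eqP; rewrite addrC addr_eq0 => /eqP.
Qed.
End Special.

End MovedZeros.

(** * Nondegeneracy and signs at the J-invariant zeros *)

Module SpecialSection.
Import all_boot all_order all_algebra all_fingroup complex.
Import boolp classical_sets reals topology normedtype.
Import functions filter.
Import zify ring lra.
Import PolynomialFunctions Graded Projections ChartCover Genericity ChartEquations Orientation SignedCount FirstOrder ComplexStructure Perturbations MovedZeros Norms GlobalCount.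
Import Order.TTheory GRing.Theory Num.Theory.
Import numFieldNormedType.Exports.
Local Open Scope classical_set_scope.
Local Open Scope ring_scope.

Section Special.
Variables (R : realType) (q : nat) (X : eqType) (clC : 'I_q -> X) (arr : rel X).
Variables (bC : pred 'I_q) (mc : nat) (tixC eixC : 'I_mc -> 'I_q * 'I_q).
Hypothesis tixCI : injective tixC.
Hypothesis eixCI : injective eixC.
Hypothesis tixCP : forall i j, (exists k, tixC k = (i, j)) <-> [&& bC i, ~~ bC j & clC i == clC j].
Hypothesis eixCP : forall i j, (exists k, eixC k = (i, j)) <-> [&& bC i, ~~ bC j & arr (clC i) (clC j)].
Local Notation p := (q + q)%N.
Local Notation m := ((mc + mc) + (mc + mc))%N.
Local Notation cl := (clR clC).
Local Notation b := (bR bC).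
Local Notation tix := (ixR tixC).
Local Notation eix := (ixR eixC).
Local Notation D := ((1 + p * p) * (1 + p * p) * (p * p))%N.
Local Notation J := (Jm R q).
Local Notation P0 := (P0 R b).
Local Notation Q0 := (Q0 R b).
Local Notation phi := (@mxof R p m tix).
Local Notation emx := (@mxof R p m eix).
Local Notation ecoord := (@coord R p m eix).
Local Notation in0 := (@in0 R p X cl).
Local Notation in1 := (@in1 R p X cl arr).
Local Notation sect := (@sect R p X cl arr).
Local Notation isproj := (@isproj R p X cl b).
Local Notation gmx := (@gmx R p X cl).
Local Notation cheq := (@cheq R p X cl arr b m tix eix).
Local Notation cheqmx := (@cheqmx R p X cl arr b m tix eix).
Local Notation chartP := (@chartP R p X cl b m tix).
Local Notation gramd := (@gramd R p m tix).
Local Notation nproj := (@nproj R p b m tix).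
Local Notation Spec := (@Spec R q X clC arr).
Local Notation C := (class_perm cl).
Local Notation zero_set := (@zero_set R p X cl arr b).
Let tI : injective tix := tixI tixCI.
Let eI : injective eix := eixI eixCI.
Let tP := tixP tixCP.
Let eP := eixP eixCP.

Lemma comm_inv (F : fieldType) n (A K : 'M[F]_n) : K \in unitmx -> A *m K = K *m A -> A *m invmx K = invmx K *m A.
Proof.
move=> u e; apply: (can_inj (mulKmx u)); rewrite mulmxA -e -mulmxA mulmxV // mulmx1.
by rewrite mulmxA mulmxV // mul1mx.
Qed.
Lemma Q0J : Q0 *m J = J *m Q0.
Proof. by rewrite /Q0 mulmxBl mulmxBr mul1mx mulmx1 P0J. Qed.
Lemma commJ_mul (A K : 'M[R]_p) : commJ A -> commJ K -> commJ (A *m K).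
Proof. by move=> e e'; rewrite /commJ -mulmxA e' mulmxA e mulmxA. Qed.
Lemma commJ_sub (A K : 'M[R]_p) : commJ A -> commJ K -> commJ (A - K).
Proof. by move=> e e'; rewrite /commJ mulmxBl mulmxBr e e'. Qed.
Lemma commJ_add (A K : 'M[R]_p) : commJ A -> commJ K -> commJ (A + K).
Proof. by move=> e e'; rewrite /commJ mulmxDl mulmxDr e e'. Qed.
Lemma commJ1 : commJ (1%:M : 'M[R]_p). Proof. by rewrite /commJ mul1mx mulmx1. Qed.
Lemma commJ_tr (A : 'M[R]_p) : commJ A -> commJ A^T.
Proof.
move=> /(congr1 trmx); rewrite !trmx_mul JmT mulNmx mulmxN => /oppr_inj e; exact: esym e.
Qed.
Lemma anti_mull (A K : 'M[R]_p) : commJ K -> anti A -> anti (K *m A).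
Proof. by move=> e e'; rewrite /anti -[LHS]mulmxA e' mulmxN; congr (- _); rewrite !mulmxA e. Qed.
Lemma anti_mulr (A K : 'M[R]_p) : commJ K -> anti A -> anti (A *m K).
Proof. by move=> e e'; rewrite /anti -[LHS]mulmxA e mulmxA e' mulNmx; congr (- _); rewrite !mulmxA. Qed.
Lemma anti_sub (A K : 'M[R]_p) : anti A -> anti K -> anti (A - K).
Proof. by move=> e e'; rewrite /anti mulmxBl mulmxBr e e' opprB opprK addrC. Qed.

Lemma phiJ v : phi (v *m Jm R (mc + mc)) = phi v *m J.
Proof.
rewrite -{1}(mxofK tI v) -coordJ; apply: (tmx_coordK tI tP).
  by apply: in0_mul; [apply: (in0_tmx tP) | apply: in0_J].
by rewrite mulmxA (P0_tmx tP) -mulmxA -Q0J mulmxA (tmx_Q0 tP).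
Qed.

Variable W : 'M[R]_p.
Hypothesis W1 : in1 W.
Hypothesis WJ : commJ W.
Variables (n0 : nat) (B : 'M[R]_(n0, D)).
Hypothesis hB : forall y, (exists Y L, Spec y Y L) <-> exists s, y = s *m B.
Local Notation ys := (ys W B).
Local Notation is_zero := (@is_zero R q X clC arr).
(** The J-invariant zeros. At such a [P] the section [ys s] takes the value [W] for every [s], so
    these zeros do not move with the perturbation. *)
Definition fixed P := [/\ isproj P, commJ P & P *m W *m (1%:M - P) = 0].
Hypothesis Hplus : forall P Th, fixed P -> in0 Th -> commJ Th -> P *m Th *m (1%:M - P) = Th ->
  Th *m W *m (1%:M - P) = P *m W *m Th -> Th = 0.
Hypothesis Hchart : forall P, isproj P -> commJ P -> exists2 c : C, commJ (gmx c) &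
  chart_mx b (gmx c) P \in unitmx.

Lemma sect_commJ s P : commJ P -> sect (ys s) 1 P = W.
Proof.
move=> cP; have [Y [L [[_ _ [_ _ L0 _ _] _] ->]]] := sect_ys W1 hB s.
by rewrite nu0 // scale0r L0 // scaler0 addr0 addr0 mulr1 scale1r.
Qed.

Section AtFixed.
Variables (c : C) (x : 'rV[R]_m).
Local Notation g := (gmx c).
Local Notation P := (chartP c x).
Local Notation h := (chart_h tix c x).
Local Notation hi := (chart_hi tix c x).
Local Notation tg := (tangent b tix c x).
Hypothesis fP : fixed P.
Hypothesis gJ : commJ g.
Let PJ : commJ P. Proof. by case: fP. Qed.
Let QJ : commJ (1%:M - P). Proof. by apply: commJ_sub => //; apply: commJ1. Qed.

(** The chart coordinate is a rational expression in P, [gmx c], P0 and Q0, all of which commute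
    with J. *)
Lemma phi_comm : commJ (phi x).
Proof.
pose K := invmx (chart_mx b g P) *m (P0 *m (g *m P *m g^T) *m Q0).
have u : chart_mx b g P \in unitmx by rewrite (chart_mx_projn tP) ?unitmx_inv ?gram_unit //; apply: gmxK.
have cP0 : commJ P0 by rewrite /commJ P0J.
have cQ0 : commJ Q0 by rewrite /commJ Q0J.
have cgPg : commJ (g *m P *m g^T) by apply: commJ_mul; [apply: commJ_mul | apply: commJ_tr].
have cm : commJ (chart_mx b g P) by apply: commJ_add => //; apply: commJ_mul => //; apply: commJ_mul.
have cK : commJ K.
  apply: commJ_mul; last by apply: commJ_mul => //; apply: commJ_mul.
  by rewrite /commJ (comm_inv u (esym cm)).
have in0gPg : in0 (g *m P *m g^T).
  apply: in0_mul; last by apply: in0_tr; apply: gmx0.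
  by apply: in0_mul; [apply: gmx0 | case: fP => -[]].
suff -> : phi x = K by [].
have <- : chart_coord b tix g P = x by apply: (chart_coord_projn tI tP); apply: gmxK.
apply: (tmx_coordK tI tP).
  apply: in0_mul.
    apply: in0_inv => //; apply: in0_add; last exact: in0_Q0.
    by apply: in0_mul; [apply: in0_mul => // |]; apply: in0_P0.
  by apply: in0_mul; [apply: in0_mul => //; apply: in0_P0 | apply: in0_Q0].
have e : P0 *m chart_mx b g P = chart_mx b g P *m P0.
  by rewrite /chart_mx mulmxDr mulmxDl P0Q0 Q0P0 !mulmxA P0P0 -[_ *m P0 *m P0]mulmxA P0P0.
rewrite /K !mulmxA (comm_inv u e) -[_ *m P0 *m P0]mulmxA P0P0 -[_ *m Q0 *m Q0]mulmxA Q0Q0.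
by [].
Qed.
Let hJ : commJ h. Proof. by apply: commJ_mul => //; apply: commJ_add; [apply: commJ1 | apply: phi_comm]. Qed.
Let hiJ : commJ hi.
Proof. by apply: commJ_mul; [apply: commJ_tr | apply: commJ_sub; [apply: commJ1 | apply: phi_comm]]. Qed.

Lemma tangentJ v : tg (v *m Jm R (mc + mc)) = tg v *m J.
Proof.
have gen (P' Q' h' hi' f : 'M[R]_p) : commJ h' -> commJ Q' ->
    P' *m (hi' *m (f *m J) *m h') *m Q' = P' *m (hi' *m f *m h') *m Q' *m J.
  by move=> e e'; rewrite -!mulmxA e' [h' *m (J *m Q')]mulmxA e -!mulmxA.
rewrite /tangent phiJ; exact: gen.
Qed.

Lemma Lop_mns (L : 'M[R]_p -> 'M[R]_p) (A : 'M[R]_p) : Lop clC arr L -> L A = L (mns A).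
Proof.
move=> [lL _ L0 _ _]; have LD A' B' : L (A' + B') = L A' + L B' by have := lL 1 A' B'; rewrite !scale1r.
by rewrite -{1}(pls_mns A) LD (L0 _ (pls_comm A)) add0r.
Qed.

(** The derivative of a projection has the form T + T^T. Replacing T by T J multiplies the
    anticommuting part by J on the right, because transposing J and moving it across each contribute
    a sign. *)
Lemma Lop_symJ (L : 'M[R]_p -> 'M[R]_p) (T : 'M[R]_p) : Lop clC arr L -> L (T *m J + (T *m J)^T) = L (T + T^T) *m J.
Proof.
move=> oL; have [_ _ _ LJ _] := oL; rewrite Lop_mns // [L (T + _)]Lop_mns // -LJ; last exact: mns_anti.
congr L; rewrite trmx_mul JmT mulNmx.
have D2 A A' : mns (A + A') = mns A + mns A' by have := mns_lin 1 A A'; rewrite !scale1r.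
have N2 A : mns (- A) = - mns A by have := mns_lin (-1) A 0; rewrite addr0 [mns 0]mns_comm ?addr0 ?scaleN1r // /commJ mulmx0 mul0mx.
rewrite !D2 N2 mns_mulJ mulmxDl; congr (_ + _).
have -> : mns (J *m T^T) = J *m mns T^T.
  by have := @mns_mul _ _ J T^T 1%:M; rewrite !mulmx1; apply=> //; apply: commJ1.
exact: esym (mns_anti _).
Qed.

(** At a J-invariant zero P_- vanishes, so |P_-|^2 has no first order term and only [W] and [L]
    contribute to the derivative. *)
Lemma fixed_jet s Y L A : Spec (s *m B) Y L -> jacobian (cheq c (ys s)) x A -> forall v,
  v *m A = gramd x ^+ 2 *: ecoord (phi v *m h *m W *m hi - h *m W *m hi *m phi v +
    h *m L (tg v + (tg v)^T) *m hi).
Proof.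
move=> S jA v; have [Y1 YJ oL yE] := S; have [lL L1 L0 LJ La] := oL.
have sW := sect_commJ s PJ.
have z : cheq c (ys s) x = 0 by apply/(cheq_eq0 eI tP eP); rewrite sW; case: fP.
have e : v *m A = gramd x ^+ 2 *: ecoord (phi v *m h *m sect (ys s) 1 P *m hi - h *m sect (ys s) 1 P *m hi *m phi v +
    h *m L (tg v + (tg v)^T) *m hi); last by rewrite e sW.
apply: (cheq_jet tP eP) => // d1 n1 jd jn en; rewrite sW.
have Z0 (A' : 'M[R]_p) : commJ A' -> mns A' = 0 by apply: mns_comm.
have gP0 : mns (gramd x *: P) = 0 by apply: Z0; rewrite /commJ -scalemxAl -scalemxAr PJ.
have L00 : L 0 = 0 by apply: L0; rewrite /commJ mulmx0 mul0mx.
have LD A' B' : L (A' + B') = L A' + L B' by have := lL 1 A' B'; rewrite !scale1r.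
have LZ a A' : L (a *: A') = a *: L A' by have := lL a A' 0; rewrite L00 !addr0.
have j1 := mjet_scale (sjet_mul jd jd) (mjet_cst W x v).
have j2 := mjet_linear (fun s0 A0 B0 => mns_lin s0 A0 B0) jn.
have j3 : sjet (fun z => nu (g^T *m nproj z *m g)) x v 0 0.
  have h2 i j := sjet_mul (j2 i j) (j2 i j).
  have := sjet_sum (index_enum _) (fun i => sjet_sum (index_enum _) (fun j => h2 i j)).
  rewrite gP0 !big1; last 2 first.
  - by move=> i _; rewrite big1 // => j _; rewrite mxE mul0r mulr0 addr0.
  - by move=> i _; rewrite big1 // => j _; rewrite mxE mul0r.
  by apply: sjet_ext => z'; apply: eq_bigr => i _; apply: eq_bigr => j _; rewrite expr2.
have j4 := mjet_scale j3 (mjet_cst Y x v).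
have j5 := mjet_scale jd (mjet_linear lL jn).
have := mjet_add j1 (mjet_add j4 j5).
have -> : (gramd x * gramd x) *: W + (0 *: Y + gramd x *: L (gramd x *: P)) = gramd x ^+ 2 *: W.
  by rewrite scale0r LZ (L0 P PJ) !scaler0 !addr0 expr2.
have -> : (gramd x * gramd x) *: 0 + (gramd x * d1 + d1 * gramd x) *: W +
   (0 *: 0 + 0 *: Y + (gramd x *: L n1 + d1 *: L (gramd x *: P))) =
   (2 * gramd x * d1) *: W + gramd x ^+ 2 *: L (tg v + (tg v)^T).
  rewrite en LD !LZ (L0 P PJ) !scaler0 !add0r scale0r add0r addr0 scalerA -expr2; congr (_ *: _ + _); ring.
apply: mjet_ext => z'.
by rewrite /ys sectD sect_yW // yE.
Qed.

(** In the coordinates of a chart commuting with J the Jacobian is complex linear, by the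
    equivariance of L. *)
Lemma fixed_det_ge0 s A : jacobian (cheq c (ys s)) x A -> 0 <= \det A.
Proof.
move=> jA; have [Y [L [S _]]] := sect_ys W1 hB s; have fj := fixed_jet S jA.
have [_ _ oL _] := S.
apply: det_commJ_ge0; apply/row_matrixP => i; rewrite 2!rowE; move: (delta_mx 0 i) => v.
rewrite [RHS]mulmxA (fj (v *m Jm R (mc + mc))) phiJ tangentJ Lop_symJ // [LHS]mulmxA fj -scalemxAl -coordJ.
congr (_ *: coord _ _).
have e1 (f h' w hi' : 'M[R]_p) : commJ h' -> commJ w -> commJ hi' ->
    f *m J *m h' *m w *m hi' = f *m h' *m w *m hi' *m J.
  by move=> a b' c'; rewrite -!mulmxA c' [w *m (J *m _)]mulmxA b' -[J *m w *m _]mulmxA [h' *m (J *m _)]mulmxA a -!mulmxA.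
have e2 (h' l hi' : 'M[R]_p) : commJ hi' -> h' *m (l *m J) *m hi' = h' *m l *m hi' *m J.
  by rewrite -!mulmxA => ->.
rewrite [LHS]mulmxDl [X in X + _ = _]mulmxBl; congr (_ - _ + _); [exact/esym/e1 | by rewrite [RHS]mulmxA | exact/esym/e2].
Qed.

Lemma mask1J A : mask1 cl arr (A *m J) = mask1 cl arr A *m J.
Proof.
apply/matrixP => i j; rewrite mulJr [LHS]mxE [X in _ = _ * X]mxE mulJr.
have -> : cl (fl j) = cl j by rewrite /clR hd_fl.
by case: (arr _ _); rewrite ?mulr0.
Qed.
Lemma mask1Jl A : mask1 cl arr (J *m A) = J *m mask1 cl arr A.
Proof.
apply/matrixP => i j; rewrite mulJl [LHS]mxE [X in _ = _ * X]mxE mulJl.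
have -> : cl (fl i) = cl i by rewrite /clR hd_fl.
by case: (arr _ _); rewrite ?mulr0.
Qed.

Lemma anti_mask (Z : 'M[R]_p) : anti Z -> anti (mask1 cl arr Z).
Proof. by rewrite /anti -mask1J -mask1Jl => ->; rewrite -scaleN1r mask1Z scaleN1r. Qed.

Section UnitExists.
(** A perturbation designed to make the derivative invertible: on the anticommuting part it cancels
    the contribution of [W] and substitutes the identification [iso] of the tangent block with the
    fibre block. *)
Let T A := P *m mns A *m (1%:M - P).
Let iso A := hi *m shift_mx tixC eixC (h *m A *m hi) *m h.
Let L A := mask1 cl arr (iso (T A) - (T A *m W *m (1%:M - P) - P *m W *m T A)).
Let Tlin s A A' : T (s *: A + A') = s *: T A + T A'.
Proof.
rewrite /T mns_lin; move: (mns A) (mns A') (1%:M - P) => U V Q.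
by rewrite mulmxDr mulmxDl -scalemxAr -scalemxAl.
Qed.
Let isolin s A A' : iso (s *: A + A') = s *: iso A + iso A'.
Proof.
rewrite /iso; move: h hi => h' hi'.
by rewrite mulmxDr mulmxDl -scalemxAr -scalemxAl shift_lin mulmxDr mulmxDl -scalemxAr -scalemxAl.
Qed.
Let gr (u a v : 'M[R]_p) : commJ v -> u *m (a *m J) *m v = u *m a *m v *m J.
Proof. by rewrite -!mulmxA => ->. Qed.
Let gl (u a v : 'M[R]_p) : commJ u -> u *m (J *m a) *m v = J *m (u *m a *m v).
Proof. by rewrite !mulmxA => ->. Qed.
Let isoJ A : iso (A *m J) = iso A *m J.
Proof. by rewrite /iso (gr h) // (shiftJr tixC eixCI) gr. Qed.
Let isoJl A : iso (J *m A) = J *m iso A.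
Proof. by rewrite /iso (gl (u := h)) // (shiftJl tixC eixCI) gl. Qed.
Let TA A : anti (T A).
Proof. by apply: anti_mulr => //; apply: anti_mull => //; apply: mns_anti. Qed.
Let iso0 : iso 0 = 0.
Proof. by have := isolin 1 0 0; rewrite !scale1r addr0 => /eqP; rewrite eq_sym -subr_eq0 addrK => /eqP. Qed.
Let isoanti A : anti A -> anti (iso A).
Proof.
move=> aA; rewrite /anti -isoJ aA -isoJl.
by have := isolin (-1) (J *m A) 0; rewrite iso0 !addr0 !scaleN1r.
Qed.
Let TJ A : T (A *m J) = T A *m J.
Proof. by rewrite /T mns_mulJ; apply: gr. Qed.
Let oL : Lop clC arr L.
Proof.
split.
- move=> s A A'; rewrite /L -mask1Z -mask1D; congr mask1; rewrite Tlin isolin.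
  move: (iso (T A)) (iso (T A')) => I1 I2; move: (T A) (T A') (1%:M - P) (P *m W) => U U' Q PW.
  have e1 : (s *: U + U') *m W *m Q = s *: (U *m W *m Q) + U' *m W *m Q by rewrite !mulmxDl -!scalemxAl.
  have e2 : PW *m (s *: U + U') = s *: (PW *m U) + PW *m U' by rewrite mulmxDr -scalemxAr.
  rewrite e1 e2.
  move: (U *m W *m Q) (U' *m W *m Q) (PW *m U) (PW *m U') => a1 a2 a3 a4.
  by apply/matrixP => i j; rewrite !mxE; ring.
- by move=> A; apply: in1_mask.
- move=> A cA; have T0 : T A = 0 by rewrite /T mns_comm // mulmx0 mul0mx.
  rewrite /L T0 iso0 !mul0mx mulmx0 !subr0.
  by apply/matrixP => i j; rewrite !mxE if_same.
- move=> A aA; rewrite /L TJ isoJ -mask1J; congr mask1; move: (iso (T A)) (T A) => I1 U.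
  have g3 (u w v : 'M[R]_p) : commJ w -> commJ v -> u *m J *m w *m v = u *m w *m v *m J.
    by move=> e1 e2; rewrite -!mulmxA e2 [w *m (J *m v)]mulmxA e1 -!mulmxA.
  rewrite g3 // [P *m W *m (U *m J)]mulmxA; move: (U *m W *m _) (P *m W *m U) => a1 a2.
  by rewrite !mulmxBl.
move=> A aA; apply: anti_mask; apply: anti_sub; first exact: isoanti.
apply: anti_sub; first by apply: anti_mulr => //; apply: anti_mulr.
by apply: anti_mull => //; apply: commJ_mul.
Qed.

(** A kernel vector is split into its commuting part [tp] and its anticommuting part [si]. With the
    special [L] the two decouple: [tp] solves the linearized complex problem, excluded by [Hplus],
    and [si] lies in the kernel of an injective map. *)
Lemma fixed_unit_ex : exists s, forall A, jacobian (cheq c (ys s)) x A -> A \in unitmx.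
Proof.
have [[P_0 PT PP trP] _ zP] := fP.
have [y Sy] := @Spec_ex R q X clC arr 0 L (ltac:(by move=> i j _; rewrite mxE)) (ltac:(by rewrite /commJ mulmx0 mul0mx)) oL.
have [s es] : exists s, y = s *m B by apply/hB; exists 0, L.
rewrite es in Sy; exists s => A jA; apply: unitmx_inj => v; rewrite (fixed_jet Sy jA v) => /eqP.
rewrite scaler_eq0 expf_eq0 /= (negPf (gramd_neq0 tix x)) /=.
move=> /eqP; set N := tg v + (tg v)^T; have [_ L1 _ _ _] := oL.
have ng : P *m tg v *m (1%:M - P) = tg v by apply: (tangent_PQ tP).
have t0 : in0 (tg v) by apply: (in0_tangent tP).
move=> /(cheq_jet_eq0 eI tP eP v W1 (L1 N) zP) eqn.
pose si := mns (tg v); pose tp := pls (tg v).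
have PP' : (1%:M - P) *m (1%:M - P) = 1%:M - P by rewrite mulmxBr mulmx1 mulmxBl mul1mx PP subrr subr0.
have PsQ : P *m si *m (1%:M - P) = si by rewrite /si -mns_mul // ng.
have PtQ : P *m tp *m (1%:M - P) = tp.
  have e1 : tp = tg v - si by rewrite -(pls_mns (tg v)) addrK.
  have gq (Q' : 'M[R]_p) : P *m (tg v - si) *m Q' = P *m tg v *m Q' - P *m si *m Q'.
    by rewrite mulmxBr mulmxBl.
  by rewrite {1}e1 gq ng PsQ -e1.
have TN : T N = si.
  rewrite /T -mns_mul // /N mulmxDr mulmxDl ng.
  have -> : P *m (tg v)^T *m (1%:M - P) = 0.
    have QT (P' : 'M[R]_p) : P'^T = P' -> (1%:M - P')^T = 1%:M - P' by move=> e'; rewrite linearB /= trmx1 e'.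
    have tgT (P' Z Q' : 'M[R]_p) : (P' *m Z *m Q')^T = Q'^T *m (Z^T *m P'^T) by rewrite !trmx_mul.
    rewrite -ng tgT (QT _ PT) PT; move: (tg v)^T (P) PP => Z P' pp.
    by rewrite [P' *m (_ *m _)]mulmxA [P' *m (1%:M - P')]mulmxBr mulmx1 pp subrr !mul0mx.
  by rewrite addr0.
have s0 : in0 si by apply: in0_mns.
have sWP : in1 (si *m W *m (1%:M - P) - P *m W *m si).
  apply: in1_add; last apply: in1_opp.
    apply: in1_in0; first exact: in0_in1.
    by apply: in0_sub => //; apply: in0_1.
  by apply: in1_in0 => //; apply: in0_in1.
have i1 : in1 (iso si).
  apply: in1_in0; last exact: (in0_chart_h tP).
  by apply: in0_in1; [apply: (in0_chart_hi tP) | apply: (in1_emx eP)].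
have LN : L N = iso si - (si *m W *m (1%:M - P) - P *m W *m si).
  by rewrite /L TN mask1_id //; apply: in1_add => //; apply: in1_opp.
have tpsi : tg v = tp + si by rewrite pls_mns.
(* The contribution of [W] on [si] has been cancelled by [L]. *)
have eqn2 : (tp *m W *m (1%:M - P) - P *m W *m tp) + P *m iso si *m (1%:M - P) = 0.
  rewrite -eqn LN tpsi.
  move: PP PP' PsQ; move: (tp) (si) (P) (iso si) (1%:M - P) => tp' si' P' ii Q pp qq psq.
  have -> : P' *m (ii - (si' *m W *m Q - P' *m W *m si')) *m Q = P' *m ii *m Q - (si' *m W *m Q - P' *m W *m si').
    rewrite [P' *m _]mulmxBr mulmxBl; congr (_ - _); rewrite mulmxBr mulmxBl; congr (_ - _).
      have -> : P' *m (si' *m W *m Q) *m Q = (P' *m si') *m W *m (Q *m Q) by rewrite !mulmxA.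
      by rewrite qq -psq !mulmxA pp.
    have -> : P' *m (P' *m W *m si') *m Q = (P' *m P') *m W *m (si' *m Q) by rewrite !mulmxA.
    by rewrite pp -[in LHS]psq -[P' *m si' *m Q *m Q]mulmxA qq psq.
  rewrite !mulmxDl !mulmxDr; move: (tp' *m W *m _) (P' *m W *m tp') (P' *m ii *m _) => a1 a2 a3.
  by move: (si' *m W *m _) (P' *m W *m si') => a4 a5; apply/matrixP => i j; rewrite !mxE; ring.
(* This term anticommutes with J, while by the equation it is the opposite of one that commutes. *)
have a3 : P *m iso si *m (1%:M - P) = 0.
  apply: comm_anti0; last by apply: anti_mulr => //; apply: anti_mull => //; apply: isoanti; apply: mns_anti.
  move/eqP: eqn2; rewrite addrC addr_eq0 => /eqP ->.
  rewrite -[- _]sub0r; apply: commJ_sub; first by rewrite /commJ mulmx0 mul0mx.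
  have tc : commJ tp by apply: pls_comm.
  by apply: commJ_sub; [apply: commJ_mul => //; apply: commJ_mul | apply: commJ_mul => //; apply: commJ_mul].
have tp0 : tp = 0.
  apply: (Hplus fP) => //; [exact: in0_pls | exact: pls_comm |].
  by move/eqP: eqn2; rewrite a3 addr0 subr_eq0 => /eqP.
have si0 : si = 0.
  have su : h \in unitmx by apply: (chart_h_unit tP).
  have hinv : invmx h = hi by apply: (chart_h_inv tP).
  have sp : spans b P h by apply: (chart_spans tP).
  have gen (u v' E' : 'M[R]_p) : u *m v' = 1%:M -> u *m (v' *m E' *m u) *m v' = E'.
    by move=> e'; rewrite !mulmxA e' mul1mx -mulmxA e' mulmx1.
  have := (spans_zero (iso si) su sp).1 a3; rewrite hinv /iso gen; last exact: (chart_hK tP).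
  rewrite /shift_mx (emx_support eP) => e0.
  have c0 : coord tix (h *m si *m hi) = 0.
    by rewrite -[LHS](mxofK eI) e0; apply/rowP => k; rewrite !mxE.
  rewrite -PsQ; apply/(spans_zero si su sp); rewrite hinv.
  have i0 : in0 (h *m si *m hi).
    by apply: in0_mul; [apply: in0_mul => //; apply: (in0_chart_h tP) | apply: (in0_chart_hi tP)].
  move: c0 i0; move: (h *m si *m hi) => Z c0 i0.
  apply/matrixP => i j; rewrite mul_Q0r mul_P0 [RHS]mxE.
  have [/tP [k ek]|] := boolP [&& b i, ~~ b j & cl i == cl j].
    have := congr1 (fun w : 'rV_m => w 0 k) c0; rewrite !mxE ek /= => ->.
    by rewrite mulr0 mul0r.
  case: (b i) => /=; last by rewrite !mul0r.
  case: (b j) => /=; first by rewrite mulr0.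
  by move=> ne; rewrite ((in0P _ _).1 i0) // !mulr0 mul0r.
have tv0 : tg v = 0 by rewrite tpsi tp0 si0 addr0.
have := tangentK tP c x v.
rewrite tv0 mulmx0 mul0mx mulmx0 mul0mx => e.
by rewrite -(mxofK tI v) -e; apply/rowP => k; rewrite !mxE.
Qed.
End UnitExists.

(** The Jacobian is affine in the parameter [s], through the first jet of the linear family, so its
    determinant is polynomial in [s]. *)
Lemma fixed_det_poly : exists2 f : 'rV[R]_n0 -> R, polyf f &
  forall s A, jacobian (cheq c (ys s)) x A -> f s = \det A.
Proof.
have [Phi1 [Phi2 [p1 p2 jP]]] := mxpolyf_jet (mxpolyf_cheqmx R arr b tix eix c).
exists (fun s => \det (\matrix_(i, k) (ys s *m Phi1 (row_mx x (delta_mx 0 i))) 0 k)).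
  apply: polyf_det => i k.
  have h' : mxpolyf (fun s => ys s *m Phi1 (row_mx x (delta_mx 0 i))).
    apply: mxpolyf_mul; last exact: mxpolyf_cst.
    by apply: mxpolyf_add; [apply: mxpolyf_cst | apply: mxpolyf_mul; [apply: mxpolyf_id | apply: mxpolyf_cst]].
  by apply: (polyf_ext (h' 0 k)) => s; rewrite [RHS]mxE.
move=> s A jA; congr determinant; apply/matrixP => i k; rewrite mxE.
have eq : cheq c (ys s) = fun z => ys s *m cheqmx c z by apply/funext => z; rewrite cheqmxE.
rewrite eq in jA; rewrite (jet2_jacobian jA (jP (ys s) x (delta_mx 0 i))).
by rewrite -rowE mxE.
Qed.
End AtFixed.

Lemma chart_of_fixed P : fixed P -> exists c x, commJ (gmx c) /\ chartP c x = P.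
Proof.
move=> [iP cP _]; have [c gJ u] := Hchart iP cP.
by have [x ex] := chart_of tixCI tixCP iP u; exists c, x.
Qed.

Lemma near_neq0 n a a' (F : 'rV[R]_n -> 'M[R]_(a, a')) v : mxpolyf F -> F v != 0 ->
  \forall w \near v, F w != 0.
Proof.
move=> pF nF; have [i [j nij]] : exists i j, F v i j != 0.
  apply: contrapT => h; case/eqP: nF; apply/matrixP => i j; rewrite [RHS]mxE; apply: contrapT => ne.
  by apply: h; exists i, j; apply/eqP.
have [d d0 hd'] := polyf_near_sgr (pF i j) nij.
apply: (near_of_ball d0) => w /hd' e; apply: contra nij => /eqP e'.
by rewrite -sgr_eq0 -e e' mxE sgr0.
Qed.

(** J-invariant zeros are isolated: at one of them a suitably perturbed section has an invertible
    difference quotient, also for nearby pairs of points. The other points have a neighbourhood free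
    of such zeros, and compactness concludes. *)
Lemma fixed_finite : exists l : seq 'rV[R]_(p * p), forall v, fixed (vec_mx v) <-> v \in l.
Proof.
pose K := @proj_set R p X cl b.
pose A := [set v : 'rV[R]_(p * p) | fixed (vec_mx v)].
have [||l hl] := @compact_isolated_finite 'rV[R]_(p * p) K A; first exact: compact_proj_set.
  move=> v Kv; have pv : mxpolyf (fun w : 'rV[R]_(p * p) => vec_mx w : 'M[R]_p).
    by apply: mxpolyf_vec_mx; apply: mxpolyf_id.
  have [fv|nf] := pselect (fixed (vec_mx v)); last first.
    have [nJ|cJ] := pselect (~ commJ (vec_mx v : 'M[R]_p)).
      have : \forall w \near v, vec_mx w *m J - J *m vec_mx w != 0.
        apply: near_neq0; last by rewrite subr_eq0; apply/eqP.
        by apply: mxpolyf_sub; apply: mxpolyf_mul => //; apply: mxpolyf_cst.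
      by apply: filterS => w nw [_ cw _]; case/eqP: nw; rewrite cw subrr.
    have {}cJ : commJ (vec_mx v : 'M[R]_p) by apply: contrapT.
    have : \forall w \near v, vec_mx w *m W *m (1%:M - vec_mx w) != 0.
      apply: near_neq0; last by apply/eqP => e; apply: nf.
      apply: mxpolyf_mul; first by apply: mxpolyf_mul => //; apply: mxpolyf_cst.
      by apply: mxpolyf_sub => //; apply: mxpolyf_cst.
    by apply: filterS => w nw [_ _ ew]; case/eqP: nw.
  have [c [x [gJ ex]]] := chart_of_fixed fv.
  have fx : fixed (chartP c x) by rewrite ex.
  have [s us] := fixed_unit_ex fx gJ.
  have pF := mxpolyf_cheq arr b tix eix c (ys s).
  have [Q [pQ _ FQ]] := mxpolyf_quotient pF.
  have uQ := us _ (jacobian_quotient x pF pQ FQ).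
  pose f y := \det (Q (row_mx x y)).
  have pf : polyf f.
    apply: polyf_det; apply: (mxpolyf_comp pQ).
    by apply: mxpolyf_row_mx; [apply: mxpolyf_cst | apply: mxpolyf_id].
  have fx0 : f x != 0 by rewrite /f -unitfE -unitmxE.
  have [d d0 hd'] := polyf_near_sgr pf fx0.
  have dv : chart_dom b c v.
    by rewrite /chart_dom /= -ex (chart_mx_projn tP) ?unitmx_inv ?gram_unit //; apply: gmxK.
  have ev : chart_psi b tix c x = v by rewrite /chart_psi ex vec_mxK.
  have ecx : chart_chi b tix c v = x by rewrite -ev; apply: (chart_psiK tI tP).
  have near1 := chart_dom_open dv; have near2 := chart_chi_cont tix dv d0.
  near=> w => fw; have dw : chart_dom b c w by near: w.
  have nw : `|chart_chi b tix c w - chart_chi b tix c v| < d by near: w.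
  rewrite ecx in nw; have iw : K w by rewrite /K /proj_set /=; case: fw.
  have ew := chart_chiK tI tP iw dw; rewrite -ew -ev; congr (chart_psi b tix c _).
  move: (chart_chi b tix c w) nw ew => y ny ey.
  have zy : cheq c (ys s) y = 0.
    apply/(cheq_eq0 eI tP eP); have -> : chartP c y = vec_mx w by rewrite -ey /chart_psi mxvecK.
    by rewrite sect_commJ; case: fw.
  have zx : cheq c (ys s) x = 0.
    by apply/(cheq_eq0 eI tP eP); rewrite sect_commJ; case: fx.
  have := FQ x y; rewrite zx zy subrr => /esym e0.
  have uy : Q (row_mx x y) \in unitmx.
    by rewrite unitmxE unitfE -sgr_eq0 (hd' _ ny) sgr_eq0.
  by move/(congr1 (mulmx^~ (invmx (Q (row_mx x y))))): e0; rewrite /= mulmxK // mul0mx => /eqP; rewrite subr_eq0 => /eqP.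
exists [seq v <- l | `[< fixed (vec_mx v) >]] => v; rewrite mem_filter; split=> [fv|/andP [/asboolP //]].
apply/andP; split; first exact/asboolP.
by apply: hl => //; rewrite /K /proj_set /=; case: fv.
Unshelve. all: by end_near.
Qed.

(** The parameter avoids finitely many negligible conditions: a zero that is not J-invariant, and a
    vanishing determinant at one of the finitely many J-invariant zeros. *)
Theorem special_section (sgn : 'rV[R]_D -> 'rV[R]_(p * p) -> R) : orientation cl arr b tix eix sgn ->
  exists y, [/\ nondegenerate cl arr b tix eix y,
    forall v, zero_set y v <-> fixed (vec_mx v) &
    forall v, fixed (vec_mx v) -> sgn y v = 1].
Proof.
move=> osgn; have [l hl] := fixed_finite.
have hf (i : 'I_(size l)) : exists f : 'rV[R]_n0 -> R, [/\ polyf f, exists s, f s != 0 &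
    exists c x, [/\ commJ (gmx c), chartP c x = vec_mx (l`_i) &
      forall s A, jacobian (cheq c (ys s)) x A -> f s = \det A]].
  have /hl fv : l`_i \in l by apply: mem_nth.
  have [c [x [gJ ex]]] := chart_of_fixed fv.
  have [f pf hf] := fixed_det_poly c x; exists f; split=> //; last by exists c, x.
  have fx : fixed (chartP c x) by rewrite ex.
  have [s us] := fixed_unit_ex fx gJ; exists s.
  have [A jA] := jacobian_ex (mxpolyf_cheq arr b tix eix c (ys s)) x.
  by rewrite (hf _ _ jA) -unitfE -unitmxE us.
have [f hfs] := choice hf.
have ng : negligible (fun s => (exists P, [/\ isproj P, is_zero (ys s) P & mns P != 0]) \/ exists i, f i s = 0).
  apply: negligible_or; first exact: (nofix_negligible tixCI eixCI tixCP eixCP W1 WJ hB).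
  apply: negligible_bigU => i; have [pf [s fs] _] := hfs i.
  by apply: negligible_polyf => //; exists s.
have [s ns] := negligible_avoid ng.
have zfix P : isproj P -> is_zero (ys s) P -> fixed P.
  move=> iP zP; have cP : commJ P.
    rewrite -[P]pls_mns; have -> : mns P = 0.
      by apply: contrapT => /eqP n; apply: ns; left; exists P.
    by rewrite addr0; apply: pls_comm.
  by split=> //; move: zP; rewrite /is_zero sect_commJ.
have fixz P : fixed P -> is_zero (ys s) P by move=> [iP cP zP]; rewrite /is_zero sect_commJ.
(* The sign, computed in a chart commuting with J, is carried to an arbitrary chart by
   [jacobian_sign]. *)
have dpos P : fixed P -> forall c x A, chartP c x = P -> jacobian (cheq c (ys s)) x A -> 0 < \det A.
  move=> fP c x A ex jA; have /hl vl : fixed (vec_mx (mxvec P)) by rewrite mxvecK.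
  have il : (index (mxvec P) l < size l)%N by rewrite index_mem.
  have [_ _ [c' [x' [gJ ex' hd']]]] := hfs (Ordinal il).
  rewrite /= nth_index // mxvecK in ex'.
  have [A' jA'] := jacobian_ex (mxpolyf_cheq arr b tix eix c' (ys s)) x'.
  have fx' : fixed (chartP c' x') by rewrite ex'.
  have p' : 0 < \det A'.
    rewrite lt_neqAle (fixed_det_ge0 fx' gJ jA') andbT eq_sym -(hd' _ _ jA'); apply/eqP => e.
    by apply: ns; right; exists (Ordinal il).
  have z : cheq c (ys s) x = 0 by apply/(cheq_eq0 eI tP eP); rewrite ex; apply: fixz.
  have tc i : cl (flperm q i) = cl i by rewrite flpermE /clR hd_fl.
  have tb i : b (flperm q i) = b i by rewrite flpermE /bR hd_fl.
  have th i : (fun i => ~~ eps i) (flperm q i) = ~~ (fun i => ~~ eps i) i by rewrite flpermE eps_fl.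
  have ee : chartP c x = chartP c' x' by rewrite ex ex'.
  have := jacobian_sign tI eI tP eP tc tb th ee z jA jA'.
  by rewrite (gtr0_sg p') => /eqP; rewrite sgr_cp0.
exists (ys s); split.
- move=> c x A z jA; rewrite unitmxE unitfE gt_eqF //; apply: (dpos _ _ _ _ _ (erefl _) jA).
  by apply: zfix; [apply: (isproj_chartP tP) | apply/(cheq_eq0 eI tP eP)].
- by move=> v; split=> [[iv zv]|fv]; [apply: zfix | split; [case: fv | apply: fixz]].
move=> v fv; have [c [x [gJ ex]]] := chart_of_fixed fv.
have [A jA] := jacobian_ex (mxpolyf_cheq arr b tix eix c (ys s)) x.
have -> : v = chart_psi b tix c x by rewrite /chart_psi ex vec_mxK.
rewrite (osgn _ _ _ A) //; first by rewrite (gtr0_sg (dpos _ fv _ _ _ ex jA)).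
by apply/(cheq_eq0 eI tP eP); rewrite ex; apply: fixz.
Qed.
End Special.

End SpecialSection.

(** * Tangent spaces of Schubert varieties and transversality *)

Module SchubertTangent.
Import all_boot all_order all_algebra.
Import zify ring.
Import boolp classical_sets functions cardinality reals.
Import -(notations) mpoly.
Import Defs PolynomialFunctions Projections.
Import Order.TTheory GRing.Theory Num.Theory.
Local Open Scope ring_scope.

Section AdaptedBasis.
Variables (F : fieldType) (n : nat) (I : pred nat) (D : nat -> {vspace 'rV[F]_n}).
Hypothesis dimD : forall i, I i -> (i <= n)%N -> \dim (D i) = i.
Hypothesis monD : forall i j, I i -> I j -> (i <= j)%N -> (j <= n)%N -> (D i <= D j)%VS.
Hypothesis In : I n.

(** Vectors are prepended one at a time, each taken from the smallest prescribed subspace of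
    dimension greater than [l]; hence the final segments of the list span the prescribed
    subspaces. *)
Lemma adapted_seq l : (l <= n)%N -> exists s : seq 'rV[F]_n, [/\ size s = l, free s,
  forall i, I i -> (i <= l)%N -> <<drop (l - i) s>>%VS = D i &
  forall i, I i -> (l <= i <= n)%N -> (<<s>> <= D i)%VS].
Proof.
elim: l => [_|l IH ln].
  exists [::]; split=> //; rewrite ?nil_free // => i Ii.
    rewrite leqn0 => /eqP e; rewrite e in Ii *; rewrite span_nil; apply/esym/eqP.
    by rewrite -dimv_eq0 dimD.
  by move=> _; rewrite span_nil sub0v.
have [s [sz fs h1 h2]] := IH (ltnW ln).
have ex : exists i, I i && (l < i <= n)%N by exists n; rewrite In ln leqnn.
have [i0 /and3P [Ii0 li0 i0n] mi0] := ex_minnP ex.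
have [w wD ws] : exists2 w, w \in D i0 & w \notin <<s>>%VS.
  apply/subvPn; apply: contraL li0 => /dimvS; rewrite dimD // -leqNgt -sz.
  by move: fs; rewrite /free => /eqP ->.
have fs' : free (w :: s) by rewrite free_cons ws.
have sub i : I i -> (l < i <= n)%N -> (<<w :: s>> <= D i)%VS.
  move=> Ii /andP [li iN]; have le : (i0 <= i)%N by apply: mi0; rewrite Ii li.
  rewrite span_cons subv_add -memvE (subvP (monD Ii0 Ii le iN)) //.
  by apply: h2; rewrite // (ltnW li).
exists (w :: s); split=> //=; first by rewrite sz.
move=> i Ii; rewrite leq_eqVlt => /predU1P [e|].
  rewrite e in Ii *; rewrite subnn drop0; apply/eqP; rewrite eqEdim sub ?leqnn // dimD //.
  by move: fs'; rewrite /free => /eqP -> /=; rewrite sz.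
by rewrite ltnS => il; rewrite subSn //= h1.
Qed.

Lemma adapted_basis : exists2 B : 'M[F]_n, B \in unitmx &
  forall i (c : 'rV_n), I i -> (i <= n)%N ->
    (c \in D i) <-> (forall l : 'I_n, (i <= l)%N -> (c *m invmx B) 0 l = 0).
Proof.
have [s [sz fs h1 _]] := adapted_seq (leqnn n).
(* The list was built from its end, so it is read backwards. *)
pose B : 'M[F]_n := \matrix_(r < n) s`_(n - r.+1).
have rB r : row r B = s`_(n - r.+1) by rewrite rowK.
have uB : B \in unitmx.
  apply: unitmx_inj => v; rewrite mulmx_sum_row => e.
  have : \sum_(i < size s) v 0 (cast_ord sz (rev_ord i)) *: s`_i = 0.
    rewrite -[RHS]e (reindex_onto (fun i : 'I_(size s) => cast_ord sz (rev_ord i))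
       (fun i => rev_ord (cast_ord (esym sz) i))) /=; last first.
      by move=> i _; rewrite rev_ordK cast_ordKV.
    apply: eq_big => [i|i _].
      by rewrite cast_ordK rev_ordK eqxx.
    rewrite rB; congr (_ *: s`_ _) => /=; have := ltn_ord i; move: sz; lia.
  have /freeP fs1 : free (in_tuple s) by [].
  move=> /(fs1 (fun i => v 0 (cast_ord sz (rev_ord i)))) hv.
  apply/rowP => j; rewrite [RHS]mxE -(hv (rev_ord (cast_ord (esym sz) j))).
  by rewrite rev_ordK cast_ordKV.
exists B => // i c Ii iN; split.
  rewrite -(h1 i Ii iN) => /(@coord_span _ _ _ (in_tuple (drop (n - i) s))) cE l il.
  rewrite cE mulmx_suml summxE big1 // => j _.
  have szd : size (in_tuple (drop (n - i) s)) = i by rewrite /= size_drop sz; lia.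
  have ji : (j < i)%N by apply: leq_trans (ltn_ord j) _; rewrite size_drop sz; lia.
  have rn : (i - j.+1 < n)%N by lia.
  have -> : (in_tuple (drop (n - i) s))`_j = row (Ordinal rn) B.
    by rewrite rB /= nth_drop; congr s`_ _; lia.
  rewrite -scalemxAl rowE mulmxK // !mxE /=.
  by case: eqP => [e|]; rewrite ?mulr0 //; move: il; rewrite e /=; lia.
move=> h; rewrite -[c](mulmxKV uB) mulmx_sum_row; apply: memv_suml => l _.
have [il|li] := leqP i l; first by rewrite h // scale0r mem0v.
apply: memvZ; rewrite -(h1 i Ii iN) rB; apply: memv_span.
have -> : s`_(n - l.+1) = (drop (n - i) s)`_(i - l.+1) by rewrite nth_drop; congr s`_ _; lia.
by apply: mem_nth; rewrite size_drop sz; have := ltn_ord l; lia.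
Qed.

End AdaptedBasis.

Section Schubert.
Variables (F : numFieldType) (N K : nat).
Hypothesis KN : (K <= N)%N.
Hypothesis K0 : (0 < K)%N.
Local Notation V := 'rV[F]_N.

Lemma mulmxr_lin (M : 'M[F]_(K, N)) (c : 'rV_K) : linfun (mulmxr M) c = c *m M.
Proof. by rewrite lfunE. Qed.

Lemma memv_row_space (M : 'M[F]_(K, N)) u : u \in row_space M <-> exists c : 'rV_K, u = c *m M.
Proof.
split=> [/coord_span ->|[c ->]].
  elim/big_ind: _ => [|x y [c ->] [c' ->]|i _]; first by exists 0; rewrite mul0mx.
    by exists (c + c'); rewrite mulmxDl.
  set X := image_tuple _ _; have : X`_i \in (X : seq _) by apply: mem_nth; rewrite size_tuple ltn_ord.
  by case/mapP => j _ ->; exists (coord X i u *: delta_mx 0 j); rewrite -scalemxAl -rowE.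
rewrite mulmx_sum_row; apply: memv_suml => i _; apply: memvZ; apply: memv_span.
by apply/mapP; exists i; rewrite ?mem_enum.
Qed.

Definition frame_pre (M : 'M[F]_(K, N)) (E : {vspace V}) : {vspace 'rV[F]_K} :=
  (linfun (mulmxr M) @^-1: E)%VS.

Lemma memv_pre (M : 'M[F]_(K, N)) E c : (c \in frame_pre M E) = (c *m M \in E).
Proof. by rewrite -memv_preim mulmxr_lin. Qed.

Lemma frame_lker (M : 'M[F]_(K, N)) (S : {vspace 'rV[F]_K}) : row_free M -> \dim (linfun (mulmxr M) @: S)%VS = \dim S.
Proof.
move=> fM; apply: limg_dim_eq; apply/eqP; rewrite -subv0; apply/subvP => c.
rewrite memv_cap memv_ker mulmxr_lin => /andP [_ /eqP e]; rewrite memv0; apply/eqP.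
by apply: (row_free_inj fM); rewrite e mul0mx.
Qed.

Lemma dim_row_space (M : 'M[F]_(K, N)) : row_free M -> \dim (row_space M) = K.
Proof.
move=> fM; have -> : row_space M = limg (linfun (mulmxr M)).
  apply/vspaceP => u; apply/idP/idP.
    by move/memv_row_space => [c ->]; rewrite -mulmxr_lin memv_img ?memvf.
  by move/memv_imgP => [c _ ->]; rewrite mulmxr_lin; apply/memv_row_space; exists c.
by rewrite frame_lker // dimvf /dim /= mul1n.
Qed.

Lemma dim_pre (M : 'M[F]_(K, N)) E : row_free M -> \dim (frame_pre M E) = \dim (row_space M :&: E)%VS.
Proof.
move=> fM; rewrite -(frame_lker _ fM); congr (\dim _).
apply/vspaceP => u; apply/idP/idP.
  move/memv_imgP => [c]; rewrite memv_pre => h ->; rewrite mulmxr_lin memv_cap h andbT.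
  by apply/memv_row_space; exists c.
rewrite memv_cap => /andP [/memv_row_space [c ->]] h; rewrite -mulmxr_lin; apply: memv_img.
by rewrite memv_pre.
Qed.

Lemma row_free_dim (M : 'M[F]_(K, N)) : \dim (row_space M) = K -> row_free M.
Proof.
move=> d; have e : row_space M = limg (linfun (mulmxr M)).
  apply/vspaceP => u; apply/idP/idP.
    by move/memv_row_space => [c ->]; rewrite -mulmxr_lin memv_img ?memvf.
  by move/memv_imgP => [c _ ->]; rewrite mulmxr_lin; apply/memv_row_space; exists c.
have := limg_ker_dim (linfun (mulmxr M) : 'Hom('rV[F]_K, 'rV[F]_N)) fullv; rewrite -e d capfv dimvf /dim /= mul1n.
move=> /eqP; rewrite -[X in _ == X]add0n eqn_add2r dimv_eq0 => /eqP k0.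
rewrite -kermx_eq0; apply/rowV0P => v /sub_kermxP hv.
by apply/eqP; rewrite -memv0 -k0 memv_ker mulmxr_lin hv.
Qed.

Lemma dim_cap_flag (U A B : {vspace V}) : (A <= B)%VS ->
  (\dim (U :&: B) + \dim A <= \dim (U :&: A) + \dim B)%N.
Proof.
move=> AB; rewrite -dimv_sum_cap addnC; apply: leq_add.
  by rewrite dimvS // -capvA capvS // capvSr.
by rewrite dimvS // subv_add capvSr.
Qed.

Variables (E : nat -> {vspace V}) (lam : seq nat).
Hypothesis fE : complete_flag E.
Hypothesis boxl : diagram_in_box K (N - K) lam.

Lemma part_le i : (part lam i <= N - K)%N.
Proof.
have /and3P [_ _ /allP h] := boxl; rewrite /part.
have [l|l] := ltnP i.-1 (size lam); last by rewrite nth_default.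
by apply: h; apply: mem_nth.
Qed.

Lemma part_mon i j : (i <= j)%N -> (part lam j <= part lam i)%N.
Proof.
move=> ij; have /and3P [s _ _] := boxl; rewrite /part.
have [l|l] := ltnP j.-1 (size lam); last by rewrite nth_default.
have geq_trans : transitive geq by move=> a c d h1 h2; apply: leq_trans h2 h1.
apply: (sorted_leq_nth geq_trans (fun x => leqnn x) 0%N s); rewrite ?inE //; last by lia.
by apply: leq_ltn_trans l; lia.
Qed.

(** The essential conditions, at the corners of the Young diagram; the last row [K] is always
    included, also when its part is 0. *)
Definition ess i := (0 < i <= K)%N && ((i == K) || (part lam i.+1 < part lam i)%N).
Definition apos i := (N - K + i - part lam i)%N.

Lemma apos_le i : (i <= K)%N -> (apos i <= N)%N.
Proof. by rewrite /apos; lia. Qed.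

Lemma apos_mon i j : (i <= j)%N -> (apos i <= apos j)%N.
Proof. by move=> ij; have := part_mon ij; have := part_le i; rewrite /apos; lia. Qed.

Lemma ess_ge j : (0 < j <= K)%N -> exists i, [/\ ess i, (j <= i <= K)%N & part lam i = part lam j].
Proof.
move=> /andP [j0 jK]; move: {2}(K - j)%N (erefl (K - j)%N) => d.
elim: d j j0 jK => [|d IH] j j0 jK dj.
  by exists j; rewrite /ess j0 jK leqnn; split=> //=; rewrite (_ : j = K) ?eqxx //; lia.
have [h|h] := ltnP (part lam j.+1) (part lam j).
  by exists j; rewrite /ess j0 jK h orbT leqnn.
have [|||i [e1 e2 e3]] := IH j.+1; try lia.
exists i; split=> //; first by lia.
by rewrite e3; apply/eqP; rewrite eqn_leq h andbT part_mon.
Qed.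

(** A condition that is not essential follows from the next essential one, which has the same part:
    passing to a flag member smaller by i - j lowers the dimension of the intersection by at most i
    - j. *)
Lemma schubert_ess U : \dim U = K -> (forall i, ess i -> (i <= \dim (U :&: E (apos i))%VS)%N) ->
  schubert K E lam U.
Proof.
move=> dU h; split=> // j j1; have [i [ei /andP [ji iK] ep]] := ess_ge j1.
have [dE mE] := fE; have aij := apos_mon ji; have ai := apos_le iK; have aj := apos_le (leq_trans ji iK).
have := dim_cap_flag U (mE _ _ aij ai); rewrite !dE // -/(apos j).
have := h i ei; move: ep (part_le i) (part_le j).
move: (\dim (U :&: E (apos i)))%VS (\dim (U :&: E (apos j)))%VS => d1 d2; rewrite /apos; lia.
Qed.

Section Tangent.
Variable M : 'M[F]_(K, N).
Hypothesis XM : schubert K E lam (row_space M).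
Variable T : {vspace 'M[F]_(K, N)}.
Hypothesis TM : is_tangent_space (schubert K E lam) M T.
Local Notation U := (row_space M).

Let fM : row_free M. Proof. by apply: row_free_dim; case: XM. Qed.

(** A polynomial vanishing on the variety vanishes on the line outside finitely many parameters,
    hence identically, and its derivative at 0 vanishes as well. *)
Lemma line_tangent v (h : {poly F}) : h != 0 ->
  (forall t, h.[t] != 0 -> schubert K E lam (row_space (M + t *: v))) -> v \in T.
Proof.
move=> h0 hX; apply/TM => f vf.
have [q [hq dq]] := line_poly_ex (mxvec M 0) (mxvec v 0) f.
have q0 : q = 0.
  apply: (poly_cofinite_eq0 h0) => t /hX /vf; rewrite hq => e.
  rewrite -[RHS]e; apply: meval_eq => i; by rewrite linearD linearZ /= !mxE.
by rewrite /differential -dq q0 deriv0 horner0.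
Qed.

(** As in the matrix determinant lemma, independence of the rows can fail only where 1 + t z
    vanishes, with z computed from a right inverse of M. *)
Lemma rank1_free (u : 'cV_K) (w : 'rV_N) : exists2 h : {poly F}, h != 0 &
  forall t, h.[t] != 0 -> row_free (M + t *: (u *m w)).
Proof.
have [Bm hB] := row_freeP fM; pose z := (w *m Bm *m u) 0 0.
exists (1 + z *: 'X).
  apply/eqP => e; have := congr1 (fun p : {poly F} => p.[0]) e.
  by rewrite hornerD hornerC hornerZ hornerX mulr0 addr0 horner0 => /eqP; rewrite oner_eq0.
move=> t; rewrite hornerD hornerC hornerZ hornerX => ht.
rewrite -kermx_eq0; apply/rowV0P => c /sub_kermxP; rewrite mulmxDr => e.
have e1 : c + (t * (c *m u) 0 0) *: (w *m Bm) = 0.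
  have := congr1 (mulmx^~ Bm) e; rewrite mulmxDl -mulmxA hB mulmx1 mul0mx -scalemxAr -scalemxAl !mulmxA.
  have cu1 : c *m u = ((c *m u) 0 0)%:M by exact: mx11_scalar.
  by rewrite {1}cu1 mul_scalar_mx -scalemxAl scalerA.
have cu : (c *m u) 0 0 = 0.
  have := congr1 (fun c => (c *m u) 0 0) e1; rewrite mulmxDl -scalemxAl mul0mx [LHS]mxE [X in _ + X]mxE -/z [RHS]mxE.
  set s := (c *m u) 0 0 => e2; have : s * (1 + z * t) = 0 by rewrite -[RHS]e2; ring.
  by move/eqP; rewrite mulf_eq0 (negPf ht) orbF => /eqP.
by move: e1; rewrite cu mulr0 scale0r addr0.
Qed.

Lemma rank1_vertical (u : 'cV_K) (c : 'rV_K) : u *m (c *m M) \in T.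
Proof.
have [h h0 hf] := rank1_free u (c *m M); apply: (line_tangent h0) => t /hf ft.
suff -> : row_space (M + t *: (u *m (c *m M))) = U by [].
apply/eqP; rewrite eqEdim !dim_row_space // leqnn andbT; apply/subvP => x /memv_row_space [d ->].
apply/memv_row_space; exists (d + t *: (d *m u *m c)).
by rewrite mulmxDr mulmxDl -scalemxAr -scalemxAl !mulmxA.
Qed.

(** Moving the frame by t u w keeps an essential condition in three cases: the new direction lies in
    the flag member, [u] does not touch the intersection, or the intersection has a dimension to
    spare. *)
Lemma rank1_tangent (u : 'cV_K) (w : 'rV_N) :
  (forall i, ess i -> [\/ w \in E (apos i), forall c, c \in frame_pre M (E (apos i)) -> c *m u = 0
     | (i < \dim (U :&: E (apos i))%VS)%N]) -> u *m w \in T.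
Proof.
move=> hw; have [h h0 hf] := rank1_free u w; apply: (line_tangent h0) => t /hf ft.
apply: schubert_ess; first exact: dim_row_space.
move=> i ei; have [_ hX] := XM.
have iK : (0 < i <= K)%N by case/andP: ei.
have di : (i <= \dim (U :&: E (apos i))%VS)%N by apply: hX.
have lin c : c *m (M + t *: (u *m w)) = c *m M + (t * (c *m u) 0 0) *: w.
  have cu1 : c *m u = ((c *m u) 0 0)%:M by exact: mx11_scalar.
  by rewrite mulmxDr -scalemxAr mulmxA {1}cu1 mul_scalar_mx scalerA.
suff [S iS hS] : exists2 S : {vspace 'rV[F]_K}, (i <= \dim S)%N &
    forall c, c \in S -> c *m (M + t *: (u *m w)) \in E (apos i).
  apply: leq_trans iS _; rewrite -(frame_lker S ft); apply: dimvS; apply/subvP => x /memv_imgP [c cS ->].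
  rewrite mulmxr_lin memv_cap hS // andbT; apply/memv_row_space; by exists c.
case: (hw i ei) => [wE|uD|lt].
- exists (frame_pre M (E (apos i))); first by rewrite dim_pre.
  by move=> c; rewrite memv_pre lin => cM; rewrite memvD // memvZ.
- exists (frame_pre M (E (apos i))); first by rewrite dim_pre.
  by move=> c hc; rewrite lin uD // mxE mulr0 scale0r addr0 -memv_pre.
exists (frame_pre M (E (apos i)) :&: lker (linfun (mulmxr u) : 'Hom('rV[F]_K, 'M[F]_1)))%VS.
  have := limg_ker_dim (linfun (mulmxr u) : 'Hom('rV[F]_K, 'M[F]_1)) (frame_pre M (E (apos i))).
  have := dimvS (subvf (linfun (mulmxr u) @: frame_pre M (E (apos i)))%VS).
  rewrite dimvf /dim /= dim_pre // muln1 => h1 h2; move: lt; rewrite -h2 => lt'.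
  rewrite -ltnS; apply: leq_trans lt' _.
  exact: leq_trans (leq_add (leqnn _) h1) (eq_leq (addn1 _)).
move=> c; rewrite memv_cap memv_ker lfunE /= => /andP [hc /eqP cu].
by rewrite lin cu mxE mulr0 scale0r addr0 -memv_pre.
Qed.

(** The essential conditions satisfied with equality; the others do not constrain rank one tangent
    vectors. *)
Definition tight i := ess i && (\dim (U :&: E (apos i))%VS == i).

Lemma essK : ess K. Proof. by rewrite /ess K0 leqnn eqxx. Qed.

Lemma dim_ess i : ess i -> (i <= \dim (U :&: E (apos i))%VS)%N.
Proof. by move=> /andP [iK _]; have [_ hX] := XM; apply: hX. Qed.

Lemma tightK : tight K.
Proof.
rewrite /tight essK /= eqn_leq dim_ess ?essK // andbT.
by apply: leq_trans (dimvS (capvSl _ _)) _; rewrite (dim_row_space fM).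
Qed.

(** In a basis adapted to the tight intersections, tangent vectors are assembled from rank one
    pieces: piece [l] may move by any vector of E + U, for the flag member E of the next tight
    condition [nx l]. *)
Lemma tangent_adapted : exists B : 'M[F]_K, exists nx : 'I_K -> nat, [/\ B \in unitmx,
  forall l : 'I_K, [/\ tight (nx l), (l < nx l <= K)%N & forall i, tight i -> (l < i)%N -> (nx l <= i)%N],
  forall (l : 'I_K) i, tight i -> (i <= l)%N -> forall c, c \in frame_pre M (E (apos i)) -> c *m col l (invmx B) = 0,
  forall l, row l B \in frame_pre M (E (apos (nx l))) &
  forall l w, w \in (E (apos (nx l)) + U)%VS -> col l (invmx B) *m w \in T].
Proof.
have tK i : tight i -> (i <= K)%N by case/andP => /andP [/andP []].
have [dE mE] := fE.
have [|||B uB hB] := @adapted_basis F K tight (fun i => frame_pre M (E (apos i))).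
- by move=> i /andP [_ /eqP ti] _; rewrite dim_pre.
- move=> i j _ tj ij jK; apply/subvP => c; rewrite !memv_pre; apply/subvP.
  by apply: mE; [apply: apos_mon | apply: apos_le].
- exact: tightK.
have nxP (l : 'I_K) : exists i, tight i && (l < i)%N by exists K; rewrite tightK ltn_ord.
pose nx l := ex_minn (nxP l).
have hnx l : [/\ tight (nx l), (l < nx l <= K)%N & forall i, tight i -> (l < i)%N -> (nx l <= i)%N].
  rewrite /nx; case: ex_minnP => i /andP [ti li] mi; split=> //; first by rewrite li tK.
  by move=> j tj lj; apply: mi; rewrite tj.
have hcol (l : 'I_K) i : tight i -> (i <= l)%N -> forall c, c \in frame_pre M (E (apos i)) -> c *m col l (invmx B) = 0.
  move=> ti il c /(hB i c ti (tK i ti)) h; apply/matrixP => a a'; rewrite !ord1 [RHS]mxE -(h l il).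
  by rewrite -colE -mulmxA || idtac; rewrite !mxE; apply: eq_bigr => k _; rewrite !mxE.
exists B, nx; split=> //.
- move=> l; have [t1 /andP [t2 t3] _] := hnx l; apply/(hB _ _ t1 t3) => k lk.
  rewrite -row_mul mulmxV // !mxE; case: eqP => // e; move: lk; rewrite -e; lia.
move=> l w /memv_addP [w1 hw1 [w2 /memv_row_space [c ->] ->]].
rewrite mulmxDr memvD ?rank1_vertical //; apply: rank1_tangent => i ei.
have [ti|nti] := boolP (tight i); last first.
  apply: Or33; rewrite ltn_neqAle dim_ess // andbT eq_sym; move: nti; rewrite /tight ei; by [].
have [il|li] := leqP i l; first by apply: Or32; apply: hcol.
apply: Or31; have [_ _ h] := hnx l; apply: (subvP (mE _ _ (apos_mon (h i ti li)) (apos_le (tK i ti)))).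
exact: hw1.
Qed.

(** A matrix satisfying the first order conditions is cut by the adapted basis into rank one pieces,
    each of which is tangent. *)
Lemma tangent_mem v : (forall i, ess i -> forall c, c \in frame_pre M (E (apos i)) ->
  c *m v \in (E (apos i) + U)%VS) -> v \in T.
Proof.
move=> hv; have [B [nx [uB h1 h2 h3 h4]]] := tangent_adapted.
have -> : v = \sum_l col l (invmx B) *m (row l B *m v).
  rewrite -[LHS]mul1mx -(mulVmx uB) -mulmxA; apply/matrixP => i j.
  rewrite mxE summxE; apply: eq_bigr => l _.
  by rewrite [RHS]mxE big_ord1 -row_mul !mxE.
apply: memv_suml => l _; apply: h4; apply: hv => //.
by have [/andP []] := h1 l.
Qed.

Lemma sumn_part : sumn lam = (\sum_(l < K) part lam l.+1)%N.
Proof.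
have /and3P [_ sz _] := boxl; rewrite /part /= sumnE (big_nth 0%N) big_mkord.
rewrite (big_ord_widen K (fun i => nth 0%N lam i) sz) big_mkcond; apply: eq_bigr => i _.
by case: ltnP => // h; rewrite nth_default.
Qed.

(** The rank one pieces give at least KN minus the sum of the [part lam (nx l)] tangent directions,
    to be compared with dim T = KN - |lam|. An essential condition that is not tight would make some
    [part lam (nx l)] smaller than [part lam l.+1], and the tangent space too large. Smoothness thus
    forces exact intersection dimensions. *)
Lemma ess_tight : (\dim T + sumn lam = K * N)%N -> forall i, ess i -> \dim (U :&: E (apos i))%VS = i.
Proof.
move=> dT i0 e0; apply/eqP.
have [B [nx [uB h1 h2 h3 h4]]] := tangent_adapted.
pose f (l : 'I_K) : 'Hom('rV[F]_N, 'M[F]_(K, N)) := linfun (mulmx (col l (invmx B))).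
pose Z l := (E (apos (nx l)) + U)%VS.
have dualB l l' : row l' B *m col l (invmx B) = (l' == l)%:R%:M.
  apply/matrixP => a a'; rewrite !ord1; transitivity ((B *m invmx B) l' l).
    by rewrite [LHS]mxE [RHS]mxE; apply: eq_bigr => k _; rewrite !mxE.
  by rewrite mulmxV // !mxE eqxx mulr1n.
have dir : directv (\sum_l (f l @: Z l))%VS.
  apply/directv_sum_independent => us hus s0 l _.
  have /fin_all_exists2 [w _ hw] k : exists2 w, w \in Z k & us k = col k (invmx B) *m w.
    by have /memv_imgP [w hw ->] := hus k isT; exists w; rewrite ?lfunE.
  have : row l B *m (\sum_k us k) = 0 by rewrite s0 mulmx0.
  rewrite mulmx_sumr (bigD1 l) //= big1 ?addr0 => [|k kl]; last first.
    by rewrite hw mulmxA dualB eq_sym (negPf kl) scalemx0 || rewrite hw mulmxA dualB eq_sym (negPf kl) mul_scalar_mx scale0r.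
  by rewrite hw mulmxA dualB eqxx mul1mx => ->; rewrite mulmx0.
have dZ l : \dim (f l @: Z l)%VS = \dim (Z l).
  apply: limg_dim_eq; apply/eqP; rewrite -subv0; apply/subvP => w.
  rewrite memv_cap memv_ker lfunE /= => /andP [_ /eqP e]; rewrite memv0; apply/eqP.
  by have := congr1 (mulmx (row l B)) e; rewrite mulmxA dualB eqxx mul1mx mulmx0.
have [dE mE] := fE.
have dZge l : (N <= \dim (Z l) + part lam (nx l))%N.
  have [/andP [_ /eqP tl] /andP [_ lK] _] := h1 l.
  have := dimv_sum_cap (E (apos (nx l))) U; rewrite capvC tl dE ?apos_le // (dim_row_space fM) -/(Z l).
  have := part_le (nx l); rewrite /apos; lia.
have le : (\sum_l \dim (Z l) <= \dim T)%N.
  have <- : \dim (\sum_l (f l @: Z l))%VS = (\sum_l \dim (Z l))%N.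
    by move: dir; rewrite directvE /= => /eqP ->; apply: eq_bigr.
  apply: dimvS; apply/subv_sumP => l _; apply/subvP => x /memv_imgP [w hw ->].
  by rewrite lfunE; apply: h4.
have sum1 : (K * N <= \sum_l \dim (Z l) + \sum_l part lam (nx l))%N.
  by rewrite -big_split /= -[X in (X * _)%N]card_ord -sum_nat_const; apply: leq_sum.
have sle : (\sum_(l < K) part lam l.+1 <= \sum_l part lam (nx l))%N.
  by move: dT le sum1; rewrite sumn_part; lia.
have pl l : (part lam (nx l) <= part lam l.+1)%N.
  by have [_ /andP [h _] _] := h1 l; apply: part_mon.
have /andP [/andP [i0p i0K] i0e] := e0.
case/predU1P: i0e => [->|lt]; first by case/andP: tightK.
apply: contraT => nt; have l0K : (i0.-1 < K)%N by lia.
(* Rows are numbered from 1 and basis vectors from 0, whence the predecessor. As i0 is not tight,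
   [nx l0] exceeds i0, after which the part drops. *)
pose l0 := Ordinal l0K.
have : (part lam (nx l0) < part lam l0.+1)%N.
  have [t1 /andP [/= t2 _] _] := h1 l0; rewrite /= prednK //; apply: leq_ltn_trans lt; apply: part_mon.
  move: t2; rewrite prednK // leq_eqVlt => /predU1P [e|//].
  by move: t1; rewrite -e /tight e0 (negPf nt).
move=> l0lt; move: sle; rewrite (bigD1 l0) //= [X in (_ <= X)%N](bigD1 l0) //=.
have : (\sum_(i | i != l0) part lam (nx i) <= \sum_(i < K | i != l0) part lam i.+1)%N by apply: leq_sum.
by move=> le1 le2; have := leq_trans (leq_add l0lt le1) le2; rewrite addSn ltnn.
Qed.

End Tangent.
End Schubert.

(** Transversality enters only through this lemma: essential intersections have exactly the expected
    dimension, and, by comparison with the dimension K^2, the only matrices tangent to all the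
    varieties are the vertical ones g M. *)
Lemma generic_solution (F : numFieldType) (N K r : nat) (lam : 'I_r -> seq nat)
    (E : 'I_r -> nat -> {vspace 'rV[F]_N}) (M : 'M[F]_(K, N)) :
  (0 < K < N)%N -> (forall j, diagram_in_box K (N - K) (lam j)) ->
  (\sum_j sumn (lam j) = K * (N - K))%N -> generic_flags K lam E -> solutions K lam E (row_space M) ->
  [/\ row_free M, forall j i, ess K (lam j) i -> \dim (row_space M :&: E j (apos N K (lam j) i))%VS = i &
  forall v : 'M_(K, N), (forall j i, ess K (lam j) i -> forall c : 'rV_K,
     c *m M \in E j (apos N K (lam j) i) -> c *m v \in (E j (apos N K (lam j) i) + row_space M)%VS) ->
     exists g : 'M_K, v = g *m M].
Proof.
move=> /andP [K0 KN'] box sm; have KN := ltnW KN'; move=> [fE gE] XM; have [T [TM dT dI]] := gE M XM.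
have XMj j : schubert K (E j) (lam j) (row_space M) by apply: XM.
have [] := boolP (row_free M) => fM; last first.
  (* Without any Schubert condition the sum of the sizes would be 0, whereas K(N - K) > 0. *)
  have [[j _]|nj] := pselect (exists j : 'I_r, True).
    by case/negP: fM; apply: row_free_dim; case: (XMj j).
  exfalso; move: sm; rewrite big1 => [|j _]; last by case: nj; exists j.
  by move/esym/eqP; rewrite muln_eq0 subn_eq0 -ltnNge || rewrite muln_eq0 subn_eq0; lia.
split=> // [j i ei|v hv].
  exact: (ess_tight KN K0 (fE j) (box j) (XMj j) (TM j) (dT j)).
have vT : v \in (\bigcap_j T j)%VS.
  rewrite memvE; apply/subv_bigcapP => j _; rewrite -memvE.
  apply: (tangent_mem KN K0 (fE j) (box j) (XMj j) (TM j)) => i ei c; rewrite memv_pre; exact: hv.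
pose f : 'Hom('M[F]_K, 'M[F]_(K, N)) := linfun (mulmxr M).
have dimf : \dim (limg f) = (K * K)%N.
  rewrite limg_dim_eq ?dimvf /dim //=; apply/eqP; rewrite -subv0; apply/subvP => w.
  rewrite memv_cap memv_ker lfunE /= => /andP [_ /eqP e]; rewrite memv0; apply/eqP.
  by apply: (row_free_inj fM); rewrite e mul0mx.
have sub : (limg f <= \bigcap_j T j)%VS.
  apply/subvP => x /memv_imgP [g _ ->]; rewrite lfunE /= memvE; apply/subv_bigcapP => j _; rewrite -memvE.
  have -> : g *m M = \sum_l col l g *m (delta_mx 0 l *m M).
    apply/matrixP => a a'; rewrite mxE summxE; apply: eq_bigr => l _.
    by rewrite [RHS]mxE big_ord1 -rowE !mxE.
  by apply: memv_suml => l _; apply: rank1_vertical (XMj j) _ (TM j) _ _.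
have : v \in limg f.
  suff <- : (\bigcap_j T j)%VS = limg f by [].
  apply/esym/eqP; rewrite eqEdim sub /= dimf; move: dI; rewrite sm.
  have e5 : (K * (N - K) + K * K = K * N)%N by rewrite -mulnDr subnK.
  by move=> /eqP; rewrite -e5 addnC eqn_add2l => /eqP ->.
by move/memv_imgP => [g _ ->]; exists g; rewrite lfunE.
Qed.

End SchubertTangent.

(** * Schubert problems as quiver representations *)

Module FlagRepresentation.
Import all_boot all_order all_algebra all_fingroup.
Import zify ring.
Import boolp.
Import Defs PolynomialFunctions Graded Projections ChartCover SchubertTangent.
Import Order.TTheory GRing.Theory Num.Theory.
Local Open Scope ring_scope.

Lemma row_free_base (F : fieldType) q N K (A : 'M[F]_(q, N)) : \rank A = K ->
  exists2 M : 'M[F]_(K, N), row_free M & (M :=: A)%MS.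
Proof. by move=> <-; exists (row_base A); [apply: row_base_free | apply: eq_row_base]. Qed.

Section Rep.
Variables (F : numFieldType) (N K p : nat) (X : finType) (x0 : X) (arr : rel X).
Variables (a be hgt : X -> nat) (g : X -> 'M[F]_N) (Es : X -> {vspace 'rV[F]_N}).
Variables (cl : 'I_p -> X) (lab : 'I_p -> nat).
Hypothesis lab_inj : forall i i', cl i = cl i' -> lab i = lab i' -> i = i'.
Hypothesis lab_lt : forall i, (lab i < a (cl i))%N.
Hypothesis lab_surj : forall x l, (l < a x)%N -> exists2 i, cl i = x & lab i = l.
Hypothesis aN : forall x, (a x <= N)%N.
Hypothesis beN : forall x, (be x <= a x)%N.
Hypothesis a0 : a x0 = N.
Hypothesis be0 : be x0 = K.
Hypothesis ug : forall x, g x \in unitmx.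
Hypothesis g0 : g x0 = 1%:M.
Hypothesis EsP : forall x c, (c \in Es x) <-> (forall l : 'I_N, (a x <= l)%N -> (c *m invmx (g x)) 0 l = 0).
Hypothesis arrP : forall x y, arr x y -> (a x <= a y)%N /\ (g x = g y \/ a y = N).
Hypothesis arr_next : forall x, x != x0 -> exists2 y, arr x y & (hgt y < hgt x)%N.

Definition bsub i := (lab i < be (cl i))%N.
Local Notation b := bsub.
Local Notation cp := (cproj F cl).
Local Notation P0 := (P0 F b).
Local Notation in0 := (@in0 F p X cl).

(** Vertex [x] carries the coordinates of the space [Es x] of dimension [a x]; [delta x] places them
    in F^N and [kappa x] is the embedding onto [Es x] through the adapted basis [g x]. *)
Definition delta x : 'M[F]_(p, N) := \matrix_(i, l) ((cl i == x) && (lab i == l))%:R.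
Definition kappa x := delta x *m g x.
(** Every arrow is the inclusion of one flag member in the next, written in the adapted bases; these
    agree along a flag, and may change only on entering the ambient space. *)
Definition rep : 'M[F]_p := \sum_x \sum_(y | arr x y) delta x *m (g x *m invmx (g y)) *m (delta y)^T.

Lemma deltaTdelta x y : (delta x)^T *m delta y = (x == y)%:R *: \matrix_(l, l') ((l == l') && (l < a x)%N)%:R.
Proof.
apply/matrixP => l l'; rewrite !mxE; have [<-|ne] := eqVneq x y; last first.
  rewrite mul0r big1 // => i _; rewrite !mxE; case: eqP => [->|]; rewrite ?mul0r //=.
  by rewrite (negPf ne) mulr0.
rewrite mul1r; have [lt|ge] := ltnP l (a x); last first.
  rewrite andbF big1 // => i _; rewrite !mxE; case: eqP => [e|]; rewrite ?mul0r //=.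
  case: eqP => [e'|]; rewrite ?mul0r //=; have := lab_lt i; rewrite e e'; lia.
have [i0 ci li] := lab_surj lt; rewrite (bigD1 i0) //= big1 ?addr0; last first.
  move=> i ne; rewrite !mxE; case: eqP => [e|]; rewrite ?mul0r //=.
  case: eqP => [e'|]; rewrite ?mul0r //=; case/eqP: ne; apply: lab_inj; congruence.
by rewrite !mxE ci li !eqxx /= mul1r andbT.
Qed.

Lemma delta_deltaT x : delta x *m (delta x)^T = cp x.
Proof.
apply/matrixP => i i'; rewrite !mxE.
have hi : (lab i < N)%N := leq_trans (lab_lt i) (aN _).
rewrite (bigD1 (Ordinal hi)) //= big1 ?addr0; last first.
  move=> l ne; rewrite !mxE; case: (lab i =P l) => [e|]; rewrite ?andbF ?mul0r //.
  by case/eqP: ne; apply: val_inj.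
rewrite !mxE eqxx andbT; have [e|ne] := eqVneq i i'.
  by rewrite -e /= eqxx andbT; case: (_ == _); rewrite ?mul1r ?mul0r.
case: eqP => [e|]; rewrite ?mul0r //=; case: eqP => [e'|]; rewrite ?mulr0 //=; case: eqP => [e''|]; rewrite ?mulr0 //.
by case/eqP: ne; apply: lab_inj; congruence.
Qed.

Lemma cp_delta x y : cp x *m delta y = (x == y)%:R *: delta y.
Proof.
apply/matrixP => i l; rewrite mxE (bigD1 i) //= big1 ?addr0; last first.
  by move=> k ne; rewrite mxE eq_sym (negPf ne) mul0r.
rewrite !mxE eqxx /=; case: (cl i =P x) => [->|ne]; first by rewrite mul1r; case: (x == y); rewrite ?mul1r ?mul0r.
rewrite mul0r; case: eqP => [<-|]; rewrite ?mul0r // mul1r; by case: eqP => // e; case: ne.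
Qed.

Lemma cp_kappa x : cp x *m kappa x = kappa x.
Proof. by rewrite /kappa mulmxA cp_delta eqxx scale1r. Qed.

Lemma cp_kappa_ne x y : x != y -> cp x *m kappa y = 0.
Proof. by move=> /negPf ne; rewrite /kappa mulmxA cp_delta ne scale0r mul0mx. Qed.

Lemma cp_cp x : cp x *m cp x = cp x.
Proof. by apply/matrixP => i j; rewrite mul_cproj mxE; case: (cl i == x); rewrite ?andbF ?mul1r ?mul0r. Qed.

Lemma sum_cp : \sum_x cp x = 1%:M.
Proof.
apply/matrixP => i j; rewrite summxE (bigD1 (cl i)) //= big1 ?addr0; last first.
  by move=> x ne; rewrite mxE [cl i == x]eq_sym (negPf ne) andbF.
by rewrite !mxE eqxx andbT.
Qed.

Lemma kappa_inj x q (A B : 'M[F]_(q, p)) : A *m kappa x = B *m kappa x -> A *m cp x = B *m cp x.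
Proof.
rewrite /kappa !mulmxA => /(can_inj (mulmxK (ug x))) e.
by rewrite -delta_deltaT !mulmxA e.
Qed.

(** Following an arrow and then embedding is embedding directly, because arrows are inclusions. *)
Lemma rep_kappa y : rep *m kappa y = \sum_(x | arr x y) kappa x.
Proof.
rewrite /rep mulmx_suml (big_mkcond (fun x => arr x y)) /=; apply: eq_bigr => x _.
have key z : arr x z -> delta x *m (g x *m invmx (g z)) *m (delta z)^T *m kappa y = (z == y)%:R *: kappa x.
  move=> xz; rewrite /kappa -mulmxA [(delta z)^T *m _]mulmxA deltaTdelta.
  have [<-|] := eqVneq z y; last by rewrite !scale0r mul0mx mulmx0.
  rewrite !scale1r; have [axz gxz] := arrP xz.
  set pd := \matrix_(l, l') _; case: gxz => [e|az].
    rewrite e mulmxV // mulmx1 mulmxA; congr (_ *m _); apply/matrixP => i l; rewrite mxE (bigD1 l) //= big1 ?addr0.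
      rewrite !mxE eqxx /=; case: eqP => [ci|]; rewrite ?mul0r //=; case: eqP => [li|]; rewrite ?mul0r //.
      by rewrite -li -ci in axz *; rewrite (leq_trans (lab_lt i) axz) mulr1.
    by move=> l' ne; rewrite !mxE (negPf ne) mulr0.
  have -> : pd = 1%:M by apply/matrixP => l l'; rewrite !mxE az ltn_ord andbT.
  by rewrite mul1mx -!mulmxA mulVmx // mulmx1.
rewrite mulmx_suml; case: ifP => xy.
  rewrite (bigD1 y) //= key // eqxx scale1r big1 ?addr0 // => z /andP [xz ne].
  by rewrite key // (negPf ne) scale0r.
by rewrite big1 // => z xz; rewrite key //; case: eqP => [e|]; rewrite ?scale0r //; rewrite e xy in xz.
Qed.

Lemma cp_rep_kappa x y : arr x y -> cp x *m rep *m kappa y = kappa x.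
Proof.
move=> xy; rewrite -mulmxA rep_kappa mulmx_sumr (bigD1 x) //= cp_kappa big1 ?addr0 // => z /andP [_ ne].
by rewrite cp_kappa_ne // eq_sym.
Qed.

Lemma in1_rep : in1 cl arr rep.
Proof.
move=> i j nij; rewrite /rep summxE big1 // => x _; rewrite summxE big1 // => y xy.
have -> : delta x *m (g x *m invmx (g y)) *m (delta y)^T = cp x *m (delta x *m (g x *m invmx (g y)) *m (delta y)^T) *m cp y.
  have e : (delta y)^T *m cp y = (delta y)^T.
    have cpT : (cp y)^T = cp y by apply/matrixP => u v; rewrite !mxE eq_sym; case: eqP => [->|].
    by apply: trmx_inj; rewrite trmx_mul trmxK cpT cp_delta eqxx scale1r.
  by rewrite !mulmxA cp_delta eqxx scale1r -[_ *m (delta y)^T *m _]mulmxA e.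
rewrite mul_cprojr mul_cproj; case: eqP => [e|]; rewrite ?mul0r //; case: eqP => [e'|]; rewrite ?mulr0 //.
by rewrite e e' xy in nij.
Qed.

Lemma memEs x s : s *m kappa x \in Es x.
Proof.
apply/EsP => l al; rewrite /kappa mulmxA mulmxK // mxE big1 // => i _; rewrite !mxE.
case: eqP => [e|]; rewrite ?mulr0 //=; case: eqP => [e'|]; rewrite ?mulr0 //.
by have := lab_lt i; rewrite e e'; lia.
Qed.

Lemma Es_kappa x w : w \in Es x -> exists s, w = s *m kappa x.
Proof.
move/EsP => h; exists (w *m invmx (g x) *m (delta x)^T).
rewrite /kappa mulmxA -[_ *m (delta x)^T *m delta x]mulmxA deltaTdelta eqxx scale1r.
rewrite -[LHS](mulmxKV (ug x)); congr (_ *m _); apply/rowP => l.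
rewrite [RHS]mxE (bigD1 l) //= big1 ?addr0 => [|l' ne]; last by rewrite !mxE (negPf ne) mulr0.
rewrite [X in _ = _ * X]mxE eqxx /=; case: ltnP => [_|/h ->]; by rewrite ?mulr1 ?mul0r.
Qed.

Lemma trace_be x : \tr (cp x *m P0) = (be x)%:R.
Proof.
rewrite trace_P0; congr (_%:R).
have /fin_all_exists2 [f f1 f2] (l : 'I_(be x)) : exists2 i, cl i = x & lab i = l.
  by apply: lab_surj; apply: leq_trans (beN x).
have fI : injective f by move=> l l' e; apply: val_inj; rewrite /= -f2 -f2 e.
rewrite -[RHS]card_ord -(card_codom fI); apply: eq_card => i; rewrite -topredE /= /bsub.
apply/andP/codomP => [[/eqP ci]|[l ->]]; last by rewrite f1 f2 eqxx ltn_ord.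
rewrite ci => li; exists (Ordinal li); apply: lab_inj; first by rewrite f1.
by rewrite f2.
Qed.

(** Symmetry is kept apart, so that the notion serves over both fields; it is added where a
    projection must be recovered from its image. *)
Definition rep_zero (P : 'M[F]_p) := [/\ in0 P, P *m P = P,
  forall x, \tr (cp x *m P) = \tr (cp x *m P0) & P *m rep *m (1%:M - P) = 0].

Section Zero.
Variable P : 'M[F]_p.
Hypothesis zP : rep_zero P.

Let P_0 : in0 P. Proof. by case: zP. Qed.
Let PP : P *m P = P. Proof. by case: zP. Qed.
Let PX : P *m rep = P *m rep *m P.
Proof. by case: zP => _ _ _ /eqP; rewrite mulmxBr mulmx1 subr_eq0 => /eqP. Qed.

Lemma rank_Pkappa x : \rank (P *m kappa x) = be x.
Proof.
have -> : \rank (P *m kappa x) = \rank (cp x *m P).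
  rewrite P_0 /kappa mulmxA.
  have -> : \rank (P *m delta x *m g x) = \rank (P *m delta x) by rewrite mxrankMfree // row_free_unit ug.
  apply/eqP; rewrite eqn_leq; apply/andP; split.
    have -> : P *m delta x = P *m cp x *m delta x by rewrite -mulmxA cp_delta eqxx scale1r.
    exact: mxrankM_maxl.
  by rewrite -delta_deltaT mulmxA mxrankM_maxl.
apply/eqP; rewrite -(eqr_nat F) mxrank_idem; first by case: zP => _ _ -> _; rewrite trace_be.
by rewrite -mulmxA [P *m (_ *m _)]mulmxA -P_0 -mulmxA PP mulmxA cp_cp.
Qed.

(** The subrepresentation is pushed along the arrows, which are inclusions in F^N, up to the
    root. *)
Lemma zero_sub x : (P *m kappa x <= P *m kappa x0)%MS.
Proof.
move: {2}(hgt x) (leqnn (hgt x)) => h; elim: h x => [|h IH] x hx.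
  by have [->//|/arr_next [y _]] := eqVneq x x0; rewrite ltnNge (leq_trans hx).
have [->//|/arr_next [y xy yx]] := eqVneq x x0.
apply: submx_trans (IH y _); last by lia.
have -> : P *m kappa x = cp x *m P *m rep *m (P *m kappa y).
  rewrite -(cp_rep_kappa xy); move: (kappa y) => k.
  by rewrite !mulmxA -P_0 -[cp x *m P *m rep]mulmxA PX !mulmxA -[_ *m P *m P]mulmxA PP.
exact: submxMl.
Qed.

(* Elements of the subrepresentation are transported along the arrows to the root. *)
Lemma transport (Th : 'M[F]_p) : in0 Th -> Th *m rep *m (1%:M - P) = P *m rep *m Th ->
  forall x (s : 'rV_p), s *m P = s -> s *m cp x = s -> exists u : 'rV_p,
   [/\ u *m P = u, u *m cp x0 = u, u *m kappa x0 = s *m kappa x &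
     (u *m Th *m kappa x0 - s *m Th *m kappa x <= P *m kappa x0)%MS].
Proof.
move=> Th0 eTh x; move: {2}(hgt x) (leqnn (hgt x)) => h; elim: h x => [|h IH] x hx s sP sx.
  have [e|/arr_next [y _]] := eqVneq x x0; last by rewrite ltnNge (leq_trans hx).
  by rewrite e in sx *; exists s; rewrite subrr sub0mx.
have [e|/arr_next [y xy yx]] := eqVneq x x0.
  by rewrite e in sx *; exists s; rewrite subrr sub0mx.
have sXP : s *m rep = s *m rep *m P by rewrite -{1}sP -mulmxA PX !mulmxA sP.
have [||| u [u1 u2 u3 u4]] := IH y _ (s *m rep *m cp y); first by lia.
- by rewrite -mulmxA P_0 mulmxA -sXP.
- by rewrite -mulmxA cp_cp.
have cyk A : A *m cp y *m kappa y = A *m kappa y by rewrite -mulmxA cp_kappa.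
exists u; split=> //.
  by rewrite u3 cyk -{1}sx -!mulmxA [cp x *m _]mulmxA cp_rep_kappa.
have -> : u *m Th *m kappa x0 - s *m Th *m kappa x =
   (u *m Th *m kappa x0 - s *m rep *m cp y *m Th *m kappa y) + (s *m rep *m cp y *m Th *m kappa y - s *m Th *m kappa x).
  by rewrite addrA subrK.
apply: addmx_sub => //; apply: submx_trans (zero_sub y).
have -> : s *m rep *m cp y *m Th *m kappa y = s *m (P *m rep *m Th) *m kappa y.
  by rewrite -[_ *m cp y *m Th]mulmxA Th0 mulmxA cyk !mulmxA sP.
rewrite -eTh mulmxBr mulmx1 mulmxBr mulmxBl.
have -> : s *m (Th *m rep) *m kappa y = s *m Th *m kappa x.
  by rewrite -{1}sx -(cp_rep_kappa xy) !mulmxA -[s *m cp x *m Th]mulmxA Th0 !mulmxA.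
rewrite addrAC subrr add0r -mulNmx; move: (kappa y) => k.
have -> : - (s *m (Th *m rep *m P)) *m k = - (s *m Th *m rep) *m (P *m k) by rewrite !mulNmx !mulmxA.
exact: submxMl.
Qed.

Variable M : 'M[F]_(K, N).
Hypothesis fM : row_free M.
Hypothesis MP : (M :=: P *m kappa x0)%MS.
Hypothesis exactE : forall x, \dim (row_space M :&: Es x)%VS = be x.

Lemma memU (w : 'rV_N) : (w \in row_space M) = (w <= M)%MS.
Proof.
apply/idP/idP => [/memv_row_space [c ->]|/submxP [c ->]]; first exact: submxMl.
by apply/memv_row_space; exists c.
Qed.

(** The component of the subrepresentation at [x] embeds in the intersection of U with [Es x] and
    has the same dimension, hence equals it. *)
Lemma exact_sub x (w : 'rV_N) : w \in row_space M -> w \in Es x -> (w <= P *m kappa x)%MS.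
Proof.
move=> wU wE; have [M' fM' eM'] := row_free_base (rank_Pkappa x).
have sub : (row_space M' <= row_space M :&: Es x)%VS.
  apply/subvP => z /memv_row_space [c ->]; rewrite memv_cap memU MP; apply/andP; split.
    by apply: submx_trans (zero_sub x); rewrite -eM' submxMl.
  have : (c *m M' <= P *m kappa x)%MS by rewrite -eM' submxMl.
  by move=> /submxP [d ->]; rewrite mulmxA memEs.
have e : row_space M' = (row_space M :&: Es x)%VS.
  by apply/eqP; rewrite eqEdim sub exactE dim_row_space //= leqnn.
have : w \in row_space M' by rewrite e memv_cap wU.
by move/memv_row_space => [c ->]; rewrite -eM' submxMl.
Qed.

(** A homomorphism [Th] from the subrepresentation to the quotient induces at the root a map of U to
    F^N modulo U that respects every flag member. Such maps vanish by transversality, and [Th]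
    vanishes at the other vertices because the intersections are exact. *)
Lemma rep_nondegenerate (Th : 'M[F]_p) :
  (forall v : 'M_(K, N), (forall x (c : 'rV_K), c *m M \in Es x -> c *m v \in (Es x + row_space M)%VS) ->
     exists h : 'M_K, v = h *m M) ->
  in0 Th -> P *m Th *m (1%:M - P) = Th -> Th *m rep *m (1%:M - P) = P *m rep *m Th -> Th = 0.
Proof.
move=> hB Th0 PTh eTh.
have PThP : P *m Th = Th by rewrite -[in LHS]PTh !mulmxA PP PTh.
have ThP : Th *m P = 0 by rewrite -PTh -mulmxA mulmxBl mul1mx PP subrr mulmx0.
have tr := transport Th0 eTh.
(* A vector sent by [Th] into the subrepresentation is sent to 0, since Th P = 0. *)
have kill x (s : 'rV_p) : s *m P = s -> s *m cp x = s -> (s *m Th *m kappa x <= P *m kappa x)%MS -> s *m Th = 0.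
  move=> sP sx /submxP [A eA]; have /kappa_inj e : s *m Th *m kappa x = A *m P *m kappa x.
    by rewrite eA; move: (kappa x) => z; rewrite mulmxA.
 
  have : s *m Th = A *m P *m cp x.
    by rewrite -e -[s *m Th *m cp x]mulmxA -Th0 mulmxA sx.
  move/(congr1 (mulmx^~ (1%:M - P))); rewrite -!mulmxA [cp x *m _]mulmxBr mulmx1 P_0 mulmxBr.
  by rewrite mulmx1 ThP subr0 !mulmxBr [P *m (P *m _)]mulmxA PP subrr.
have /submxP [A eA] : (M <= P *m kappa x0)%MS by rewrite MP.
pose L := A *m P *m cp x0.
have LM : L *m kappa x0 = M by rewrite /L -mulmxA cp_kappa eA [RHS]mulmxA.
have LP : L *m P = L by rewrite /L -mulmxA P_0 mulmxA -[A *m P *m P]mulmxA PP.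
have Lx : L *m cp x0 = L by rewrite /L -mulmxA cp_cp.
have rootE (u : 'rV_p) c : u *m cp x0 = u -> u *m kappa x0 = c *m M -> u = c *m L.
  by move=> ux e; rewrite -ux -Lx mulmxA; apply: kappa_inj; rewrite -mulmxA LM.
have [|h eh] := hB (L *m Th *m kappa x0).
  move=> x c cE; have cU : c *m M \in row_space M by apply/memv_row_space; exists c.
  have /submxP [A' eA'] := exact_sub cU cE.
  have [||u [u1 u2 u3 u4]] := tr x (A' *m P *m cp x).
  - by rewrite -[LHS]mulmxA P_0 mulmxA -[A' *m P *m P]mulmxA PP.
  - by rewrite -[LHS]mulmxA cp_cp.
  have eu : u = c *m L.
    by apply: rootE => //; rewrite u3 -[LHS]mulmxA cp_kappa eA' [RHS]mulmxA.
  have -> : c *m (L *m Th *m kappa x0) = A' *m P *m cp x *m Th *m kappa x +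
      (u *m Th *m kappa x0 - A' *m P *m cp x *m Th *m kappa x).
    by rewrite addrC subrK eu !mulmxA.
  by apply: memv_add; [apply: memEs | rewrite memU MP].
have LTh : L *m Th = 0.
  apply/row_matrixP => i; rewrite row_mul row0; apply: (kill x0).
  - by rewrite -row_mul LP.
  - by rewrite -row_mul Lx.
  rewrite -2!row_mul eh row_mul -MP; exact: submxMl.
have all0 x (s : 'rV_p) : s *m P = s -> s *m cp x = s -> s *m Th = 0.
  move=> sP sx; apply: (kill x) => //; have [u [u1 u2 u3 u4]] := tr x s sP sx.
  have : u *m kappa x0 \in row_space M.
    by rewrite memU MP -u1 -mulmxA submxMl.
  move/memv_row_space => [c /rootE eu]; have {}eu := eu u2.
  have uTh : u *m Th = 0 by rewrite eu -mulmxA LTh mulmx0.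
  apply: exact_sub; last exact: memEs.
  rewrite memU MP; move: u4; rewrite uTh mul0mx sub0r => h'.
  by rewrite -[_ *m kappa x]opprK eqmx_opp.
rewrite -PThP -[P]mulmx1 -sum_cp mulmx_sumr mulmx_suml big1 // => x _.
apply/row_matrixP => i; rewrite row_mul row0; apply: (all0 x).
  by rewrite -row_mul -mulmxA P_0 mulmxA PP.
by rewrite -row_mul -mulmxA cp_cp.
Qed.

End Zero.

(** The exact intersections determine the subspace at each vertex from the one at the root;
    orthogonality then determines the projection. *)
Lemma zero_inj (P P' : 'M[F]_p) (M : 'M[F]_(K, N)) : rep_zero P -> rep_zero P' -> P^T = P -> P'^T = P' ->
  row_free M -> (M :=: P *m kappa x0)%MS -> (M :=: P' *m kappa x0)%MS ->
  (forall x, \dim (row_space M :&: Es x)%VS = be x) -> P = P'.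
Proof.
move=> zP zP' sP sP' fM MP MP' ex.
have key (Q Q' : 'M[F]_p) : rep_zero Q -> rep_zero Q' -> (M :=: Q *m kappa x0)%MS ->
    (M :=: Q' *m kappa x0)%MS -> Q *m Q' = Q.
  move=> zQ zQ' MQ MQ'; have [Q0 QQ _ _] := zQ; have [Q0' QQ' _ _] := zQ'.
  rewrite -[in RHS](mulmx1 Q) -sum_cp mulmx_sumr -[Q in LHS](mulmx1 Q) -sum_cp mulmx_sumr mulmx_suml.
  apply: eq_bigr => x _; apply/row_matrixP => i.
  have wU : row i Q *m kappa x \in row_space M.
    rewrite memU MQ; apply: submx_trans (zero_sub zQ x); by rewrite -row_mul row_sub.
  have /submxP [A eA] := exact_sub zQ' MQ' ex wU (memEs x _).
  have e2 : row i Q *m cp x = A *m Q' *m cp x by apply: kappa_inj; rewrite eA [LHS]mulmxA.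
  rewrite !row_mul e2 -!mulmxA [cp x *m Q']Q0' [Q' *m (Q' *m _)]mulmxA QQ'.
  by [].
have h1 := key P P' zP zP' MP MP'; have h2 := key P' P zP' zP MP' MP.
by rewrite -sP -h1 trmx_mul sP sP' h2.
Qed.

Section Flags.
Variables (r : nat) (lam : 'I_r -> seq nat) (E : 'I_r -> nat -> {vspace 'rV[F]_N}).
Hypothesis KN : (0 < K < N)%N.
Hypothesis boxl : forall j, diagram_in_box K (N - K) (lam j).
Hypothesis sum_lam : (\sum_j sumn (lam j) = K * (N - K))%N.
Hypothesis gE : generic_flags K lam E.
Hypothesis exE : forall j i, ess K (lam j) i -> exists2 x, be x = i & Es x = E j (apos N K (lam j) i).
Hypothesis Esx : forall x, Es x = fullv /\ be x = K \/
  exists j i, [/\ ess K (lam j) i, be x = i & Es x = E j (apos N K (lam j) i)].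

(** The root component has dimension K and contains the images of all vertices, which gives the
    essential Schubert conditions; transversality supplies the rest. *)
Lemma rep_zero_solution P : rep_zero P -> exists M : 'M[F]_(K, N), [/\ row_free M,
  (M :=: P *m kappa x0)%MS, solutions K lam E (row_space M),
  forall x, \dim (row_space M :&: Es x)%VS = be x &
  forall v : 'M_(K, N), (forall x (c : 'rV_K), c *m M \in Es x -> c *m v \in (Es x + row_space M)%VS) ->
     exists h : 'M_K, v = h *m M].
Proof.
move=> zP; have := rank_Pkappa zP x0; rewrite be0 => /row_free_base [M fM eM].
have dM := dim_row_space fM.
have [K0 KN'] := andP KN.
have sM : solutions K lam E (row_space M).
  move=> j _; apply: schubert_ess => //; first exact: ltnW.
    by case: gE => h _; apply: h.
  move=> i /exE [x <- <-].
  have [M' fM' eM'] := row_free_base (rank_Pkappa zP x); rewrite -(dim_row_space fM'); apply: dimvS.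
  apply/subvP => z /memv_row_space [c ->].
  have h : (c *m M' <= P *m kappa x)%MS by rewrite -eM' submxMl.
  rewrite memv_cap; apply/andP; split.
    have : (c *m M' <= M)%MS by rewrite eM; apply: submx_trans (zero_sub zP x).
    by move=> /submxP [d ->]; apply/memv_row_space; exists d.
  by move/submxP: h => [d ->]; rewrite mulmxA memEs.
have [_ dims hB] := generic_solution KN boxl sum_lam gE sM.
exists M; split=> //.
  move=> x; have [[-> ->]|[j [i [ei -> ->]]]] := Esx x; first by rewrite capvf.
  exact: dims.
move=> v hv; apply: hB => j i ei c; have [x _ <-] := exE ei; exact: hv.
Qed.

Lemma rep_zero_nondegenerate P (Th : 'M[F]_p) : rep_zero P -> in0 Th ->
  P *m Th *m (1%:M - P) = Th -> Th *m rep *m (1%:M - P) = P *m rep *m Th -> Th = 0.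
Proof.
move=> zP; have [M [fM eM _ ex hB]] := rep_zero_solution zP.
exact: (rep_nondegenerate zP eM ex hB).
Qed.

Lemma rep_zero_card_inj : exists sol : 'M[F]_p -> {vspace 'rV[F]_N},
  (forall P, rep_zero P -> solutions K lam E (sol P)) /\
  forall P P', rep_zero P -> rep_zero P' -> P^T = P -> P'^T = P' -> sol P = sol P' -> P = P'.
Proof.
have h P : exists U, rep_zero P -> exists M : 'M[F]_(K, N), [/\ U = row_space M, row_free M,
  (M :=: P *m kappa x0)%MS, solutions K lam E (row_space M) &
  forall x, \dim (row_space M :&: Es x)%VS = be x].
  have [zP|nz] := pselect (rep_zero P); last by exists 0%VS.
  by have [M [fM eM sM ex _]] := rep_zero_solution zP; exists (row_space M) => _; exists M.
have [sol hs] := choice h; exists sol; split=> [P /hs [M [-> _ _ sM _]] //|P P' zP zP' sP sP' e].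
have [M [eM fM MP _ ex]] := hs _ zP; have [M' [eM' fM' MP' _ _]] := hs _ zP'.
have eq : (M :=: M')%MS.
  apply/eqmxP/andP; split; apply/row_subP => i; rewrite -memU.
    by rewrite -eM' -e eM memU row_sub.
  by rewrite -eM e eM' memU row_sub.
apply: (zero_inj zP zP' sP sP' fM MP _ ex); exact: eqmx_trans eq MP'.
Qed.

(** The largest graded subspace mapped into the row space of [M] by all embeddings; being defined
    this way it is stable under the arrows. *)
Definition subrep (M : 'M[F]_(K, N)) := (\bigcap_x kermx (kappa x *m cokermx M))%MS.

Lemma sub_subrep M a' (s : 'M[F]_(a', p)) : (s <= subrep M)%MS <-> forall x, (s *m kappa x <= M)%MS.
Proof.
split=> [h x|h].
  rewrite submxE -mulmxA -sub_kermx; move/sub_bigcapmxP: h; exact.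
by apply/sub_bigcapmxP => x _; rewrite sub_kermx mulmxA -submxE.
Qed.

Lemma subrep_cp M y : (subrep M *m cp y <= subrep M)%MS.
Proof.
apply/sub_subrep => x; rewrite -mulmxA; have [->|ne] := eqVneq y x.
  by rewrite cp_kappa; exact: ((sub_subrep M _).1 (submx_refl _) x).
by rewrite cp_kappa_ne // mulmx0 sub0mx.
Qed.

Lemma subrep_rep M : (subrep M *m rep <= subrep M)%MS.
Proof.
apply/sub_subrep => y; rewrite -mulmxA rep_kappa mulmx_sumr; apply: summx_sub => x _.
exact: ((sub_subrep M _).1 (submx_refl _) x).
Qed.

Lemma Es_subrep M x (w : 'rV_N) : w \in Es x -> (w <= M)%MS -> (w <= subrep M *m kappa x)%MS.
Proof.
move=> /Es_kappa [s es] wM.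
have : (s *m cp x <= subrep M)%MS.
  apply/sub_subrep => y; rewrite -mulmxA; have [<-|ne] := eqVneq x y; first by rewrite cp_kappa -es.
  by rewrite cp_kappa_ne // mulmx0 sub0mx.
move=> /submxP [D eD]; rewrite es; have -> : s *m kappa x = s *m cp x *m kappa x by rewrite -mulmxA cp_kappa.
by rewrite eD -mulmxA submxMl.
Qed.

Lemma rank_subrep M x : row_free M -> \rank (subrep M *m cp x) = \dim (row_space M :&: Es x)%VS.
Proof.
move=> fM; set Y := subrep M.
have -> : \rank (Y *m cp x) = \rank (Y *m kappa x).
  apply/eqP; rewrite eqn_leq; apply/andP; split.
    have -> : Y *m cp x = Y *m kappa x *m (invmx (g x) *m (delta x)^T).
      by rewrite /kappa -delta_deltaT !mulmxA mulmxK.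
    exact: mxrankM_maxl.
  have -> : Y *m kappa x = Y *m cp x *m kappa x by rewrite -mulmxA cp_kappa.
  exact: mxrankM_maxl.
have [M' fM' eM'] := row_free_base (erefl (\rank (Y *m kappa x))).
rewrite -(dim_row_space fM'); congr (\dim _); apply/eqP; rewrite eqEsubv; apply/andP; split; apply/subvP => z.
  move=> /memv_row_space [c ->]; have h : (c *m M' <= Y *m kappa x)%MS by rewrite -eM' submxMl.
  rewrite memv_cap; apply/andP; split.
    have : (c *m M' <= M)%MS by apply: (submx_trans h); exact: ((sub_subrep M _).1 (submx_refl _) x).
    by move/submxP => [d ->]; apply/memv_row_space; exists d.
  by move/submxP: h => [d ->]; rewrite mulmxA memEs.
rewrite memv_cap => /andP [/memv_row_space [c ->] zE].
have : (c *m M <= M')%MS by rewrite eM'; apply: Es_subrep => //; apply: submxMl.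
by move/submxP => [d ->]; apply/memv_row_space; exists d.
Qed.

Lemma row_space_ex (U : {vspace 'rV[F]_N}) : \dim U = K -> exists M : 'M[F]_(K, N), row_space M = U.
Proof.
move=> dU; exists (\matrix_(i < K) (vbasis U)`_i); rewrite /row_space -[RHS](span_basis (vbasisP U)).
congr (<<_>>%VS); apply: (@eq_from_nth _ 0); first by rewrite size_image card_ord size_tuple dU.
move=> i; rewrite size_image card_ord => lt.
by rewrite (nth_map (Ordinal lt)) ?size_enum_ord // rowK nth_enum_ord.
Qed.

Lemma solution_subrep : exists Bm : {vspace 'rV[F]_N} -> 'M[F]_p,
  (forall U, solutions K lam E U -> [/\ forall x, (Bm U *m cp x <= Bm U)%MS,
     (Bm U *m rep <= Bm U)%MS & forall x, \rank (Bm U *m cp x) = be x]) /\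
  forall U U', solutions K lam E U -> solutions K lam E U' -> (Bm U == Bm U')%MS -> U = U'.
Proof.
have [K0 KN'] := andP KN.
have r0 : exists j : 'I_r, True.
  apply: contrapT => h; have := sum_lam; rewrite big1; last by move=> j; case: h; exists j.
  by move/esym/eqP; rewrite muln_eq0 subn_eq0 leqNgt KN' orbF eqn0Ngt K0.
have dimU U : solutions K lam E U -> \dim U = K.
  by case: r0 => j _ /(_ j I) [].
have h U : exists M : 'M[F]_(K, N), solutions K lam E U -> row_space M = U.
  have [sU|] := pselect (solutions K lam E U); last by exists 0.
  by have [M eM] := row_space_ex (dimU _ sU); exists M.
have [Mf hM] := choice h; exists (fun U => subrep (Mf U)).
have gen U : solutions K lam E U -> row_free (Mf U) /\ forall x, \dim (row_space (Mf U) :&: Es x)%VS = be x.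
  move=> sU; have eM := hM _ sU; have sM : solutions K lam E (row_space (Mf U)) by rewrite eM.
  have [fM dims _] := generic_solution KN boxl sum_lam gE sM; split=> // x.
  have [[-> ->]|[j [i [ei -> ->]]]] := Esx x; first by rewrite capvf dim_row_space.
  exact: dims.
split=> [U sU|U U' sU sU' /eqmxP e].
  have [fM dE] := gen U sU; split=> [x||x]; [exact: subrep_cp | exact: subrep_rep |].
  by rewrite rank_subrep.
have fullE w : w \in Es x0 by apply/EsP => l; rewrite a0 leqNgt ltn_ord.
have eqM (M : 'M[F]_(K, N)) : (M :=: subrep M *m kappa x0)%MS.
  apply/eqmxP/andP; split; last exact: ((sub_subrep M _).1 (submx_refl _) x0).
  by apply/row_subP => i; apply: Es_subrep => //; apply: row_sub.
have eq : (Mf U :=: Mf U')%MS.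
  apply: (eqmx_trans (eqM _)); apply: (eqmx_trans (eqmxMr _ e)); exact: eqmx_sym (eqM _).
rewrite -(hM _ sU) -(hM _ sU'); apply/vspaceP => w; by rewrite !memU eq.
Qed.

(** Interface shared by both fields: the real problem uses the passage from zeros to solutions, the
    complex one the passage from solutions to stable subspaces, and both use the nondegeneracy. *)
Lemma rep_package : exists X0 : 'M[F]_p,
  let zero P := [/\ in0 P, P *m P = P, forall x, \tr (cp x *m P) = \tr (cp x *m P0) &
    P *m X0 *m (1%:M - P) = 0] in
  [/\ in1 cl arr X0 /\ forall x, \tr (cp x *m P0) = (be x)%:R,
  forall P Th, zero P -> in0 Th -> P *m Th *m (1%:M - P) = Th ->
    Th *m X0 *m (1%:M - P) = P *m X0 *m Th -> Th = 0,
  exists sol : 'M[F]_p -> {vspace 'rV[F]_N}, (forall P, zero P -> solutions K lam E (sol P)) /\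
    forall P P', zero P -> zero P' -> P^T = P -> P'^T = P' -> sol P = sol P' -> P = P' &
  exists Bm : {vspace 'rV[F]_N} -> 'M[F]_p,
    (forall U, solutions K lam E U -> [/\ forall x, (Bm U *m cp x <= Bm U)%MS,
     (Bm U *m X0 <= Bm U)%MS & forall x, \rank (Bm U *m cp x) = be x]) /\
    forall U U', solutions K lam E U -> solutions K lam E U' -> (Bm U == Bm U')%MS -> U = U'].
Proof.
exists rep; split.
- by split; [exact: in1_rep | exact: trace_be].
- by move=> P Th; apply: rep_zero_nondegenerate.
- exact: rep_zero_card_inj.
exact: solution_subrep.
Qed.

End Flags.
End Rep.

End FlagRepresentation.

(** * The tree quiver of a Schubert problem and its dimension count *)

Module IndexData.
Import all_boot all_order all_algebra all_fingroup.
Import boolp reals.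
Import zify.
Import Defs Graded ChartCover SchubertTangent FlagRepresentation ComplexStructure.
Import Order.TTheory GRing.Theory Num.Theory.

Lemma sum_by_parts (f : nat -> nat) k : (forall i, f i.+1 <= f i)%N ->
  (\sum_(t < k) t.+1 * (f t - f t.+1) + k * f k = \sum_(t < k) f t)%N.
Proof.
move=> mf; elim: k => [|k IH]; first by rewrite !big_ord0 mul0n.
rewrite !big_ord_recr /= -IH -addnA -mulnDr subnK ?mf // mulSn [(f k + _)%N]addnC addnA //.
Qed.

Section Data.
Variables (k n r : nat) (lam : 'I_r -> seq nat).
Hypothesis kn : (0 < k < n)%N.
Hypothesis boxl : forall j, diagram_in_box k (n - k) (lam j).
Hypothesis sum_lam : (\sum_j sumn (lam j) = k * (n - k))%N.
Local Notation X := (option ('I_r * 'I_k)).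
Local Notation pt j i := (part (lam j) i).

Lemma pt_mon j i i' : (i <= i')%N -> (pt j i' <= pt j i)%N.
Proof. by move=> h; case/andP: kn => k0 k1; apply: (part_mon (ltnW k1) k0 (boxl j)). Qed.
Lemma pt_le j i : (pt j i <= n - k)%N. Proof. exact: (part_le (boxl j)). Qed.
Lemma pt_last j : pt j k.+1 = 0%N.
Proof. by rewrite /part /= nth_default //; case/and3P: (boxl j). Qed.

(** Every row of every diagram gets a vertex, so that the tree has a uniform shape; a row without an
    essential condition repeats a later essential one with the same part. *)
Lemma e_ex : exists e : 'I_r * 'I_k -> nat, forall jt, [/\ ess k (lam jt.1) (e jt),
  (jt.2.+1 <= e jt <= k)%N & pt jt.1 (e jt) = pt jt.1 jt.2.+1].
Proof.
have h (jt : 'I_r * 'I_k) : exists i, [/\ ess k (lam jt.1) i, (jt.2.+1 <= i <= k)%N &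
    pt jt.1 i = pt jt.1 jt.2.+1].
  by case/andP: kn => k0 k1; apply: (ess_ge (ltnW k1) k0 (boxl jt.1)); exact: ltn_ord.
by have [e he] := choice h; exists e.
Qed.
Variable e : 'I_r * 'I_k -> nat.
Hypothesis eP : forall jt, [/\ ess k (lam jt.1) (e jt),
  (jt.2.+1 <= e jt <= k)%N & pt jt.1 (e jt) = pt jt.1 jt.2.+1].

(** Where the part drops after row t + 1, that row is its own representative; elsewhere the common
    factor is 0. *)
Lemma e_jump jt : (e jt * (pt jt.1 jt.2.+1 - pt jt.1 jt.2.+2) = jt.2.+1 * (pt jt.1 jt.2.+1 - pt jt.1 jt.2.+2))%N.
Proof.
have [_ /andP [h1 h2] h3] := eP jt; have [e1|ne] := eqVneq (e jt) jt.2.+1; first by rewrite e1.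
have lt : (jt.2.+2 <= e jt)%N by rewrite ltn_neqAle eq_sym ne h1.
have := pt_mon jt.1 lt; rewrite h3 => le; have -> : (pt jt.1 jt.2.+1 - pt jt.1 jt.2.+2 = 0)%N by lia.
by rewrite !muln0.
Qed.
Lemma e_mon j (t t' : 'I_k) : t' = t.+1 :> nat -> (e (j, t) <= e (j, t'))%N.
Proof.
move=> et; have [/andP [_ es] /andP [h1 h2] h3] := eP (j, t).
have [_ /andP [h1' h2'] h3'] := eP (j, t'); rewrite /= in h1 h2 h3 h1' h2' h3' es.
rewrite leqNgt; apply/negP => lt.
have [e1|ne] := eqVneq (e (j, t)) t.+1; first by rewrite et in h1'; lia.
have lt2 : (t.+2 <= e (j, t))%N by rewrite ltn_neqAle eq_sym ne h1.
have := pt_mon j lt2; rewrite h3 => le; have := pt_mon j (leqnSn t.+1) => le2.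
have e' : pt j (e (j, t')) = pt j (e (j, t)) by rewrite h3 h3' et; lia.
have [/andP [_ es'] _ _] := eP (j, t'); rewrite /= in es'.
case/orP: es' => [/eqP ek|lt3]; first by lia.
have := pt_mon j lt; rewrite -e'; lia.
Qed.

Lemma e_ess j i : ess k (lam j) i -> exists t : 'I_k, e (j, t) = i.
Proof.
move=> /andP [/andP [i0 ik] es]; have lt : (i.-1 < k)%N by lia.
exists (Ordinal lt); have [_ /andP [h1 h2] h3] := eP (j, Ordinal lt); rewrite /= prednK // in h1 h3.
case/orP: es => [/eqP ei|lt2]; first by lia.
apply/eqP; rewrite eqn_leq h1 andbT leqNgt; apply/negP => lt3.
by have := pt_mon j lt3; rewrite h3; lia.
Qed.

Definition be (x : X) : nat := if x is Some jt then e jt else k.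
Definition av (x : X) : nat := if x is Some jt then apos n k (lam jt.1) (e jt) else n.
Definition nxt (jt : 'I_r * 'I_k) : X := omap (fun t => (jt.1, t)) (insub jt.2.+1).
(** The rows of each diagram form a chain leading to the root [None], so that every other vertex has
    exactly one outgoing arrow. *)
Definition arr : rel X := fun x y => if x is Some jt then y == nxt jt else false.
Definition hgt (x : X) : nat := if x is Some jt then (k - jt.2)%N else 0%N.

Lemma apos_e jt : apos n k (lam jt.1) (e jt) = (n - k + e jt - pt jt.1 jt.2.+1)%N.
Proof. by have [_ _ h] := eP jt; rewrite /apos h. Qed.
Lemma nxtP (jt : 'I_r * 'I_k) : (exists t' : 'I_k, t' = jt.2.+1 :> nat /\ nxt jt = Some (jt.1, t')) \/
  (jt.2.+1 = k /\ nxt jt = None).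
Proof.
rewrite /nxt; case: insubP => [t' _ et|]; first by left; exists t'.
by move=> h; right; split=> //; have := ltn_ord jt.2; lia.
Qed.
Lemma be_av x : (be x <= av x)%N.
Proof.
case: x => [jt|] /=; last by lia.
by rewrite apos_e; have := pt_le jt.1 jt.2.+1; lia.
Qed.
Lemma av_n x : (av x <= n)%N.
Proof.
case: x => [jt|] //=; rewrite apos_e; have [_ h _] := eP jt; lia.
Qed.
Lemma gap x : (av x - be x = if x is Some jt then (n - k) - pt jt.1 jt.2.+1 else n - k)%N.
Proof. by case: x => [jt|] //=; rewrite apos_e; have := pt_le jt.1 jt.2.+1; lia. Qed.
Lemma gap_nxt jt : (av (nxt jt) - be (nxt jt) = (n - k) - pt jt.1 jt.2.+2)%N.
Proof.
rewrite gap; have [[t' [et ->]]|[ek ->]] := nxtP jt; first by rewrite /= et.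
by rewrite ek pt_last subn0.
Qed.
Lemma arr_av x y : arr x y -> (av x <= av y)%N.
Proof.
case: x => [jt|] //= /eqP ->; have [[t' [et ->]]|[ek ->]] := nxtP jt; last exact: (av_n (Some jt)).
case: jt et => j t /= et; have := apos_e (j, t); have := apos_e (j, t'); rewrite /= et => -> ->; have := @e_mon j t t' et.
have := pt_mon j (leqnSn t.+1); have := pt_le j t.+1; lia.
Qed.
Lemma arr_hgt x : x != None -> exists2 y, arr x y & (hgt y < hgt x)%N.
Proof.
case: x => [jt|] // _; exists (nxt jt); first by rewrite /arr eqxx.
have := ltn_ord jt.2; have [[t' [et ->]]|[ek ->]] := nxtP jt; rewrite /= ?et; lia.
Qed.

(** The dimension of the product of Grassmannians against the rank of the bundle. Each vertex other
    than the root contributes to the rank its own dimension plus t times the drop of the part after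
    row t; along a chain these terms sum to the size of the diagram by Abel summation, and the sizes
    add up to k(n - k), the dimension at the root. *)
Lemma count_eq : (\sum_x be x * (av x - be x) = \sum_x \sum_(y | arr x y) be x * (av y - be y))%N.
Proof.
have sp (f : X -> nat) : (\sum_x f x = f None + \sum_jt f (Some jt))%N.
  rewrite (bigD1 None) //=; congr (_ + _)%N.
  transitivity (\sum_(x | x != None) \sum_(jt | Some jt == x) f (Some jt))%N.
    apply: eq_bigr => -[jt0|] // _.
    have e1 : (fun jt => Some jt == Some jt0) =1 pred1 jt0 by [].
    by rewrite (eq_bigl _ _ e1) big_pred1_eq.
  rewrite (exchange_big_dep predT) //=; apply: eq_bigr => jt _.
  by rewrite (big_pred1 (Some jt)) // => -[jt'|] //=; apply: eq_sym.
rewrite !sp [X in _ = (X + _)%N]big_pred0 // add0n gap.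
have e1 jt : (\sum_(y | arr (Some jt) y) be (Some jt) * (av y - be y) =
   be (Some jt) * (av (Some jt) - be (Some jt)) + jt.2.+1 * (pt jt.1 jt.2.+1 - pt jt.1 jt.2.+2))%N.
  rewrite (big_pred1 (nxt jt)) // gap_nxt gap -e_jump /= -mulnDr; congr (_ * _)%N.
  have := pt_le jt.1 jt.2.+1; have := pt_mon jt.1 (leqnSn jt.2.+1); lia.
rewrite (eq_bigr _ (fun jt _ => e1 jt)) big_split /= [RHS]addnC; congr (_ + _)%N.
rewrite -sum_lam -(pair_bigA _ (fun j (t : 'I_k) => t.+1 * (pt j t.+1 - pt j t.+2))%N) /=.
apply: eq_bigr => j _; rewrite (sumn_part (boxl j)).
have := @sum_by_parts (fun t => pt j t.+1) k (fun i => pt_mon j (leqnSn i.+1)).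
by rewrite pt_last muln0 addn0 => ->.
Qed.
End Data.

Section Index.
Variables (X : finType) (a be : X -> nat) (arr : rel X).
Hypothesis bea : forall x, (be x <= a x)%N.
Hypothesis counts : (\sum_x be x * (a x - be x) = \sum_x \sum_(y | arr x y) be x * (a y - be y))%N.
Local Notation H := {x : X & 'I_(a x)}.
Local Notation q := #|{: H}|.
Let clC (i : 'I_q) : X := tag (enum_val i).
Let labC (i : 'I_q) : nat := tagged (enum_val i).
Let bC (i : 'I_q) := (labC i < be (clC i))%N.

Let lab_inj i i' : clC i = clC i' -> labC i = labC i' -> i = i'.
Proof.
rewrite /clC /labC => e1 e2; apply: enum_val_inj; move: (enum_val i) (enum_val i') e1 e2 => [x l] [x' l'] /= e.
by case: _ / e l' => l' /val_inj ->.
Qed.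
Let lab_lt i : (labC i < a (clC i))%N. Proof. exact: ltn_ord. Qed.
Let lab_surj x l : (l < a x)%N -> exists2 i, clC i = x & labC i = l.
Proof.
by move=> lt; exists (enum_rank (Tagged (fun x => 'I_(a x)) (Ordinal lt))); rewrite /clC /labC enum_rankK.
Qed.
Let card_lab x c : (c <= a x)%N -> #|[set i | (labC i < c)%N && (clC i == x)]| = c.
Proof.
move=> ca; have /fin_all_exists2 [f f1 f2] (l : 'I_c) : exists2 i, clC i = x & labC i = l.
  by apply: lab_surj; apply: leq_trans ca.
have fI : injective f by move=> l l' e; apply: val_inj; rewrite /= -f2 -f2 e.
rewrite -[RHS]card_ord -(card_codom fI); apply: eq_card => i; rewrite inE.
apply/andP/codomP => [[li /eqP ci]|[l ->]]; last by rewrite f1 f2 eqxx ltn_ord.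
exists (Ordinal li); apply: lab_inj; first by rewrite f1.
by rewrite f2.
Qed.
Let card_b x : #|[set i | bC i && (clC i == x)]| = be x.
Proof.
rewrite -[RHS](card_lab (bea x)); apply: eq_card => i; rewrite !inE /bC.
by case: eqP => [->|]; rewrite ?andbF.
Qed.
Let card_nb x : #|[set i | ~~ bC i && (clC i == x)]| = (a x - be x)%N.
Proof.
have e1 : #|[set i | clC i == x]| = a x.
  rewrite -[RHS](card_lab (leqnn (a x))); apply: eq_card => i; rewrite !inE.
  by case: eqP => [<-|]; rewrite ?andbF // lab_lt.
rewrite -e1 -(cardsID [set i | bC i] [set i | clC i == x]).
have -> : [set i | clC i == x] :&: [set i | bC i] = [set i | bC i && (clC i == x)].
  by apply/setP => i; rewrite !inE andbC.
by rewrite card_b addKn; apply: eq_card => i; rewrite !inE.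
Qed.
Let card_pairs (rl : rel X) : #|[pred ij : 'I_q * 'I_q | [&& bC ij.1, ~~ bC ij.2 & rl (clC ij.1) (clC ij.2)]]| =
  (\sum_x \sum_(y | rl x y) be x * (a y - be y))%N.
Proof.
rewrite -sum1_card -(pair_big_dep bC (fun i j => ~~ bC j && rl (clC i) (clC j)) (fun _ _ => 1%N)) /=.
rewrite (partition_big clC predT) //=; apply: eq_bigr => x _.
transitivity (\sum_(i | bC i && (clC i == x)) \sum_(y | rl x y) (a y - be y))%N; last first.
  by rewrite sum_nat_cond_const card_b big_distrr.
apply: eq_bigr => i /andP [_ /eqP ->]; rewrite (partition_big clC (rl x)) /=; last by move=> j /andP [].
apply: eq_bigr => y xy; rewrite sum1dep_card -card_nb; apply: eq_card => j; rewrite !inE.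
by case: eqP => [->|]; rewrite ?andbF // xy !andbT.
Qed.

(** The basis is the disjoint union of the coordinate sets of the vertices. The tangent and fibre
    blocks have equally many entries by [counts], so that a single index type enumerates both. *)
Lemma index_ex : exists q (clC : 'I_q -> X) (labC : 'I_q -> nat) mc (tixC eixC : 'I_mc -> 'I_q * 'I_q),
  [/\ forall i i', clC i = clC i' -> labC i = labC i' -> i = i',
    forall i, (labC i < a (clC i))%N, forall x l, (l < a x)%N -> exists2 i, clC i = x & labC i = l,
    injective tixC /\ injective eixC &
    let bC i := (labC i < be (clC i))%N in
    (forall i j, (exists k, tixC k = (i, j)) <-> [&& bC i, ~~ bC j & clC i == clC j]) /\
    (forall i j, (exists k, eixC k = (i, j)) <-> [&& bC i, ~~ bC j & arr (clC i) (clC j)])].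
Proof.
pose pr (rl : rel X) := [pred ij : 'I_q * 'I_q | [&& bC ij.1, ~~ bC ij.2 & rl (clC ij.1) (clC ij.2)]].
have ec : #|pr eq_op| = #|pr arr|.
  rewrite !card_pairs -counts; apply: eq_bigr => x _; rewrite (big_pred1 x) // => y /=; by rewrite eq_sym.
have vP (rl : rel X) i j : (exists k : 'I_#|pr rl|, enum_val k = (i, j)) <-> [&& bC i, ~~ bC j & rl (clC i) (clC j)].
  split=> [[k ek]|h]; first by have := enum_valP k; rewrite ek.
  have h' : (i, j) \in pr rl by [].
  by exists (enum_rank_in h' (i, j)); rewrite enum_rankK_in.
exists q, clC, labC, #|pr eq_op|, enum_val, (fun k => enum_val (cast_ord ec k)); split=> //.
  split; first exact: enum_val_inj.
  by move=> k k' /enum_val_inj /cast_ord_inj.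
split=> i j; first exact: vP.
rewrite -(vP arr); split=> [[k <-]|[k <-]]; first by exists (cast_ord ec k).
by exists (cast_ord (esym ec) k); rewrite cast_ordKV.
Qed.
End Index.

End IndexData.

(** * Complex subrepresentations as J-invariant orthogonal projections *)

Module Realification.
Import all_boot all_order all_algebra all_fingroup complex.
Import boolp reals.
Import zify ring.
Import Defs Graded Projections ChartCover LinearOperators ChartEquations ComplexStructure Perturbations.
Import Order.TTheory GRing.Theory Num.Theory.
Local Open Scope ring_scope.

Section OrthogonalProjection.
Variables (R : realFieldType) (p : nat).
Implicit Types P K : 'M[R]_p.
(** The formula M^T (M M^T)^-1 M for a basis M of the row space; the Gram matrix is invertible over
    a real field. *)
Lemma orthproj a (B : 'M[R]_(a, p)) : exists P : 'M[R]_p, [/\ P^T = P, P *m P = P & (P :=: B)%MS].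
Proof.
have := row_base_free B; have := eq_row_base B; move: (row_base B) => M eM fM.
have u : M *m M^T \in unitmx.
  apply: unitmx_inj => v e; apply: (row_free_inj fM); rewrite mul0mx; apply: mul_tr_eq0.
  by rewrite trmx_mul !mulmxA -[v *m M *m M^T]mulmxA e mul0mx.
exists (M^T *m invmx (M *m M^T) *m M); split.
- by rewrite !trmx_mul trmxK trmx_inv trmx_mul trmxK mulmxA.
- by rewrite !mulmxA -[_ *m M *m M^T]mulmxA -[_ *m invmx _ *m (M *m M^T)]mulmxA mulVmx // mulmx1.
apply: eqmx_trans eM; apply/eqmxP/andP; split; first exact: submxMl.
by apply/submxP; exists M; rewrite !mulmxA mulmxV // mul1mx.
Qed.

Lemma proj_sub_id a P (Y : 'M[R]_(a, p)) : P *m P = P -> (Y <= P)%MS -> Y *m P = Y.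
Proof. by move=> PP /submxP [D ->]; rewrite -mulmxA PP. Qed.

(** Stability under [K] and under its transpose means that the space and its orthogonal complement
    are both stable under [K]. *)
Lemma orthproj_comm a (B : 'M[R]_(a, p)) P K : P^T = P -> P *m P = P -> (P :=: B)%MS ->
  (B *m K <= B)%MS -> (B *m K^T <= B)%MS -> P *m K = K *m P.
Proof.
move=> PT PP eP h1 h2.
have key K' : (B *m K' <= B)%MS -> P *m K' *m P = P *m K'.
  by move=> h; apply: proj_sub_id => //; rewrite (eqmxMr K' eP) eP.
have := congr1 trmx (key _ h2); rewrite !trmx_mul trmxK PT mulmxA => e.
by rewrite -(key _ h1) e.
Qed.

Lemma comm_idem (F : fieldType) (A B : 'M[F]_p) : A *m A = A -> B *m B = B -> A *m B = B *m A ->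
  A *m B *m (A *m B) = A *m B.
Proof. by move=> a b e; rewrite {2}e mulmxA -[A *m B *m B]mulmxA b -mulmxA -e mulmxA a. Qed.
End OrthogonalProjection.

Section Realify.
Variables (R : realType) (q : nat) (X : eqType) (clC : 'I_q -> X) (arr : rel X) (bC : pred 'I_q).
Local Notation C := (complex R).
Local Notation p := (q + q)%N.
Local Notation cl := (clR clC).
Local Notation b := (bR bC).
Local Notation J := (Jm R q).
Local Notation isproj := (@isproj R p X cl b).

Lemma rhoE a c (Z : 'M[C]_(a, c)) e i e' j : rho Z (emb e i) (emb e' j) =
  match e, e' with false, false => re Z i j | false, true => im Z i j
   | true, false => - im Z i j | true, true => re Z i j end.
Proof.
by rewrite /rho /emb; case: e; case: e'; rewrite ?block_mxEul ?block_mxEur ?block_mxEdl ?block_mxEdr // mxE.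
Qed.
Lemma emb_eq a e e' (i j : 'I_a) : (emb e i == emb e' j) = (e == e') && (i == j).
Proof.
apply/eqP/andP => [h|[/eqP -> /eqP ->] //].
by have := congr1 (@eps a) h; have := congr1 (@hd a) h; rewrite !hd_emb !eps_emb => -> ->.
Qed.
Lemma rho_diag (f : pred 'I_q) : rho (\matrix_(i, j) ((i == j) && f i)%:R : 'M[C]_q) =
  \matrix_(i, j) ((i == j) && f (hd i))%:R.
Proof.
apply/matrixP => i j; rewrite -(emb_hd i) -(emb_hd j) rhoE [RHS]mxE emb_eq hd_emb.
by case: (eps i); case: (eps j); rewrite /= !mxE; case: (_ == _); case: (f _); rewrite /= ?oppr0.
Qed.
Lemma rho_cproj x : rho (cproj C clC x) = cproj R cl x.
Proof. exact: (rho_diag (fun i => clC i == x)). Qed.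
Lemma rho_P0 : rho (P0 C bC) = P0 R b. Proof. exact: rho_diag. Qed.
Lemma rho_out (Z : 'M[C]_q) i j : Z (hd i) (hd j) = 0 -> rho Z i j = 0.
Proof.
move=> h; rewrite -(emb_hd i) -(emb_hd j) rhoE !mxE h /=.
by case: (eps i); case: (eps j); rewrite ?oppr0.
Qed.
Lemma in1_rho (Z : 'M[C]_q) : in1 clC arr Z -> in1 cl arr (rho Z).
Proof. by move=> h i j n; apply: rho_out; apply: h. Qed.
Lemma in0_rho (Z : 'M[C]_q) : in0 clC Z <-> in0 cl (rho Z).
Proof.
split=> h x; first by rewrite -rho_cproj -!rhoM h.
by apply: rho_inj; rewrite !rhoM rho_cproj h.
Qed.

Lemma cpcp (F : fieldType) (x : X) : cproj F clC x *m cproj F clC x = cproj F clC x.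
Proof. by apply/matrixP => i j; rewrite mul_cproj mxE; case: (clC i == x); rewrite ?andbF ?mul1r ?mul0r. Qed.
Lemma cpT (x : X) : (cproj R cl x)^T = cproj R cl x.
Proof. by apply/matrixP => u v; rewrite !mxE eq_sym; case: eqP => [->|]. Qed.

(** The traces at the vertices are compared through ranks, which realification doubles. *)
Lemma cx_proj P : isproj P -> commJ P -> [/\ rho (cx P) = P, in0 clC (cx P), cx P *m cx P = cx P &
  forall x, \tr (cproj C clC x *m cx P) = \tr (cproj C clC x *m P0 C bC)].
Proof.
move=> [i0 PT PP tr] cP; have e := cxK cP; move: (cx P) e => Pc e; rewrite -e in i0 PP tr *.
have PPc : Pc *m Pc = Pc by apply: rho_inj; rewrite rhoM.
have i0c : in0 clC Pc by apply/in0_rho.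
split=> // x.
have id1 : cproj C clC x *m Pc *m (cproj C clC x *m Pc) = cproj C clC x *m Pc.
  by apply: comm_idem => //; apply: cpcp.
have id2 : cproj C clC x *m P0 C bC *m (cproj C clC x *m P0 C bC) = cproj C clC x *m P0 C bC.
  apply: comm_idem; [exact: cpcp | exact: P0P0 | apply: in0_P0].
have eR (Z : 'M[C]_q) : Z *m Z = Z -> (2 * \rank Z)%:R = \tr (rho Z) :> R.
  by move=> zz; rewrite -rank_rho; apply: mxrank_idem; rewrite -rhoM zz.
have := eR _ id1; rewrite rhoM rho_cproj tr -rho_cproj -rho_P0 -rhoM -(eR _ id2) => /eqP.
rewrite eqr_nat eqn_pmul2l // => /eqP er.
by rewrite -(mxrank_idem id1) er (mxrank_idem id2).
Qed.

Definition dperm_fun (s : 'S_q) (i : 'I_p) : 'I_p := emb (eps i) (s (hd i)).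
Lemma dperm_inj s : injective (dperm_fun s).
Proof.
move=> i j h; have := congr1 (@hd _) h; have := congr1 (@eps _) h; rewrite !hd_emb !eps_emb => h1 /perm_inj h2.
exact: double_eq.
Qed.
Definition dperm s : 'S_p := perm (@dperm_inj s).
Lemma rho_perm (s : 'S_q) : rho (perm_mx s : 'M[C]_q) = perm_mx (dperm s).
Proof.
apply/matrixP => i j; rewrite -(emb_hd i) -(emb_hd j) rhoE [RHS]mxE [in RHS]mxE permE /dperm_fun eps_emb hd_emb emb_eq.
by case: (eps i); case: (eps j); rewrite /= !mxE; case: (_ == _); rewrite /= ?oppr0.
Qed.

(** The complex projection lies in a chart given by a permutation of the complex indices; performed
    on both real copies, it gives a permutation matrix commuting with J. *)
Lemma commJ_chart P : isproj P -> commJ P -> exists2 c : class_perm cl, commJ (gmx R c) &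
  chart_mx b (gmx R c) P \in unitmx.
Proof.
move=> iP cP; have [e i0c PPc trc] := cx_proj iP cP; have [i0 PT PP _] := iP.
have [s [scl hs]] := cover_perm i0c PPc trc.
have hc : [forall i, cl (dperm s i) == cl i].
  by apply/forallP => i; rewrite permE /dperm_fun /clR hd_emb scl.
exists (exist _ (dperm s) hc); first by rewrite /gmx /= -rho_perm; apply: rhoJ.
rewrite /gmx /=; set g := perm_mx (dperm s); apply: unitmx_inj => v hv.
have hP : v *m P0 R b *m g *m P = 0 -> v *m P0 R b = 0.
  move=> h; apply: cxv_eq0; rewrite -rho_P0 cxv_mul; apply: hs.
  rewrite -!cxv_mul rho_P0 rho_perm e h.
  by apply/rowP => j; rewrite !mxE.
have e1 : v *m P0 R b *m g *m P *m g^T *m P0 R b = 0.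
  have := congr1 (mulmx^~ (P0 R b)) hv; rewrite /chart_mx /= mul0mx mulmxDr mulmxDl.
  by rewrite -[v *m Q0 R b *m _]mulmxA Q0P0 mulmx0 addr0 !mulmxA -[_ *m P0 R b *m P0 R b]mulmxA P0P0.
have e2 : v *m Q0 R b = 0.
  have := congr1 (mulmx^~ (Q0 R b)) hv; rewrite /chart_mx /= mul0mx [v *m (_ + _)]mulmxDr mulmxDl.
  by rewrite -[v *m Q0 R b *m _]mulmxA Q0Q0 !mulmxA -[_ *m P0 R b *m Q0 R b]mulmxA P0Q0 mulmx0 add0r.
have e3 : v *m P0 R b = 0.
  apply: hP; apply: mul_tr_eq0; rewrite [(_ *m P)^T]trmx_mul PT.
  rewrite [(_ *m g)^T]trmx_mul [(v *m _)^T]trmx_mul P0T !mulmxA.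
  by rewrite -[_ *m P *m P]mulmxA PP e1 mul0mx.
by rewrite -[v]mulmx1 -(subrK (P0 R b) 1%:M) -/(Q0 R b) mulmxDr e2 e3 addr0.
Qed.

(** The orthogonal projection onto the realified subspace. As J^T = - J and the vertex projections
    are symmetric, stability gives the commutations by [orthproj_comm]. *)
Lemma subrep_proj (X0 Bm : 'M[C]_q) : (forall x, (Bm *m cproj C clC x <= Bm)%MS) ->
  (Bm *m X0 <= Bm)%MS -> (forall x, \tr (cproj C clC x *m P0 C bC) = (\rank (Bm *m cproj C clC x))%:R) ->
  exists P, [/\ isproj P, commJ P, P *m rho X0 *m (1%:M - P) = 0 & (P :=: rho Bm)%MS].
Proof.
move=> hc hX hr; have [P [PT PP eP]] := orthproj (rho Bm); exists P.
have i0 : in0 cl P.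
  move=> x; apply/esym/(orthproj_comm PT PP eP); rewrite ?cpT -rho_cproj -rhoM rho_submx hc //.
have cJ : commJ P.
  have hJ : (rho Bm *m J <= rho Bm)%MS by rewrite rhoJ submxMl.
  by apply: (orthproj_comm PT PP eP) => //; rewrite JmT mulmxN eqmx_opp.
split=> //.
  split=> // x; have id2 : cproj C clC x *m P0 C bC *m (cproj C clC x *m P0 C bC) = cproj C clC x *m P0 C bC.
    by apply: comm_idem; [exact: cpcp | exact: P0P0 | apply: in0_P0].
  have cc : cproj R cl x *m cproj R cl x = cproj R cl x by rewrite -rho_cproj -rhoM cpcp.
  rewrite -mxrank_idem; last by apply: comm_idem => //; apply: i0.
  rewrite i0 (eqmxMr _ eP) -rho_cproj -rhoM rank_rho.
  have := hr x; rewrite -(mxrank_idem id2) => /eqP; rewrite eqr_nat => /eqP <-.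
  rewrite -rho_P0 -rhoM -rank_rho; apply: mxrank_idem; by rewrite -rhoM id2.
have e : P *m rho X0 *m P = P *m rho X0.
  by apply: proj_sub_id => //; rewrite (eqmxMr _ eP) eP -rhoM rho_submx.
by rewrite mulmxBr mulmx1 e subrr.
Qed.
End Realify.

End Realification.

(** * Constant sections, doubled diagrams and doubled indices *)

Module Doubling.
Import all_boot all_order all_algebra all_fingroup complex.
Import boolp classical_sets functions cardinality reals.
Import zify ring.
Import Defs PolynomialFunctions ImplicitFunction Graded Projections ChartCover Genericity ChartEquations Orientation SignedCount FirstOrder ComplexStructure Perturbations MovedZeros SpecialSection SchubertTangent FlagRepresentation IndexData Realification.
Import Order.TTheory GRing.Theory Num.Theory.
Local Open Scope ring_scope.

Section ConstantSection.
Variables (R : realType) (p : nat) (X : eqType) (cl : 'I_p -> X) (arr : rel X).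
Variables (b : pred 'I_p) (m : nat) (tix eix : 'I_m -> 'I_p * 'I_p).
Hypothesis tixI : injective tix.
Hypothesis eixI : injective eix.
Hypothesis tixP : forall i j, (exists k, tix k = (i, j)) <-> [&& b i, ~~ b j & cl i == cl j].
Hypothesis eixP : forall i j, (exists k, eix k = (i, j)) <-> [&& b i, ~~ b j & arr (cl i) (cl j)].
Variable X0 : 'M[R]_p.
Hypothesis X1 : in1 cl arr X0.
Definition ycst := test_sect (form0 R p) (form0 R p) X0.
Lemma sect_ycst a P : sect cl arr ycst a P = (a * a) *: X0.
Proof. by rewrite /ycst sect_test // !xi_form0. Qed.
Hypothesis nd : forall P Th, isproj cl b P -> P *m X0 *m (1%:M - P) = 0 -> in0 cl Th ->
  P *m Th *m (1%:M - P) = Th -> Th *m X0 *m (1%:M - P) = P *m X0 *m Th -> Th = 0.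

(** For a constant section the variation S1 is 0, and a kernel vector of the Jacobian is a
    homomorphism from the subrepresentation to the quotient, which [nd] excludes. *)
Lemma ycst_nondegenerate : nondegenerate cl arr b tix eix ycst.
Proof.
move=> c x A z jA; apply: unitmx_inj => v e.
have iP := isproj_chartP (R := R) tixP c x.
have s1 : sect cl arr ycst 1 (chartP b tix c x) = X0 by rewrite sect_ycst mulr1 scale1r.
have zP := (cheq_eq0 eixI tixP eixP c ycst x).1 z; rewrite s1 in zP.
have e1 : v *m A = gramd tix x ^+ 2 *: coord eix
   (mxof tix v *m chart_h tix c x *m sect cl arr ycst 1 (chartP b tix c x) *m chart_hi tix c x -
    chart_h tix c x *m sect cl arr ycst 1 (chartP b tix c x) *m chart_hi tix c x *m mxof tix v +
    chart_h tix c x *m 0 *m chart_hi tix c x).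
  apply: (cheq_jet tixP eixP z) jA => d1 n1 jd jn en; rewrite s1.
  have := mjet_scale (sjet_mul jd jd) (mjet_cst X0 x v).
  rewrite -expr2 scaler0 add0r addr0.
  have -> : gramd tix x * d1 + d1 * gramd tix x = 2 * gramd tix x * d1 by ring.
  by apply: mjet_ext => w; rewrite sect_ycst.
move: e; rewrite e1 s1 => /eqP; rewrite scaler_eq0 expf_eq0 /= (negPf (gramd_neq0 tix x)) /= => /eqP.
have z1 : in1 cl arr (0 : 'M[R]_p) by move=> i j _; rewrite mxE.
move=> /(cheq_jet_eq0 eixI tixP eixP v X1 z1 zP).
rewrite mulmx0 mul0mx addr0 => /eqP; rewrite subr_eq0 => /eqP eT.
have t0 := nd iP zP (in0_tangent tixP c x v) (tangent_PQ tixP c x v) eT.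
have := tangentK tixP c x v; rewrite t0 mulmx0 mul0mx mulmx0 mul0mx => e2.
by rewrite -(mxofK tixI v) -e2; apply/rowP => k; rewrite !mxE.
Qed.
End ConstantSection.

Section Doubled.
Variables (k n : nat) (l : seq nat).
Hypothesis boxl : diagram_in_box k (n - k) l.
Local Notation Dl := (double_diagram l).
Lemma nth_double i : nth 0%N Dl (2 * i) = (2 * nth 0%N l i)%N /\ nth 0%N Dl (2 * i).+1 = (2 * nth 0%N l i)%N.
Proof.
rewrite /double_diagram; elim: (l) i => [|a s IH] [|i]; rewrite ?mulnS ?add2n /= ?nth_nil ?muln0 //.
Qed.
Lemma part_double i : (0 < i)%N -> part Dl (2 * i) = (2 * part l i)%N.
Proof.
case: i => // i _; rewrite /part -(nth_double i).2; congr (nth _ _ _); lia.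
Qed.
Lemma part_double_odd i : part Dl (2 * i).+1 = (2 * part l i.+1)%N.
Proof. by rewrite /part /= (nth_double i).1. Qed.
Lemma sumn_double : sumn Dl = (4 * sumn l)%N.
Proof. by rewrite /double_diagram; elim: (l) => //= a s; lia. Qed.
Lemma box_double : diagram_in_box (2 * k) (2 * n - 2 * k) Dl.
Proof.
case/and3P: boxl => so sz al; apply/and3P; split.
- rewrite /double_diagram; elim: (l) so => [|a [|c s] IH] //=; first by rewrite /geq /= leqnn.
  move=> /andP [h1 h2]; have := IH h2; rewrite /= => ->; rewrite andbT /geq /= leqnn leq_mul2l; exact: h1.
- have -> : size Dl = (2 * size l)%N by rewrite /double_diagram; elim: (l) => //= a s ->; lia.
  by rewrite leq_mul2l sz orbT.
rewrite /double_diagram; elim: (l) al => //= a s IH /andP [h1 /IH ->]; rewrite andbT andbb /geq /=.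
by rewrite /geq /= in h1; lia.
Qed.
(** The rows of a doubled diagram come in equal pairs, so that only the second row of a pair can be
    a corner. *)
Lemma ess_double i : ess (2 * k) Dl i -> exists2 i', ess k l i' & i = (2 * i')%N.
Proof.
move=> /andP [/andP [i0 ik] es].
have [m [ei|ei]] : exists m, i = (2 * m).+1 \/ i = (2 * m)%N.
  by exists i./2; have := odd_double_half i; rewrite -mul2n; case: (odd i) => /=; lia.
  rewrite ei in es; case/orP: es => [/eqP e|]; first by lia.
  have e2 : (2 * m).+2 = (2 * m.+1)%N by lia.
  by rewrite e2 part_double // part_double_odd ltnn.
exists m => //; rewrite ei in i0 ik es.
apply/andP; split; first by lia.
case/orP: es => [/eqP e|]; first by apply/orP; left; apply/eqP; lia.
by rewrite part_double_odd part_double; last lia; rewrite ltn_mul2l /= => ->; rewrite orbT.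
Qed.
Lemma ess_doubled i : ess k l i -> ess (2 * k) Dl (2 * i).
Proof.
move=> /andP [/andP [i0 ik] es]; apply/andP; split; first by lia.
case/orP: es => [/eqP ->|lt]; first by rewrite eqxx.
by rewrite part_double_odd part_double // ltn_mul2l lt orbT.
Qed.
(** The flag members occurring in the doubled problem have twice the dimension of those in the
    original one: both problems use the same quiver, with doubled dimension vectors. *)
Lemma apos_double i : (0 < i <= k)%N -> apos (2 * n) (2 * k) Dl (2 * i) = (2 * apos n k l i)%N.
Proof. by move=> /andP [i0 ik]; rewrite /apos part_double //; lia. Qed.
End Doubled.

Section FlagData.
Variables (F0 : fieldType) (N r k : nat) (E : 'I_r -> nat -> {vspace 'rV[F0]_N}).
Local Notation X := (option ('I_r * 'I_k)).
Variable a : X -> nat.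
Definition gd (G : 'I_r -> 'M[F0]_N) (x : X) := if x is Some jt then G jt.1 else 1%:M.
Definition Esd (x : X) : {vspace 'rV[F0]_N} := if x is Some jt then E jt.1 (a x) else fullv.
Lemma flag_data : (forall j, complete_flag (E j)) -> a None = N -> (forall x, a x <= N)%N ->
  exists G, (forall x, gd G x \in unitmx) /\
    forall x c, (c \in Esd x) <-> (forall l : 'I_N, (a x <= l)%N -> (c *m invmx (gd G x)) 0 l = 0).
Proof.
move=> fE a0 aN.
have h j : exists B : 'M[F0]_N, B \in unitmx /\ forall i (c : 'rV_N), (i <= N)%N ->
    (c \in E j i) <-> (forall l : 'I_N, (i <= l)%N -> (c *m invmx B) 0 l = 0).
  have [d m] := fE j; have [||B uB hB] := @adapted_basis F0 N predT (E j) _ _ isT.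
  - by move=> i _; apply: d.
  - by move=> i i' _ _; apply: m.
  by exists B; split=> // i c; apply: hB.
have [G hG] := choice h; exists G; split=> [[[j t]|]|[jt|] c] /=.
- by case: (hG j).
- exact: unitmx1.
- by apply: (hG jt.1).2.
by rewrite memvf a0; split=> // _ l; rewrite leqNgt ltn_ord.
Qed.
End FlagData.

Section DoubledIndex.
Variables (q : nat) (X : finType) (clC : 'I_q -> X) (labC : 'I_q -> nat) (a be : X -> nat).
Hypothesis lab_inj : forall i i', clC i = clC i' -> labC i = labC i' -> i = i'.
Hypothesis lab_lt : forall i, (labC i < a (clC i))%N.
Hypothesis lab_surj : forall x l, (l < a x)%N -> exists2 i, clC i = x & labC i = l.
(** The two real copies of a complex label are interleaved, so that labels below [be] correspond to
    labels below twice [be], and [bR] is the base point of the real problem as well. *)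
Definition labR (i : 'I_(q + q)) : nat := (2 * labC (hd i) + eps i)%N.
Lemma labR_inj i i' : clR clC i = clR clC i' -> labR i = labR i' -> i = i'.
Proof.
rewrite /labR => e1 e2; have e3 : labC (hd i) = labC (hd i') by case: (eps i) (eps i') e2 => [] [] /=; lia.
apply: double_eq; first exact: lab_inj.
by case: (eps i) (eps i') e2 => [] [] /=; lia.
Qed.
Lemma labR_lt i : (labR i < 2 * a (clR clC i))%N.
Proof. by have := lab_lt (hd i); rewrite /labR /clR; case: (eps i) => /=; lia. Qed.
Lemma labR_surj x l : (l < 2 * a x)%N -> exists2 i, clR clC i = x & labR i = l.
Proof.
move=> lt; have [|i ci li] := @lab_surj x l./2; first by lia.
exists (emb (odd l) i); rewrite /clR /labR hd_emb ?eps_emb // li.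
by rewrite -[RHS](odd_double_half l) addnC mul2n.
Qed.
Lemma bsubR i : bsub (fun x => 2 * be x)%N (clR clC) labR i = bR (bsub be clC labC) i.
Proof. by rewrite /bsub /bR /labR /clR; case: (eps i) => /=; lia. Qed.
End DoubledIndex.

End Doubling.

(** * Comparison of the two counts *)

Module Assembly.
Import all_boot all_order all_algebra all_fingroup complex.
Import boolp classical_sets functions cardinality reals.
Import zify ring lra.
Import Defs PolynomialFunctions ImplicitFunction Graded Projections ChartCover Genericity ChartEquations Orientation SignedCount FirstOrder ComplexStructure Perturbations MovedZeros SpecialSection SchubertTangent FlagRepresentation IndexData Realification Doubling.
Import Order.TTheory GRing.Theory Num.Theory.
Local Open Scope ring_scope.

Section Assembly.
Variables (R : realType) (k n r : nat) (lam : 'I_r -> seq nat).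
Variables (F : 'I_r -> nat -> {vspace 'rV[R]_(2 * n)}) (A : 'I_r -> nat -> {vspace 'rV[complex R]_n}).
Hypothesis kn : (0 < k < n)%N.
Hypothesis boxl : forall j, diagram_in_box k (n - k) (lam j).
Hypothesis sum_lam : (\sum_j sumn (lam j) = k * (n - k))%N.
Hypothesis gF : generic_flags (2 * k) (fun j => double_diagram (lam j)) F.
Hypothesis gA : generic_flags k lam A.
Local Notation X := (option ('I_r * 'I_k)).
Variable e : 'I_r * 'I_k -> nat.
Hypothesis eP : forall jt, [/\ ess k (lam jt.1) (e jt), (jt.2.+1 <= e jt <= k)%N &
  part (lam jt.1) (e jt) = part (lam jt.1) jt.2.+1].
Local Notation a := (av n lam e).
Local Notation be := (be e).
Local Notation arr := (@arr k r).
Variables (q : nat) (clC : 'I_q -> X) (labC : 'I_q -> nat).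
Hypothesis li : forall i i', clC i = clC i' -> labC i = labC i' -> i = i'.
Hypothesis ll : forall i, (labC i < a (clC i))%N.
Hypothesis ls : forall x l, (l < a x)%N -> exists2 i, clC i = x & labC i = l.
Local Notation bC := (bsub be clC labC).
Local Notation C := (complex R).

Let aN x : (a x <= n)%N. Proof. exact: (av_n kn sum_lam eP). Qed.
Let bea x : (be x <= a x)%N. Proof. exact: (be_av kn boxl sum_lam eP). Qed.

Lemma arr_gd (F0 : fieldType) N (G : 'I_r -> 'M[F0]_N) (x y : X) : arr x y -> gd G x = gd G y \/ y = None.
Proof.
case: x => [jt|] // /eqP ->; have [[t' [_ ->]]|[_ ->]] : (exists t' : 'I_k, t' = jt.2.+1 :> nat /\ nxt jt = Some (jt.1, t')) \/
    (jt.2.+1 = k /\ nxt jt = None).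
- exact: (nxtP kn sum_lam jt).
- by left.
by right.
Qed.

Lemma complex_package : exists X0 : 'M[C]_q,
  let zero P := [/\ in0 clC P, P *m P = P, forall x, \tr (cproj C clC x *m P) = \tr (cproj C clC x *m P0 C bC) &
    P *m X0 *m (1%:M - P) = 0] in
  [/\ in1 clC arr X0, forall x, \tr (cproj C clC x *m P0 C bC) = (be x)%:R,
  forall P Th, zero P -> in0 clC Th -> P *m Th *m (1%:M - P) = Th ->
    Th *m X0 *m (1%:M - P) = P *m X0 *m Th -> Th = 0 &
  exists Bm : {vspace 'rV[C]_n} -> 'M[C]_q,
    (forall U, solutions k lam A U -> [/\ forall x, (Bm U *m cproj C clC x <= Bm U)%MS,
     (Bm U *m X0 <= Bm U)%MS & forall x, \rank (Bm U *m cproj C clC x) = be x]) /\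
    forall U U', solutions k lam A U -> solutions k lam A U' -> (Bm U == Bm U')%MS -> U = U'].
Proof.
have [fA _] := gA.
have [G [uG hG]] := flag_data fA (erefl : a None = n) aN.
have arrP' x y : arr x y -> (a x <= a y)%N /\ (gd G x = gd G y \/ a y = n).
  move=> xy; split; first exact: (arr_av kn boxl sum_lam eP xy).
  by have [|->] := arr_gd G xy; [left | right].
have exE' j i : ess k (lam j) i -> exists2 x, be x = i & Esd A a x = A j (apos n k (lam j) i).
  move=> ei; have [t et] := e_ess kn boxl sum_lam eP ei.
  by exists (Some (j, t)); rewrite /= ?et.
have Esx' x : Esd A a x = fullv /\ be x = k \/
    exists j i, [/\ ess k (lam j) i, be x = i & Esd A a x = A j (apos n k (lam j) i)].
  case: x => [jt|]; last by left.
  by right; exists jt.1, (e jt); case: (eP jt).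
have := @rep_package C n k q X None arr a be (@hgt k r) (gd G) (Esd A a) clC labC li ll ls aN bea
  (erefl _) (erefl _) uG hG arrP' (fun x => arr_hgt kn sum_lam (x := x)) r lam A kn boxl sum_lam gA exE' Esx'.
by case=> X0 [[h1 h2] h3 _ h4]; exists X0; split.
Qed.

(** The representation of the doubled problem lives on the realified index set of the complex one,
    so that both give sections of the same bundle. *)
Lemma real_package : exists X0 : 'M[R]_(q + q),
  let zero P := isproj (clR clC) (bR bC) P /\ P *m X0 *m (1%:M - P) = 0 in
  [/\ in1 (clR clC) arr X0,
  forall P Th, zero P -> in0 (clR clC) Th -> P *m Th *m (1%:M - P) = Th ->
    Th *m X0 *m (1%:M - P) = P *m X0 *m Th -> Th = 0 &
  exists sol : 'M[R]_(q + q) -> {vspace 'rV[R]_(2 * n)},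
    (forall P, zero P -> solutions (2 * k) (fun j => double_diagram (lam j)) F (sol P)) /\
    forall P P', zero P -> zero P' -> sol P = sol P' -> P = P'].
Proof.
have [fF _] := gF.
pose aR (x : X) := (2 * a x)%N; pose beR (x : X) := (2 * be x)%N.
have aRN x : (aR x <= 2 * n)%N by rewrite leq_mul2l aN.
have beRa x : (beR x <= aR x)%N by rewrite leq_mul2l bea.
have [G [uG hG]] := flag_data fF (erefl : aR None = (2 * n)%N) aRN.
have arrP' x y : arr x y -> (aR x <= aR y)%N /\ (gd G x = gd G y \/ aR y = (2 * n)%N).
  move=> xy; split; first by rewrite leq_mul2l (arr_av kn boxl sum_lam eP xy).
  by have [|->] := arr_gd G xy; [left | right].
have exE' j i : ess (2 * k) (double_diagram (lam j)) i -> exists2 x, beR x = i &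
    Esd F aR x = F j (apos (2 * n) (2 * k) (double_diagram (lam j)) i).
  move=> ei; have [i' ei' ->] := ess_double (boxl j) ei.
  have [t et] := e_ess kn boxl sum_lam eP ei'; have /andP [ik _] := ei'.
  exists (Some (j, t)); rewrite /beR /= ?et //.
  by rewrite (apos_double (boxl j) ik) /aR /= et.
have Esx' x : Esd F aR x = fullv /\ beR x = (2 * k)%N \/
    exists j i, [/\ ess (2 * k) (double_diagram (lam j)) i, beR x = i &
      Esd F aR x = F j (apos (2 * n) (2 * k) (double_diagram (lam j)) i)].
  case: x => [jt|]; last by left.
  have [es _ _] := eP jt; have /andP [ik _] := es.
  right; exists jt.1, (2 * e jt)%N; split=> //; first exact: (ess_doubled (boxl jt.1) es).
  by rewrite (apos_double (boxl jt.1) ik).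
have KN : (0 < 2 * k < 2 * n)%N by move: kn; lia.
have boxD j : diagram_in_box (2 * k) (2 * n - 2 * k) (double_diagram (lam j)) by apply: box_double.
have sumD : (\sum_j sumn (double_diagram (lam j)) = 2 * k * (2 * n - 2 * k))%N.
  rewrite (eq_bigr (fun j => 4 * sumn (lam j))%N); last by move=> j _; apply: sumn_double.
  by rewrite -big_distrr /= sum_lam -mulnBr mulnACA.
have := @rep_package R (2 * n) (2 * k) (q + q) X None arr aR beR (@hgt k r) (gd G) (Esd F aR) (clR clC) (labR labC)
  (labR_inj li) (labR_lt ll) (labR_surj ls) aRN beRa
  (erefl _) (erefl _) uG hG arrP' (fun x => arr_hgt kn sum_lam (x := x)) r _ F KN boxD sumD gF exE' Esx'.
have eP0 : P0 R (bsub beR (clR clC) (labR labC)) = P0 R (bR bC).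
  by apply/matrixP => i j; rewrite !mxE bsubR.
rewrite eP0; case=> X0 [[h1 h2] h3 [sol [s1 s2]] _]; exists X0.
split=> //; first by move=> P Th [[i0 PT PP tr] zP]; apply: h3.
exists sol; split=> [P [[i0 PT PP tr] zP]|P P' [[i0 PT PP tr] zP] [[i0' PT' PP' tr'] zP']].
  by apply: s1.
by apply: s2.
Qed.

Variables (mc : nat) (tixC eixC : 'I_mc -> 'I_q * 'I_q).
Hypothesis tI : injective tixC.
Hypothesis eI : injective eixC.
Hypothesis tP : forall i j, (exists k, tixC k = (i, j)) <-> [&& bC i, ~~ bC j & clC i == clC j].
Hypothesis iP : forall i j, (exists k, eixC k = (i, j)) <-> [&& bC i, ~~ bC j & arr (clC i) (clC j)].
Local Notation cl := (clR clC).
Local Notation b := (bR bC).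

(** The complex solutions inject into the zeros of the special section, whose number is their signed
    count, equal to that of the real section; the latter is at most the number of zeros of the real
    section, and these inject into the real solutions. *)
Lemma solutions_card_le :
  (solutions k lam A #<= solutions (2 * k) (fun j => double_diagram (lam j)) F)%card.
Proof.
have [XC /= [XC1 trC ndC [Bm [hB1 hB2]]]] := complex_package.
have [XR /= [XR1 ndR [sol [hs1 hs2]]]] := real_package.
pose W : 'M[R]_(q + q) := rho XC.
have W1 : in1 cl arr W by apply: in1_rho.
have WJ : commJ W by apply: rhoJ.
have tI' := tixI tI; have eI' := eixI eI; have tP' := tixP tP; have eP' := eixP iP.
have tc i : cl (flperm q i) = cl i by rewrite flpermE /clR hd_fl.
have tb i : b (flperm q i) = b i by rewrite flpermE /bR hd_fl.
have th i : (fun i => ~~ eps i) (flperm q i) = ~~ (fun i => ~~ eps i) i by rewrite flpermE eps_fl.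
have [sgn osgn] := orientation_ex R tI' eI' tP' eP' tc tb th.
have [||n0 [B hB]] := @span_matrix R _ (fun y => exists Y L, @Spec R q X clC arr y Y L).
- exists 0, (fun=> 0); split; [by move=> i j _; rewrite mxE | by rewrite /commJ mulmx0 mul0mx | exact: Lop0 |].
  by move=> a0 P; rewrite sect0 !scaler0 addr0.
- move=> c y y' [Y [L S]] [Y' [L' S']]; exists (c *: Y + Y'), (fun A => c *: L A + L' A).
  exact: Spec_lin.
have Hplus P Th : fixed clC bC W P -> in0 cl Th -> commJ Th -> P *m Th *m (1%:M - P) = Th ->
    Th *m W *m (1%:M - P) = P *m W *m Th -> Th = 0.
  move=> [isP cP zP] i0 cT PT eT; have [ec i0c PPc trc] := cx_proj isP cP.
  have eth := cxK cT; rewrite -ec -eth /W in zP PT eT *.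
  rewrite -(rho1 R q) -rhoB -!rhoM in zP PT eT.
  rewrite (ndC (cx P) (cx Th)) ?rho0 //.
  - split=> //; apply: rho_inj; by rewrite zP rho0.
  - by apply/in0_rho; rewrite eth.
  - exact: rho_inj PT.
  exact: rho_inj eT.
have Hchart P : isproj cl b P -> commJ P -> exists2 c : class_perm cl, commJ (gmx R c) &
  chart_mx b (gmx R c) P \in unitmx by apply: commJ_chart.
have [y1 [nd1 z1 s1]] := special_section tI eI tP iP W1 WJ hB Hplus Hchart osgn.
have nd0 := ycst_nondegenerate tI' eI' tP' eP' XR1 (fun P Th p1 p2 => ndR P Th (conj p1 p2)).
have [N [[l0 [u0 m0 sum0]] [l1 [u1 m1 sum1]]]] := signed_count_eq tI' eI' tP' eP' osgn nd0 nd1.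
(* All signs are 1 on the special side and at most 1 on the real side. *)
have sz : (size l1 <= size l0)%N.
  rewrite -(ler_nat R); have cnt (l : seq 'rV[R]_((q + q) * (q + q))) : \sum_(v <- l) (1 : R) = (size l)%:R.
    by rewrite big_const_seq count_predT iter_addr_0.
  rewrite -!cnt; have -> : \sum_(v <- l1) (1 : R) = N.
    by rewrite -sum1; apply: eq_big_seq => v /m1 /z1 /s1 ->.
  rewrite -sum0 big_seq [X in _ <= X]big_seq; apply: ler_sum => v /m0 [iv zv].
  have iv' : proj_set cl b v by [].
  have [c dc] := chart_cover iv'; have ec := chart_chiK tI' tP' iv' dc.
  have [A' jA] := jacobian_ex (mxpolyf_cheq arr b (ixR tixC) (ixR eixC) c (ycst XR)) (chart_chi b (ixR tixC) c v).
  rewrite -ec (osgn _ _ _ A') //; first by case: sgrP => *; lra.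
  by apply/(zero_set_chart eI' tP' eP'); rewrite ec.
have hz U : exists P, solutions k lam A U -> fixed clC bC W P /\ (P :=: rho (Bm U))%MS.
  have [sU|] := pselect (solutions k lam A U); last by exists 0.
  have [hc hX hr] := hB1 U sU.
  have [|P [isP cP zP eP1]] := subrep_proj (bC := bC) hc hX; first by move=> x; rewrite trC hr.
  by exists P.
have [zf hzf] := choice hz.
have in1l U : solutions k lam A U -> mxvec (zf U) \in l1.
  by move=> /hzf [fz _]; apply/m1/z1; rewrite mxvecK.
(* The zeros of the two sections are matched by their positions in the two lists; the comparison of
   the lengths is all that is known. *)
pose idx U := index (mxvec (zf U)) l1.
have idx_lt U : solutions k lam A U -> (idx U < size l0)%N.
  by move=> sU; apply: leq_trans sz; rewrite index_mem in1l.
pose phi U := sol (vec_mx (nth 0 l0 (idx U))).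
have z0 U : solutions k lam A U -> let P := vec_mx (nth 0 l0 (idx U)) in
    isproj cl b P /\ P *m XR *m (1%:M - P) = 0.
  move=> sU; have /m0 [iv zv] : nth 0 l0 (idx U) \in l0 by apply: mem_nth; apply: idx_lt.
  by split=> //; move: zv; rewrite (sect_ycst XR1) mulr1 scale1r.
have inj : {in solutions k lam A &, injective phi}.
  move=> U U'; rewrite !in_setE => sU sU' /(hs2 _ _ (z0 U sU) (z0 U' sU')) /(can_inj vec_mxK) /eqP.
  rewrite nth_uniq ?idx_lt // => /eqP ei.
  have ez : mxvec (zf U) = mxvec (zf U').
    by rewrite -(nth_index 0 (in1l U sU)) -(nth_index 0 (in1l U' sU')) -/(idx U) -/(idx U') ei.
  have {}ez := can_inj mxvecK ez.
  have [_ e1] := hzf U sU; have [_ e2] := hzf U' sU'; rewrite ez in e1.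
  apply: hB2 => //.
  by apply/andP; split; rewrite -rho_submx -?e1 -?e2.
have /card_eqPle [_ le1] := inj_card_eq inj.
apply: (card_le_trans le1); apply: subset_card_le => _ [U sU <-].
exact: hs1 (z0 U sU).
Qed.
End Assembly.

End Assembly.

Require Import Defs.
From mathcomp Require Import all_boot all_order all_algebra.
From mathcomp Require Import complex.
From mathcomp Require Import boolp classical_sets functions cardinality reals.

Local Open Scope classical_set_scope.
Local Open Scope nat_scope.

Theorem proposition7p1 (R : realType) (k n r : nat)
    (lam : 'I_r -> seq nat)
    (F : 'I_r -> nat -> {vspace 'rV[R]_(2 * n)})
    (A : 'I_r -> nat -> {vspace 'rV[complex R]_n}) :
  0 < k < n ->
  (forall j, diagram_in_box k (n - k) (lam j)) ->
  \sum_j sumn (lam j) = k * (n - k) ->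
  generic_flags (2 * k) (fun j => double_diagram (lam j)) F ->
  generic_flags k lam A ->
  (solutions k lam A #<=
    solutions (2 * k) (fun j => double_diagram (lam j)) F)%card.
Proof.
move=> kn boxl sum_lam gF gA.
have [e eP] := IndexData.e_ex kn boxl.
have [q [clC [labC [mc [tixC [eixC [li ll ls [tI eI] [tP eP']]]]]]]] :=
  IndexData.index_ex (IndexData.be_av kn boxl sum_lam eP) (IndexData.count_eq kn boxl sum_lam eP).
exact: (Assembly.solutions_card_le kn boxl sum_lam gF gA eP li ll ls tI eI tP eP').
Qed.
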